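(* Let $\Omega\subset\mathbb{R}^n$ be an $(\varepsilon,\infty)$-domain with $\varepsilon\in(0,1]$. Let $m\in\mathbb{N}$ and let $X(\mathbb{R}^n)$ be a ball Banach function space such that (a) $X(\mathbb{R}^n)$ has an absolutely continuous norm; (b) there exists $p\in[1,\infty)$ such that $X^{\frac1p}(\mathbb{R}^n)$ is a ball Banach function space and the Hardy--Littlewood maximal operator is bounded on $[X^{\frac1p}(\mathbb{R}^n)]'$. Then there exists a linear extension operator $\Lambda:\ \dot{W}^{m,X}(\Omega)\to\dot{W}^{m,X}(\mathbb{R}^n)$ such that, for any $f\in\dot{W}^{m,X}(\Omega)$, (i) $\Lambda(f)=f$ almost everywhere in $\Omega$; (ii) $\|\Lambda(f)\|_{\dot{W}^{m,X}(\mathbb{R}^n)}\leq C\|f\|_{\dot{W}^{m,X}(\Omega)}$, where the positive constant $C$ is independent of $f$.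
   Context: Ball Banach function spaces. $\mathscr{M}(E)$ is the set of all measurable functions on $E$. A quasi-Banach space $X(\mathbb{R}^n)\subset\mathscr{M}(\mathbb{R}^n)$, with a quasi-norm $\|\cdot\|_{X(\mathbb{R}^n)}$ which makes sense for all functions in $\mathscr{M}(\mathbb{R}^n)$ (values in $[0,\infty]$, $X(\mathbb{R}^n)$ consisting of the functions of finite quasi-norm), is a ball quasi-Banach function space if: (1) $\|f\|_{X(\mathbb{R}^n)}=0$ implies $f=0$ a.e.; (2) $|g|\le|f|$ a.e. implies $\|g\|_{X(\mathbb{R}^n)}\le\|f\|_{X(\mathbb{R}^n)}$; (3) $0\le f_k\uparrow f$ a.e. implies $\|f_k\|_{X(\mathbb{R}^n)}\uparrow\|f\|_{X(\mathbb{R}^n)}$; (4) $\mathbf{1}_B\in X(\mathbb{R}^n)$ for every ball $B$. It is a ball Banach function space if moreover: (5) $\|f+g\|_{X(\mathbb{R}^n)}\le\|f\|_{X(\mathbb{R}^n)}+\|g\|_{X(\mathbb{R}^n)}$ for all $f,g\in X(\mathbb{R}^n)$; (6) for every ball $B$ there is $C_{(B)}>0$ with $\int_B|f(x)|\,dx\le C_{(B)}\|f\|_{X(\mathbb{R}^n)}$ for all $f\in X(\mathbb{R}^n)$. For $q\in(0,\infty)$, the $q$-convexification is $X^q(\mathbb{R}^n):=\{f\in\mathscr{M}(\mathbb{R}^n):|f|^q\in X(\mathbb{R}^n)\}$ with $\|f\|_{X^q(\mathbb{R}^n)}:=\|\,|f|^q\|_{X(\mathbb{R}^n)}^{1/q}$.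 The associate space $Y'(\mathbb{R}^n)$ of a ball Banach function space $Y(\mathbb{R}^n)$ is the set of $f\in\mathscr{M}(\mathbb{R}^n)$ with $\|f\|_{Y'(\mathbb{R}^n)}:=\sup\{\|fg\|_{L^1(\mathbb{R}^n)}:\|g\|_{Y(\mathbb{R}^n)}=1\}<\infty$. $X(\mathbb{R}^n)$ has an absolutely continuous norm if, for any $f\in X(\mathbb{R}^n)$ and any measurable sets $E_j$ with $\mathbf{1}_{E_j}\to0$ a.e., one has $\|f\mathbf{1}_{E_j}\|_{X(\mathbb{R}^n)}\to0$. The Hardy--Littlewood maximal operator is $\mathcal{M}(f)(x):=\sup_{B\ni x}\frac1{|B|}\int_B|f(y)|\,dy$, the supremum over all balls $B$ containing $x$. Restrictive space. For open $\Omega\subset\mathbb{R}^n$, $X(\Omega):=\{f\in\mathscr{M}(\Omega): f=g|_\Omega\text{ for some }g\in X(\mathbb{R}^n)\}$, with $\|f\|_{X(\Omega)}:=\inf\{\|g\|_{X(\mathbb{R}^n)}: f=g|_\Omega,\ g\in X(\mathbb{R}^n)\}$. Homogeneous Sobolev space. $\dot{W}^{m,X}(\Omega)$ is the set of $f\in L^1_{\mathrm{loc}}(\Omega)$ such that, for every multi-index $\alpha\in\mathbb{Z}_+^n$ with $|\alpha|=m$, the weak derivative $D^\alpha f$ exists and belongs to $X(\Omega)$; $\|f\|_{\dot{W}^{m,X}(\Omega)}:=\sum_{|\alpha|=m}\|D^\alpha f\|_{X(\Omega)}$. (Same definition with $\Omega=\mathbb{R}^n$.) Domains. For $\varepsilon\in(0,1]$,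 an open set $\Omega\subset\mathbb{R}^n$ is an $(\varepsilon,\infty)$-domain if, for any $x,y\in\Omega$ with $x\ne y$, there is a rectifiable curve $\Gamma$ lying in $\Omega$, connecting $x$ and $y$, with Euclidean length $\ell(\Gamma)\le\varepsilon^{-1}|x-y|$ and $\mathrm{dist}(z,\partial\Omega)\ge\frac{\varepsilon|x-z||y-z|}{|x-y|}$ for any point $z$ on $\Gamma$. *)

(* Defs.v *)
From HB Require Import structures.
From mathcomp Require Import all_boot all_order all_algebra.
From mathcomp Require Import all_classical all_reals all_analysis.

Set SsrOldRewriteGoalsOrder.
Set Implicit Arguments.
Unset Strict Implicit.
Unset Printing Implicit Defensive.
Import Order.TTheory GRing.Theory Num.Theory.
Import numFieldNormedType.Exports.
Local Open Scope classical_set_scope.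
Local Open Scope ring_scope.

(* R^d with d >= 1 is 'rV[R]_n.+1, where d = n.+1. *)

Section lebesgue_outer_measure.
Context {R : realType} {n : nat}.
Local Notation E := 'rV[R]_n.+1.
Local Open Scope ereal_scope.

Definition box (b : E * E) : set E :=
  [set x | forall i, (b.1 ord0 i < x ord0 i <= b.2 ord0 i)%R].

Definition box_volume (b : E * E) : R :=
  (\prod_i Num.max 0 (b.2 ord0 i - b.1 ord0 i))%R.

Definition box_cover (A : set E) : set (nat -> E * E) :=
  [set B | A `<=` \bigcup_k box (B k)].

Definition lebesgue_outer (A : set E) : \bar R :=
  ereal_inf [set \sum_(k <oo) (box_volume (B k))%:E | B in box_cover A].

Lemma box_volume_ge0 b : 0 <= (box_volume b)%:E.
Proof. by rewrite lee_fin; apply: prodr_ge0 => i _; rewrite le_max lexx. Qed.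

Lemma lebesgue_outer_ge0 A : 0 <= lebesgue_outer A.
Proof.
apply: le_ereal_inf_tmp => _ [B _ <-].
by apply: nneseries_ge0 => k _ _; exact: box_volume_ge0.
Qed.

Lemma lebesgue_outer0 : lebesgue_outer set0 = 0.
Proof.
apply/eqP; rewrite eq_le lebesgue_outer_ge0 andbT.
apply: ereal_inf_lbound; exists (fun=> (0, 0)%R); first by move=> x.
apply: eseries0 => k _ _.
by rewrite /box_volume big_ord_recl/= subrr maxxx mul0r.
Qed.

Lemma le_lebesgue_outer :
  {homo lebesgue_outer : A B / A `<=` B >-> A <= B}.
Proof.
move=> A B AB; apply/ereal_inf_le_tmp => _ [C BC <-].
by exists C => //; exact: subset_trans BC.
Qed.

Lemma lebesgue_outer_sigma_subadditive : sigma_subadditive lebesgue_outer.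
Proof.
move=> A; have [[i ioo]|] := pselect (exists i, lebesgue_outer (A i) = +oo).
  rewrite (eseries_pinfty _ _ ioo) ?leey// => k _.
  by rewrite -ltNye (lt_le_trans _ (lebesgue_outer_ge0 _)).
rewrite -forallNE => Aoo.
suff add2e (e : {posnum R}) : lebesgue_outer (\bigcup_k A k) <=
    \sum_(i <oo) lebesgue_outer (A i) + e%:num%:E.
  by apply/lee_addgt0Pr => _/posnumP[].
rewrite (le_trans _ (epsilon_trick _ _ _))//; last first.
  by move=> k; exact: lebesgue_outer_ge0.
pose P k (B : nat -> E * E) := box_cover (A k) B /\
  \sum_(j <oo) (box_volume (B j))%:E <=
  lebesgue_outer (A k) + (e%:num / (2 ^ k.+1)%:R)%:E.
have [G PG] : {G : nat -> nat -> E * E & forall k, P k (G k)}.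
  apply: (@choice _ _ P) => k; rewrite /P /lebesgue_outer.
  set S := (X in ereal_inf X); move infS : (ereal_inf S) => iS.
  case: iS infS => [r Sr|Soo|Soo].
  - have en1 : (0 < e%:num / (2 ^ k.+1)%:R)%R by [].
    have /(lb_ereal_inf_adherent en1) : ereal_inf S \is a fin_num by rewrite Sr.
    move=> [x [B AnB muBx] xS].
    by exists B; split => //; rewrite muBx -Sr; exact/ltW.
  - by have := Aoo k; rewrite /lebesgue_outer Soo.
  - suff : lbound S 0 by move/le_ereal_inf_tmp; rewrite Soo.
    move=> /= _ [B AnB <-].
    by apply: nneseries_ge0 => j _ _; exact: box_volume_ge0.
pose v b := (box_volume b)%:E.
have v_ge0 b : 0 <= v b by exact: box_volume_ge0.
have vG_ge0 x : 0 <= (v \o uncurry G) x by exact: v_ge0.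
apply: (@le_trans _ _ (\esum_(i in setT) (v \o uncurry G) i)).
  apply: ereal_inf_lbound => /=.
  have /card_esym/ppcard_eqP[f] := card_nat2.
  exists (uncurry G \o f).
    apply: (@subset_trans _  (\bigcup_k \bigcup_j box (G k j))) => [t [i _]|].
      by move=> /((PG i).1) -[j _ ?]; exists i => //; exists j.
    move=> t [i _ [j _ Bijt]]; exists (f^-1%FUN (i, j)) => //=.
    by rewrite invK ?inE.
  rewrite -(esum_pred_image (v \o uncurry G) _ xpredT) ?[fun=> _]set_true//.
  by rewrite image_eq.
rewrite (_ : esum _ _ = \sum_(i <oo) \sum_(j <oo ) v (G i j)); last first.
  pose J : nat -> set (nat * nat) := fun i => [set (i, j) | j in setT].
  rewrite (_ : setT = \bigcup_k J k); last first.
    by rewrite predeqE => -[a b]; split => // _; exists a => //; exists b.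
  rewrite esum_bigcupT /=; last 2 first.
    - apply/trivIsetP => i j _ _ ij.
      rewrite predeqE => -[k l] /=; split => //= -[] [_] _ [<-{k} _].
      by move=> [m' _] [] /esym/eqP; rewrite (negbTE ij).
    - by move=> /= [k l]; exact: v_ge0.
  rewrite -(image_id [set: nat]) -fun_true esum_pred_image//; last first.
    by move=> k _; exact: esum_ge0.
  apply: eq_eseriesr => /= j _.
  rewrite -(esum_pred_image (v \o uncurry G) (pair j) predT)//=; last first.
    by move=> ? ? _ _; exact: (@can_inj _ _ _ snd).
  by congr esum; rewrite predeqE => -[a b]; split; move=> [i _ <-]; exists i.
apply: lee_lim.
- apply: is_cvg_nneseries => k *.
  by apply: nneseries_ge0 => l *; exact: (vG_ge0 (k, l)).
- apply: is_cvg_nneseries => k *.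
  by apply: adde_ge0 => //; exact: lebesgue_outer_ge0.
- by near=> k; apply: lee_sum => i _; exact: (PG i).2.
Unshelve. all: by end_near. Qed.

HB.instance Definition _ := isOuterMeasure.Build R E lebesgue_outer
  lebesgue_outer0 lebesgue_outer_ge0 le_lebesgue_outer
  lebesgue_outer_sigma_subadditive.

End lebesgue_outer_measure.

(* The measurable sets of R^d are the Lebesgue measurable ones, i.e., the
   Caratheodory measurable sets of the Lebesgue outer measure. *)
HB.instance Definition _ (R : realType) (n : nat) :=
  @isMeasurable.Build (caratheodory_display (@lebesgue_outer R n))
    'rV[R]_n.+1 (@lebesgue_outer R n).-caratheodory
    (caratheodory_measurable_set0 _)
    (@caratheodory_measurable_setC _ _ _)
    (@caratheodory_measurable_bigcup _ _ _).

Definition lebesgue_rV {R : realType} {n : nat} : set 'rV[R]_n.+1 -> \bar R :=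
  lebesgue_outer.

HB.instance Definition _ (R : realType) (n : nat) :=
  isMeasure.Build _ 'rV[R]_n.+1 R (@lebesgue_rV R n)
    lebesgue_outer0 lebesgue_outer_ge0
    (caratheodory_measure_sigma_additive (mu := @lebesgue_outer R n)).

Section euclidean_geometry.
Context {R : realType} {n : nat}.
Local Notation E := 'rV[R]_n.+1.
Implicit Types (x y c : E) (A Omega : set E) (gamma : R -> E).

(* The library's norm on 'rV[R]_n.+1 is the sup norm: it is used only for the
   topology and for derivatives, which do not depend on the choice of a norm. *)
Definition enorm x : R := Num.sqrt (\sum_i x ord0 i ^+ 2).

Definition eball c (r : R) : set E := [set y | enorm (y - c) < r].

(* The distance to the empty set is +oo. *)
Definition dist_to_set x A : \bar R := ereal_inf [set (enorm (x - y))%:E | y in A].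

Definition boundary A : set E := closure A `\` interior A.

Definition polygon_length (a b : R) gamma (s : seq R) : R :=
  let F := gamma \o nth b (a :: s) in
  \sum_(0 <= k < size s) enorm (F k.+1 - F k).

Definition curve_length (a b : R) gamma : \bar R :=
  ereal_sup [set (polygon_length a b gamma s)%:E | s in itv_partition a b].

(* A curve is parametrized by [0, 1]; it is rectifiable as soon as its length
   has the required real upper bound. *)
Definition eps_infty_domain (eps : R) Omega : Prop :=
  open Omega /\
  forall x y, Omega x -> Omega y -> x != y ->
  exists gamma : R -> E,
    [/\ {within `[0, 1]%classic, continuous gamma},
        gamma 0 = x /\ gamma 1 = y,
        forall t : R, t \in `[0, 1] -> Omega (gamma t),
        (curve_length 0 1 gamma <= (eps^-1 * enorm (x - y))%:E)%E &
        forall t : R, t \in `[0, 1] ->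
          ((eps * enorm (x - gamma t) * enorm (y - gamma t)
             / enorm (x - y))%:E <= dist_to_set (gamma t) (boundary Omega))%E].

End euclidean_geometry.

Section ball_banach_function_spaces.
Context {R : realType} {n : nat}.
Local Notation E := 'rV[R]_n.+1.
Implicit Types (f g : E -> R) (N : (E -> R) -> \bar R).
Local Open Scope ereal_scope.

(* A space X(R^d) is given by its norm N, a function with values in [0, +oo];
   only the values of N on measurable functions are meaningful. *)
Definition fspace N : set (E -> R) :=
  [set f | measurable_fun setT f /\ N f < +oo].

Record ball_quasi_banach N : Prop := BallQuasiBanach {
  bqb_ge0 : forall f, measurable_fun setT f -> 0 <= N f ;
  bqb_homogeneous : forall (a : R) f, fspace N f ->
    N (fun x => a * f x)%R = `|a|%:E * N f ;
  bqb_quasi_triangle : exists K : R, forall f g, fspace N f -> fspace N g ->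
    N (f \+ g)%R <= K%:E * (N f + N g) ;
  bqb_complete : forall u : (E -> R)^nat, (forall k, fspace N (u k)) ->
    (forall e : R, (0 < e)%R -> exists k0, forall i j,
       (k0 <= i)%N -> (k0 <= j)%N -> N (u i \- u j)%R < e%:E) ->
    exists2 f, fspace N f & N (u k \- f)%R @[k --> \oo] --> 0 ;
  bqb_eq0 : forall f, measurable_fun setT f -> N f = 0 ->
    {ae lebesgue_rV, forall x, f x = 0%R} ;
  bqb_mono : forall f g, measurable_fun setT f -> measurable_fun setT g ->
    {ae lebesgue_rV, forall x, (`|g x| <= `|f x|)%R} -> N g <= N f ;
  bqb_fatou : forall (u : (E -> R)^nat) f,
    (forall k, measurable_fun setT (u k)) -> measurable_fun setT f ->
    {ae lebesgue_rV, forall x,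
      [/\ forall k, (0 <= u k x)%R, nondecreasing_seq (u ^~ x) &
          u k x @[k --> \oo] --> f x]} ->
    nondecreasing_seq (N \o u) /\ N (u k) @[k --> \oo] --> N f ;
  bqb_ball : forall c (r : R), (0 < r)%R -> fspace N \1_(eball c r) }.

Record ball_banach N : Prop := BallBanach {
  bb_quasi : ball_quasi_banach N ;
  bb_triangle : forall f g, fspace N f -> fspace N g ->
    N (f \+ g)%R <= N f + N g ;
  bb_ball_integral : forall c (r : R), (0 < r)%R ->
    exists2 C : R, (0 < C)%R & forall f, fspace N f ->
      \int[lebesgue_rV]_(x in eball c r) `|f x|%:E <= C%:E * N f }.

Definition convexification (q : R) N : (E -> R) -> \bar R :=
  fun f => N (fun x => `|f x| `^ q)%R `^ q^-1.

(* Defined on extended real functions, so that it applies to the maximal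
   function, which may take the value +oo. *)
Definition associate_norm N (h : E -> \bar R) : \bar R :=
  ereal_sup [set \int[lebesgue_rV]_x `|h x * (g x)%:E| |
             g in [set g | measurable_fun setT g /\ N g = 1]].

Definition associate_space N : set (E -> R) :=
  [set f | measurable_fun setT f /\ associate_norm N (EFin \o f) < +oo].

Definition abs_continuous_norm N : Prop :=
  forall f (A : (set E)^nat), fspace N f -> (forall j, measurable (A j)) ->
    {ae lebesgue_rV, forall x, (\1_(A j) x : R) @[j --> \oo] --> (0 : R)%R} ->
    N (fun x => f x * \1_(A j) x)%R @[j --> \oo] --> 0.

Definition maximal f (x : E) : \bar R :=
  ereal_sup
    [set (lebesgue_rV (eball b.1 b.2))^-1 *
         \int[lebesgue_rV]_(y in eball b.1 b.2) `|f y|%:E |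
     b in [set b : E * R | (0 < b.2)%R /\ eball b.1 b.2 x]].

Definition maximal_bounded_on_associate N : Prop :=
  exists2 C : R, (0 < C)%R & forall f, associate_space N f ->
    associate_norm N (maximal f) <= C%:E * associate_norm N (EFin \o f).

Definition restr_norm N (Omega : set E) f : \bar R :=
  ereal_inf [set N g | g in [set g | fspace N g /\
    {ae lebesgue_rV, forall x, Omega x -> f x = g x}]].

(* A function on Omega is represented by a total function whose values outside
   Omega are irrelevant. *)
Definition restr_space N (Omega : set E) : set (E -> R) :=
  [set f | measurable_fun Omega f /\ exists2 g, fspace N g &
    {ae lebesgue_rV, forall x, Omega x -> f x = g x}].

Lemma restr_norm_setT N f : ball_banach N -> measurable_fun setT f ->
  restr_norm N setT f = N f.
Proof.
move=> [qN _ _] mf; apply/eqP; rewrite eq_le; apply/andP; split.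
  have [Nfoo|] := ltP (N f) +oo; last by rewrite leye_eq => /eqP ->; rewrite leey.
  by apply: ereal_inf_lbound; exists f => //; split => //; exact: aeW.
apply: le_ereal_inf_tmp => _ [g [[mg _] fg] <-].
apply: (bqb_mono qN) => //; apply: filterS fg => x /(_ I) ->.
exact: lexx.
Qed.

End ball_banach_function_spaces.

Section homogeneous_sobolev_spaces.
Context {R : realType} {n : nat}.
Local Notation E := 'rV[R]_n.+1.
Implicit Types (f g phi : E -> R) (Omega : set E) (alpha : 'I_n.+1 -> nat).

Definition pderiv (i : 'I_n.+1) phi : E -> R := 'D_(delta_mx ord0 i) phi.

Definition mderiv alpha phi : E -> R :=
  foldr (fun i => iter (alpha i) (pderiv i)) phi (enum 'I_n.+1).

Definition smooth phi : Prop :=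
  forall s : seq 'I_n.+1, let psi := foldr pderiv phi s in
    continuous psi /\ forall x i, derivable psi x (delta_mx ord0 i).

Definition test_function Omega phi : Prop :=
  let supp := closure [set x | phi x != 0] in
  [/\ smooth phi, compact supp & supp `<=` Omega].

Definition loc_integrable Omega f : Prop :=
  measurable_fun Omega f /\ forall K, compact K -> K `<=` Omega ->
    (\int[lebesgue_rV]_(x in K) `|f x|%:E < +oo)%E.

Definition is_weak_deriv Omega alpha f g : Prop :=
  loc_integrable Omega g /\ forall phi, test_function Omega phi ->
    \int[lebesgue_rV]_(x in Omega) (f x * mderiv alpha phi x) =
    (-1) ^+ (\sum_i alpha i)%N *
      \int[lebesgue_rV]_(x in Omega) (g x * phi x).

(* Unique up to a.e. equality on Omega when it exists. *)
Definition weak_deriv Omega alpha f : E -> R :=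
  xget (fun=> 0) [set g | is_weak_deriv Omega alpha f g].

Variable N : (E -> R) -> \bar R.

Definition sobolev (m : nat) Omega : set (E -> R) :=
  [set f | loc_integrable Omega f /\
    forall alpha, (\sum_i alpha i)%N = m ->
      exists2 g, is_weak_deriv Omega alpha f g & restr_space N Omega g].

(* The entries of a multi-index of length m are at most m. *)
Definition sobolev_norm (m : nat) Omega f : \bar R :=
  (\sum_(alpha : {ffun 'I_n.+1 -> 'I_m.+1} | (\sum_i alpha i)%N == m)
    restr_norm N Omega (weak_deriv Omega (fun i => alpha i : nat) f))%E.

(* Elements of the homogeneous Sobolev spaces are functions up to a.e.
   equality; linearity is understood accordingly. *)
Record sobolev_linear_operator (m : nat) (Omega Omega' : set E)
    (L : (E -> R) -> E -> R) : Prop := SobolevLinearOperator {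
  slo_maps : forall f, sobolev m Omega f -> sobolev m Omega' (L f) ;
  slo_ae : forall f g, sobolev m Omega f -> sobolev m Omega g ->
    {ae lebesgue_rV, forall x, Omega x -> f x = g x} ->
    {ae lebesgue_rV, forall x, Omega' x -> L f x = L g x} ;
  slo_linear : forall (a : R) f g, sobolev m Omega f -> sobolev m Omega g ->
    {ae lebesgue_rV, forall x, Omega' x ->
      L (fun y => a * f y + g y) x = a * L f x + L g x} }.

End homogeneous_sobolev_spaces.

(* Main.v *)
(** The extension operator is built as in the Whitney-Jones construction, but so
    as to need neither Fubini's theorem nor a Poincare inequality. For each K, a
    dyadic partition of unity of R^d is made of cells of side 2^-k, k < K, whose
    distance to Omega is comparable to 2^-k, and of cells of side 2^-K near Omega.
    A cell is reflected to a cube of Omega of comparable size, where f has an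
    averaged Taylor polynomial, and FK is the sum of these polynomials weighted
    by the partition. Two neighbouring cells are joined by a bounded chain of
    cubes along a curve of the domain. Along the chain the polynomials differ by
    weak derivatives of order m of f tested against explicit functions, because
    two product bumps differ by a sum of partial derivatives of test functions.
    Hence the derivatives of order m of FK are dominated by an averaging
    operator TK applied to g, the sum of |D^alpha f|, and FK converges in L^1 of
    every ball, its limit being equal to f on Omega. No information on the
    measure of the boundary is needed: the derivatives of FK are uniformly
    integrable near it.

    The averaging operators are bounded on X: by convexity |T v|^p <= C T(|v|^p),
    which reduces the claim to Y = X^(1/p); there one dualizes against a norming
    function h and moves the averages onto h, where the maximal function appears.
    The norming function is obtained by projecting, in L^2 of a ball, a bounded
    function w with norm larger than 1 onto the unit ball of Y. *)

From HB Require Import structures.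
Require Import Defs.
From mathcomp Require Import all_boot all_order all_algebra.
From mathcomp Require Import all_classical all_reals all_analysis.
From mathcomp Require Import measurable_realfun.
From mathcomp Require Import ring lra zify.
Set Implicit Arguments.
Unset Strict Implicit.
Unset Printing Implicit Defensive.
Import Order.TTheory GRing.Theory Num.Theory.
Import numFieldNormedType.Exports.
Local Open Scope classical_set_scope.
Local Open Scope ring_scope.

(** * Smooth functions *)

(** Every FK is smooth on the whole of R^d, because the cells of side 2^-K also cover Omega. So
    integration by parts is classical for each K, and weak derivatives only appear in the limit. On
    Omega, FK f is a smoothing of f at scale 2^-K; far from Omega it does not depend on K. The
    delicate zone is the collar of the boundary, where FK changes with K: there the averages read g
    only close to the boundary, and g is integrable on bounded parts of Omega, so the collar
    contributes nothing in the limit.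

    If Omega is bounded, very large cells have no cube of their own size to be reflected to. They
    all share one cube, so their polynomials coincide and do not contribute to derivatives of order
    m.

    In the calculus of test functions, translation invariance takes the place of iterated integrals:
    it makes the integral of a partial derivative vanish, so that all product bumps have the same
    integral.

    The norming function stands in for the Lorentz-Luxemburg identity between Y and its second
    associate space. *)

Section smoothness.
Context {R : realType} {V : normedModType R} {I : Type} (dir : I -> V).
Implicit Types (f g : V -> R) (k : nat).

(** The family [dir] lets one calculus serve both the real line, with the single direction 1, and
    row vectors, with the coordinate directions. *)
Fixpoint Ck k f : Prop :=
  continuous f /\
  if k is k'.+1 then
    forall i, (forall x, derivable f x (dir i)) /\ Ck k' ('D_(dir i) f)
  else True.

Definition Coo f : Prop := forall k, Ck k f.

Lemma Ck_continuous k f : Ck k f -> continuous f.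
Proof. by case: k => [|k] []. Qed.

Lemma CkS k f : Ck k.+1 f -> Ck k f.
Proof.
elim: k f => [|k IH] f [cf df]; split=> // i.
by have [dfi /IH] := df i.
Qed.

Lemma Ck_cst k (a : R) : Ck k (fun=> a).
Proof.
elim: k a => [|k IH] a; split => //; try (by move=> x; exact: cst_continuous).
move=> i; split=> [x|]; first exact: derivable_cst.
rewrite (_ : 'D_(dir i) _ = fun=> 0)//; apply/funext => x.
exact: derive_cst.
Qed.

Lemma CkD k f g : Ck k f -> Ck k g -> Ck k (fun x => f x + g x).
Proof.
elim: k f g => [|k IH] f g [cf df] [cg dg].
  by split=> // x; apply: continuousD; [exact: cf|exact: cg].
split=> [x|i]; first by apply: continuousD; [exact: cf|exact: cg].
have [dfi Cf] := df i; have [dgi Cg] := dg i; split=> [x|].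
  exact: derivableD.
rewrite (_ : 'D_(dir i) _ = (fun x => 'D_(dir i) f x + 'D_(dir i) g x)).
  exact: IH.
by apply/funext => x; exact: deriveD.
Qed.

Lemma CkM k f g : Ck k f -> Ck k g -> Ck k (fun x => f x * g x).
Proof.
elim: k f g => [|k IH] f g [cf df] [cg dg].
  by split=> // x; apply: continuousM; [exact: cf|exact: cg].
split=> [x|i]; first by apply: continuousM; [exact: cf|exact: cg].
have [dfi Cf] := df i; have [dgi Cg] := dg i; split=> [x|].
  exact: derivableM.
rewrite (_ : 'D_(dir i) _ = (fun x => f x * 'D_(dir i) g x +
   g x * 'D_(dir i) f x)).
  by apply: CkD; apply: IH => //; apply: CkS; split.
by apply/funext => x; exact: deriveM.
Qed.

Lemma CkZ k (a : R) f : Ck k f -> Ck k (fun x => a * f x).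
Proof. by move=> Cf; apply: CkM => //; exact: Ck_cst. Qed.

Lemma CkN k f : Ck k f -> Ck k (fun x => - f x).
Proof.
move=> /(CkZ (-1)); rewrite (_ : (fun x => -1 * f x) = (fun x => - f x))//.
by apply/funext => x; rewrite mulN1r.
Qed.

Lemma CkB k f g : Ck k f -> Ck k g -> Ck k (fun x => f x - g x).
Proof. by move=> Cf Cg; apply: CkD => //; exact: CkN. Qed.

Lemma CkV k f : (forall x, f x != 0) -> Ck k f -> Ck k (fun x => (f x)^-1).
Proof.
move=> f0; elim: k => [|k IH] [cf df].
  by split=> // x; apply: continuousV; [exact: f0|exact: cf].
split=> [x|i]; first by apply: continuousV; [exact: f0|exact: cf].
have [dfi Cf] := df i; split=> [x|]; first exact: derivableV.
rewrite (_ : 'D_(dir i) _ = (fun x => - ((f x)^-1 * (f x)^-1 * 'D_(dir i) f x))).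
  have CV : Ck k (fun x => (f x)^-1) by apply: IH; apply: CkS; split.
  by apply: CkN; apply: CkM => //; exact: CkM.
by apply/funext => x; rewrite deriveV// -mulNr -invfM -expr2.
Qed.

Lemma Ck_sum k (T : Type) (s : seq T) (P : pred T) (F : T -> V -> R) :
  (forall t, Ck k (F t)) -> Ck k (fun x => \sum_(t <- s | P t) F t x).
Proof.
move=> CF; elim: s => [|t s IH].
  rewrite (_ : (fun x => _) = fun=> 0); first exact: Ck_cst.
  by apply/funext => x; rewrite big_nil.
have [Pt|Pt] := boolP (P t); last first.
  by under eq_fun do rewrite big_cons (negbTE Pt).
by under eq_fun do rewrite big_cons Pt; exact: CkD.
Qed.

Lemma Ck_prod k (T : Type) (s : seq T) (P : pred T) (F : T -> V -> R) :
  (forall t, Ck k (F t)) -> Ck k (fun x => \prod_(t <- s | P t) F t x).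
Proof.
move=> CF; elim: s => [|t s IH].
  rewrite (_ : (fun x => _) = fun=> 1); first exact: Ck_cst.
  by apply/funext => x; rewrite big_nil.
have [Pt|Pt] := boolP (P t); last first.
  by under eq_fun do rewrite big_cons (negbTE Pt).
by under eq_fun do rewrite big_cons Pt; exact: CkM.
Qed.

Lemma Coo_derivable f i x : Coo f -> derivable f x (dir i).
Proof. by move=> /(_ 1%N)[_ /(_ i)[]]. Qed.

Lemma Coo_derive f i : Coo f -> Coo ('D_(dir i) f).
Proof. by move=> Cf k; have [_ /(_ i)[]] := Cf k.+1. Qed.

Lemma Coo_continuous f : Coo f -> continuous f.
Proof. by move=> /(_ 0%N)[]. Qed.

End smoothness.

(* A sealed copy of pderiv: unification would otherwise unfold limits. *)
HB.lock Definition pd {R : realType} {n : nat} (i : 'I_n.+1)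
  (u : 'rV[R]_n.+1 -> R) : 'rV[R]_n.+1 -> R := pderiv i u.

(** * Partial derivatives of smooth functions and the Leibniz rule *)

Section partial_derivatives.
Context {R : realType} {n : nat}.
Local Notation E := 'rV[R]_n.+1.
Implicit Types (u v f g : E -> R) (x y z : E) (s : seq 'I_n.+1) (i j : 'I_n.+1).

Definition basis (i : 'I_n.+1) : E := delta_mx ord0 i.

(* Derivatives are indexed by lists of coordinates; [mlist] and [mcount]
   translate from and to multi-indices. *)
Definition DD s u : E -> R := foldr pd u s.

Lemma pdE : @pd R n = @pderiv R n.
Proof. by apply/funext => i; apply/funext => u; rewrite pd.unlock. Qed.

Lemma DDE s u : DD s u = foldr (@pderiv R n) u s.
Proof. by rewrite /DD pdE. Qed.

Lemma pd_derive i u x : pd i u x = 'D_(basis i) u x.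
Proof. by rewrite pdE. Qed.

Lemma DD_rcons s i u : DD (rcons s i) u = DD s (pd i u).
Proof. by rewrite /DD -cats1 foldr_cat. Qed.

Lemma DD_cat s1 s2 u : DD (s1 ++ s2) u = DD s1 (DD s2 u).
Proof. by rewrite /DD foldr_cat. Qed.

Lemma DD_cons i s u : DD (i :: s) u = pd i (DD s u).
Proof. by []. Qed.

(* A record, so that conversion does not unfold smoothness. *)
Record Smooth u : Prop := MkSmooth { Smooth_smooth : smooth u }.

Lemma smoothP u : Smooth u <-> Coo basis u.
Proof.
split=> [[su] k|Cu]; last split=> s.
  suff H : forall s, Ck basis k (foldr (@pderiv R n) u s) by exact: (H [::]).
  elim: k => [|k IH] s; first by split=> //; exact: (su s).1.
  split; first exact: (su s).1.
  by move=> i; split=> [x|]; [exact: (su s).2|exact: (IH (i :: s))].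
have H : Coo basis (foldr (@pderiv R n) u s).
  by elim: s => // i s IH; exact: Coo_derive.
split; first exact: Coo_continuous H.
by move=> x i; exact: Coo_derivable.
Qed.

Lemma smooth_continuous u : Smooth u -> continuous u.
Proof. by move=> [/(_ [::])[]]. Qed.

Lemma smooth_derivable u x i : Smooth u -> derivable u x (basis i).
Proof. by move=> [/(_ [::])[_ ]]; exact. Qed.

Lemma smooth_DD s u : Smooth u -> Smooth (DD s u).
Proof. by move=> [su]; split=> t; have := su (t ++ s); rewrite foldr_cat DDE. Qed.

Lemma smooth_pderiv i u : Smooth u -> Smooth (pd i u).
Proof. exact: (smooth_DD [:: i]). Qed.

Lemma smooth_cst (a : R) : Smooth (fun _ : E => a).
Proof. by apply/smoothP => k; exact: Ck_cst. Qed.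

Lemma smoothD u v : Smooth u -> Smooth v -> Smooth (fun x => u x + v x).
Proof.
by move=> /smoothP su /smoothP sv; apply/smoothP => k; exact: CkD.
Qed.

Lemma smoothB u v : Smooth u -> Smooth v -> Smooth (fun x => u x - v x).
Proof.
by move=> /smoothP su /smoothP sv; apply/smoothP => k; exact: CkB.
Qed.

Lemma smoothM u v : Smooth u -> Smooth v -> Smooth (fun x => u x * v x).
Proof.
by move=> /smoothP su /smoothP sv; apply/smoothP => k; exact: CkM.
Qed.

Lemma smoothZ (a : R) u : Smooth u -> Smooth (fun x => a * u x).
Proof. by move=> /smoothP su; apply/smoothP => k; exact: CkZ. Qed.

Lemma smooth_sum (T : Type) (t : seq T) (P : pred T) (F : T -> E -> R) :
  (forall q, Smooth (F q)) -> Smooth (fun x => \sum_(q <- t | P q) F q x).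
Proof.
by move=> sF; apply/smoothP => k; apply: Ck_sum => q; have /smoothP := sF q; exact.
Qed.

Lemma smooth_prod (T : Type) (t : seq T) (P : pred T) (F : T -> E -> R) :
  (forall q, Smooth (F q)) -> Smooth (fun x => \prod_(q <- t | P q) F q x).
Proof.
by move=> sF; apply/smoothP => k; apply: Ck_prod => q; have /smoothP := sF q; exact.
Qed.

Lemma pderivD i u v : Smooth u -> Smooth v ->
  pd i (fun x => u x + v x) = fun x => pd i u x + pd i v x.
Proof.
move=> su sv; apply/funext => x.
by rewrite !pd_derive; apply: deriveD; exact: smooth_derivable.
Qed.

Lemma pderivM i u v : Smooth u -> Smooth v ->
  pd i (fun x => u x * v x) =
  fun x => u x * pd i v x + pd i u x * v x.
Proof.
move=> su sv; apply/funext => x.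
rewrite [RHS](_ : _ = u x *: pd i v x + v x *: pd i u x).
  by rewrite !pd_derive; apply: deriveM; exact: smooth_derivable.
by rewrite [pd i u x * _]mulrC.
Qed.

Lemma pderivZ i (a : R) u : Smooth u ->
  pd i (fun x => a * u x) = fun x => a * pd i u x.
Proof.
move=> su; apply/funext => x.
by rewrite !pd_derive; apply: deriveZ; exact: smooth_derivable.
Qed.

Lemma pderiv_cst i (a : R) : pd i (fun _ : E => a) = fun=> 0.
Proof. by apply/funext => x; rewrite pd_derive; exact: derive_cst. Qed.

Lemma near_eq_pderiv i u v x :
  (\near x, u x = v x) -> pd i u x = pd i v x.
Proof. by rewrite !pd_derive; exact: near_eq_derive. Qed.

Lemma DDD s u v : Smooth u -> Smooth v ->
  DD s (fun x => u x + v x) = fun x => DD s u x + DD s v x.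
Proof.
move=> su sv; elim: s => // i s IH.
by rewrite DD_cons IH pderivD//; exact: smooth_DD.
Qed.

Lemma DDZ s (a : R) u : Smooth u ->
  DD s (fun x => a * u x) = fun x => a * DD s u x.
Proof.
move=> su; elim: s => // i s IH.
by rewrite DD_cons IH pderivZ//; exact: smooth_DD.
Qed.

Lemma DDB s u v : Smooth u -> Smooth v ->
  DD s (fun x => u x - v x) = fun x => DD s u x - DD s v x.
Proof.
move=> su sv; under eq_fun do rewrite -mulN1r.
rewrite DDD//; last exact: smoothZ.
by rewrite DDZ//; apply/funext => x; rewrite mulN1r.
Qed.

Lemma DD_cst0 s : DD s (fun _ : E => 0 : R) = fun=> 0.
Proof. by elim: s => // i s IH; rewrite DD_cons IH pderiv_cst. Qed.

Lemma DD_sum s (T : Type) (t : seq T) (P : pred T) (F : T -> E -> R) :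
  (forall q, Smooth (F q)) ->
  DD s (fun x => \sum_(q <- t | P q) F q x) =
  fun x => \sum_(q <- t | P q) DD s (F q) x.
Proof.
move=> sF; elim: t => [|q t IH].
  under eq_fun do rewrite big_nil; rewrite DD_cst0.
  by apply/funext => x; rewrite big_nil.
have [Pt|Pt] := boolP (P q); last first.
  under eq_fun do rewrite big_cons (negbTE Pt).
  by rewrite IH; apply/funext => x; rewrite big_cons (negbTE Pt).
under eq_fun do rewrite big_cons Pt.
rewrite DDD//; last exact: smooth_sum.
by rewrite IH; apply/funext => x; rewrite big_cons Pt.
Qed.

Lemma near_eq_DD s u v x : (\near x, u x = v x) -> \near x, DD s u x = DD s v x.
Proof.
move=> uv; elim: s => // i s IH.
have /nbhs_interior := IH; apply: filterS => y yint.
by rewrite !DD_cons; exact: near_eq_pderiv.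
Qed.

Lemma near0_DD s u x : (\near x, u x = 0) -> DD s u x = 0.
Proof.
move=> u0.
have /(near_eq_DD s)/nbhs_singleton -> : \near x, u x = (fun=> 0) x by [].
by rewrite DD_cst0.
Qed.

(* The Leibniz rule peels derivatives off the inner end of the list, so that
   both factors stay in the class of functions with scaled bounds. *)
Lemma DD_prod_le s u v x (A B r : R) : 0 <= A -> 0 <= B -> 0 < r ->
  Smooth u -> Smooth v ->
  (forall t, (size t <= size s)%N -> `|DD t u x| <= A / r ^+ size t) ->
  (forall t, (size t <= size s)%N -> `|DD t v x| <= B / r ^+ size t) ->
  `|DD s (fun x => u x * v x) x| <= 2 ^+ size s * A * B / r ^+ size s.
Proof.
move=> + + r0; move: {2}(size s) (erefl (size s)) => k.
elim: k s u v A B => [|k IH] s u v A B sk A0 B0 su sv uA vB.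
  move: sk => /eqP; rewrite size_eq0 => /eqP s0; subst s.
  rewrite /= expr0 mul1r divr1 normrM ler_pM//.
    by have := uA [::]; rewrite expr0 divr1; apply.
  by have := vB [::]; rewrite expr0 divr1; apply.
case/lastP: s sk uA vB => // s i; rewrite size_rcons => -[sk] uA vB.
rewrite DD_rcons pderivM// DDD; last 2 first.
- by apply: smoothM => //; exact: smooth_pderiv.
- by apply: smoothM => //; exact: smooth_pderiv.
have le_A : forall w C, 0 <= C ->
   (forall t, (size t <= (size s).+1)%N -> `|DD t w x| <= C / r ^+ size t) ->
   (forall t, (size t <= size s)%N -> `|DD t w x| <= C / r ^+ size t) /\
   (forall t, (size t <= size s)%N ->
     `|DD t (pd i w) x| <= C / r / r ^+ size t).
  move=> w C C0 wC; split=> t ts; first by apply: wC; exact: leq_trans ts _.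
  rewrite -DD_rcons (le_trans (wC _ _))// ?size_rcons//.
  by rewrite exprS invfM mulrA.
have [uA1 uA2] := le_A u A A0 uA; have [vB1 vB2] := le_A v B B0 vB.
have Ar : 0 <= A / r by rewrite divr_ge0// ltW.
have Br : 0 <= B / r by rewrite divr_ge0// ltW.
rewrite (le_trans (ler_normD _ _))//.
rewrite (@le_trans _ _ (2 ^+ size s * A * (B / r) / r ^+ size s +
  2 ^+ size s * (A / r) * B / r ^+ size s))//.
  by apply: lerD; apply: IH => //; exact: smooth_pderiv.
rewrite !exprS invfM le_eqVlt; apply/orP; left; apply/eqP.
by rewrite !mulrA; ring.
Qed.

End partial_derivatives.

(** * Directional derivatives only depend on the restriction to a line *)

Section derive_congr.
Context {R : realType} {V V' : normedModType R}.
Variables (f : V -> R) (g : V' -> R) (a v : V) (a' v' : V').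
Hypothesis fg : forall h : R, f (h *: v + a) = g (h *: v' + a').

Let quot_eq : (fun h : R => h^-1 *: ((f \o shift a) (h *: v) - f a)) =
  (fun h => h^-1 *: ((g \o shift a') (h *: v') - g a')).
Proof.
apply/funext => h /=; congr (_ *: (_ - _)); first exact: fg.
by have := fg 0; rewrite !scale0r !add0r.
Qed.

Lemma derivable_congr : derivable f a v = derivable g a' v'.
Proof. by rewrite /derivable quot_eq. Qed.

Lemma derive_congr : 'D_v f a = 'D_v' g a'.
Proof. by rewrite /derive quot_eq. Qed.

End derive_congr.

(** * Symmetry of mixed derivatives, multi-indices, affine changes of variable *)

Section partial_derivatives2.
Context {R : realType} {n : nat}.
Local Notation E := 'rV[R]_n.+1.
Implicit Types (u v f g : E -> R) (x y z : E) (s : seq 'I_n.+1) (i j : 'I_n.+1).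

Lemma basisE i j : basis i ord0 j = (j == i)%:R :> R.
Proof. by rewrite /basis mxE eqxx. Qed.

Lemma normr_coord x i : `|x ord0 i| <= `|x|.
Proof.
rewrite [leRHS]/Num.norm/= mx_normrE.
exact: (@le_bigmax _ _ _ 0 (fun ij : 'I_1 * 'I_n.+1 => `|x ij.1 ij.2|) (ord0, i)).
Qed.

Lemma normr_rV_le x (r : R) : 0 <= r -> (forall i, `|x ord0 i| <= r) -> `|x| <= r.
Proof.
move=> r0 xr; rewrite [leLHS]/Num.norm/= mx_normrE.
by apply: bigmax_le => // -[a b] _ /=; rewrite ord1.
Qed.

Lemma normr_rV_lt x (r : R) : 0 < r -> (forall i, `|x ord0 i| < r) -> `|x| < r.
Proof.
move=> r0 xr; rewrite [ltLHS]/Num.norm/= mx_normrE.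
by apply: bigmax_lt => // -[a b] _ /=; rewrite ord1.
Qed.

Lemma norm_basis i : `|basis i : E| <= 1.
Proof.
by apply: normr_rV_le => // j; rewrite basisE; case: eqP; rewrite ?normr1 ?normr0.
Qed.

Lemma is_derive_line u x i (t : R) : Smooth u ->
  is_derive t 1 (fun h => u (h *: basis i + x)) (pd i u (t *: basis i + x)).
Proof.
move=> su.
have e h : u (h *: (1 : R) *: basis i + (t *: basis i + x)) =
           u ((h *: (1 : R) + t) *: basis i + x).
  by rewrite addrA -scalerDl.
apply: DeriveDef.
  rewrite (@derivable_congr _ _ _ _ u t 1 (t *: basis i + x) (basis i)).
    exact: smooth_derivable.
  by move=> h; rewrite -e [h *: (1 : R)]mulr1.
rewrite pd_derive; apply: derive_congr => h.
by rewrite -e [h *: (1 : R)]mulr1.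
Qed.

Lemma MVT_line u x i (h : R) : Smooth u -> 0 < h ->
  exists2 c, 0 < c < h & u (h *: basis i + x) - u x = h * pd i u (c *: basis i + x).
Proof.
move=> su h0.
have [||c] := @MVT _ (fun t => u (t *: basis i + x))
  (fun t => pd i u (t *: basis i + x)) 0 h h0.
- by move=> t _; exact: is_derive_line.
- apply: derivable_within_continuous => t _.
  by have [] := is_derive_line x i t su.
rewrite in_itv/= => ch; rewrite scale0r add0r subr0 => ->.
by exists c => //; rewrite mulrC.
Qed.

Lemma smooth_shift u (c : E) : Smooth u -> Smooth (fun x => u (x + c)).
Proof.
suff H s : DD s (fun x => u (x + c)) = fun x => DD s u (x + c).
  move=> su; split=> s; rewrite -DDE [DD _ _]H.
  have sD := smooth_DD s su; split=> [x|x i].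
    apply: (@continuous_comp _ _ _ (fun x => x + c) (DD s u)).
      by apply: continuousD; [exact: cvg_id|exact: cst_continuous].
    exact: smooth_continuous.
  rewrite (@derivable_congr _ _ _ _ (DD s u) _ _ (x + c) (basis i)).
    exact: smooth_derivable.
  by move=> h; rewrite addrA.
elim: s => // i s IH; rewrite DD_cons IH; apply/funext => x.
by rewrite /= !pd_derive; apply: derive_congr => h; rewrite addrA.
Qed.

Lemma pderiv_shift i u (c : E) :
  pd i (fun x => u (x + c)) = fun x => pd i u (x + c).
Proof. by apply/funext => x; rewrite /= !pd_derive; apply: derive_congr => h; rewrite addrA. Qed.

(* Both iterated derivatives are limits of the same mixed second difference. *)
Lemma pderivC i j u : Smooth u -> pd i (pd j u) = pd j (pd i u).
Proof.
move=> su; apply/funext => x.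
pose second u' i j (h : R) := u' (h *: basis i + (h *: basis j + x)) -
  u' (h *: basis j + x) - (u' (h *: basis i + x) - u' x).
(* Two uses of the mean value theorem, first on the increment of u' along j', then on a derivative
   of u', write the second difference as h^2 times a mixed derivative at a point within 2h of x. *)
have key u' i' j' (h : R) : Smooth u' -> 0 < h ->
    exists2 y, `|y - x| < 2 * h & second u' i' j' h = h * h * pd j' (pd i' u') y.
  move=> su' h0.
  pose w y := u' (y + h *: basis j') - u' y.
  have sw : Smooth w by apply: smoothB => //; exact: smooth_shift.
  have [c /andP[c0 ch] e] := MVT_line x i' sw h0.
  have [d /andP[d0 dh] e'] := MVT_line (c *: basis i' + x) j' (smooth_pderiv i' su') h0.
  exists (d *: basis j' + (c *: basis i' + x)).
    rewrite addrA addrK (le_lt_trans (ler_normD _ _))// mulr_natl mulr2n ltrD//.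
      rewrite normrZ gtr0_norm// (le_lt_trans _ dh)// -[leRHS]mulr1.
      by rewrite ler_wpM2l ?norm_basis// ltW.
    rewrite normrZ gtr0_norm// (le_lt_trans _ ch)// -[leRHS]mulr1.
    by rewrite ler_wpM2l ?norm_basis// ltW.
  transitivity (w (h *: basis i' + x) - w x).
    rewrite /second /w [x + _]addrC -[_ + x + _]addrA [x + _]addrC.
    by ring.
  rewrite e -mulrA -e'; congr (_ * _); rewrite /w.
  have -> : pd i' (fun y => u' (y + h *: basis j') - u' y) =
     fun y => pd i' u' (y + h *: basis j') - pd i' u' y.
    have := @DDB _ _ [:: i'] _ _ (smooth_shift (h *: basis j') su') su'.
    by rewrite /= pderiv_shift.
  by rewrite [_ + h *: _]addrC.
have sym (h : R) : second u i j h = second u j i h.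
  by rewrite /second addrCA; ring.
apply/eqP; rewrite -subr_eq0 -normr_le0; apply/ler_addgt0Pl => e e0.
have sij := smooth_continuous (smooth_pderiv i (smooth_pderiv j su)).
have sji := smooth_continuous (smooth_pderiv j (smooth_pderiv i su)).
have e20 : 0 < e / 2 by rewrite divr_gt0.
have /cvgrPdist_lt/(_ _ e20)/nbhs_ballP[r1 /= r10 H1] := sij x.
have /cvgrPdist_lt/(_ _ e20)/nbhs_ballP[r2 /= r20 H2] := sji x.
have [h h0 hE] : exists2 h, 0 < h & 2 * h = Num.min r1 r2.
  exists (Num.min r1 r2 / 2); last by rewrite mulrC divfK.
  by rewrite divr_gt0// lt_min r10.
have [y1 yx1 E1] := key u j i h su h0.
have [y2 yx2 E2] := key u i j h su h0.
rewrite hE in yx1 yx2; rewrite lt_min in yx1; rewrite lt_min in yx2.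
move/andP: yx1 => [yx1 _]; move/andP: yx2 => [_ yx2].
have EE : pd i (pd j u) y1 = pd j (pd i u) y2.
  have hh : h * h != 0 by rewrite mulf_neq0// gt_eqF.
  exact: (mulfI hh (etrans (esym E1) (etrans (esym (sym h)) E2))).
have := H1 y1; rewrite -ball_normE /= distrC => /(_ yx1) K1.
have := H2 y2; rewrite -ball_normE /= distrC => /(_ yx2) K2.
have tri (a b c d : R) : c = d -> a - b = (a - c) - (b - d).
  by move=> ->; rewrite opprB addrA subrK.
rewrite addr0 (tri _ _ _ _ EE).
by rewrite (le_trans (ler_normB _ _))// (splitr e) ltW// ltrD.
Qed.

Lemma pderiv_DD i s u : Smooth u -> pd i (DD s u) = DD s (pd i u).
Proof.
move=> su; elim: s => // j s IH.
by rewrite !DD_cons -IH pderivC//; exact: smooth_DD.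
Qed.

Lemma DD_perm s t u : Smooth u -> perm_eq s t -> DD s u = DD t u.
Proof.
move=> su; elim: s t => [|i s IH] t st.
  by rewrite perm_sym in st; move/perm_nilP : st => ->.
have it : i \in t by rewrite -(perm_mem st) mem_head.
have [p1 [p2 tE]] : exists p1 p2, t = p1 ++ i :: p2.
  by case/splitPr: it => p1 p2; exists p1, p2.
rewrite tE in st *; rewrite DD_cons (IH (p1 ++ p2)); last first.
  by rewrite -(perm_cons i) (permPl st) perm_catC/= perm_cons perm_catC.
by rewrite !DD_cat DD_cons pderiv_DD//; exact: smooth_DD.
Qed.

Definition mlist (alpha : 'I_n.+1 -> nat) : seq 'I_n.+1 :=
  flatten [seq nseq (alpha i) i | i <- enum 'I_n.+1].

Lemma mderivE alpha u : mderiv alpha u = DD (mlist alpha) u.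
Proof.
rewrite /mderiv /mlist -pdE; elim: (enum _) => //= i s IH.
rewrite DD_cat -IH; elim: (alpha i) => //= k ->.
by [].
Qed.

Lemma count_mlist alpha i : count_mem i (mlist alpha) = alpha i.
Proof.
rewrite /mlist count_flatten -map_comp.
rewrite (eq_map (g := fun j => (j == i) * alpha j)%N); last first.
  by move=> j /=; rewrite count_nseq/= eq_sym.
rewrite sumnE big_map big_enum/= (bigD1 i)//= eqxx mul1n big1 ?addn0//.
by move=> j /negbTE->.
Qed.

Lemma size_mlist alpha : size (mlist alpha) = (\sum_i alpha i)%N.
Proof.
rewrite /mlist size_flatten /shape -map_comp sumnE big_map big_enum/=.
by apply: eq_bigr => i _; rewrite size_nseq.
Qed.

Definition mcount s : 'I_n.+1 -> nat := fun i => count_mem i s.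

Lemma DD_mderiv s u : Smooth u -> DD s u = mderiv (mcount s) u.
Proof.
move=> su; rewrite mderivE; apply: DD_perm => //.
by apply/permP => a; apply/permP; apply/allP => i _ /=; rewrite count_mlist.
Qed.

Lemma sum_mcount s : (\sum_i mcount s i)%N = size s.
Proof.
rewrite -size_mlist; apply: perm_size; apply/allP => i _ /=.
by rewrite count_mlist.
Qed.

Lemma coord_continuous i : continuous (fun x : E => x ord0 i).
Proof. by move=> x; exact: coord_continuous. Qed.

Definition dirR : unit -> R := fun=> 1.

Lemma pderiv_coord (h : R -> R) i j : Coo dirR h ->
  pd j (fun x => h (x ord0 i)) =
  fun x => (if j == i then 'D_1 h (x ord0 i) else 0).
Proof.
move=> ch; apply/funext => x; rewrite /= pd_derive; have [->|ji] := eqVneq j i.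
  by apply: derive_congr => t; rewrite mxE [X in X + _]mxE basisE eqxx.
have -> : 'D_(basis j) (fun x : E => h (x ord0 i)) x =
    'D_(basis j) (fun _ : E => h (x ord0 i)) x.
  by apply: derive_congr => t; rewrite mxE [X in X + _]mxE basisE eq_sym (negbTE ji) mulr0 add0r.
exact: (derive_cst (h (x ord0 i))).
Qed.

Lemma smooth_coord (h : R -> R) i : Coo dirR h -> Smooth (fun x => h (x ord0 i)).
Proof.
move=> ch; apply/smoothP => k; elim: k h ch => [|k IH] h ch.
  split=> // x; apply: (@continuous_comp _ _ _ (fun x : E => x ord0 i) h).
    exact: coord_continuous.
  exact: Coo_continuous ch _.
split; first exact: Ck_continuous (IH _ ch).
move=> j; split=> [x|].
  have [->|ji] := eqVneq j i.
    rewrite (@derivable_congr _ _ _ _ h _ _ (x ord0 i) 1).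
      exact: (@Coo_derivable _ _ _ dirR h tt (x ord0 i) ch).
    by move=> t; rewrite mxE [X in X + _]mxE basisE eqxx.
  rewrite (@derivable_congr _ _ _ _ (fun _ : E => h (x ord0 i)) _ _ x (basis j)).
    exact: derivable_cst.
  by move=> t; rewrite mxE [X in X + _]mxE basisE eq_sym (negbTE ji) mulr0 add0r.
rewrite (_ : 'D_(basis j) _ = pd j (fun x : E => h (x ord0 i))); last by rewrite pdE.
rewrite pderiv_coord//.
case: eqP => _; last exact: Ck_cst.
exact: (IH _ (@Coo_derive _ _ _ dirR h tt ch)).
Qed.

Lemma pderiv_affine i u (a : R) (c : E) : Smooth u ->
  pd i (fun x => u (a *: x + c)) = fun x => a * pd i u (a *: x + c).
Proof.
move=> su; apply/funext => x.
pose U h := u (h *: basis i + (a *: x + c)).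
have dU : @is_derive R R R 0 1 U (pd i u (0 *: basis i + (a *: x + c))).
  exact: is_derive_line.
have da : @is_derive R R R 0 1 (fun h => a * h) a.
  rewrite (_ : (fun h => a * h) = a \*: id)//.
  by apply: is_derive_eq; rewrite [_ *: _]mulr1.
rewrite /= !pd_derive; transitivity ('D_1 (U \o (fun h => a * h)) 0).
  apply: derive_congr => h.
  by rewrite /U /= addr0 [h *: (1 : R)]mulr1 scalerDr scalerA addrA.
rewrite -derive1E derive1_comp; last 2 first.
- by have [] := da.
- by rewrite mulr0; have [] := dU.
rewrite !derive1E mulr0 (@derive_val _ _ _ _ _ _ _ dU).
by rewrite (@derive_val _ _ _ _ _ _ _ da) scale0r add0r mulrC pd_derive.
Qed.

Lemma derivable_affine i u (a : R) (c : E) x : Smooth u ->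
  derivable (fun x => u (a *: x + c)) x (basis i).
Proof.
move=> su.
pose U h := u (h *: basis i + (a *: x + c)).
have dU : @is_derive R R R 0 1 U (pd i u (0 *: basis i + (a *: x + c))).
  exact: is_derive_line.
rewrite (@derivable_congr _ _ _ _ (U \o (fun h => a * h)) _ _ 0 1).
  apply/derivable1_diffP/differentiable_comp; apply/derivable1_diffP.
    exact: derivableZ.
  by rewrite mulr0; have [] := dU.
move=> h.
by rewrite /U /= addr0 [h *: (1 : R)]mulr1 scalerDr scalerA addrA.
Qed.

Lemma smooth_affine u (a : R) (c : E) : Smooth u ->
  Smooth (fun x => u (a *: x + c)).
Proof.
move=> su; apply/smoothP => k; elim: k u su => [|k IH] u su; split => //.
- move=> x; apply: (@continuous_comp _ _ _ (fun x => a *: x + c) u).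
    apply: continuousD; [exact: scaler_continuous|exact: cst_continuous].
  exact: smooth_continuous.
- move=> x; apply: (@continuous_comp _ _ _ (fun x => a *: x + c) u).
    apply: continuousD; [exact: scaler_continuous|exact: cst_continuous].
  exact: smooth_continuous.
move=> i; split=> [x|]; first exact: derivable_affine.
rewrite (_ : 'D_(basis i) _ = pd i (fun x => u (a *: x + c))); last by rewrite pdE.
rewrite pderiv_affine//.
by apply: CkZ; apply: IH; exact: smooth_pderiv.
Qed.

Lemma DD_affine s u (a : R) (c : E) : Smooth u ->
  DD s (fun x => u (a *: x + c)) =
  fun x => a ^+ size s * DD s u (a *: x + c).
Proof.
move=> su; elim: s => [|i s IH]; first by apply/funext => x; rewrite mul1r.
rewrite DD_cons IH pderivZ; last by apply: smooth_affine; exact: smooth_DD.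
apply/funext => x; rewrite pderiv_affine; last exact: smooth_DD.
by rewrite mulrA -exprSr.
Qed.

End partial_derivatives2.

(** * A smooth step function of one real variable *)

Section real_calculus.
Context {R : realType}.
Implicit Types (f g h : R -> R) (x y u : R).

Lemma is_derive_comp1 f g x (df dg : R) :
  is_derive x 1 g dg -> is_derive (g x) 1 f df ->
  is_derive x 1 (f \o g) (df * dg).
Proof.
move=> [Dg <-] [Df <-]; apply: DeriveDef.
  apply/derivable1_diffP/differentiable_comp; apply/derivable1_diffP.
    exact: Dg.
  exact: Df.
by rewrite -derive1E derive1_comp; [rewrite !derive1E|exact: Dg|exact: Df].
Qed.

Lemma is_derive_affine (a c x : R) : @is_derive R R R x 1 (fun y => a * y + c) a.
Proof.
rewrite (_ : (fun y => a * y + c) = (a \*: id) + cst c)//.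
by apply: is_derive_eq; rewrite addr0 [_ *: _]mulr1.
Qed.

Lemma Coo_affine f (a c : R) : Coo dirR f -> Coo dirR (fun x => f (a * x + c)).
Proof.
have D g x : Coo dirR g ->
    is_derive x 1 (fun x => g (a * x + c)) ('D_1 g (a * x + c) * a).
  move=> Cg; apply: (is_derive_comp1 (is_derive_affine a c x)).
  by apply: derivableP; exact: (@Coo_derivable _ _ _ dirR g tt).
move=> Cf k; elim: k f Cf => [|k IH] f Cf.
  split=> // x; apply: differentiable_continuous; apply/derivable1_diffP.
  by have [] := D f x Cf.
split=> [|[]].
  move=> x; apply: differentiable_continuous; apply/derivable1_diffP.
  by have [] := D f x Cf.
split=> [x|]; first by have [] := D f x Cf.
rewrite (_ : 'D_(dirR tt) _ = (fun x => 'D_1 f (a * x + c) * a)).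
  apply: CkM; last exact: Ck_cst.
  exact: (IH _ (@Coo_derive _ _ _ dirR f tt Cf)).
by apply/funext => x; have [] := D f x Cf.
Qed.

(** By induction on p, from u^j <= j! exp(u). At u = 1/x with k = 2 it makes [flat p] vanish to
    second order at 0. *)
Lemma poly_exp_bound (p : {poly R}) (k : nat) :
  exists2 C, 0 <= C & forall u, 0 <= u -> `|p.[u]| * u ^+ k * expR (- u) <= C.
Proof.
have mono (j : nat) u : 0 <= u -> u ^+ j * expR (- u) <= j`!%:R.
  move=> u0; rewrite expRN ler_pdivrMr ?expR_gt0//.
  case: j => [|j]; first by rewrite expr0 mul1r -expR0 ler_expR.
  rewrite -ler_pdivrMl ?ltr0n ?fact_gt0// mulrC.
  by rewrite (le_trans _ (expR_ge1Dxn j u0))// ler_wpDl.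
elim/poly_ind: p k => [|p c IH] k.
  by exists 0 => // u _; rewrite horner0 normr0 !mul0r.
have [C C0 HC] := IH k.+1.
exists (C + `|c| * k`!%:R) => [|u u0]; first by rewrite addr_ge0// mulr_ge0.
rewrite hornerMXaddC.
apply: (@le_trans _ _ ((`|p.[u]| * u + `|c|) * u ^+ k * expR (- u))).
  rewrite -!mulrA ler_wpM2r ?mulr_ge0 ?exprn_ge0 ?expR_ge0//.
  by rewrite (le_trans (ler_normD _ _))// normrM [`|u|]ger0_norm.
rewrite !mulrDl; apply: lerD.
  by rewrite (le_trans _ (HC u u0))// exprS !mulrA.
by rewrite -mulrA ler_wpM2l// mono.
Qed.

(** This class contains exp(-1/x) and is closed under derivation, which sends p to X^2 (p - p');
    smoothness then follows by induction on the order. *)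
Definition flat (p : {poly R}) x := if 0 < x then p.[x^-1] * expR (- x^-1) else 0.

Lemma is_derive_flat p x : is_derive x 1 (flat p) (flat ('X^2 * (p - p^`())) x).
Proof.
have [x0|x0|x0] := ltgtP x 0.
- apply: (near_eq_is_derive (f := fun=> 0)); last first.
    by apply: is_derive_eq; rewrite /flat ltNge ltW.
  have : \forall y \near x, y < 0 by exact: lt_nbhsl.
  by apply: filterS => y y0; rewrite /flat ltNge ltW.
- apply: (near_eq_is_derive (f := fun x => p.[x^-1] * expR (- x^-1))).
    have : \forall y \near x, 0 < y by exact: lt_nbhsr.
    by apply: filterS => y y0; rewrite /flat y0.
  have xn0 : x != 0 by rewrite gt_eqF.
  have di : is_derive x 1 (fun y : R => y^-1) (- x ^- 2).
    apply: DeriveDef; first exact: derivableV.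
    by rewrite deriveV// derive_id [_ *: _]mulr1.
  have dp : is_derive x 1 (horner p \o (fun y : R => y^-1)) (p^`().[x^-1] * - x ^- 2).
    exact: (is_derive_comp1 di).
  have de : is_derive x 1 (expR \o (fun y : R => - y^-1)) (expR (- x^-1) * - (- x ^- 2)).
    by apply: is_derive_comp1.
  have := is_deriveM dp de; rewrite /flat x0 => H.
  rewrite (_ : _ * _ = p.[x^-1] * (expR (- x^-1) * - (- x ^- 2)) +
    expR (- x^-1) * (p^`().[x^-1] * - x ^- 2))//.
  by rewrite hornerM hornerXn hornerD hornerN exprVn; ring.
- rewrite x0 /flat ltxx.
  have [C C0 HC] := poly_exp_bound p 2.
  have lim0 : (fun t : R => t^-1 *: ((flat p \o shift (0 : R)) (t *: (1 : R)) - flat p 0)) @ 0^' --> (0 : R).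
    apply/cvgrPdist_le => e e0.
    near=> h.
    rewrite /= addr0 [_ *: (1 : R)]mulr1 {2}/flat ltxx subr0 sub0r normrN /flat.
    have [h0|h0] := ltP 0 h; last by rewrite scaler0 normr0 ltW.
    rewrite normrM !normrM (ger0_norm (expR_ge0 _)).
    have hi : 0 < h^-1 by rewrite invr_gt0.
    rewrite (gtr0_norm hi).
    apply: (@le_trans _ _ (C * h)).
      rewrite -ler_pdivrMr// (le_trans _ (HC _ (ltW hi)))//.
      rewrite le_eqVlt; apply/orP; left; apply/eqP; rewrite expr2; ring.
    rewrite (@le_trans _ _ ((C + 1) * h))//; first by rewrite ler_pM2r// lerDl.
    rewrite mulrC -ler_pdivlMr; last by rewrite ltr_wpDl.
    rewrite ltW// (le_lt_trans (ler_norm _))//.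
    near: h; apply: dnbhs0_lt; rewrite divr_gt0//.
    by rewrite ltr_wpDl.
  by apply: DeriveDef; [apply/cvg_ex; exists 0|exact: cvg_lim lim0].
Unshelve. all: by end_near. Qed.

Lemma Coo_flat p : Coo dirR (flat p).
Proof.
have cf q : continuous (flat q).
  move=> x; apply: differentiable_continuous; apply/derivable1_diffP.
  by have [] := is_derive_flat q x.
move=> k; elim: k p => [|k IH] p; split => // -[]; split.
  by move=> x; have [] := is_derive_flat p x.
rewrite (_ : 'D_(dirR tt) _ = flat ('X^2 * (p - p^`()))); first exact: IH.
by apply/funext => x; have [] := is_derive_flat p x.
Qed.

Let e := flat 1.

Let e_ge0 x : 0 <= e x.
Proof. by rewrite /e /flat; case: ifP => // _; rewrite hornerC mul1r expR_ge0. Qed.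

Let e_gt0 x : 0 < x -> 0 < e x.
Proof. by rewrite /e /flat => ->; rewrite hornerC mul1r expR_gt0. Qed.

Let e_eq0 x : x <= 0 -> e x = 0.
Proof. by rewrite /e /flat leNgt => /negbTE->. Qed.

Let den x := e x + e (-1 * x + 1).

Let den_gt0 x : 0 < den x.
Proof.
rewrite /den; have [x0|x0] := ltP 0 x.
  by rewrite ltr_wpDr// e_gt0.
by rewrite ltr_wpDl// e_gt0//; lra.
Qed.

(** The standard smooth transition, equal to 0 for x <= 0 and to 1 for x >= 1; the denominator is
    positive since x or 1 - x is. The form -1 * x + 1 is the one of [Coo_affine]. *)
Definition step x : R := flat 1 x / (flat 1 x + flat 1 (-1 * x + 1)).

Lemma Coo_step : Coo dirR step.
Proof.
move=> k; apply: CkM; first exact: Coo_flat.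
apply: CkV; first by move=> x; rewrite gt_eqF// den_gt0.
by apply: CkD; [exact: Coo_flat|exact: (Coo_affine (-1) 1 (Coo_flat 1))].
Qed.

Lemma step0 x : x <= 0 -> step x = 0.
Proof. by move=> x0; rewrite /step -/e e_eq0// mul0r. Qed.

Lemma step1 x : 1 <= x -> step x = 1.
Proof.
move=> x1; rewrite /step -/e (e_eq0 (x := -1 * x + 1)); last lra.
by rewrite addr0 divff// gt_eqF// e_gt0//; lra.
Qed.

Lemma step_ge0 x : 0 <= step x.
Proof. by rewrite /step divr_ge0// ?e_ge0// ltW// den_gt0. Qed.

Lemma step_le1 x : step x <= 1.
Proof. by rewrite /step ler_pdivrMr ?den_gt0// mul1r lerDl e_ge0. Qed.

(** This difference is the hat function of the partition of unity, carried by [-1, 1]. For x >= 0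
    its first term is 1, for x < 0 its second term is 0. *)
Lemma step_sub_ge0 x : 0 <= step (x + 1) - step x.
Proof.
have [x0|x0] := leP 0 x; first by rewrite (@step1 (x + 1)) ?subr_ge0 ?step_le1//; lra.
by rewrite (@step0 x) ?subr0 ?step_ge0// ltW.
Qed.

Lemma step_sub_eq0 x : 1 <= `|x| -> step (x + 1) - step x = 0.
Proof.
have [x0|x0] := leP 0 x.
  by rewrite ger0_norm// => x1; rewrite !step1 ?subrr//; lra.
by rewrite ltr0_norm// => x1; rewrite !step0 ?subrr//; lra.
Qed.

Lemma sum_step (a : R) (N : nat) :
  \sum_(j < N) (step (a - j%:R + 1) - step (a - j%:R)) =
  step (a + 1) - step (a + 1 - N%:R).
Proof.
elim: N => [|N IH]; first by rewrite big_ord0 subr0 subrr.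
rewrite big_ord_recr/= IH -natr1 (_ : a - N%:R + 1 = a + 1 - N%:R); last by ring.
rewrite (_ : a + 1 - (N%:R + 1) = a - N%:R); last by ring.
by rewrite addrA subrK.
Qed.

Definition dstep x : R := 'D_1 step x.

Lemma Coo_dstep : Coo dirR dstep.
Proof. exact: (@Coo_derive _ _ _ dirR step tt Coo_step). Qed.

Lemma is_derive_step x : is_derive x 1 step (dstep x).
Proof. by apply: derivableP; exact: (@Coo_derivable _ _ _ dirR step tt x Coo_step). Qed.

(** On the open half-lines [step] is locally constant; the end points 0 and 1 follow by continuity
    of [dstep]. *)
Lemma dstep_eq0 x : x <= 0 \/ 1 <= x -> dstep x = 0.
Proof.
have cd := Coo_continuous Coo_dstep.
have ev y : y < 0 \/ 1 < y -> dstep y = 0.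
  case=> y0.
    rewrite /dstep (@near_eq_derive _ R R _ (fun=> 0 : R)); first exact: (derive_cst (0 : R)).
    have : \forall z \near y, z < 0 by exact: lt_nbhsl.
    by apply: filterS => z z0; rewrite step0// ltW.
  rewrite /dstep (@near_eq_derive _ R R _ (fun=> 1 : R)); first exact: (derive_cst (1 : R)).
  have : \forall z \near y, 1 < z by exact: lt_nbhsr.
  by apply: filterS => z z0; rewrite step1// ltW.
have close (y : R) (s : R) : (forall t, 0 < t -> dstep (y + s * t) = 0) -> dstep y = 0.
  move=> H; apply/eqP; rewrite -normr_le0; apply/ler_addgt0Pl => d d0.
  have /cvgrPdist_le/(_ _ d0)/nbhs_ballP[r /= r0 Hr] := cd y.
  pose t := r / (`|s| + 1) / 2.
  have s1 : 0 < `|s| + 1 by rewrite ltr_wpDl.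
  have t0 : 0 < t by rewrite !divr_gt0.
  have := Hr (y + s * t); rewrite H// subr0 addr0; apply.
  rewrite -ball_normE /= opprD addrA subrr sub0r normrN normrM (gtr0_norm t0).
  rewrite (@lt_le_trans _ _ ((`|s| + 1) * t))//; first by rewrite ltr_pM2r// ltrDl.
  have -> : (`|s| + 1) * t = r / 2 by rewrite /t mulrA [_ * (r / _)]mulrC divfK ?gt_eqF.
  lra.
case=> x0.
  apply: (close x (-1)) => t t0; apply: ev; left; lra.
apply: (close x 1) => t t0; apply: ev; right; lra.
Qed.

(** The quotient rule gives e(x) b + e(1 - x) a divided by the square of [den x], where a and b are
    the nonnegative derivatives of e at x and at 1 - x. *)
Lemma dstep_ge0 x : 0 <= dstep x.
Proof.
have fl y : 0 <= flat ('X^2 * (1 - 1^`())) y.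
  rewrite /flat; case: ifP => // y0.
  by rewrite derivC subr0 mulr1 hornerXn mulr_ge0 ?expR_ge0// exprn_ge0// invr_ge0 ltW.
have de := is_derive_flat 1 x; rewrite -/e in de.
have de1 : is_derive x 1 (fun x => e (-1 * x + 1))
    (flat ('X^2 * (1 - 1^`())) (-1 * x + 1) * -1).
  exact: (is_derive_comp1 (is_derive_affine (-1) 1 x) (is_derive_flat 1 _)).
have dd := is_deriveD de de1.
have dv : is_derive x 1 (fun y => (den y)^-1) (- (den x) ^- 2 *:
    (flat ('X^2 * (1 - 1^`())) x + flat ('X^2 * (1 - 1^`())) (-1 * x + 1) * -1)).
  apply: DeriveDef.
    by apply: derivableV; [rewrite gt_eqF// den_gt0|have [] := dd].
  rewrite deriveV; [|by rewrite gt_eqF// den_gt0|by have [] := dd].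
  by congr (_ *: _); have [] := dd.
have := is_deriveM de dv => -[_ H].
rewrite /dstep (_ : step = e * (fun y => (den y)^-1))// H.
set a := flat _ x in fl *; have a0 : 0 <= a by exact: fl.
set b := flat _ (-1 * x + 1); have b0 : 0 <= b by exact: fl.
have dx := den_gt0 x.
rewrite (_ : _ + _ = (den x) ^- 2 * (e x * b + e (-1 * x + 1) * a)).
  by rewrite mulr_ge0 ?addr_ge0 ?mulr_ge0// invr_ge0 exprn_ge0// ltW.
have -> : (den x)^-1 *: a = (den x)^-2 * (den x * a).
  by rewrite [LHS]/GRing.scale/= expr2 invfM -mulrA [_^-1 * (den x * a)]mulrA mulVf ?mul1r// gt_eqF.
set D := (den x)^-2.
change (e x * (- D * (a + b * -1)) + D * (den x * a) =
  D * (e x * b + e (-1 * x + 1) * a)).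
by move: D; rewrite /den => D; ring.
Qed.

Lemma dstep_gt0 : exists2 c, 0 < c < 1 & 0 < dstep c.
Proof.
have [||c c01] := @MVT _ step dstep 0 1 ltr01.
- by move=> t _; exact: is_derive_step.
- apply: derivable_within_continuous => t _.
  by have [] := is_derive_step t.
rewrite step1// step0// !subr0 mulr1 => c1.
by exists c; [rewrite in_itv in c01|rewrite -c1].
Qed.

End real_calculus.

(** * Lebesgue measure and integration *)

Section lebesgue_measure_rV.
Context {R : realType} {n : nat}.
Local Notation E := 'rV[R]_n.+1.
Local Notation mu := (@lebesgue_rV R n).
Implicit Types (A B : set E) (x y c : E) (b : E * E).

Definition ccube c (r : R) : set E := [set y | `|y - c| <= r].

Lemma lebesgue_le_box A b : A `<=` box b -> (mu A <= (box_volume b)%:E)%E.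
Proof.
move=> Ab; apply: ereal_inf_lbound.
pose B k : E * E := if k is 0%N then b else (0, 0).
exists B; first by move=> x /Ab ?; exists 0%N.
have B0 : box_volume (0 : E, 0 : E) = 0.
  by rewrite /box_volume big_ord_recl/= subrr maxxx mul0r.
rewrite (nneseries_split 0 1); last by move=> k _; exact: box_volume_ge0.
rewrite big_nat1 /= eseries0 ?adde0// => k k1 _.
by case: k k1 => //= k _; rewrite B0.
Qed.

(** Boxes are open on the left, so the closed cube is put in a slightly larger box; the side 3r
    instead of 2r is a convenience. *)
Lemma mu_ccube c (r : R) : 0 < r -> (mu (ccube c r) <= ((3 * r) ^+ n.+1)%:E)%E.
Proof.
move=> r0; pose b : E * E := (c - const_mx (2 * r), c + const_mx r).
have -> : (3 * r) ^+ n.+1 = box_volume b.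
  rewrite /box_volume (eq_bigr (fun=> 3 * r)) ?prodr_const ?card_ord// => i _ /=.
  rewrite !mxE max_r; last by lra.
  by ring.
apply: lebesgue_le_box => x /= xc i; rewrite !mxE.
have := normr_coord (x - c) i; rewrite !mxE => /le_trans/(_ xc).
by rewrite ler_norml => /andP[? ?]; lra.
Qed.

Definition half i (a : R) : set E := [set x | x ord0 i <= a].

(** Caratheodory's criterion: the hyperplane cuts each box of a cover into two boxes whose volumes
    add up. *)
Lemma measurable_half i (a : R) : measurable (half i a).
Proof.
apply: le_caratheodory_measurable => X; apply: le_ereal_inf_tmp => _ [B XB <-].
pose u (v : E) (t : R) : E := \row_j (if j == i then t else v ord0 j).
pose B1 k : E * E := ((B k).1, u (B k).2 (Num.min ((B k).2 ord0 i) a)).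
pose B2 k : E * E := (u (B k).1 (Num.max ((B k).1 ord0 i) a), (B k).2).
have vol k : box_volume (B1 k) + box_volume (B2 k) = box_volume (B k).
  rewrite /box_volume (bigD1 i)//= [X in _ + X](bigD1 i)//= [RHS](bigD1 i)//=.
  rewrite !mxE !eqxx.
  rewrite [X in _ * X + _](eq_bigr (fun j => Num.max 0 ((B k).2 ord0 j - (B k).1 ord0 j))); last first.
    by move=> j /negbTE ji; rewrite !mxE ji.
  rewrite [X in _ + _ * X](eq_bigr (fun j => Num.max 0 ((B k).2 ord0 j - (B k).1 ord0 j))); last first.
    by move=> j /negbTE ji; rewrite !mxE ji.
  rewrite -mulrDl; congr (_ * _).
  move: ((B k).1 ord0 i) ((B k).2 ord0 i) => p q.
  have [qa|aq] := leP q a; have [pa|ap] := leP p a;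
    rewrite !maxEle; do ![case: ifPn; rewrite -?ltNge => ?]; lra.
apply: (@le_trans _ _ (\sum_(k <oo) (box_volume (B1 k))%:E +
    \sum_(k <oo) (box_volume (B2 k))%:E)%E); last first.
  rewrite -nneseriesD; last 2 first.
  - by move=> k _ _; exact: box_volume_ge0.
  - by move=> k _ _; exact: box_volume_ge0.
  by apply: lee_nneseries => k _; rewrite ?adde_ge0 ?box_volume_ge0// -EFinD vol.
apply: leeD; apply: ereal_inf_lbound.
- exists B1 => // x [/XB[k _ Bx] xa]; exists k => // j; rewrite /= mxE.
  have := Bx j; have [->|//] := eqVneq j i.
  by rewrite le_min => /andP[-> ->].
- exists B2 => // x [/XB[k _ Bx] /negP xa]; exists k => // j; rewrite /= mxE.
  have := Bx j; have [->|//] := eqVneq j i.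
  by rewrite gt_max => /andP[-> ->]; rewrite /= andbT ltNge.
Qed.

Lemma measurable_box b : measurable (box b).
Proof.
have -> : box b = \big[setI/setT]_(i < n.+1) (~` half i (b.1 ord0 i) `&` half i (b.2 ord0 i)).
  apply/seteqP; split => x.
    move=> H; apply: (big_ind (fun S : set E => S x)) => [//|S T Sx Tx|i _]; first by split.
    by have /andP[ax xb] := H i; split=> //; apply/negP; rewrite -ltNge.
  move=> H i; have : (~` half i (b.1 ord0 i) `&` half i (b.2 ord0 i)) x.
    by move: H; rewrite (bigD1 i)//= => -[].
  by move=> [/negP + xb]; rewrite -ltNge => ->.
by apply: bigsetI_measurable => i _; apply: measurableI;
  [apply: measurableC|]; exact: measurable_half.
Qed.

(** An open set is the countable union of the rational boxes that it contains. *)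
Lemma open_measurable_rV A : open A -> measurable A.
Proof.
move=> oA.
pose qb (q : 'rV[rat]_n.+1 * 'rV[rat]_n.+1) : E * E :=
  (map_mx ratr q.1, map_mx ratr q.2).
pose F k : set E := if (unpickle k : option ('rV[rat]_n.+1 * 'rV[rat]_n.+1)) is Some q
  then [set x | box (qb q) x /\ box (qb q) `<=` A] else set0.
have -> : A = \bigcup_k F k.
  apply/seteqP; split => [x Ax|x [k _]]; last first.
    by rewrite /F; case: unpickle => // q [xq]; apply.
  have /nbhs_ballP[r /= r0 rA] : nbhs x A by exact: open_nbhs_nbhs.
  have /fin_all_exists[q1 q1E] (i : 'I_n.+1) : exists q : rat,
     x ord0 i - r / 2 < ratr q < x ord0 i.
    have [|q] := @rat_in_itvoo R (x ord0 i - r / 2) (x ord0 i); first by lra.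
    by rewrite in_itv /= => ?; exists q.
  have /fin_all_exists[q2 q2E] (i : 'I_n.+1) : exists q : rat,
     x ord0 i < ratr q < x ord0 i + r / 2.
    have [|q] := @rat_in_itvoo R (x ord0 i) (x ord0 i + r / 2); first by lra.
    by rewrite in_itv /= => ?; exists q.
  pose q := (\row_i q1 i, \row_i q2 i).
  exists (pickle q) => //; rewrite /F pickleK; split=> [i|y yq].
    rewrite /= !mxE; have /andP[_ ->] := q1E i.
    by have /andP[/ltW-> _] := q2E i.
  apply: rA; rewrite -ball_normE /=.
  apply: (@le_lt_trans _ _ (r / 2)); last by lra.
  apply: normr_rV_le => [|i]; first by lra.
  have := yq i; rewrite /= !mxE => /andP[? ?].
  have /andP[? ?] := q1E i; have /andP[? ?] := q2E i.
  by rewrite ler_norml; lra.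
apply: bigcup_measurable => k _; rewrite /F; case: unpickle => // q.
have [qA|qA] := pselect (box (qb q) `<=` A).
  rewrite (_ : [set x | _] = box (qb q)); first exact: measurable_box.
  by apply/seteqP; split => x //= [].
rewrite (_ : [set x | _] = set0); first exact: measurable0.
by apply/seteqP; split => x //= [].
Qed.

Lemma closed_measurable_rV A : closed A -> measurable A.
Proof.
by move=> cA; rewrite -(setCK A); apply: measurableC; apply: open_measurable_rV;
  exact: closed_openC.
Qed.

Lemma continuous_measurable_rV (f : E -> R) : continuous f -> measurable_fun setT f.
Proof.
move=> /continuousP cf; move=> mD; move: mD.
apply: (measurability _ (RGenOpens.measurableE R)) => _ [_ [a [b ->] <-]].
by rewrite setTI; apply: open_measurable_rV; apply: cf; exact: interval_open.
Qed.

Lemma closed_ccube c (r : R) : closed (ccube c r).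
Proof.
have -> : ccube c r = (fun y => `|y - c|) @^-1` [set t | t <= r] by [].
apply: closed_comp => [y _|]; last exact: closed_le.
apply: continuous_comp; last exact: norm_continuous.
by apply: continuousB; [exact: cvg_id|exact: cst_continuous].
Qed.

Lemma measurable_ccube c (r : R) : measurable (ccube c r).
Proof. by apply: closed_measurable_rV; exact: closed_ccube. Qed.

Lemma mu_ccube_fin c (r : R) : (mu (ccube c r) < +oo)%E.
Proof.
apply: (@le_lt_trans _ _ (mu (ccube c (`|r| + 1)))).
  apply: le_lebesgue_outer => y /= yr.
  by rewrite /ccube /= (le_trans yr)// (le_trans (ler_norm _))// lerDl.
by rewrite (le_lt_trans (mu_ccube _ _)) ?ltry// ltr_wpDl.
Qed.

Lemma ccube_compact c (r : R) : compact (ccube c r).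
Proof.
apply: bounded_closed_compact; last exact: closed_ccube.
exists (`|c| + `|r|); split; first exact: num_real.
move=> t ct y /= yr; rewrite -(subrK c y) (le_trans (ler_normD _ _))//.
by rewrite ltW// (le_lt_trans _ ct)// addrC lerD2l (le_trans yr)// ler_norm.
Qed.

Lemma compact_ccube A : compact A -> exists2 r : R, 0 < r & A `<=` ccube 0 r.
Proof.
move=> /compact_bounded[r [_ rA]]; exists (`|r| + 1); first by rewrite ltr_wpDl.
move=> x Ax; rewrite /ccube /= subr0; apply: rA => //.
by rewrite (le_lt_trans (ler_norm _))// ltrDl.
Qed.

Lemma sub_closed_compact A (c : E) (r : R) : closed A -> A `<=` ccube c r -> compact A.
Proof.
by move=> cA AB; exact: (subclosed_compact cA (@ccube_compact c r) AB).
Qed.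

Lemma box_volume_shift b c : box_volume (b.1 + c, b.2 + c) = box_volume b.
Proof.
by apply: eq_bigr => i _ /=; rewrite !mxE [X in _ - X]addrC opprD addrA addrK.
Qed.

Lemma lebesgue_outer_shift A c : lebesgue_outer [set x + c | x in A] = lebesgue_outer A.
Proof.
have le B (d : E) : (lebesgue_outer [set (x + d)%R | x in B] <= lebesgue_outer B)%E.
  apply: le_ereal_inf_tmp => _ [C BC <-]; apply: ereal_inf_lbound.
  exists (fun k => ((C k).1 + d, (C k).2 + d)).
    move=> _ [x /BC[k _ xk] <-]; exists k => // i; rewrite /= !mxE.
    by rewrite ltrD2r lerD2r; exact: xk.
  by apply: eq_eseriesr => k _; rewrite box_volume_shift.
apply/eqP; rewrite eq_le le /=.
rewrite [leLHS](_ : _ = lebesgue_outer [set x + - c | x in [set x + c | x in A]]) ?le//.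
congr lebesgue_outer; apply/seteqP; split => [x Ax|_ [_ [x Ax <-] <-]].
  by exists (x + c); rewrite ?addrK//; exists x.
by rewrite addrK.
Qed.

Lemma preimage_shift A c : (fun x => x + c) @^-1` A = [set x + - c | x in A].
Proof.
apply/seteqP; split => [x Ax|_ [x Ax <-]]; last by rewrite /preimage /= subrK.
by exists (x + c) => //; rewrite addrK.
Qed.

Lemma measurable_preimage_shift A c : measurable A -> measurable ((fun x => x + c) @^-1` A).
Proof.
move=> mA; apply: le_caratheodory_measurable => X.
have e Y : (fun x => x + c) @^-1` A `&` Y =
    [set x + - c | x in A `&` [set x + c | x in Y]].
  apply/seteqP; split => [x [/= Ax Yx]|_ [x [Ax [y Yy yx]] <-]].
    by exists (x + c); rewrite ?addrK//; split=> //; exists x.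
  by rewrite -yx /preimage /= addrK; split => //; rewrite yx.
have e' Y : ~` ((fun x => x + c) @^-1` A) `&` Y =
    [set x + - c | x in ~` A `&` [set x + c | x in Y]].
  apply/seteqP; split => [x [/= Ax Yx]|_ [x [Ax [y Yy yx]] <-]].
    by exists (x + c); rewrite ?addrK//; split=> //; exists x.
  by rewrite -yx /preimage /= addrK; split => //=; rewrite yx.
rewrite setIC e [X in (_ + X)%E](_ : _ = lebesgue_outer (~` ((fun x => x + c) @^-1` A) `&` X)); last by rewrite setIC.
rewrite e' -[leLHS]/(lebesgue_outer _ + lebesgue_outer _)%E -[leRHS]/(lebesgue_outer _).
rewrite !lebesgue_outer_shift -(lebesgue_outer_shift X c).
rewrite [A `&` _]setIC [~` A `&` _]setIC.
by rewrite [leRHS](mA [set x + c | x in X]).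
Qed.

Lemma measurable_fun_shift c : measurable_fun setT (fun x : E => x + c).
Proof. by move=> _ A mA; rewrite setTI; exact: measurable_preimage_shift. Qed.

Lemma integral_shift (f : E -> \bar R) c : measurable_fun setT f ->
  mu.-integrable setT (fun x => f (x + c)) ->
  (\int[mu]_x f (x + c)%R = \int[mu]_x f x)%E.
Proof.
move=> mf intf.
apply: etrans (esym (integral_pushforward (measurable_fun_shift c) mf intf measurableT)) _.
apply: (eq_measure_integral mu); first exact: measurable_fun_shift.
by move=> ? A mA _; rewrite /= /pushforward preimage_shift; exact: lebesgue_outer_shift.
Qed.

End lebesgue_measure_rV.

(** * Nontriviality of the Lebesgue outer measure *)

Section lebesgue_positive.
Context {R : realType}.
Local Open Scope ereal_scope.

(* Peeling off the last coordinate by integrating over ]0, 1] in one variable. *)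
Lemma weighted_box_cover (l : nat) (a b : nat -> nat -> R) (c : nat -> R) :
  (forall k, (0 <= c k)%R) ->
  (forall x : nat -> R, (forall i, (i < l)%N -> (0 < x i <= 1)%R) ->
    1 <= \sum_(k <oo) (c k * \prod_(i < l) ((a k i < x i <= b k i)%R : nat)%:R)%:E) ->
  1 <= \sum_(k <oo) (c k * \prod_(i < l) Num.max 0 (b k i - a k i))%:E.
Proof.
elim: l c => [|l IH] c c0 H.
  apply: le_trans (H (fun=> 1%R) _) _ => //.
  by apply: lee_nneseries => k _; rewrite !big_ord0// lee_fin mulr1.
pose len k : R := Num.max 0%R (b k l - a k l)%R.
have len0 k : (0 <= len k)%R by rewrite le_max lexx.
rewrite [leRHS](_ : _ = \sum_(k <oo) (c k * len k * \prod_(i < l) Num.max 0 (b k i - a k i))%:E).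
  apply: (IH (fun k => c k * len k)%R) => [k|x Hx]; first by rewrite mulr_ge0.
  pose D : set R := `]0%R, 1%R]%classic.
  have mD : measurable D by exact: measurable_itv.
  pose w k : R := (c k * \prod_(i < l) ((a k i < x i <= b k i)%R : nat)%:R)%R.
  have w0 k : (0 <= w k)%R by rewrite mulr_ge0// prodr_ge0.
  pose I k : set R := `]a k l, b k l]%classic.
  have mI k : measurable (I k) by exact: measurable_itv.
  have D1 : lebesgue_measure D = 1.
    by rewrite lebesgue_measure_itv /= lte_fin ltr01 oppr0 adde0.
  apply: (@le_trans _ _ (\int[lebesgue_measure]_(t in D) cst 1 t)).
    by rewrite integral_cst// [X in _ * X]D1 mule1.
  apply: (@le_trans _ _ (\int[lebesgue_measure]_(t in D)
      \sum_(k <oo) ((w k)%:E * (\1_(I k) t)%:E))).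
    apply: ge0_le_integral => //.
    - apply: ge0_emeasurable_sum => [k t _ _|k _].
        by rewrite mule_ge0// lee_fin.
      apply/measurable_EFinP; apply: measurable_funM => //.
      apply: measurable_indic; exact: mI.
    move=> t; rewrite /D /= in_itv /= => t01.
    have := H (fun i => if (i == l)%N then t else x i) _.
    move=> /(_ _)/le_trans; apply.
      move=> i; rewrite ltnS leq_eqVlt; case: eqP => [//|_ /= il]; exact: Hx.
    apply: lee_nneseries => k _; first by rewrite lee_fin mulr_ge0// prodr_ge0.
    rewrite -EFinM lee_fin big_ord_recr /= eqxx mulrA.
    rewrite (eq_bigr (fun i : 'I_l => ((a k i < x i <= b k i)%R : nat)%:R)); last first.
      by move=> i _; rewrite ltn_eqF.
    apply: ler_wpM2l; first exact: w0.
    rewrite indicE /I.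
    rewrite (_ : (t \in _) = (a k l < t <= b k l)%R)//.
    by apply/idP/idP; rewrite inE /= in_itv.
  rewrite integral_nneseries//; last 2 first.
  - move=> k; apply/measurable_EFinP; apply: measurable_funM => //.
    apply: measurable_indic; exact: mI.
  - by move=> k t _; rewrite mule_ge0// lee_fin.
  apply: lee_nneseries => [k _ _|k _].
    by apply: integral_ge0 => t _; rewrite mule_ge0// lee_fin.
  rewrite ge0_integralZl_EFin//; last first.
    by apply/measurable_EFinP; apply: measurable_indic; exact: mI.
  rewrite (_ : (c k * len k * _)%:E = (w k)%:E * (len k)%:E); last first.
    by rewrite -EFinM /w -mulrA [(len k * _)%R]mulrC mulrA.
  apply: lee_pmul; [by rewrite lee_fin| |by []|].
    by apply: integral_ge0 => t _; rewrite lee_fin.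
  rewrite integral_indic//; last exact: mI.
  apply: (@le_trans _ _ (lebesgue_measure (I k))).
    apply: le_measure; rewrite ?inE; [|exact: mI|exact: subIsetl].
    by apply: measurableI; [exact: mI|].
  rewrite lebesgue_measure_itv /= lte_fin; case: ifP => ab.
    by rewrite -EFinB lee_fin le_max lexx orbT.
  by rewrite lee_fin.
apply: eq_eseriesr => k _; rewrite big_ord_recr /= mulrA.
by rewrite -/(len k) -!mulrA [(len k * _)%R]mulrC.
Qed.

(** A cover of the space covers the unit cube, hence has total volume at least 1. Through
    translations this makes every cube of positive measure, see [mu_ccube_gt0]. *)
Lemma lebesgue_rV_setT_gt0 (n : nat) : 0 < @lebesgue_rV R n setT.
Proof.
apply: (@lt_le_trans _ _ 1); first exact: lte01.
apply: le_ereal_inf_tmp => _ [B covB <-].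
pose a k i : R := if insub i is Some j then (B k).1 ord0 (j : 'I_n.+1) else 0%R.
pose b k i : R := if insub i is Some j then (B k).2 ord0 (j : 'I_n.+1) else 0%R.
have aE k (i : 'I_n.+1) : a k i = (B k).1 ord0 i by rewrite /a valK.
have bE k (i : 'I_n.+1) : b k i = (B k).2 ord0 i by rewrite /b valK.
apply: le_trans (@weighted_box_cover n.+1 a b (fun=> 1%R) _ _) _ => [//|x _|].
  have [k _ Bk] := covB (\row_(i < n.+1) x i) I.
  rewrite (nneseries_split 0 k.+1); last by move=> j _; rewrite lee_fin mul1r prodr_ge0.
  rewrite add0n big_nat_recr//= -[leLHS]add0e -addeA leeD//.
    by apply: sume_ge0 => j _; rewrite lee_fin mul1r prodr_ge0.
  rewrite -[leLHS]adde0 leeD//.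
    rewrite mul1r big1// => i _; rewrite aE bE.
    by have := Bk i; rewrite mxE => ->.
  by apply: nneseries_ge0 => j _ _; rewrite lee_fin mul1r prodr_ge0.
apply: lee_nneseries => k _.
  by rewrite lee_fin mul1r prodr_ge0// => i _; rewrite le_max lexx.
rewrite lee_fin mul1r /box_volume.
by rewrite (eq_bigr (fun i => Num.max 0 ((B k).2 ord0 i - (B k).1 ord0 i))%R)// => i _; rewrite aE bE.
Qed.

End lebesgue_positive.

(** * Real-valued integrals, translation invariance, integration by parts *)

Section integration.
Context {R : realType} {n : nat}.
Local Notation E := 'rV[R]_n.+1.
Local Notation mu := (@lebesgue_rV R n).
Implicit Types (A B D K : set E) (x y c : E) (u v f g phi : E -> R) (s : seq 'I_n.+1).

(* A record, so that conversion does not unfold integrability. *)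
Record integ D f : Prop := Integ { integ_integrable : mu.-integrable D (EFin \o f) }.

Lemma integ_measurable D f : integ D f -> measurable_fun D f.
Proof. by move=> [/integrableP[/measurable_EFinP]]. Qed.

Lemma integP D f : measurable_fun D f -> (\int[mu]_(x in D) `|f x|%:E < +oo)%E ->
  integ D f.
Proof. by move=> mf fi; split; apply/integrableP; split => //; exact/measurable_EFinP. Qed.

Lemma integ_fin D f : integ D f -> (\int[mu]_(x in D) `|f x|%:E < +oo)%E.
Proof. by move=> [/integrableP[]]. Qed.

Lemma integ_le D f g : measurable D -> measurable_fun D f -> integ D g ->
  (forall x, D x -> `|f x| <= `|g x|) -> integ D f.
Proof.
move=> mD mf [ig] fg; split; apply: (le_integrable mD _ _ ig).
  exact/measurable_EFinP.
by move=> x Dx; rewrite lee_fin fg.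
Qed.

Lemma integ_sub A B f : measurable A -> measurable B -> A `<=` B -> integ B f -> integ A f.
Proof. by move=> mA mB AB [fi]; split; exact: integrableS fi. Qed.

Lemma integ_norm D f : measurable D -> integ D f -> integ D (fun x => `|f x|).
Proof. by move=> mD [fi]; split; exact: integrable_norm. Qed.

Lemma integD D f g : measurable D -> integ D f -> integ D g ->
  integ D (fun x => f x + g x).
Proof.
move=> mD [fi] [gi]; split; rewrite (_ : _ \o _ = (EFin \o f) \+ (EFin \o g))%E//.
exact: integrableD.
Qed.

Lemma integB D f g : measurable D -> integ D f -> integ D g ->
  integ D (fun x => f x - g x).
Proof.
move=> mD [fi] [gi]; split; rewrite (_ : _ \o _ = (EFin \o f) \- (EFin \o g))%E//.
exact: integrableB.
Qed.

Lemma integZ D (a : R) f : measurable D -> integ D f -> integ D (fun x => a * f x).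
Proof.
move=> mD [fi]; split; rewrite (_ : _ \o _ = (fun x => a%:E * (EFin \o f) x))%E//.
exact: integrableZl.
Qed.

Lemma RintD D f g : measurable D -> integ D f -> integ D g ->
  \int[mu]_(x in D) (f x + g x) = \int[mu]_(x in D) f x + \int[mu]_(x in D) g x.
Proof. by move=> mD [fi] [gi]; exact: RintegralD. Qed.

Lemma RintB D f g : measurable D -> integ D f -> integ D g ->
  \int[mu]_(x in D) (f x - g x) = \int[mu]_(x in D) f x - \int[mu]_(x in D) g x.
Proof. by move=> mD [fi] [gi]; exact: RintegralB. Qed.

Lemma RintZ D (a : R) f : measurable D -> integ D f ->
  \int[mu]_(x in D) (a * f x) = a * \int[mu]_(x in D) f x.
Proof. by move=> mD [fi]; exact: RintegralZl. Qed.

Lemma le_Rint D f g : measurable D -> integ D f -> integ D g ->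
  (forall x, D x -> f x <= g x) -> \int[mu]_(x in D) f x <= \int[mu]_(x in D) g x.
Proof. by move=> mD [fi] [gi]; exact: le_Rintegral. Qed.

Lemma le_norm_Rint D f : measurable D -> integ D f ->
  `|\int[mu]_(x in D) f x| <= \int[mu]_(x in D) `|f x|.
Proof. by move=> mD [fi]; exact: le_normr_Rintegral. Qed.

Lemma integ_sum D (T : Type) (t : seq T) (F : T -> E -> R) : measurable D ->
  (forall i, integ D (F i)) -> integ D (fun x => \sum_(i <- t) F i x).
Proof.
move=> mD iF; elim: t => [|i t IH].
  under eq_fun do rewrite big_nil; split; exact: integrable0.
by under eq_fun do rewrite big_cons; exact: integD.
Qed.

Lemma Rintegral_sum D (T : Type) (t : seq T) (F : T -> E -> R) : measurable D ->
  (forall i, integ D (F i)) ->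
  \int[mu]_(x in D) (\sum_(i <- t) F i x) = \sum_(i <- t) \int[mu]_(x in D) F i x.
Proof.
move=> mD iF; elim: t => [|i t IH].
  under eq_Rintegral do rewrite big_nil.
  by rewrite big_nil Rintegral_cst// mul0r.
rewrite big_cons -IH -RintD//; last exact: integ_sum.
by apply: eq_Rintegral => x _; rewrite big_cons.
Qed.

Lemma integ_bounded D f (C : R) : measurable D -> (mu D < +oo)%E ->
  measurable_fun D f -> (forall x, D x -> `|f x| <= C) -> integ D f.
Proof.
move=> mD muD mf fC; split; apply: measurable_bounded_integrable => //.
exists C; split; first exact: num_real.
by move=> r Cr x /fC fx; rewrite /= (le_trans fx)// ltW.
Qed.

Lemma integM D f u (C : R) : measurable D -> integ D f ->
  measurable_fun D u -> (forall x, D x -> `|u x| <= C) ->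
  integ D (fun x => f x * u x).
Proof.
move=> mD fi mu_ uC; apply: (@integ_le _ _ (fun x => C * f x)); first exact: mD.
- by apply: measurable_funM; [exact: integ_measurable fi|exact: mu_].
- exact: integZ.
move=> x Dx; rewrite !normrM mulrC ler_wpM2r//.
by rewrite (le_trans (uC x Dx))// ler_norm.
Qed.

Lemma continuous_bounded_ccube f c (r : R) : continuous f ->
  exists2 C : R, 0 <= C & forall x, ccube c r x -> `|f x| <= C.
Proof.
move=> cf; have : compact (f @` ccube c r).
  apply: continuous_compact; last exact: ccube_compact.
  exact: continuous_subspaceT.
move=> /compact_bounded[C [_ HC]]; exists (`|C| + 1); first by rewrite addr_ge0.
move=> x cx; apply: HC; last by exists x.
by rewrite (le_lt_trans (ler_norm _))// ltrDl.
Qed.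

Definition supp_in (r : R) u := forall x, r < `|x| -> u x = 0.

Lemma supp_inDD r u s : supp_in r u -> supp_in r (DD s u).
Proof.
move=> ur x rx; apply: near0_DD.
have : open [set y : E | r < `|y|].
  rewrite (_ : [set _ | _] = ~` ccube 0 r).
    by apply: closed_openC; exact: closed_ccube.
  by apply/seteqP; split => y; rewrite /ccube /= subr0 ltNge => /negP.
move=> /(_ x rx); apply: filterS => y /= ry; exact: ur.
Qed.

Lemma supp_bounded r u : continuous u -> supp_in r u ->
  exists2 C : R, 0 <= C & forall x, `|u x| <= C.
Proof.
move=> cu ur; have [C C0 HC] := continuous_bounded_ccube 0 r cu.
exists C => // x; have [xr|xr] := leP `|x| r; last by rewrite ur// normr0.
by apply: HC; rewrite /ccube /= subr0.
Qed.

Lemma integ_supp D K f u (C : R) : measurable D -> measurable K -> K `<=` D ->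
  integ K f -> measurable_fun D f -> measurable_fun D u ->
  (forall x, `|u x| <= C) -> (forall x, D x -> ~ K x -> u x = 0) ->
  integ D (fun x => f x * u x) /\
  \int[mu]_(x in D) (f x * u x) = \int[mu]_(x in K) (f x * u x).
Proof.
move=> mD mK KD fi mf mu_ uC u0.
have e : (fun x => f x * u x) \_ D = (fun x => f x * u x) \_ K.
  apply/funext => x; rewrite /patch; case: ifPn => [/set_mem Dx|xD].
    case: ifPn => // /negP xK; rewrite u0 ?mulr0// => Kx; apply: xK; exact/mem_set.
  by case: ifPn => // /set_mem /KD /mem_set; rewrite (negbTE xD).
split; last by rewrite Rintegral_mkcond e -Rintegral_mkcond.
have mfu : measurable_fun D (fun x => f x * u x) by exact: measurable_funM.
apply: integP => //; rewrite integral_mkcond.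
rewrite (_ : _ \_ D = (fun x => `|f x * u x|%:E) \_ K)%E; last first.
  apply/funext => x; have := congr1 (fun h => `|h x|%:E) e.
  by rewrite /patch; do 2 (case: ifP => _); rewrite ?normr0.
rewrite -integral_mkcond; apply: integ_fin.
by apply: (@integM K f u C) => //; exact: measurable_funS mu_.
Qed.

Lemma integ_cs r f : continuous f -> supp_in r f -> integ setT f.
Proof.
move=> cf fr; have [C C0 HC] := supp_bounded cf fr.
have mf := continuous_measurable_rV cf.
have := @integ_supp setT (ccube 0 r) (fun=> 1) f C measurableT (measurable_ccube _ _)
  (@subsetT _ _).
move=> /(_ _ _ mf HC)[|//|x _|].
- apply: (@integ_bounded _ _ 1); first exact: measurable_ccube.
  + exact: mu_ccube_fin.
  + exact: measurable_cst.
  + by move=> x _; rewrite normr1.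
- by rewrite /ccube /= subr0 => /negP; rewrite -ltNge; exact: fr.
by move=> + _; under eq_fun do rewrite mul1r.
Qed.

Lemma Rintegral_shift f c : integ setT f -> integ setT (fun x => f (x + c)) ->
  \int[mu]_x f (x + c) = \int[mu]_x f x.
Proof.
move=> fi [fci]; rewrite /Rintegral; congr fine.
apply: (integral_shift (f := EFin \o f)); last exact: fci.
by apply/measurable_EFinP; exact: integ_measurable.
Qed.

Lemma cvg_Rintegral D (F : nat -> E -> R) f g : measurable D ->
  (forall k, measurable_fun D (F k)) -> measurable_fun D f -> integ D g ->
  (forall x, D x -> F ^~ x @ \oo --> f x) ->
  (forall k x, D x -> `|F k x| <= g x) ->
  [/\ integ D f, \int[mu]_(x in D) `|F k x - f x| @[k --> \oo] --> 0 &
      \int[mu]_(x in D) F k x @[k --> \oo] --> \int[mu]_(x in D) f x].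
Proof.
move=> mD mF mf [gi] Ff Fg.
have [] := @dominated_convergence _ E R mu D mD (fun k => EFin \o F k) (EFin \o f) (EFin \o g).
- by move=> k; exact/measurable_EFinP.
- exact/measurable_EFinP.
- by apply: aeW => x Dx; apply: cvg_EFin; [exact: nearW|exact: Ff].
- exact: gi.
- by apply: aeW => x k Dx; rewrite lee_fin Fg.
move=> fi H1 H2.
have Fi k : integ D (F k).
  apply: integ_le (Integ gi) _ => // x Dx.
  by rewrite (le_trans (Fg k x Dx))// ler_norm.
split; first by split.
  by apply: fine_cvg; apply: cvg_trans H1; apply: near_eq_cvg; exact: nearW.
by apply: fine_cvg; rewrite fineK//; exact: (integrable_fin_num mD fi).
Qed.

Lemma norm_shift_gt (r : R) (d x : E) : `|d| <= 1 -> r + 1 < `|x| -> r < `|d + x|.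
Proof.
move=> d1 xr; have : `|x| <= `|d + x| + `|d|.
  by rewrite -{1}(addKr d x) (le_trans (ler_normD _ _))// normrN addrC.
lra.
Qed.

(** The difference quotients have integral zero by translation invariance; the mean value theorem
    bounds them uniformly, and dominated convergence passes to the derivative. *)
Lemma Rintegral_pd0 r u i : Smooth u -> supp_in r u -> \int[mu]_x pd i u x = 0.
Proof.
move=> su ur.
have spd := smooth_pderiv i su.
have [C C0 HC] := supp_bounded (smooth_continuous spd) (supp_inDD [:: i] ur).
(* Steps of length at most 1 keep all the quotients supported in the cube of radius r + 1. *)
pose h (k : nat) : R := k.+1%:R^-1.
have h0 k : 0 < h k by rewrite invr_gt0 ltr0n.
have h1 k : h k <= 1 by rewrite invf_le1 ?ltr0n// ler1n.
pose q k x := (h k)^-1 * (u (h k *: basis i + x) - u x).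
have cq k : continuous (q k).
  apply: smooth_continuous; apply: smoothZ; apply: smoothB => //.
  by under eq_fun do rewrite addrC; exact: smooth_shift.
have hb k : `|h k *: basis i : E| <= 1.
  by rewrite normrZ gtr0_norm// -[leRHS]mulr1 ler_pM// ?norm_basis// ltW.
have qC k x : `|q k x| <= C.
  have [c _] := MVT_line x i su (h0 k).
  rewrite /q => ->; rewrite mulrA mulVf ?gt_eqF// mul1r; exact: HC.
have q0 k : \int[mu]_x q k x = 0.
  have iu : integ setT u by exact: integ_cs (smooth_continuous su) ur.
  have ius : integ setT (fun x => u (x + h k *: basis i)).
    apply: (@integ_cs (r + 1)); first by apply: smooth_continuous; exact: smooth_shift.
    by move=> x xr; apply: ur; rewrite addrC norm_shift_gt.
  have -> : q k = fun x => (h k)^-1 * (u (x + h k *: basis i) - u x).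
    by apply/funext => x; rewrite /q [_ + x]addrC.
  rewrite RintZ//; last exact: integB.
  by rewrite RintB// Rintegral_shift// subrr mulr0.
have [] := @cvg_Rintegral setT q (pd i u) (fun x => C * \1_(ccube 0 (r + 1)) x) measurableT.
- by move=> k; exact: continuous_measurable_rV.
- exact/continuous_measurable_rV/smooth_continuous.
- apply: integZ => //; split.
  apply/integrableP; split.
    by apply/measurable_EFinP; apply: measurable_indic; exact: measurable_ccube.
  under eq_integral do rewrite /= ger0_norm//.
  rewrite integral_indic//; last exact: measurable_ccube.
  by rewrite setIT; exact: mu_ccube_fin.
- move=> x _; have du := @smooth_derivable _ _ u x i su.
  rewrite pd_derive.
  have hh : h @ \oo --> 0^'.
    move=> A [e /= e0 eA]; have /cvgrPdist_lt/(_ e e0) := @cvg_harmonic R.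
    by apply: filterS => k hk; apply: eA => //; rewrite gt_eqF.
  exact: (cvg_comp _ _ hh du).
- move=> k x _; rewrite indicE; have [xr|xr] := boolP (x \in _); first by rewrite mulr1 qC.
  have {}xr : r + 1 < `|x|.
    by rewrite ltNge; apply: contra xr => xr; rewrite inE /ccube /= subr0.
  rewrite mulr0 /q (ur x); last by rewrite (lt_trans _ xr)// ltrDl.
  by rewrite ur ?subrr ?mulr0 ?normr0// norm_shift_gt.
move=> _ _; under eq_fun do rewrite q0.
move=> /(cvg_lim (@Rhausdorff R)) <-; exact: lim_cst.
Qed.

Lemma supp_inM r u v : supp_in r u -> supp_in r (fun x => v x * u x).
Proof. by move=> ur x /ur->; rewrite mulr0. Qed.

(** The list is reversed because the outermost derivative of u is moved first and so becomes the
    innermost one of v. *)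
Lemma integration_by_parts r u v s : Smooth u -> Smooth v -> supp_in r u ->
  \int[mu]_x (v x * DD s u x) = (-1) ^+ size s * \int[mu]_x (DD (rev s) v x * u x).
Proof.
move=> su + ur; elim: s v => [|i s IH] v sv; first by rewrite mul1r.
have sDs := smooth_DD s su.
have e : \int[mu]_x (v x * pd i (DD s u) x) = - \int[mu]_x (pd i v x * DD s u x).
  have i1 : integ setT (fun x => v x * pd i (DD s u) x).
    apply: (@integ_cs r); first by apply: smooth_continuous; apply: smoothM => //; exact: smooth_pderiv.
    by apply: supp_inM; exact: (supp_inDD (i :: s)).
  have i2 : integ setT (fun x => pd i v x * DD s u x).
    apply: (@integ_cs r); first by apply: smooth_continuous; apply: smoothM => //; exact: smooth_pderiv.
    by apply: supp_inM; exact: (supp_inDD s).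
  apply/eqP; rewrite -addr_eq0 -RintD//.
  have := @Rintegral_pd0 r (fun x => v x * DD s u x) i (smoothM sv sDs).
  rewrite pderivM// => ->//; apply: supp_inM; exact: supp_inDD.
rewrite DD_cons e IH; last exact: smooth_pderiv.
by rewrite rev_cons DD_rcons exprS mulN1r mulNr.
Qed.

Lemma test_functionP D K phi : Smooth phi -> compact K -> K `<=` D ->
  (forall x, ~ K x -> phi x = 0) -> test_function D phi.
Proof.
move=> [sphi] cK KD phi0.
have clK : closure [set x | phi x != 0] `<=` K.
  have cK' : closed K by apply: compact_closed => //; exact: norm_hausdorff.
  rewrite [X in _ `<=` X](closure_id K).1//; apply: closure_subset => x /= /eqP px.
  by apply: contrapT => /phi0.
split=> //; last exact: subset_trans KD.
by apply: subclosed_compact cK clK; exact: closed_closure.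
Qed.

Lemma test_function_supp D phi : test_function D phi ->
  Smooth phi /\ exists K r, [/\ compact K, K `<=` D, K `<=` ccube 0 r,
    (forall x, ~ K x -> phi x = 0) & supp_in r phi].
Proof.
move=> [sphi cK KD]; split=> //.
have [r r0 Kr] := compact_ccube cK.
have phi0 x : ~ closure [set x | phi x != 0] x -> phi x = 0.
  by move=> xK; apply/eqP; apply: contrapT => /negP px; apply: xK; exact: subset_closure.
exists (closure [set x | phi x != 0]), r; split=> // x rx; apply: phi0 => /Kr.
by rewrite /ccube /= subr0 leNgt rx.
Qed.

End integration.

(** * Density of smooth functions in L^1 *)

Section density.
Import HBSimple.
Context {R : realType} {n : nat}.
Local Notation E := 'rV[R]_n.+1.
Local Notation mu := (@lebesgue_rV R n).
Implicit Types (A B D K : set E) (x y c : E) (u v f g phi : E -> R).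

Definition approximable g : Prop := integ setT g /\
  forall e : R, 0 < e -> exists phi r, [/\ Smooth phi, supp_in r phi &
    \int[mu]_x `|g x - phi x| <= e].

Lemma supp_in_le r r' u : r <= r' -> supp_in r u -> supp_in r' u.
Proof. by move=> rr ur x xr; apply: ur; exact: le_lt_trans xr. Qed.

Lemma approximable_lim g : integ setT g ->
  (forall e : R, 0 < e -> exists2 h, approximable h & \int[mu]_x `|g x - h x| <= e) ->
  approximable g.
Proof.
move=> gi H; split=> // e e0; have e2 : 0 < e / 2 by rewrite divr_gt0.
have [h [hi /(_ _ e2)[phi [r [sphi pr hphi]]]] gh] := H _ e2.
exists phi, r; split => //.
have phii : integ setT phi by exact: integ_cs (smooth_continuous sphi) pr.
apply: (@le_trans _ _ (\int[mu]_x (`|g x - h x| + `|h x - phi x|))).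
  apply: le_Rint => //.
  - by apply: integ_norm => //; exact: integB.
  - by apply: integD => //; apply: integ_norm => //; exact: integB.
  by move=> x _; exact: ler_distD.
rewrite RintD//; last 2 first.
- by apply: integ_norm => //; exact: integB.
- by apply: integ_norm => //; exact: integB.
by rewrite (splitr e) lerD.
Qed.

Lemma approximableD g h : approximable g -> approximable h ->
  approximable (fun x => g x + h x).
Proof.
move=> [gi ga] [hi ha]; split; first exact: integD.
move=> e e0; have e2 : 0 < e / 2 by rewrite divr_gt0.
have [p [r [sp pr gp]]] := ga _ e2; have [q [s [sq qs hq]]] := ha _ e2.
exists (fun x => p x + q x), (Num.max r s); split; first exact: smoothD.
  by move=> x; rewrite gt_max => /andP[xr xs]; rewrite pr// qs// addr0.
have pi : integ setT p by exact: integ_cs (smooth_continuous sp) pr.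
have qi : integ setT q by exact: integ_cs (smooth_continuous sq) qs.
apply: (@le_trans _ _ (\int[mu]_x (`|g x - p x| + `|h x - q x|))).
  apply: le_Rint => //.
  - by apply: integ_norm => //; apply: integB => //; exact: integD.
  - by apply: integD => //; apply: integ_norm => //; exact: integB.
  by move=> x _; rewrite opprD addrACA ler_normD.
rewrite RintD//; last 2 first.
- by apply: integ_norm => //; exact: integB.
- by apply: integ_norm => //; exact: integB.
by rewrite (splitr e) lerD.
Qed.

Lemma approximableZ (a : R) g : approximable g -> approximable (fun x => a * g x).
Proof.
move=> [gi ga]; split; first exact: integZ.
move=> e e0; have a0 : 0 < `|a| + 1 by rewrite ltr_wpDl.
have [p [r [sp pr gp]]] := ga _ (divr_gt0 e0 a0).
have pi : integ setT p by exact: integ_cs (smooth_continuous sp) pr.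
exists (fun x => a * p x), r; split; first exact: smoothZ.
  by move=> x xr; rewrite pr// mulr0.
rewrite (_ : (fun x => _) = (fun x => `|a| * `|g x - p x|)); last first.
  by apply/funext => x; rewrite -mulrBr normrM.
rewrite RintZ//; last by apply: integ_norm => //; exact: integB.
apply: (@le_trans _ _ ((`|a| + 1) * (e / (`|a| + 1)))).
  apply: ler_pM => //; last by rewrite lerDl.
  by apply: Rintegral_ge0.
by rewrite mulrC divfK// gt_eqF.
Qed.

Lemma approximable0 : approximable (fun _ : E => 0).
Proof.
have i0 : integ setT (fun _ : E => 0 : R) by split; exact: integrable0.
split=> // e e0; exists (fun=> 0), 0; split => //; first exact: smooth_cst.
under eq_Rintegral do rewrite subrr normr0.
by rewrite Rintegral_cst// mul0r ltW.
Qed.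

Lemma approximable_sum (I : Type) (s : seq I) (F : I -> E -> R) :
  (forall i, approximable (F i)) -> approximable (fun x => \sum_(i <- s) F i x).
Proof.
move=> aF; elim: s => [|i s IH].
  by under eq_fun do rewrite big_nil; exact: approximable0.
by under eq_fun do rewrite big_cons; exact: approximableD.
Qed.

(** Since [step] vanishes at 0, for large l this is equal to the indicator of the half-open box at
    any given point, faces included. *)
Definition smooth_box (l : nat) (b : E * E) x : R :=
  \prod_(i < n.+1) (step (l%:R * (x ord0 i - b.1 ord0 i)) *
                    (1 - step (l%:R * (x ord0 i - b.2 ord0 i)))).

Lemma Coo_step_affine (a c : R) : Coo dirR (fun t : R => step (a * (t - c))).
Proof.
have := Coo_affine a (- (a * c)) (@Coo_step R).
by under eq_fun do rewrite -mulrBr.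
Qed.

Lemma smooth_smooth_box l b : Smooth (smooth_box l b).
Proof.
apply: smooth_prod => i; apply: smoothM.
  exact: (smooth_coord i (Coo_step_affine l%:R (b.1 ord0 i))).
apply: smoothB; first exact: smooth_cst.
exact: (smooth_coord i (Coo_step_affine l%:R (b.2 ord0 i))).
Qed.

Lemma smooth_box_ge0 l b x : 0 <= smooth_box l b x.
Proof.
by apply: prodr_ge0 => i _; rewrite mulr_ge0 ?step_ge0// subr_ge0 step_le1.
Qed.

Lemma smooth_box_le1 l b x : smooth_box l b x <= 1.
Proof.
apply: prodr_ile1 => i _; rewrite mulr_ge0 ?step_ge0 ?subr_ge0 ?step_le1//=.
by rewrite mulr_ile1 ?step_ge0 ?step_le1 ?subr_ge0 ?step_le1// gerBl step_ge0.
Qed.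

Lemma smooth_box_supp l b : (0 < l)%N ->
  supp_in (`|b.1| + `|b.2| + 1) (smooth_box l b).
Proof.
move=> l0 x xr; have l1 : 1 <= l%:R :> R by rewrite ler1n.
have [i xi] : exists i, `|b.1| + `|b.2| + 1 < `|x ord0 i|.
  apply: contrapT => H; move: xr; apply/negP; rewrite -leNgt.
  apply: normr_rV_le => [|i]; first by rewrite !addr_ge0.
  by rewrite leNgt; apply/negP => xi; apply: H; exists i.
rewrite /smooth_box (bigD1 i)//=.
have := normr_coord b.1 i; have := normr_coord b.2 i.
rewrite !ler_norml => /andP[B1 B2] /andP[A1 A2].
have n1 := normr_ge0 b.1; have n2 := normr_ge0 b.2.
have [x0|x0] := leP 0 (x ord0 i).
  rewrite ger0_norm// in xi.
  rewrite (@step1 _ (_ * (_ - b.2 _ _))) ?subrr ?mulr0 ?mul0r//.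
  by rewrite -[leLHS]mulr1 ler_pM//; lra.
rewrite ltr0_norm// in xi.
rewrite step0 ?mul0r// pmulr_rle0 ?(lt_le_trans ltr01)//; lra.
Qed.

Lemma nat_large (a : R) : \forall l \near \oo, a <= l%:R.
Proof. by have := @cvgr_idn R => /cvgryPge /(_ a). Qed.

Lemma smooth_box_cvg b x : \forall l \near \oo, smooth_box l b x = \1_(box b) x.
Proof.
have H i : \forall l \near \oo, step (l%:R * (x ord0 i - b.1 ord0 i)) *
    (1 - step (l%:R * (x ord0 i - b.2 ord0 i))) =
    (b.1 ord0 i < x ord0 i <= b.2 ord0 i)%R%:R.
  have lar (t : R) : 0 < t -> \forall l \near \oo, 1 <= l%:R * t.
    move=> t0; apply: filterS (nat_large t^-1) => l.
    by rewrite -[leLHS]mul1r ler_pdivrMr.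
  have small (t : R) (l : nat) : t <= 0 -> l%:R * t <= 0 by exact: mulr_ge0_le0.
  have [b1|b1] := ltP (b.1 ord0 i) (x ord0 i); last first.
    by apply: nearW => l; rewrite step0 ?mul0r//= small// subr_le0.
  have [b2|b2] := leP (x ord0 i) (b.2 ord0 i).
    have x1 : 0 < x ord0 i - b.1 ord0 i by rewrite subr_gt0.
    apply: filterS (lar _ x1) => l ?; rewrite step1//.
    by rewrite step0 ?subr0 ?mulr1// small// subr_le0.
  have x1 : 0 < x ord0 i - b.2 ord0 i by rewrite subr_gt0.
  by apply: filterS (lar _ x1) => l ?; rewrite [X in 1 - X]step1// subrr mulr0.
have : \forall l \near \oo, forall i : 'I_n.+1, step (l%:R * (x ord0 i - b.1 ord0 i)) *
    (1 - step (l%:R * (x ord0 i - b.2 ord0 i))) =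
    (b.1 ord0 i < x ord0 i <= b.2 ord0 i)%R%:R.
  exact: filter_forall.
apply: filterS => l Hl; rewrite /smooth_box (eq_bigr _ (fun i _ => Hl i)).
rewrite indicE; have [/set_mem xb|xb] := boolP (x \in box b).
  by rewrite big1// => i _; rewrite xb.
have [i xi] : exists i, ~~ (b.1 ord0 i < x ord0 i <= b.2 ord0 i).
  apply: contrapT => nx; move/negP: xb; apply; apply/mem_set => i.
  by apply: contrapT => /negP xi; apply: nx; exists i.
by rewrite (bigD1 i)//= (negbTE xi) mul0r.
Qed.

Definition box_union (B : nat -> E * E) (N : nat) : set E :=
  \big[setU/set0]_(k < N) box (B k).

Lemma box_unionP (Bs : nat -> E * E) N x :
  box_union Bs N x <-> exists2 k, (k < N)%N & box (Bs k) x.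
Proof.
rewrite /box_union; elim: N => [|N IH].
  by rewrite big_ord0; split => // -[].
rewrite big_ord_recr /=; split.
  case=> [/IH[k kN xk]|xN]; last by exists N.
  by exists k => //; exact: ltnW.
move=> [k]; rewrite ltnS leq_eqVlt => /predU1P[->|kN] xk; first by right.
by left; apply/IH; exists k.
Qed.

Lemma measurable_box_union Bs N : measurable (box_union Bs N).
Proof. by apply: bigsetU_measurable => k _; exact: measurable_box. Qed.

(** The product form remains meaningful, and smooth, when the indicators of the boxes are replaced
    by smooth boxes. *)
Lemma indic_box_union Bs N x :
  \1_(box_union Bs N) x = 1 - \prod_(k < N) (1 - \1_(box (Bs k)) x) :> R.
Proof.
rewrite /box_union; elim: N => [|N IH]; first by rewrite !big_ord0 indic0 subrr.
rewrite !big_ord_recr /= !indicE in IH *.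
rewrite in_setU.
move: IH; set p := \prod_(i < N) _.
case: (x \in \big[setU/set0]_(i < N) box (Bs i)) => /= /esym/eqP.
  by rewrite subr_eq addrC -subr_eq subrr => /eqP <-; rewrite mul0r subr0.
rewrite subr_eq add0r => /eqP <-; rewrite mul1r subKr.
by case: (x \in box (Bs N)).
Qed.

Lemma integ_indic A : measurable A -> (mu A < +oo)%E -> integ setT (\1_A : E -> R).
Proof.
move=> mA Afin; apply: integP; first exact: measurable_indic.
under eq_integral do rewrite ger0_norm//.
by rewrite integral_indic// setIT.
Qed.

Lemma box_sub_ccube (b : E * E) : box b `<=` ccube 0 (`|b.1| + `|b.2|).
Proof.
move=> x bx; rewrite /ccube /= subr0; apply: normr_rV_le => [|i].
  by rewrite addr_ge0.
have := normr_coord b.1 i; have := normr_coord b.2 i.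
rewrite !ler_norml => /andP[B1 B2] /andP[A1 A2].
have n1 := normr_ge0 b.1; have n2 := normr_ge0 b.2.
by have /andP[? ?] := bx i; lra.
Qed.

Lemma approximable_box_union Bs N : approximable (\1_(box_union Bs N)).
Proof.
pose r : R := \sum_(k < N) (`|(Bs k).1| + `|(Bs k).2| + 1).
have rk (k : 'I_N) : `|(Bs k).1| + `|(Bs k).2| + 1 <= r.
  rewrite /r (bigD1 k)//= lerDl sumr_ge0// => i _; by rewrite !addr_ge0.
pose phi l x : R := 1 - \prod_(k < N) (1 - smooth_box l.+1 (Bs k) x).
have sphi l : Smooth (phi l).
  apply: smoothB; first exact: smooth_cst.
  apply: smooth_prod => k; apply: smoothB; first exact: smooth_cst.
  exact: smooth_smooth_box.
have suppphi l : supp_in r (phi l).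
  move=> x xr; rewrite /phi big1 ?subrr// => k _; rewrite smooth_box_supp ?subr0//.
  exact: le_lt_trans (rk k) xr.
have phi01 l x : 0 <= phi l x <= 1.
  have P0 : 0 <= \prod_(k < N) (1 - smooth_box l.+1 (Bs k) x).
    by apply: prodr_ge0 => k _; rewrite subr_ge0 smooth_box_le1.
  have P1 : \prod_(k < N) (1 - smooth_box l.+1 (Bs k) x) <= 1.
    by apply: prodr_ile1 => k _; rewrite subr_ge0 smooth_box_le1 gerBl smooth_box_ge0.
  by rewrite /phi subr_ge0 P1 gerBl.
have Ufin : (mu (box_union Bs N) < +oo)%E.
  apply: (@le_lt_trans _ _ (mu (ccube 0 r))); last exact: mu_ccube_fin.
  apply: le_lebesgue_outer => x /box_unionP[k kN].
  move=> /box_sub_ccube; rewrite /ccube /= => xk; apply: (le_trans xk).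
  by apply: le_trans (rk (Ordinal kN)); rewrite lerDl.
split; first by apply: integ_indic => //; exact: measurable_box_union.
move=> e e0.
have [|||||_ H _] := @cvg_Rintegral _ _ setT phi (\1_(box_union Bs N)) (\1_(ccube 0 r)) measurableT.
- by move=> l; apply: continuous_measurable_rV; exact: smooth_continuous.
- by apply: measurable_indic; exact: measurable_box_union.
- by apply: integ_indic; [exact: measurable_ccube|exact: mu_ccube_fin].
- move=> x _.
  have : \forall l \near \oo, forall k : 'I_N, smooth_box l (Bs k) x = \1_(box (Bs k)) x.
    by apply: filter_forall => k; exact: smooth_box_cvg.
  move=> [l0 _ Hl]; apply: cvg_near_cst; exists l0 => // l /= l0l.
  rewrite indic_box_union /phi; congr (1 - _); apply: eq_bigr => k _.
  by rewrite (Hl l.+1)//= leqW.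
- move=> l x _; have /andP[p0 p1] := phi01 l x; rewrite ger0_norm// indicE.
  have [xr|xr] := boolP (x \in _); first exact: p1.
  rewrite suppphi// ltNge; apply: contra xr => xr.
  by rewrite inE /ccube /= subr0.
have /cvgrPdist_le/(_ _ e0)[l _ /(_ l (leqnn l))] := H.
rewrite sub0r normrN => Hl.
exists (phi l), r; split => //.
apply: le_trans (le_trans (ler_norm _) Hl).
rewrite le_eqVlt; apply/orP; left; apply/eqP.
by apply: eq_Rintegral => x _; rewrite distrC.
Qed.

(** A nearly optimal cover V of A exceeds it by at most e / 2, and finitely many of its boxes leave
    out at most e / 2 of V; both errors are measured against V. *)
Lemma approximable_indic A : measurable A -> (mu A < +oo)%E -> approximable (\1_A).
Proof.
move=> mA Afin; apply: approximable_lim; first exact: integ_indic.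
move=> e e0; have e2 : 0 < e / 2 by rewrite divr_gt0.
have Af : ereal_inf [set (\sum_(k <oo) (box_volume (B k))%:E)%E | B in box_cover A]
    \is a fin_num.
  by rewrite ge0_fin_numE//; exact: lebesgue_outer_ge0.
have [_ [B AB <-] Blt] := lb_ereal_inf_adherent e2 Af.
rewrite -/(lebesgue_outer A) -[lebesgue_outer A]/(mu A) in Blt.
pose U := box_union B; pose V := \bigcup_k U k.
have mU k : measurable (U k) by exact: measurable_box_union.
have mV : measurable V by exact: bigcup_measurable.
have VE : V = \bigcup_k box (B k).
  apply/seteqP; split => x [k _].
    by move=> /box_unionP[j _ xj]; exists j.
  by move=> xk; exists k.+1 => //; apply/box_unionP; exists k.
have AV : A `<=` V by rewrite VE.
have muV : (mu V <= \sum_(k <oo) (box_volume (B k))%:E)%E.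
  by apply: ereal_inf_lbound; exists B => //; rewrite VE.
have Vfin : (mu V < +oo)%E.
  apply: (le_lt_trans muV); apply: (lt_trans Blt).
  by rewrite lte_add_pinfty// ltry.
have ndU : {homo U : k l / (k <= l)%N >-> (k <= l)%O}.
  move=> k l kl; apply/subsetPset => x /box_unionP[j jk xj].
  by apply/box_unionP; exists j => //; exact: leq_trans kl.
have Ufin k : (mu (U k) < +oo)%E.
  by apply: le_lt_trans Vfin; apply: le_lebesgue_outer => x xk; exists k.
have cU := @nondecreasing_cvg_mu _ _ _ mu U mU mV ndU.
have cU' : fine (mu (U k)) @[k --> \oo] --> fine (mu V).
  by apply: fine_cvg; rewrite fineK ?ge0_fin_numE ?lebesgue_outer_ge0.
have /cvgrPdist_le/(_ _ e2)[N _ /(_ N (leqnn N))] := cU'.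
move=> VUN; exists (\1_(U N)); first exact: approximable_box_union.
have UV : U N `<=` V by move=> x xN; exists N.
have iI S : measurable S -> S `<=` V -> integ setT (\1_S : E -> R).
  move=> mS SV; apply: integ_indic => //; apply: le_lt_trans Vfin.
  exact: le_lebesgue_outer.
have fI S : measurable S -> \int[mu]_x (\1_S x : R) = fine (mu S).
  by move=> mS; rewrite /Rintegral integral_indic// setIT.
apply: (@le_trans _ _ (\int[mu]_x ((\1_V x - \1_A x) + (\1_V x - \1_(U N) x)))).
  apply: le_Rint => //.
  - by apply: integ_norm => //; apply: integB => //; [exact: iI|exact: iI].
  - by apply: integD => //; apply: integB => //; exact: iI.
  move=> x _.
  have le1 S : S `<=` V -> (\1_S x : R) <= \1_V x.
    move=> SV; rewrite !indicE; case: (boolP (x \in S)) => //.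
    by move=> /set_mem/SV/mem_set ->.
  have := le1 _ AV; have := le1 _ UV; rewrite ler_norml; lra.
rewrite RintD//; [|by apply: integB => //; exact: iI|by apply: integB => //; exact: iI].
rewrite !RintB//; [|exact: iI|exact: iI|exact: iI|exact: iI].
rewrite !fI// (splitr e) lerD//; last by rewrite (le_trans (ler_norm _)).
rewrite lerBlDl -lee_fin EFinD !fineK ?ge0_fin_numE ?lebesgue_outer_ge0//.
exact: le_trans muV (ltW Blt).
Qed.

(** Chebyshev's inequality on one level set; it brings the nonzero levels of a simple approximation
    within reach of [approximable_indic]. *)
Lemma level_set_finite f (y : R) : integ setT f -> y != 0 ->
  measurable (f @^-1` [set y]) -> (mu (f @^-1` [set y]) < +oo)%E.
Proof.
move=> fi y0 my; have mf := integ_measurable fi.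
have : (`|y|%:E * mu (f @^-1` [set y]) < +oo)%E.
  apply: le_lt_trans (integ_fin fi); move: mf my {fi} => mf my.
  have <- : (\int[mu]_x (`|y|%:E * (\1_(f @^-1` [set y]) x)%:E) =
     `|y|%:E * mu (f @^-1` [set y]))%E.
    rewrite ge0_integralZl_EFin.
    - by rewrite integral_indic ?setIT.
    - exact: measurableT.
    - by move=> x _; rewrite lee_fin.
    - by apply/measurable_EFinP; exact: measurable_indic.
    - exact: normr_ge0.
  apply: ge0_le_integral.
  - exact: measurableT.
  - by move=> x _; rewrite mule_ge0// lee_fin.
  - apply/measurable_EFinP; apply: measurable_funM; first exact: measurable_cst.
    exact: measurable_indic.
  - apply/measurable_EFinP; apply: measurableT_comp; last exact: mf.
    by apply: continuous_measurable_fun => z; exact: (@norm_continuous _ R).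
  move=> x _; rewrite -EFinM lee_fin indicE.
  have [/set_mem/= ->|_] := boolP (x \in _); first by rewrite mulr1.
  by rewrite mulr0.
have := @lebesgue_outer_ge0 R n (f @^-1` [set y]).
rewrite -[lebesgue_outer _]/(mu _); case: (mu _) => [r _ _|_|//]; first exact: ltry.
by rewrite gt0_muley// lte_fin normr_gt0.
Qed.

Lemma approximable_integ g : integ setT g -> approximable g.
Proof.
move=> gi; apply: approximable_lim => // e e0.
have [h [hi hg H]] := approximation_sfun_integrable measurableT (integ_integrable gi).
have {H}H : \int[mu]_x `|g x - h k x| @[k --> \oo] --> 0 by exact: fine_cvg.
have /cvgrPdist_le/(_ _ e0)[k _ /(_ k (leqnn k))] := H.
rewrite sub0r normrN => Hk; exists (h k); last exact: le_trans (ler_norm _) Hk.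
have hki : integ setT (h k) by split; exact: hi.
have -> : (h k : E -> R) = _ := funext (fimfunEord (h k)).
apply: approximable_sum => i; move: (_`_i) => y.
have [->|y0] := eqVneq y 0.
  by under eq_fun do rewrite mul0r; exact: approximable0.
apply: approximableZ; apply: approximable_indic; first exact: measurable_funPTI.
by apply: (level_set_finite hki) => //; exact: measurable_funPTI.
Qed.

End density.

(** * Averaged Taylor polynomials *)

Section averaged_taylor.
Context {R : realType} {n : nat}.
Local Notation E := 'rV[R]_n.+1.
Implicit Types (K : set E) (x y z : E) (u v eta zeta : E -> R) (i j : 'I_n.+1)
  (s I : seq 'I_n.+1).

Definition dcoord x i : E -> R := fun z => x ord0 i - z ord0 i.

Lemma Coo_id : Coo dirR (fun t : R => t).
Proof.
move=> k; case: k => [|k]; split=> //; try by move=> t; exact: cvg_id.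
case; split=> [t|]; first exact: derivable_id.
rewrite (_ : 'D_(dirR tt) _ = (fun _ : R => (1 : R))); first exact: Ck_cst.
by apply/funext => t; exact: (derive_id t (1 : R)).
Qed.

Lemma smooth_coord_id i : Smooth (fun z : E => z ord0 i).
Proof. exact: (smooth_coord i Coo_id). Qed.

Lemma pd_coord_id i j : pd j (fun z : E => z ord0 i) = fun=> (j == i)%:R.
Proof.
rewrite (pderiv_coord i j Coo_id); apply/funext => z.
by case: eqP => // _; exact: (derive_id (z ord0 i) (1 : R)).
Qed.

Lemma smooth_dcoord x i : Smooth (dcoord x i).
Proof. by apply: smoothB; [exact: smooth_cst|exact: smooth_coord_id]. Qed.

Lemma pd_dcoord x i j : pd j (dcoord x i) = fun=> - (j == i)%:R.
Proof.
have := @DDB _ _ [:: j] _ _ (smooth_cst (x ord0 i)) (smooth_coord_id i).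
by rewrite /= pd_coord_id pderiv_cst => ->; apply/funext => z; rewrite sub0r.
Qed.

Definition mul_dcoord x i u : E -> R := fun z => dcoord x i z * u z.

Lemma smooth_mul_dcoord x i u : Smooth u -> Smooth (mul_dcoord x i u).
Proof. by move=> su; apply: smoothM => //; exact: smooth_dcoord. Qed.

Lemma mul_dcoord_pd x i j u : Smooth u ->
  mul_dcoord x i (pd j u) =
  fun z => pd j (mul_dcoord x i u) z + (j == i)%:R * u z.
Proof.
move=> su; rewrite /mul_dcoord pderivM//; last exact: smooth_dcoord.
by rewrite pd_dcoord; apply/funext => z; rewrite mulNr subrK.
Qed.

(** This is the sum, over the words I of length k, of D^I applied to (x - y)^I eta(y), see
    [Bk_words]. Up to the sign (-1)^k, integrating it against f averages with weight eta the k-th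
    derivative of f at y in the direction x - y. *)
Fixpoint Bk k x eta : E -> R :=
  if k is k'.+1 then fun y => \sum_i pd i (Bk k' x (mul_dcoord x i eta)) y
  else eta.

Lemma smooth_Bk k x eta : Smooth eta -> Smooth (Bk k x eta).
Proof.
elim: k eta => // k IH eta se /=; apply: smooth_sum => i.
by apply: smooth_pderiv; apply: IH; exact: smooth_mul_dcoord.
Qed.

Lemma BkDZ k x (a : R) eta zeta : Smooth eta -> Smooth zeta ->
  Bk k x (fun z => a * eta z + zeta z) = fun y => a * Bk k x eta y + Bk k x zeta y.
Proof.
elim: k eta zeta => // k IH eta zeta se sz; apply/funext => y /=.
rewrite mulr_sumr -big_split /=; apply: eq_bigr => i _.
have sme := smooth_mul_dcoord x i se; have smz := smooth_mul_dcoord x i sz.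
rewrite (_ : mul_dcoord x i _ = fun z => a * mul_dcoord x i eta z + mul_dcoord x i zeta z); last first.
  by apply/funext => z; rewrite /mul_dcoord mulrDr mulrCA.
rewrite IH// pderivD; [|by apply: smoothZ; exact: smooth_Bk|exact: smooth_Bk].
by rewrite pderivZ//; exact: smooth_Bk.
Qed.

(** Moving the derivative across a factor x_i - y_i leaves a Kronecker delta that removes the
    factor; the k factors give k copies of the lower term. At k = 0 the value of [k.-1] is harmless,
    its coefficient being 0. *)
Lemma Bk_pd k x j eta : Smooth eta ->
  Bk k x (pd j eta) = fun y => pd j (Bk k x eta) y + k%:R * pd j (Bk k.-1 x eta) y.
Proof.
elim: k eta => [|k IH] eta se; apply/funext => y; first by rewrite mul0r addr0.
have sp := smooth_pderiv j se.
rewrite /= (eq_bigr (fun i => pd i (pd j (Bk k x (mul_dcoord x i eta))) y +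
   k%:R * pd i (pd j (Bk k.-1 x (mul_dcoord x i eta))) y +
   (j == i)%:R * pd i (Bk k x eta) y)); last first.
  move=> i _; have sm := smooth_mul_dcoord x i se.
  rewrite mul_dcoord_pd//.
  rewrite (_ : (fun z => _) = (fun z => (j == i)%:R * eta z + pd j (mul_dcoord x i eta) z)); last first.
    by apply/funext => z; rewrite addrC.
  rewrite BkDZ//; last exact: smooth_pderiv.
  rewrite IH//.
  have s1 : Smooth (Bk k x eta) by exact: smooth_Bk.
  have s2 : Smooth (pd j (Bk k x (mul_dcoord x i eta))).
    by apply: smooth_pderiv; exact: smooth_Bk.
  have s3 : Smooth (pd j (Bk k.-1 x (mul_dcoord x i eta))).
    by apply: smooth_pderiv; exact: smooth_Bk.
  rewrite pderivD; [|exact: smoothZ|by apply: smoothD => //; exact: smoothZ].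
  rewrite pderivZ// pderivD//; last exact: smoothZ.
  by rewrite pderivZ// addrC.
rewrite big_split big_split /= -mulr_sumr.
have pds (F : 'I_n.+1 -> E -> R) : (forall i, Smooth (F i)) ->
    \sum_i pd i (pd j (F i)) y = pd j (fun y => \sum_i pd i (F i) y) y.
  move=> sF; have := @DD_sum _ _ [:: j] _ (index_enum 'I_n.+1) xpredT (fun i => pd i (F i))
    (fun i => smooth_pderiv i (sF i)).
  rewrite /= => ->; apply: eq_bigr => i _; by rewrite pderivC.
rewrite pds; last by move=> i; apply: smooth_Bk; exact: smooth_mul_dcoord.
rewrite pds; last by move=> i; apply: smooth_Bk; exact: smooth_mul_dcoord.
rewrite (bigD1 j)//= eqxx mul1r big1 ?addr0; last first.
  by move=> i /negbTE ij; rewrite eq_sym ij mul0r.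
by rewrite -natr1 mulrDl mul1r addrA; case: k {IH} => [|k]; first by rewrite !mul0r.
Qed.

(* Integrated against f, this is the Taylor polynomial of order m of f
   evaluated at x and averaged with weight eta, all derivatives having been
   moved from f to the weight. *)
Definition taylor m x eta : E -> R :=
  fun y => \sum_(k < m) ((-1) ^+ k / k`!%:R) * Bk k x eta y.

Lemma smooth_taylor m x eta : Smooth eta -> Smooth (taylor m x eta).
Proof.
by move=> se; apply: smooth_sum => k; apply: smoothZ; exact: smooth_Bk.
Qed.

Lemma taylorDZ m x (a : R) eta zeta : Smooth eta -> Smooth zeta ->
  taylor m x (fun z => a * eta z + zeta z) =
  fun y => a * taylor m x eta y + taylor m x zeta y.
Proof.
move=> se sz; apply/funext => y; rewrite /taylor mulr_sumr -big_split /=.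
by apply: eq_bigr => k _; rewrite BkDZ// mulrDr mulrCA.
Qed.

(* The sum telescopes: only the derivative of the top term survives. *)
Lemma taylor_pd m x j eta : Smooth eta ->
  taylor m.+1 x (pd j eta) = fun y => ((-1) ^+ m / m`!%:R) * pd j (Bk m x eta) y.
Proof.
move=> se; apply/funext => y; rewrite /taylor.
rewrite -(big_mkord xpredT (fun k => (-1) ^+ k / k`!%:R * Bk k x (pd j eta) y)).
elim: m => [|m IH]; first by rewrite big_nat1 /=.
rewrite big_nat_recr//= -[X in _ + _ * X]/(Bk m.+1 x (pd j eta) y) IH Bk_pd//.
rewrite -[m.+1.-1]/m mulrDr addrCA -[RHS]addr0; congr (_ + _).
rewrite mulrA -mulrDl [X in X * _](_ : _ = 0) ?mul0r//.
rewrite exprS factS natrM; have f0 : m`!%:R != 0 :> R by rewrite pnatr_eq0 -lt0n fact_gt0.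
have m0 : m.+1%:R != 0 :> R by rewrite pnatr_eq0.
by field; rewrite f0 addrC natr1 m0.
Qed.

Definition tst K u : Prop := Smooth u /\ forall y, ~ K y -> u y = 0.

Lemma tst_smooth K u : tst K u -> Smooth u. Proof. by case. Qed.

Lemma tst_DD K s u : closed K -> tst K u -> tst K (DD s u).
Proof.
move=> cK [su u0]; split; first exact: smooth_DD.
move=> y Ky; apply: near0_DD.
have : open (~` K) by exact: closed_openC.
by move=> /(_ y Ky); apply: filterS => z; exact: u0.
Qed.

Lemma tst_pd K i u : closed K -> tst K u -> tst K (pd i u).
Proof. by move=> cK; exact: (tst_DD [:: i] cK). Qed.

Lemma tstM K u v : Smooth v -> tst K u -> tst K (fun y => v y * u y).
Proof.
by move=> sv [su u0]; split=> [|y /u0 ->]; [exact: smoothM|rewrite mulr0].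
Qed.

Lemma tstZ K (a : R) u : tst K u -> tst K (fun y => a * u y).
Proof. by apply: tstM; exact: smooth_cst. Qed.

Lemma tst_sum K (T : Type) (t : seq T) (P : pred T) (F : T -> E -> R) :
  (forall q, tst K (F q)) -> tst K (fun y => \sum_(q <- t | P q) F q y).
Proof.
move=> tF; split=> [|y Ky]; first by apply: smooth_sum => q; case: (tF q).
by rewrite big1// => q _; case: (tF q) => _ ->.
Qed.

Lemma tst0 K : tst K (fun=> 0).
Proof. by split=> //; exact: smooth_cst. Qed.

Lemma tst_Bk K k x u : closed K -> tst K u -> tst K (Bk k x u).
Proof.
move=> cK; elim: k u => // k IH u tu /=; apply: tst_sum => i.
by apply: tst_pd => //; apply: IH; apply: tstM => //; exact: smooth_dcoord.
Qed.

Lemma tst_taylor K m x u : closed K -> tst K u -> tst K (taylor m x u).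
Proof. by move=> cK tu; apply: tst_sum => k; apply: tstZ; exact: tst_Bk. Qed.

(** Linearity is only asked on functions carried by K: integration against a locally integrable
    function offers no more. *)
Definition lin_on K (L : (E -> R) -> R) : Prop := forall (a : R) u v,
  tst K u -> tst K v -> L (fun y => a * u y + v y) = a * L u + L v.

Section linear_functional.
Variables (K : set E) (L : (E -> R) -> R).
Hypotheses (cK : closed K) (linL : lin_on K L).

Lemma lin0 : L (fun=> 0) = 0.
Proof.
have := linL (-1) (tst0 K) (tst0 K).
by under eq_fun do rewrite mulr0 addr0; rewrite mulN1r addNr.
Qed.

Lemma linZ (a : R) u : tst K u -> L (fun y => a * u y) = a * L u.
Proof.
move=> tu; have := linL a tu (tst0 K).
by under eq_fun do rewrite addr0; rewrite lin0 addr0.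
Qed.

Lemma linD u v : tst K u -> tst K v -> L (fun y => u y + v y) = L u + L v.
Proof.
move=> tu tv; have := linL 1 tu tv.
by under eq_fun do rewrite mul1r; rewrite mul1r.
Qed.

Lemma lin_sum (T : Type) (t : seq T) (F : T -> E -> R) : (forall q, tst K (F q)) ->
  L (fun y => \sum_(q <- t) F q y) = \sum_(q <- t) L (F q).
Proof.
move=> tF; elim: t => [|q t IH].
  by rewrite big_nil; under eq_fun do rewrite big_nil; exact: lin0.
rewrite big_cons -IH -linD//; last exact: tst_sum.
by congr L; apply/funext => y; rewrite big_cons.
Qed.

(** Polynomials of degree less than k, described by the vanishing of their derivatives so that no
    coefficients have to be carried along. *)
Definition polyd k (p : E -> R) : Prop :=
  Smooth p /\ forall s, (k <= size s)%N -> DD s p = fun=> 0.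

Lemma polyd_cst (a : R) : polyd 1 (fun=> a).
Proof.
split; first exact: smooth_cst.
move=> s; case/lastP: s => // s i _; rewrite DD_rcons pderiv_cst.
exact: DD_cst0.
Qed.

Lemma polyd_le k l p : (k <= l)%N -> polyd k p -> polyd l p.
Proof. by move=> kl [sp p0]; split=> // s ls; apply: p0; exact: leq_trans ls. Qed.

Lemma polydD k p q : polyd k p -> polyd k q -> polyd k (fun x => p x + q x).
Proof.
move=> [sp p0] [sq q0]; split; first exact: smoothD.
by move=> s ks; rewrite DDD// p0// q0//; apply/funext => x; rewrite addr0.
Qed.

Lemma polydZ k (a : R) p : polyd k p -> polyd k (fun x => a * p x).
Proof.
move=> [sp p0]; split; first exact: smoothZ.
by move=> s ks; rewrite DDZ// p0//; apply/funext => x; rewrite mulr0.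
Qed.

Lemma polyd_sum k (T : Type) (t : seq T) (F : T -> E -> R) :
  (forall q, polyd k (F q)) -> polyd k (fun x => \sum_(q <- t) F q x).
Proof.
move=> pF; split=> [|s ks]; first by apply: smooth_sum => q; case: (pF q).
rewrite DD_sum; last by move=> q; case: (pF q).
by apply/funext => x; rewrite big1// => q _; have [_ ->] := pF q.
Qed.

Lemma polyd_coord k i p : polyd k p -> polyd k.+1 (fun x => x ord0 i * p x).
Proof.
elim: k p => [|k IH] p [sp p0].
  have -> : p = fun=> 0 by exact: (p0 [::]).
  by under eq_fun do rewrite mulr0; exact: polyd_cst.
have sx := smooth_coord_id i.
split=> [|s]; first exact: smoothM.
case/lastP: s => // s j; rewrite size_rcons ltnS => ks.
rewrite DD_rcons pderivM// pd_coord_id DDD; last 2 first.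
- by apply: smoothM => //; exact: smooth_pderiv.
- by apply: smoothM => //; exact: smooth_cst.
have pp : polyd k (pd j p).
  split=> [|t kt]; first exact: smooth_pderiv.
  by rewrite -DD_rcons p0// size_rcons ltnS.
have [_ ->//] := IH _ pp.
by rewrite DDZ// p0//; apply/funext => x; rewrite mulr0 addr0.
Qed.

Lemma Bk_coord k x i u : Smooth u ->
  Bk k x (mul_dcoord x i u) = fun y => x ord0 i * Bk k x u y - Bk k x (fun z => z ord0 i * u z) y.
Proof.
move=> su; have sz : Smooth (fun z => z ord0 i * u z).
  by apply: smoothM => //; exact: smooth_coord_id.
have -> : mul_dcoord x i u = fun z => x ord0 i * u z + (-1 * (z ord0 i * u z) + 0).
  by apply/funext => z; rewrite /mul_dcoord /dcoord mulrBl mulN1r addr0.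
rewrite BkDZ//; last by apply: smoothD; [exact: smoothZ|exact: smooth_cst].
rewrite BkDZ//; last exact: smooth_cst.
have -> : Bk k x (fun=> 0) = fun=> 0.
  have := @BkDZ k x (-1) _ _ (smooth_cst 0) (smooth_cst 0).
  under eq_fun do rewrite mulr0 addr0.
  by move=> ->; apply/funext => y; rewrite mulN1r addNr.
by apply/funext => y; rewrite mulN1r addr0.
Qed.

(** Expanding one factor x_i - z_i gives x_i times a polynomial of the previous degree in x, minus
    another such polynomial. *)
Lemma polyd_lin_Bk k s u : tst K u -> polyd k.+1 (fun x => L (DD s (Bk k x u))).
Proof.
elim: k s u => [|k IH] s u tu; first exact: (polyd_cst (L (DD s u))).
have tz i : tst K (fun z => z ord0 i * u z).
  by apply: tstM => //; exact: smooth_coord_id.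
rewrite (_ : (fun x => _) = fun x => \sum_i (x ord0 i * L (DD (rcons s i) (Bk k x u)) +
   -1 * L (DD (rcons s i) (Bk k x (fun z => z ord0 i * u z))))).
  apply: polyd_sum => i; apply: polydD; first by apply: polyd_coord; exact: IH.
  by apply: polydZ; apply: (@polyd_le k.+1) => //; exact: IH.
apply/funext => x; rewrite /= DD_sum; last first.
  move=> i; apply: smooth_pderiv; apply: smooth_Bk; apply: smooth_mul_dcoord.
  exact: tst_smooth tu.
rewrite lin_sum; last first.
  move=> i; apply: tst_DD => //; apply: tst_pd => //; apply: tst_Bk => //.
  by apply: tstM => //; exact: smooth_dcoord.
apply: eq_bigr => i _; rewrite Bk_coord; last exact: tst_smooth tu.
rewrite -DD_rcons -linZ; last by apply: tst_DD => //; exact: tst_Bk.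
rewrite -[X in _ + X]linZ; last by apply: tst_DD => //; exact: tst_Bk.
rewrite -linD; last 2 first.
- by apply: tstZ; apply: tst_DD => //; exact: tst_Bk.
- by apply: tstZ; apply: tst_DD => //; exact: tst_Bk.
have s1 : Smooth (Bk k x u) by apply: smooth_Bk; exact: tst_smooth tu.
have s2 : Smooth (Bk k x (fun z => z ord0 i * u z)).
  by apply: smooth_Bk; exact: tst_smooth (tz i).
rewrite DDB//; last exact: smoothZ.
by rewrite DDZ//; congr L; apply/funext => y; rewrite mulN1r.
Qed.

Lemma polyd_taylor m u : tst K u -> polyd m (fun x => L (taylor m x u)).
Proof.
move=> tu; rewrite (_ : (fun x => _) =
  fun x => \sum_(k < m) ((-1) ^+ k / k`!%:R) * L (DD [::] (Bk k x u))).
  apply: polyd_sum => k; apply: polydZ; apply: (@polyd_le k.+1) => //.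
  exact: polyd_lin_Bk.
apply/funext => x; rewrite lin_sum; last by move=> k; apply: tstZ; exact: tst_Bk.
by apply: eq_bigr => k _; rewrite linZ//; exact: tst_Bk.
Qed.

Definition mono x I u : E -> R := foldr (mul_dcoord x) u I.

Lemma tst_mono x I u : tst K u -> tst K (mono x I u).
Proof.
by move=> tu; elim: I => // i I IH; apply: tstM => //; exact: smooth_dcoord.
Qed.

Lemma mono_mul x I (v : E -> R) u :
  mono x I (fun z => v z * u z) = fun z => v z * mono x I u z.
Proof.
by elim: I => // i I IH; rewrite /= IH; apply/funext => z; rewrite /mul_dcoord mulrCA.
Qed.

(** The words obtained from I by deleting one occurrence of j, listed with multiplicity: they index
    the derivative of (x - z)^I along x_j. *)
Fixpoint dl j I : seq (seq 'I_n.+1) :=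
  if I is i :: I' then (if j == i then [:: I'] else [::]) ++ map (cons i) (dl j I')
  else [::].

Lemma dl_size j I I' : I' \in dl j I -> size I = (size I').+1.
Proof.
elim: I I' => // i I IH I' /=; rewrite mem_cat => /orP[|/mapP[I'' /IH -> ->]//].
by case: ifP => // _; rewrite inE => /eqP ->.
Qed.

Lemma size_dl j I : (size (dl j I) <= size I)%N.
Proof.
elim: I => // i I IH /=; rewrite size_cat size_map.
by case: ifP => _ /=; rewrite ?add1n ?add0n ?ltnS// leqW.
Qed.

Lemma lin_mono_pd I u : tst K u ->
  Smooth (fun x => L (mono x I u)) /\
  forall j, pd j (fun x => L (mono x I u)) = fun x => \sum_(I' <- dl j I) L (mono x I' u).
Proof.
elim: I u => [|i I IH] u tu.
  split=> [|j]; first exact: (smooth_cst (L u)).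
  by rewrite /= pderiv_cst; apply/funext => x; rewrite big_nil.
have tz : tst K (fun z => z ord0 i * u z).
  by apply: tstM => //; exact: smooth_coord_id.
have e J : (fun x => L (mono x (i :: J) u)) =
    fun x => x ord0 i * L (mono x J u) - L (mono x J (fun z => z ord0 i * u z)).
  apply/funext => x; have t1 := tst_mono x J tu; have t2 := tst_mono x J tz.
  rewrite -mulN1r -!linZ// -linD; [|exact: tstZ|exact: tstZ].
  congr L; apply/funext => z; rewrite /= /mul_dcoord /dcoord mono_mul.
  by rewrite mulrBl mulN1r.
have [s1 d1] := IH u tu; have [s2 d2] := IH _ tz.
have sx := smooth_coord_id i.
rewrite e; split=> [|j]; first by apply: smoothB => //; exact: smoothM.
have -> : pd j (fun x => x ord0 i * L (mono x I u) - L (mono x I (fun z => z ord0 i * u z))) =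
  fun x => pd j (fun x => x ord0 i * L (mono x I u)) x - pd j (fun x => L (mono x I (fun z => z ord0 i * u z))) x.
  exact: (DDB [:: j] (smoothM sx s1) s2).
rewrite pderivM// d1 d2 pd_coord_id; apply/funext => x.
rewrite [RHS](_ : _ = (j == i)%:R * L (mono x I u) +
    \sum_(J <- dl j I) L (mono x (i :: J) u)); last first.
  rewrite [dl j (i :: I)]/= big_cat big_map; congr (_ + _).
  by case: eqP => _; rewrite ?big_seq1 ?big_nil ?mul1r ?mul0r.
rewrite [X in X - _]addrC -addrA; congr (_ + _).
rewrite mulr_sumr -sumrN -big_split; apply: eq_bigr => J _.
by rewrite (congr1 (fun h => h x) (e J)).
Qed.

(** Each derivative in x produces at most |I| shorter monomials, by [size_dl], and each lost factor
    x_i - z_i costs 1/r. *)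
Lemma lin_mono_le s I u x (Q r : R) : tst K u -> 0 <= Q -> 0 < r ->
  (forall I', `|L (mono x I' u)| <= Q * r ^+ size I') ->
  `|DD s (fun x => L (mono x I u)) x| <= (size I)%:R ^+ size s * Q * r ^+ size I / r ^+ size s.
Proof.
move=> tu Q0 r0 H; move: {2}(size s) (erefl (size s)) => k.
elim: k s I => [|k IH] s I.
  move=> /eqP; rewrite size_eq0 => /eqP ->.
  by rewrite /= expr0 mul1r expr0 divr1; exact: H.
case/lastP: s => // s j; rewrite size_rcons => -[sk].
have [_ dI] := lin_mono_pd I tu.
rewrite DD_rcons dI DD_sum; last by move=> I'; case: (lin_mono_pd I' tu).
apply: (le_trans (ler_norm_sum _ _ _)).
apply: (@le_trans _ _ (\sum_(I' <- dl j I) ((size I)%:R ^+ size s * Q * r ^+ size I / r ^+ (size s).+1))).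
  rewrite big_seq [leRHS]big_seq; apply: ler_sum => I' I'I.
  have sI := dl_size I'I; apply: (le_trans (IH s I' sk)).
  rewrite sI [r ^+ (size I').+1]exprS [r ^+ (size s).+1]exprS invfM.
  rewrite [leRHS](_ : _ = (size I').+1%:R ^+ size s * Q * r ^+ size I' / r ^+ size s); last first.
    by field; rewrite !expf_neq0 ?gt_eqF.
  do 3 (apply: ler_wpM2r; first by rewrite ?invr_ge0 ?exprn_ge0// ltW).
  by apply: lerXn2r; rewrite ?nnegrE ?ler0n// ler_nat.
rewrite big_const_seq count_predT iter_addr_0 -[leLHS]mulr_natl.
rewrite [leRHS](_ : _ = (size I)%:R *
  ((size I)%:R ^+ size s * Q * r ^+ size I / r ^+ (size s).+1)); last first.
  by rewrite exprS !mulrA.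
apply: ler_wpM2r; last by rewrite ler_nat size_dl.
by rewrite !mulr_ge0 ?invr_ge0 ?exprn_ge0 ?ler0n// ltW.
Qed.

Fixpoint words k : seq (seq 'I_n.+1) :=
  if k is k'.+1 then [seq i :: J | i <- enum 'I_n.+1, J <- words k'] else [:: [::]].

Lemma size_words k I : I \in words k -> size I = k.
Proof.
elim: k I => [|k IH] I /=; first by rewrite inE => /eqP ->.
by move=> /allpairsP[[i J] /= [_ /IH <- ->]].
Qed.

Lemma Bk_words k x u : Smooth u ->
  Bk k x u = fun y => \sum_(I <- words k) DD I (mono x I u) y.
Proof.
elim: k u => [|k IH] u su; apply/funext => y; first by rewrite big_seq1.
rewrite /= big_allpairs_dep /= big_enum /=; apply: eq_bigr => i _.
have sm : Smooth (mul_dcoord x i u) by exact: smooth_mul_dcoord.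
have smo J w : Smooth w -> Smooth (mono x J w).
  by move=> sw; elim: J => //= j J IHJ; exact: smooth_mul_dcoord.
rewrite IH//.
have := @DD_sum _ _ [:: i] _ (words k) xpredT (fun I => DD I (mono x I (mul_dcoord x i u))).
rewrite /= => ->; last by move=> I; apply: smooth_DD; exact: smo.
apply: eq_bigr => I _; rewrite (_ : mono x I (mul_dcoord x i u) = mul_dcoord x i (mono x I u))//.
exact: mono_mul.
Qed.

End linear_functional.

End averaged_taylor.

(** * Product bumps and their differences as sums of derivatives *)

Section bumps.
Context {R : realType} {n : nat}.
Local Notation E := 'rV[R]_n.+1.
Local Notation mu := (@lebesgue_rV R n).
Implicit Types (A K : set E) (x y z p : E) (u v eta : E -> R) (i j : 'I_n.+1)
  (s : seq 'I_n.+1) (r rho sigma : R).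

Lemma dstep_bounded : exists2 C : R, 1 <= C & forall t : R, `|dstep t| <= C.
Proof.
have cd : continuous (fun x : 'rV[R]_1 => dstep (x ord0 ord0)).
  exact: smooth_continuous (smooth_coord ord0 (@Coo_dstep R)).
have [C C0 HC] := continuous_bounded_ccube 0 1 cd.
exists (C + 1); first by rewrite lerDr.
move=> t; have [t1|t1] := leP `|t| 1.
  have := HC (const_mx t); rewrite mxE => H; rewrite (le_trans (H _)) ?lerDl//.
  by rewrite /ccube /= subr0; apply: normr_rV_le => // i; rewrite mxE.
rewrite dstep_eq0 ?normr0 ?addr_ge0//.
have [t0|t0] := leP 0 t; [right|left; exact: ltW].
by rewrite ger0_norm// in t1; exact: ltW.
Qed.

(** The derivative of [prim1], carried by [c, c + rho]. The explicit primitive is what allows two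
    bumps to be compared by derivatives. *)
Definition bump1 (c rho : R) : R -> R := fun t => rho^-1 * dstep (rho^-1 * (t - c)).

Definition prim1 (c rho : R) : R -> R := fun t => step (rho^-1 * (t - c)).

Lemma Coo_prim1 c rho : Coo dirR (prim1 c rho).
Proof.
have := Coo_affine rho^-1 (- (rho^-1 * c)) (@Coo_step R).
by under eq_fun do rewrite -mulrBr.
Qed.

Lemma Coo_bump1 c rho : Coo dirR (bump1 c rho).
Proof.
have := Coo_affine rho^-1 (- (rho^-1 * c)) (@Coo_dstep R).
by under eq_fun do rewrite -mulrBr; move=> H k; exact: CkZ.
Qed.

Lemma derive_prim1 c rho : 'D_1 (prim1 c rho) = bump1 c rho.
Proof.
apply/funext => t.
have H : is_derive t 1 (fun t => rho^-1 * t + - (rho^-1 * c)) (rho^-1).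
  exact: is_derive_affine.
have [_ ] := is_derive_comp1 H (is_derive_step _).
rewrite (_ : step \o _ = prim1 c rho); last first.
  by apply/funext => q; rewrite /prim1 /= mulrBr.
by rewrite /bump1 mulrBr mulrC => ->.
Qed.

Lemma prim1_0 c rho t : 0 < rho -> t <= c -> prim1 c rho t = 0.
Proof. by move=> r0 tc; rewrite /prim1 step0// pmulr_rle0 ?invr_gt0// subr_le0. Qed.

Lemma prim1_1 c rho t : 0 < rho -> c + rho <= t -> prim1 c rho t = 1.
Proof.
move=> r0 tc; rewrite /prim1 step1// -(mulVf (lt0r_neq0 r0)) ler_pM2l ?invr_gt0//.
by rewrite lerBrDl.
Qed.

Lemma bump1_eq0 c rho t : 0 < rho -> t <= c \/ c + rho <= t -> bump1 c rho t = 0.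
Proof.
move=> r0 tc; rewrite /bump1 dstep_eq0 ?mulr0//; case: tc => tc; [left|right].
  by rewrite pmulr_rle0 ?invr_gt0// subr_le0.
rewrite -(mulVf (lt0r_neq0 r0)) ler_pM2l ?invr_gt0//.
by rewrite lerBrDl.
Qed.

Lemma bump1_ge0 c rho t : 0 < rho -> 0 <= bump1 c rho t.
Proof. by move=> r0; rewrite mulr_ge0 ?dstep_ge0// invr_ge0 ltW. Qed.

Lemma pd_prod_coord (h : 'I_n.+1 -> R -> R) j : (forall i, Coo dirR (h i)) ->
  pd j (fun y => \prod_i h i (y ord0 i)) =
  fun y => \prod_i (if i == j then 'D_1 (h j) else h i) (y ord0 i).
Proof.
move=> ch; apply/funext => y; rewrite pd_derive (bigD1 j)//= eqxx.
rewrite (eq_bigr (fun i => h i (y ord0 i))); last by move=> i /negbTE ->.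
pose C := \prod_(i | i != j) h i (y ord0 i).
have -> : 'D_(basis j) (fun y : E => \prod_i h i (y ord0 i)) y =
    'D_1 (fun t : R => C * h j t) (y ord0 j).
  apply: derive_congr => t; rewrite (bigD1 j)//= mulrC; congr (_ * _).
    apply: eq_bigr => i ij; congr (h i _).
    by rewrite mxE [X in X + _]mxE basisE (negbTE ij) mulr0 add0r.
  by congr (h j _); rewrite mxE [X in X + _]mxE basisE eqxx.
rewrite mulrC; apply: deriveZ.
exact: (@Coo_derivable _ _ _ dirR (h j) tt _ (ch j)).
Qed.

Lemma smooth_prod_coord (h : 'I_n.+1 -> R -> R) : (forall i, Coo dirR (h i)) ->
  Smooth (fun y => \prod_i h i (y ord0 i)).
Proof. by move=> ch; apply: smooth_prod => i; exact: smooth_coord. Qed.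

Definition bump z rho : E -> R := fun y => \prod_i bump1 (z ord0 i) rho (y ord0 i).

Lemma smooth_bump z rho : Smooth (bump z rho).
Proof.
exact: (@smooth_prod_coord (fun i => bump1 (z ord0 i) rho) (fun i => Coo_bump1 _ _)).
Qed.

Lemma bump_ge0 z rho y : 0 < rho -> 0 <= bump z rho y.
Proof. by move=> r0; apply: prodr_ge0 => i _; exact: bump1_ge0. Qed.

Lemma ccube_out p r y : 0 <= r -> ~ ccube p r y -> exists i, r < `|y ord0 i - p ord0 i|.
Proof.
move=> r0 yp; apply: contrapT => H; apply: yp.
apply: normr_rV_le => // i; rewrite mxE [X in _ + X]mxE leNgt; apply/negP => ri.
by apply: H; exists i.
Qed.

Lemma tst_bump z rho p r : 0 < rho -> `|z - p| + rho <= r ->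
  tst (ccube p r) (bump z rho).
Proof.
move=> r0 zp; split=> [|y yp]; first exact: smooth_bump.
have rr : 0 <= r by rewrite (le_trans _ zp)// addr_ge0// ltW.
have [i ri] := ccube_out rr yp; rewrite /bump (bigD1 i)//= bump1_eq0 ?mul0r//.
have := normr_coord (z - p) i; rewrite mxE [X in `|_ + X|]mxE ler_norml.
case: (leP 0 (y ord0 i - p ord0 i)) => s0 /andP[? ?].
  by rewrite ger0_norm// in ri; right; lra.
by rewrite ltr0_norm// in ri; left; lra.
Qed.

Lemma supp_in_bump z rho : 0 < rho -> supp_in (`|z| + rho) (bump z rho).
Proof.
move=> r0 y yr; have := @tst_bump z rho 0 (`|z| + rho) r0.
rewrite subr0 => /(_ (lexx _))[_]; apply.
by rewrite /ccube /= subr0 => /(lt_le_trans yr); rewrite ltxx.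
Qed.

Lemma integ_bump z rho : 0 < rho -> integ setT (bump z rho).
Proof.
move=> r0; apply: (@integ_cs _ _ (`|z| + rho)) (supp_in_bump r0).
exact: smooth_continuous (smooth_bump z rho).
Qed.

Section hybrid.
Variables (z z' : E) (rho rho' : R).

Let h j i : R -> R := if (i < j)%N then bump1 (z' ord0 i) rho'
  else if i == j then fun t => prim1 (z ord0 i) rho t - prim1 (z' ord0 i) rho' t
  else bump1 (z ord0 i) rho.

(* The factor i = j is a difference of primitives, so that the derivative in
   direction j exchanges the j-th factor of one bump for that of the other. *)
Definition hyb j : E -> R := fun y => \prod_i h j i (y ord0 i).

Let Coo_h j i : Coo dirR (h j i).
Proof.
rewrite /h; case: ifP => _; first exact: Coo_bump1.
case: ifP => _; last exact: Coo_bump1.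
by move=> k; apply: CkB; exact: Coo_prim1.
Qed.

Lemma smooth_hyb j : Smooth (hyb j).
Proof. exact: smooth_prod_coord. Qed.

(** Exchange the factors of the two products one coordinate at a time and telescope; the exchange of
    the j-th factors is a derivative along j. *)
Lemma bump_sub :
  (fun y => bump z rho y - bump z' rho' y) = fun y => \sum_j pd j (hyb j) y.
Proof.
apply/funext => y.
pose G (k : nat) : R := \prod_(i < n.+1) (if (i < k)%N then bump1 (z' ord0 i) rho'
   else bump1 (z ord0 i) rho) (y ord0 i).
have G0 : G 0%N = bump z rho y by apply: eq_bigr.
have Gn : G n.+1 = bump z' rho' y by apply: eq_bigr => i _; rewrite ltn_ord.
have -> : bump z rho y - bump z' rho' y = - \sum_(0 <= k < n.+1) (G k.+1 - G k).
  by rewrite telescope_sumr// Gn G0 opprB.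
rewrite big_mkord -sumrN; apply: eq_bigr => j _; rewrite opprB.
rewrite pd_prod_coord//.
have DB : 'D_1 (h j j) = fun t => bump1 (z ord0 j) rho t - bump1 (z' ord0 j) rho' t.
  rewrite /h ltnn eqxx; apply/funext => t.
  rewrite -!derive_prim1; apply: deriveB.
    exact: (@Coo_derivable _ _ _ dirR _ tt _ (Coo_prim1 _ _)).
  exact: (@Coo_derivable _ _ _ dirR _ tt _ (Coo_prim1 _ _)).
rewrite [RHS](bigD1 j)//= eqxx [X in _ = X * _](congr1 (@^~ (y ord0 j)) DB).
rewrite /G (bigD1 j)//= [X in _ - X](bigD1 j)//= ltnn ltnS leqnn.
rewrite mulrBl; congr (_ * _ - _ * _).
  apply: eq_bigr => i ij; rewrite (negbTE ij) /h (negbTE ij).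
  by case: ifP.
apply: eq_bigr => i ij; rewrite (negbTE ij) /h (negbTE ij) ltnS leq_eqVlt.
by rewrite -val_eqE/= in ij; rewrite (negbTE ij).
Qed.

Hypotheses (rho0 : 0 < rho) (rho0' : 0 < rho').

(** Both primitives are 0 to the left of the cube and 1 to its right, so their difference, unlike
    each of them, is compactly supported. *)
Lemma tst_hyb p r j : `|z - p| + rho <= r -> `|z' - p| + rho' <= r ->
  tst (ccube p r) (hyb j).
Proof.
move=> zp zp'; split=> [|y yp]; first exact: smooth_hyb.
have rr : 0 <= r by rewrite (le_trans _ zp)// addr_ge0// ltW.
have [i ri] := ccube_out rr yp; rewrite /hyb (bigD1 i)//=.
have := normr_coord (z - p) i; rewrite mxE [X in `|_ + X|]mxE ler_norml => /andP[z1 z2].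
have := normr_coord (z' - p) i; rewrite mxE [X in `|_ + X|]mxE ler_norml => /andP[z3 z4].
have le_r : z ord0 i + rho <= p ord0 i + r /\ z' ord0 i + rho' <= p ord0 i + r by lra.
have ge_r : p ord0 i - r <= z ord0 i /\ p ord0 i - r <= z' ord0 i.
  by move: (rho0) (rho0') => ? ?; lra.
move: le_r ge_r => [le_r1 le_r2] [ge_r1 ge_r2].
have [] : y ord0 i < p ord0 i - r \/ p ord0 i + r < y ord0 i.
- case: (leP 0 (y ord0 i - p ord0 i)) => s0.
    by rewrite ger0_norm// in ri; right; lra.
  by rewrite ltr0_norm// in ri; left; lra.
- move=> yi; suff -> : h j i (y ord0 i) = 0 by rewrite mul0r.
  rewrite /h; case: ifP => _.
    by rewrite bump1_eq0//; left; move: (rho0) (rho0') => ? ?; lra.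
  case: ifP => _; last by rewrite bump1_eq0//; left; lra.
  by rewrite !prim1_0 ?subrr//; lra.
move=> yi; suff -> : h j i (y ord0 i) = 0 by rewrite mul0r.
rewrite /h; case: ifP => _.
  by rewrite bump1_eq0//; right; lra.
case: ifP => _; last by rewrite bump1_eq0//; right; lra.
by rewrite !prim1_1 ?subrr//; lra.
Qed.

(** The j-th factor is bounded by 1, so only n of the n + 1 factors contribute 1 / sigma: one power
    of the scale is gained over a bump. *)
Lemma hyb_le (C sigma : R) j y : 0 < sigma -> sigma <= rho -> sigma <= rho' ->
  0 <= C -> (forall t : R, `|dstep t| <= C) -> `|hyb j y| <= (C / sigma) ^+ n.
Proof.
move=> s0 s1 s2 C0 HC; rewrite /hyb normr_prod (bigD1 j)//=.
have hj : `|h j j (y ord0 j)| <= 1.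
  rewrite /h ltnn eqxx ler_norml.
  have := step_ge0 (rho^-1 * (y ord0 j - z ord0 j)).
  have := step_ge0 (rho'^-1 * (y ord0 j - z' ord0 j)).
  have := step_le1 (rho^-1 * (y ord0 j - z ord0 j)).
  have := step_le1 (rho'^-1 * (y ord0 j - z' ord0 j)).
  rewrite /prim1; lra.
have b1 c r t : 0 < r -> sigma <= r -> `|bump1 c r t| <= C / sigma.
  move=> r0 sr; rewrite /bump1 normrM mulrC; apply: ler_pM => //.
  by rewrite ger0_norm ?invr_ge0 ?(ltW r0)// lef_pV2// posrE.
rewrite -[leRHS]mul1r; apply: ler_pM => //; first exact: prodr_ge0.
apply: (@le_trans _ _ (\prod_(i < n.+1 | i != j) (C / sigma))).
  apply: ler_prod => i ij; rewrite normr_ge0 /= /h (negbTE ij).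
  by case: ifP => _; exact: b1.
rewrite prodr_const; rewrite (_ : #|_| = n)//.
by rewrite -[RHS]/(n.+1.-1) -[in RHS](card_ord n.+1) (cardC1 j).
Qed.

End hybrid.

Lemma bump_scale z rho : 0 < rho ->
  bump z rho = fun y => rho^-1 ^+ n.+1 * bump 0 1 (rho^-1 *: y + - (rho^-1 *: z)).
Proof.
move=> r0; apply/funext => y; rewrite /bump -[X in X ^+ _]/(rho^-1).
have -> : rho^-1 ^+ n.+1 = \prod_(i < n.+1) rho^-1 by rewrite prodr_const card_ord.
rewrite -big_split /=; apply: eq_bigr => i _; rewrite /bump1 !mxE invr1 mul1r mul1r subr0.
by rewrite mulrBr.
Qed.

Lemma Bk_affine k x u (a : R) (c : E) : a != 0 -> Smooth u ->
  Bk k x (fun y => u (a *: y + c)) = fun y => Bk k (a *: x + c) u (a *: y + c).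
Proof.
move=> a0; elim: k u => // k IH u su; apply/funext => y /=.
apply: eq_bigr => i _.
have sm := smooth_mul_dcoord (a *: x + c) i su.
have -> : mul_dcoord x i (fun y => u (a *: y + c)) =
    fun y => a^-1 * mul_dcoord (a *: x + c) i u (a *: y + c) + 0.
  apply/funext => q; rewrite /mul_dcoord /dcoord !mxE addr0 !mulrA; congr (_ * _).
  by rewrite mulrBr; field.
rewrite BkDZ; [|exact: smooth_affine|exact: smooth_cst].
rewrite IH// (_ : Bk k x (fun=> 0) = fun=> 0); last first.
  have := @BkDZ _ _ k x (-1) _ _ (smooth_cst 0) (smooth_cst 0).
  under eq_fun do rewrite mulr0 addr0.
  by move=> ->; apply/funext => q; rewrite mulN1r addNr.
under eq_fun do rewrite addr0.
rewrite pderivZ; last by apply: smooth_affine; exact: smooth_Bk.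
by rewrite pderiv_affine ?mulrA ?mulVf ?mul1r//; exact: smooth_Bk.
Qed.

Lemma Bk_bounded k s u (q r0 : R) : Smooth u -> supp_in q u -> 0 <= r0 ->
  exists2 C : R, 0 <= C & forall x y, `|x| <= r0 -> `|DD s (Bk k x u) y| <= C.
Proof.
move=> + + r00; elim: k s u => [|k IH] s u su uq.
  have [C C0 HC] := supp_bounded (smooth_continuous (smooth_DD s su)) (supp_inDD s uq).
  by exists C.
have sz i : Smooth (fun z : E => z ord0 i * u z).
  by apply: smoothM => //; exact: smooth_coord_id.
have zq i : supp_in q (fun z : E => z ord0 i * u z) by exact: supp_inM.
have /fin_all_exists2[C1 C10 H1] i := IH (rcons s i) u su uq.
have /fin_all_exists2[C2 C20 H2] i := IH (rcons s i) _ (sz i) (zq i).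
exists (\sum_i (r0 * C1 i + C2 i)).
  by apply: sumr_ge0 => i _; rewrite addr_ge0// mulr_ge0.
move=> x y xr /=.
rewrite DD_sum; last by move=> i; apply: smooth_pderiv; apply: smooth_Bk; exact: smooth_mul_dcoord.
apply: (le_trans (ler_norm_sum _ _ _)); apply: ler_sum => i _.
have s1 := smooth_Bk k x su; have s2 := smooth_Bk k x (sz i).
rewrite -DD_rcons Bk_coord// DDB//; last exact: smoothZ.
rewrite DDZ// (le_trans (ler_normB _ _))// lerD ?H2// normrM.
by apply: ler_pM => //; [rewrite (le_trans (normr_coord x i))|exact: H1].
Qed.

(** Scaling reduces to the unit bump at the origin, where x stays in a bounded set; the density 1 /
    rho^(n+1) is the Jacobian. *)
Lemma taylor_bump_bounded m (r0 : R) : 0 <= r0 -> exists2 C : R, 0 <= C &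
  forall x y z rho, 0 < rho -> `|x - z| <= r0 * rho ->
    `|taylor m x (bump z rho) y| <= C * rho^-1 ^+ n.+1.
Proof.
move=> r00.
have sb := smooth_bump 0 1.
have bq := @supp_in_bump 0 1 ltr01.
have /fin_all_exists2[C C0 HC] (k : 'I_m) := Bk_bounded k [::] sb bq r00.
exists (\sum_(k < m) C k); first exact: sumr_ge0.
move=> x y z rho rho0 xz; have ri : 0 < rho^-1 by rewrite invr_gt0.
apply: (le_trans (ler_norm_sum _ _ _)); rewrite mulr_suml; apply: ler_sum => k _.
rewrite bump_scale//.
have sa : Smooth (fun y => bump 0 1 (rho^-1 *: y + - (rho^-1 *: z))) by exact: smooth_affine.
rewrite (_ : (fun y => _) = fun y => rho^-1 ^+ n.+1 *
  bump 0 1 (rho^-1 *: y + - (rho^-1 *: z)) + 0); last by apply/funext => q; rewrite addr0.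
rewrite BkDZ//; last exact: smooth_cst.
rewrite (_ : Bk k x (fun=> 0) = fun=> 0); last first.
  have := @BkDZ _ _ k x (-1) _ _ (smooth_cst 0) (smooth_cst 0).
  under eq_fun do rewrite mulr0 addr0.
  by move=> ->; apply/funext => q; rewrite mulN1r addNr.
rewrite addr0 Bk_affine ?gt_eqF// !normrM mulrCA mulrC.
have rn : 0 <= rho^-1 ^+ n.+1 by rewrite exprn_ge0 ?ltW.
rewrite [`|rho^-1 ^+ _|]ger0_norm//; apply: ler_wpM2r => //.
rewrite -[leRHS]mul1r; apply: ler_pM => //.
  rewrite normrX normrN1 expr1n mul1r ger0_norm ?invr_ge0 ?ler0n//.
  by rewrite invf_le1 ?ler1n ?ltr0n ?fact_gt0.
apply: (HC k); rewrite -scalerBr normrZ gtr0_norm// mulrC ler_pdivrMr//.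
Qed.

(** By [bump_sub] the difference is a sum of derivatives of compactly supported functions, so one
    normalizing constant serves all bumps. *)
Lemma Rintegral_bump z rho z' rho' : 0 < rho -> 0 < rho' ->
  \int[mu]_y bump z rho y = \int[mu]_y bump z' rho' y.
Proof.
move=> r0 r0'.
apply/eqP; rewrite -subr_eq0 -RintB//; [|exact: integ_bump|exact: integ_bump].
have e := bump_sub z z' rho rho'.
have -> : \int[mu]_y (bump z rho y - bump z' rho' y) = \int[mu]_y (\sum_j pd j (hyb z z' rho rho' j) y).
  by apply: eq_Rintegral => y _; exact: (congr1 (fun h => h y) e).
pose r := `|z| + `|z'| + rho + rho'.
have th j : supp_in r (hyb z z' rho rho' j).
  have := @tst_hyb z z' rho rho' r0 r0' 0 r j; rewrite !subr0 => H.
  have [z0 z0'] : 0 <= `|z| /\ 0 <= `|z'| by [].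
  have [||_ {}H] := H; [rewrite /r; lra|rewrite /r; lra|].
  move=> y yr; apply: H; rewrite /ccube /= subr0 => /(lt_le_trans yr).
  by rewrite ltxx.
have sh j := smooth_hyb z z' rho rho' j.
rewrite Rintegral_sum//; last first.
  move=> j; apply: (@integ_cs _ _ r); first exact: smooth_continuous (smooth_pderiv j (sh j)).
  exact: (supp_inDD [:: j]).
by apply/eqP; apply: big1 => j _; exact: (Rintegral_pd0 _ (sh j) (th j)).
Qed.

(** If one cube were null, so would be all its translates, and the countably many translates with
    rational centres cover the space. *)
Lemma mu_ccube_gt0 z r : 0 < r -> (0 < mu (ccube z r))%E.
Proof.
move=> r0; rewrite lt0e; apply/andP; split; last exact: lebesgue_outer_ge0.
apply/eqP => z0.
have w0 w : mu (ccube w r) = 0.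
  rewrite -z0 -[RHS](lebesgue_outer_shift _ (w - z)); congr (mu _).
  apply/seteqP; split => [y yw|_ [y yz <-]]; last first.
    by rewrite /ccube /= (_ : _ - w = y - z)//; apply/rowP => i; rewrite !mxE; ring.
  exists (y - (w - z)); last by rewrite subrK.
  move: yw; rewrite /ccube /= (_ : y - w = y - (w - z) - z)//.
  by apply/rowP => i; rewrite !mxE; ring.
have := @lebesgue_rV_setT_gt0 R n; apply/negP; rewrite -leNgt.
pose F k : set E := if (unpickle k : option 'rV[rat]_n.+1) is Some q
  then ccube (map_mx ratr q) r else set0.
have cov : [set: E] `<=` \bigcup_k F k.
  move=> y _.
  have /fin_all_exists[q qE] (i : 'I_n.+1) : exists q : rat, y ord0 i - r < ratr q < y ord0 i.
    have [|q] := @rat_in_itvoo R (y ord0 i - r) (y ord0 i); first by lra.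
    by rewrite in_itv /= => ?; exists q.
  exists (pickle (\row_i q i)) => //; rewrite /F pickleK; apply: normr_rV_le => [|i].
    exact: ltW.
  by rewrite !mxE; have /andP[? ?] := qE i; rewrite ler_norml; lra.
apply: (le_trans (le_lebesgue_outer cov)).
apply: (le_trans (lebesgue_outer_sigma_subadditive F)).
rewrite eseries0// => k _ _; rewrite /F; case: unpickle => [q|]; last exact: lebesgue_outer0.
exact: w0.
Qed.

(** [dstep] is positive at some c, hence larger than half that value near c, and the unit bump is
    bounded below on a small cube around the point with all coordinates c. *)
Lemma Rintegral_bump_gt0 z rho : 0 < rho -> 0 < \int[mu]_y bump z rho y.
Proof.
move=> r0; rewrite (Rintegral_bump z 0 r0 ltr01).
have [c _ c0] := @dstep_gt0 R.
have cd : continuous (fun t : R => dstep t) by exact: Coo_continuous (@Coo_dstep R).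
have /cvgrPdist_lt/(_ _ (divr_gt0 c0 (ltr0Sn _ 1)))/nbhs_ballP[d /= d0 Hd] := cd c.
pose w : E := const_mx c; pose a := dstep c / 2.
have a0 : 0 < a by rewrite divr_gt0.
have lowb y : ccube w (d / 2) y -> a ^+ n.+1 <= bump 0 1 y.
  move=> yw; rewrite /bump.
  have -> : a ^+ n.+1 = \prod_(i < n.+1) a by rewrite prodr_const card_ord.
  apply: ler_prod => i _; rewrite ltW//= /bump1 invr1 !mul1r mxE subr0.
  have : ball c d (y ord0 i).
    rewrite -ball_normE /= distrC (le_lt_trans _ (_ : d / 2 < d))//; last by lra.
    by have := normr_coord (y - w) i; rewrite !mxE => /le_trans; apply.
  move=> /Hd; rewrite ltr_norml => /andP[_]; rewrite /a; lra.
have ib : integ setT (bump 0 1) by exact: integ_bump.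
have d20 : 0 < d / 2 by rewrite divr_gt0.
have mc := measurable_ccube w (d / 2).
apply: (@lt_le_trans _ _ (a ^+ n.+1 * fine (mu (ccube w (d / 2))))).
  rewrite mulr_gt0 ?exprn_gt0// fine_gt0// mu_ccube_gt0//=.
  exact: mu_ccube_fin.
have -> : a ^+ n.+1 * fine (mu (ccube w (d / 2))) =
    \int[mu]_y (a ^+ n.+1 * \1_(ccube w (d / 2)) y).
  rewrite RintZ//; last by apply: integ_indic => //; exact: mu_ccube_fin.
  by rewrite /Rintegral integral_indic// setIT.
apply: le_Rint => //.
  by apply: integZ => //; apply: integ_indic => //; exact: mu_ccube_fin.
move=> y _; rewrite indicE; have [/set_mem yw|_] := boolP (y \in _).
  by rewrite mulr1 lowb.
by rewrite mulr0 bump_ge0.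
Qed.

End bumps.

(** * Local polynomials of f and comparison of two of them in a common cube *)

Section local_polynomials.
Context {R : realType} {n : nat}.
Local Notation E := 'rV[R]_n.+1.
Local Notation mu := (@lebesgue_rV R n).
Implicit Types (K : set E) (x y z p : E) (u v eta : E -> R) (i j : 'I_n.+1)
  (s : seq 'I_n.+1) (r rho sigma : R).

(** The point z is the lower corner, not the centre, of the cube of side rho that carries the
    weight; hence the conditions |z - p| + rho <= r in the sequel. *)
Definition lpoly (Omega : set E) m (f : E -> R) z rho : E -> R := fun x =>
  (\int[mu]_y bump z rho y)^-1 * \int[mu]_(y in Omega) (f y * taylor m x (bump z rho) y).

Variable Omega : set E.
Hypothesis mOmega : measurable Omega.

Definition locint (f : E -> R) := measurable_fun Omega f /\
  forall p r, ccube p r `<=` Omega -> integ (ccube p r) f.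

Lemma locint_tst (h : E -> R) p r u : locint h -> ccube p r `<=` Omega ->
  tst (ccube p r) u ->
  integ Omega (fun y => h y * u y) /\
  \int[mu]_(y in Omega) (h y * u y) = \int[mu]_(y in ccube p r) (h y * u y).
Proof.
move=> [mh hi] pO [su u0].
have cu := smooth_continuous su.
have [C C0 HC] := continuous_bounded_ccube p r cu.
apply: (@integ_supp _ _ Omega (ccube p r) h u C) => //.
- exact: measurable_ccube.
- exact: hi.
- by apply: measurable_funS (continuous_measurable_rV cu).
- move=> y; have [/HC//|/u0 ->] := pselect (ccube p r y).
  by rewrite normr0.
- by move=> y _; exact: u0.
Qed.

Lemma lin_on_integral (h : E -> R) p r : locint h -> ccube p r `<=` Omega ->
  lin_on (ccube p r) (fun u => \int[mu]_(y in Omega) (h y * u y)).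
Proof.
move=> hi pO a u v tu tv.
have [iu _] := locint_tst hi pO tu; have [iv _] := locint_tst hi pO tv.
rewrite -RintZ// -RintD//; last exact: integZ.
by apply: eq_Rintegral => y _; rewrite mulrDr mulrCA.
Qed.

Lemma lpoly_polyd (f : E -> R) m z rho p r : locint f -> ccube p r `<=` Omega ->
  0 < rho -> `|z - p| + rho <= r -> polyd m (lpoly Omega m f z rho).
Proof.
move=> fi pO r0 zp; apply: polydZ.
apply: (@polyd_taylor _ _ (ccube p r) (fun u => \int[mu]_(y in Omega) (f y * u y))).
- exact: closed_ccube.
- exact: lin_on_integral.
- exact: tst_bump.
Qed.

Lemma lpoly_le m (r0 : R) : 0 <= r0 -> exists2 C : R, 0 <= C &
  forall f x z rho p r, locint f -> 0 < rho -> ccube p r `<=` Omega ->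
    `|z - p| + rho <= r -> `|x - z| <= r0 * rho ->
    `|lpoly Omega m f z rho x| <= C * rho^-1 ^+ n.+1 * \int[mu]_(y in ccube p r) `|f y|.
Proof.
move=> r00; have [C C0 HC] := @taylor_bump_bounded R n m r0 r00.
exists ((\int[mu]_y bump (0 : E) 1 y)^-1 * C).
  by rewrite mulr_ge0// invr_ge0 ltW// Rintegral_bump_gt0.
move=> f x z rho p r fi rho0 pO zp xz.
have c0 := Rintegral_bump_gt0 z rho0.
rewrite (Rintegral_bump 0 z ltr01 rho0) /lpoly normrM gtr0_norm ?invr_gt0// -!mulrA.
rewrite ler_pM2l ?invr_gt0//.
have tb : tst (ccube p r) (taylor m x (bump z rho)).
  by apply: tst_taylor; [exact: closed_ccube|exact: tst_bump].
have [_ ->] := locint_tst fi pO tb.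
have mK := measurable_ccube p r; have fK := fi.2 p r pO.
have mt : measurable_fun (ccube p r) (taylor m x (bump z rho)).
  apply: measurable_funS (continuous_measurable_rV (smooth_continuous (tst_smooth tb))) => //.
have bnd y : `|taylor m x (bump z rho) y| <= C * rho^-1 ^+ n.+1 by exact: HC.
apply: (le_trans (le_norm_Rint mK _)).
  by apply: (@integM _ _ _ _ _ (C * rho^-1 ^+ n.+1)).
rewrite mulrA -RintZ//; last exact: integ_norm.
apply: le_Rint => //.
- by apply: integ_norm => //; apply: (@integM _ _ _ _ _ (C * rho^-1 ^+ n.+1)).
- by apply: integZ => //; exact: integ_norm.
by move=> y _; rewrite normrM mulrC ler_wpM2r.
Qed.

(* [D s] stands for the weak derivative of f along the list s. *)
Record weak_data m (f : E -> R) (D : seq 'I_n.+1 -> E -> R) (g : E -> R) : Prop :=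
  WeakData {
  weak_data_f : locint f ;
  weak_data_g : locint g ;
  weak_data_D : forall s, size s = m -> locint (D s) ;
  weak_data_le : forall s y, size s = m -> Omega y -> `|D s y| <= g y ;
  weak_data_eq : forall K s u, compact K -> K `<=` Omega -> tst K u -> size s = m ->
     \int[mu]_(y in Omega) (f y * DD s u y) =
     (-1) ^+ m * \int[mu]_(y in Omega) (D s y * u y) }.

Lemma smooth_sum_seq (T : eqType) (t : seq T) (F : T -> E -> R) :
  {in t, forall q, Smooth (F q)} -> Smooth (fun x => \sum_(q <- t) F q x).
Proof.
elim: t => [|q t IH] sF; first by under eq_fun do rewrite big_nil; exact: smooth_cst.
under eq_fun do rewrite big_cons; apply: smoothD; first by apply: sF; rewrite mem_head.
by apply: IH => q' q't; apply: sF; rewrite inE q't orbT.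
Qed.

Section one_step.
Variable m' : nat.
Let m := m'.+1.

(** Write the difference of the bumps by [bump_sub]. By [taylor_pd] only the terms with exactly m
    derivatives remain, and these are moved onto f by the definition of weak derivatives. *)
Lemma lpoly_sub f D g z z' rho rho' p r x : weak_data m f D g -> 0 < rho -> 0 < rho' ->
  ccube p r `<=` Omega -> `|z - p| + rho <= r -> `|z' - p| + rho' <= r ->
  lpoly Omega m f z rho x - lpoly Omega m f z' rho' x =
  \sum_j \sum_(I <- words m') (- ((\int[mu]_y bump (0 : E) 1 y)^-1 / m'`!%:R)) *
     \int[mu]_(y in Omega) (D (j :: I) y * mono x I (hyb z z' rho rho' j) y).
Proof.
move=> [fi gi Di Dg wD] r0 r0' pO zp zp'.
pose K := ccube p r; have cK : closed K by exact: closed_ccube.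
pose L u := \int[mu]_(y in Omega) (f y * u y).
have linL : lin_on K L by exact: lin_on_integral.
have tb : tst K (bump z rho) by exact: tst_bump.
have tb' : tst K (bump z' rho') by exact: tst_bump.
have th j : tst K (hyb z z' rho rho' j) by exact: tst_hyb.
have lpE w q : 0 < q -> lpoly Omega m f w q x =
    (\int[mu]_y bump (0 : E) 1 y)^-1 * L (taylor m x (bump w q)).
  by move=> q0; rewrite /lpoly (Rintegral_bump w 0 q0 ltr01).
rewrite lpE// lpE// -mulrBr; move: (_^-1) => c0.
have tt : tst K (taylor m x (bump z rho)) by exact: tst_taylor.
have tt' : tst K (taylor m x (bump z' rho')) by exact: tst_taylor.
have -> : L (taylor m x (bump z rho)) - L (taylor m x (bump z' rho')) =
    L (taylor m x (fun y => bump z rho y - bump z' rho' y)).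
  rewrite addrC -mulN1r -linL//; congr L.
  rewrite -taylorDZ; [|exact: smooth_bump|exact: smooth_bump].
  by congr taylor; apply/funext => y; rewrite mulN1r addrC.
rewrite bump_sub.
have -> : L (taylor m x (fun y => \sum_j pd j (hyb z z' rho rho' j) y)) =
    \sum_j L (taylor m x (pd j (hyb z z' rho rho' j))).
  apply: (@lin_sum _ _ K (fun v => L (taylor m x v)) _ _ (index_enum _)
     (fun j => pd j (hyb z z' rho rho' j))) => [a u v tu tv|j]; last exact: tst_pd.
  rewrite taylorDZ; [|exact: tst_smooth tu|exact: tst_smooth tv].
  by rewrite linL//; exact: tst_taylor.
rewrite mulr_sumr; apply: eq_bigr => j _.
have sh : Smooth (hyb z z' rho rho' j) by exact: tst_smooth (th j).
rewrite taylor_pd// (linZ linL); last by apply: tst_pd => //; exact: tst_Bk.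
rewrite Bk_words// .
have smo I : Smooth (mono x I (hyb z z' rho rho' j)) by apply: (@tst_smooth _ _ K); exact: tst_mono.
have -> : pd j (fun y => \sum_(I <- words m') DD I (mono x I (hyb z z' rho rho' j)) y) =
    fun y => \sum_(I <- words m') DD (j :: I) (mono x I (hyb z z' rho rho' j)) y.
  apply: (DD_sum [:: j]) => I; exact: smooth_DD.
rewrite (lin_sum linL); last by move=> I; apply: (tst_DD (j :: I) cK); exact: tst_mono.
rewrite !mulr_sumr big_seq [RHS]big_seq; apply: eq_bigr => I Im.
have sI := size_words Im.
rewrite /L (wD _ (j :: I) _ (@ccube_compact _ _ p r) pO); [|exact: tst_mono|by rewrite /= sI].
rewrite !mulrA; congr (_ * _).
(* The sign of the top Taylor term against that of m integrations by parts. *)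
have sg : (-1) ^+ m' * (-1) ^+ m = -1 :> R by rewrite /m exprS mulrCA -exprD addnn -mul2n mulnC exprM sqrr_sign mulr1.
by rewrite mulrAC -[c0 * _ * _]mulrA sg mulrN1 mulNr.
Qed.

(** In x, [lpoly_sub] is a combination of the functions of [lin_mono_le], with r' a bound for |x_i -
    y_i| on the cube. *)
Lemma lpoly_sub_le : exists2 C : R, 0 <= C &
  forall f D g z z' rho rho' p r x r' sigma s, weak_data m f D g -> 0 < sigma -> sigma <= rho -> sigma <= rho' ->
  ccube p r `<=` Omega -> `|z - p| + rho <= r -> `|z' - p| + rho' <= r ->
  0 < r' -> `|x - p| + r <= r' ->
  `|DD s (fun x => lpoly Omega m f z rho x - lpoly Omega m f z' rho' x) x| <=
    C ^+ size s * C * sigma^-1 ^+ n * r' ^+ m' / r' ^+ size s * \int[mu]_(y in ccube p r) g y.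
Proof.
have [Cb Cb1 HCb] := @dstep_bounded R; have Cb0 : 0 <= Cb by exact: le_trans Cb1.
pose c0 := (\int[mu]_y bump (0 : E) 1 y)^-1.
have c00 : 0 < c0 by rewrite invr_gt0 Rintegral_bump_gt0.
pose C1 := n.+1%:R * (size (@words n m'))%:R * (c0 / m'`!%:R * Cb ^+ n).
have C10 : 0 <= C1.
  by apply: mulr_ge0; [exact: mulr_ge0|apply: mulr_ge0; [exact: divr_ge0 (ltW c00) _|exact: exprn_ge0]].
(* One constant plays two roles: it dominates the base m' of the powers coming from [lin_mono_le],
   and the factor C1. *)
exists (C1 + m'%:R); first by rewrite addr_ge0.
move=> f D g z z' rho rho' p r x r' sigma s W; have [fi gi Di Dg wD] := W; move=> s0 s1 s2 pO zp zp' r'0 xr.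
have r0 : 0 < rho by exact: lt_le_trans s1.
have r0' : 0 < rho' by exact: lt_le_trans s2.
pose K := ccube p r; have cK : closed K by exact: closed_ccube.
have mK : measurable K by exact: measurable_ccube.
have th j : tst K (hyb z z' rho rho' j) by exact: tst_hyb.
have G0 : 0 <= \int[mu]_(y in K) g y.
  apply: Rintegral_ge0 => y /pO Oy.
  by rewrite (le_trans (normr_ge0 _) (@Dg (nseq m ord0) y _ Oy))// size_nseq.
under [X in DD s X]eq_fun do rewrite (lpoly_sub _ W r0 r0' pO zp zp').
pose L j I u := \int[mu]_(y in Omega) (D (j :: I) y * u y).
have linL j I : I \in words m' -> lin_on K (L j I).
  by move=> Im; apply: lin_on_integral => //; apply: Di; rewrite /= (size_words Im).
pose Q := (Cb / sigma) ^+ n * \int[mu]_(y in K) g y.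
have Q0 : 0 <= Q by rewrite mulr_ge0// exprn_ge0// divr_ge0// ltW.
have mono_le j J y : K y -> `|mono x J (hyb z z' rho rho' j) y| <= r' ^+ size J * (Cb / sigma) ^+ n.
  move=> Ky; elim: J => [|i J IH] /=; first by rewrite mul1r hyb_le.
  rewrite /mul_dcoord normrM exprS -mulrA; apply: ler_pM => //.
  rewrite /dcoord; have := normr_coord (x - y) i; rewrite mxE [X in `|_ + X|]mxE.
  move=> /le_trans; apply; rewrite -(subrKA p) (le_trans (ler_normD _ _))//.
  by rewrite (le_trans _ xr)// lerD2l distrC.
have LQ j I J : I \in words m' ->
    `|L j I (mono x J (hyb z z' rho rho' j))| <= Q * r' ^+ size J.
  move=> Im; have szI : size (j :: I) = m by rewrite /= (size_words Im).
  have tm : tst K (mono x J (hyb z z' rho rho' j)) by exact: tst_mono.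
  have [_ ] := locint_tst (Di _ szI) pO tm; rewrite /L => ->.
  have mm : measurable_fun K (mono x J (hyb z z' rho rho' j)).
    by apply: measurable_funS (continuous_measurable_rV (smooth_continuous (tst_smooth tm))).
  have iD := (Di _ szI).2 p r pO.
  have iDm : integ K (fun y => D (j :: I) y * mono x J (hyb z z' rho rho' j) y).
    apply: (@integM _ _ _ _ _ (r' ^+ size J * (Cb / sigma) ^+ n)) => //.
    by move=> y; exact: mono_le.
  apply: (le_trans (le_norm_Rint mK iDm)).
  rewrite (_ : Q * _ = r' ^+ size J * (Cb / sigma) ^+ n * \int[mu]_(y in K) g y); last first.
    by rewrite /Q mulrC mulrA.
  have ig := gi.2 p r pO.
  rewrite -RintZ//; apply: le_Rint => //; [exact: integ_norm|exact: integZ|].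
  move=> y Ky; rewrite normrM mulrC; apply: ler_pM => //; first exact: mono_le.
  by apply: Dg => //; exact: pO.
have smI j I : I \in words m' -> Smooth (fun x => L j I (mono x I (hyb z z' rho rho' j))).
  by move=> Im; have [] := lin_mono_pd (linL j I Im) I (th j).
have smW j W' : {subset W' <= words m'} -> Smooth (fun x => \sum_(I <- W') (- (c0 / m'`!%:R)) *
     L j I (mono x I (hyb z z' rho rho' j))).
  by move=> WW; apply: smooth_sum_seq => I IW; apply: smoothZ; apply: smI; exact: WW.
rewrite DD_sum; last by move=> j; exact: smW.
have bnd j I : I \in words m' ->
    `|DD s (fun x => L j I (mono x I (hyb z z' rho rho' j))) x| <=
      m'%:R ^+ size s * Q * r' ^+ m' / r' ^+ size s.
  move=> Im; have := @lin_mono_le _ _ K (L j I) (linL j I Im) s I _ x Q r' (th j) Q0 r'0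
    (fun J => LQ j I J Im).
  by rewrite (size_words Im).
have cm0 : 0 <= c0 / m'`!%:R by exact: divr_ge0 (ltW c00) _.
have tot j (W' : seq (seq 'I_n.+1)) : {subset W' <= @words n m'} ->
     `|DD s (fun x => \sum_(I <- W') (- (c0 / m'`!%:R)) *
     L j I (mono x I (hyb z z' rho rho' j))) x| <=
     (size W')%:R * (c0 / m'`!%:R * (m'%:R ^+ size s * Q * r' ^+ m' / r' ^+ size s)).
  elim: W' => [_|I W' IH WW].
    under [X in DD s X]eq_fun do rewrite big_nil.
    by rewrite DD_cst0 normr0 mul0r.
  have Im : I \in words m' by apply: WW; rewrite mem_head.
  have WW' : {subset W' <= words m'} by move=> J JW; apply: WW; rewrite inE JW orbT.
  under [X in DD s X]eq_fun do rewrite big_cons.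
  rewrite DDD; [|by apply: smoothZ; exact: smI|exact: smW].
  rewrite DDZ; last exact: smI.
  rewrite (le_trans (ler_normD _ _))// /= -natr1 addrC mulrDl mul1r lerD//; first exact: IH.
  by rewrite normrM normrN (ger0_norm cm0) ler_wpM2l ?bnd.
apply: (le_trans (ler_norm_sum _ _ _)).
apply: (le_trans (ler_sum _ (fun j _ => tot j _ (fun _ => id)))).
rewrite sumr_const card_ord -[leLHS]mulr_natl.
rewrite [leLHS](_ : _ = m'%:R ^+ size s * C1 * (sigma^-1 ^+ n * r' ^+ m' / r' ^+ size s *
    \int[mu]_(y in K) g y)); last first.
  rewrite /C1 /Q [(Cb / sigma) ^+ n]exprMn; move: (Cb ^+ n) (sigma^-1 ^+ n) (r' ^+ m') => a1 a2 a3.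
  move: (r' ^+ size s)^-1 (m'%:R ^+ size s) (c0 / m'`!%:R) => a4 a5 a6.
  by move: (size _)%:R n.+1%:R (\int[mu]_(y in K) g y) => a7 a8 a9; ring.
clearbody C1.
have [sg0 r'g0] : 0 <= sigma /\ 0 <= r' by rewrite !ltW.
rewrite -!mulrA [leLHS]mulrA [leRHS]mulrA; apply: ler_pM.
- by rewrite mulr_ge0 ?exprn_ge0.
- apply: mulr_ge0; first by apply: exprn_ge0; rewrite invr_ge0.
  apply: mulr_ge0; first exact: exprn_ge0.
  by apply: mulr_ge0 => //; rewrite invr_ge0 exprn_ge0.
- apply: ler_pM; rewrite ?exprn_ge0// ?lerDl//.
  by apply: lerXn2r; rewrite ?nnegrE ?addr_ge0// lerDr.
by [].
Qed.

End one_step.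

End local_polynomials.

(** * Reflection and chains in the domain *)

Section geometry.
Context {R : realType} {n : nat}.
Local Notation E := 'rV[R]_n.+1.
Implicit Types (x y z w p q : E) (r t rho sigma eps h a : R).
Local Notation d := (n.+1%:R : R).

Lemma le_enorm x : `|x| <= enorm x.
Proof.
apply: normr_rV_le => [|i]; first exact: sqrtr_ge0.
rewrite -sqrtr_sqr; apply: ler_wsqrtr; rewrite (bigD1 i)//= lerDl.
by apply: sumr_ge0 => j _; exact: sqr_ge0.
Qed.

Lemma enorm_le x : enorm x <= d * `|x|.
Proof.
have d0 : 0 <= d * `|x| by rewrite mulr_ge0.
rewrite -[leRHS]ger0_norm// -sqrtr_sqr; apply: ler_wsqrtr.
apply: (@le_trans _ _ (\sum_(i < n.+1) `|x| ^+ 2)).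
  by apply: ler_sum => i _; rewrite -real_normK ?num_real// lerXn2r ?nnegrE// normr_coord.
rewrite sumr_const card_ord -[leLHS]mulr_natl exprMn; apply: ler_wpM2r; first exact: sqr_ge0.
by rewrite expr2 ler_peMl// ler1n.
Qed.

(** The segment from z to a point of the cube does not meet the boundary, so by connectedness it
    stays in Omega. The factor d compares the Euclidean norm with the sup norm. *)
Lemma ccube_sub_dist (Omega : set E) z rho r : open Omega -> Omega z -> d * r < rho ->
  (rho%:E <= dist_to_set z (boundary Omega))%E -> ccube z r `<=` Omega.
Proof.
move=> oO Oz rr zd w; rewrite /ccube /= => zw; apply: contrapT => Ow.
pose g t : E := z + t *: (w - z).
have cg : continuous g.
  move=> t; apply: cvgD; first exact: cvg_cst.
  by apply: cvgZr_tmp; exact: cvg_id.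
have cI : connected (g @` `[0, 1]).
  apply: connected_continuous_connected; first exact: segment_connected.
  exact: continuous_subspaceT.
have bO : ~ (exists2 t, t \in `[0, 1] & boundary Omega (g t)).
  move=> [t]; rewrite in_itv /= => /andP[t0 t1] bt.
  have : (dist_to_set z (boundary Omega) <= (enorm (z - g t))%:E)%E.
    by apply: ereal_inf_lbound; exists (g t).
  move=> /(le_trans zd); rewrite lee_fin leNgt => /negP; apply.
  rewrite (le_lt_trans (enorm_le _))// (le_lt_trans _ rr)// ler_pM2l//.
  rewrite /g opprD addrA subrr sub0r normrN normrZ ger0_norm//.
  by rewrite (le_trans _ zw)// ler_piMl.
have gO : g @` `[0, 1] `&` Omega = g @` `[0, 1].
  apply: cI.
  - by exists z; split => //; exists 0; rewrite /= ?in_itv /= ?lexx ?ler01// /g scale0r addr0.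
  - by exists Omega.
  exists (closure Omega); first exact: closed_closure.
  apply/seteqP; split => [x [gx Ox]|x [gx cx]]; split => //; first exact: subset_closure.
  case: gx => t t01 gt; apply: contrapT => Ox; apply: bO; exists t => //.
  rewrite gt; split => // ix; apply: Ox; exact: interior_subset ix.
have : (g @` `[0, 1] `&` Omega) w.
  rewrite gO; exists 1; rewrite /= ?in_itv /= ?lexx ?ler01//.
  by rewrite /g scale1r addrC subrK.
by case.
Qed.

Fixpoint vlen x (p : seq E) : R := if p is y :: p' then `|x - y| + vlen y p' else 0.

Lemma vlen_ge0 x (p : seq E) : 0 <= vlen x p.
Proof. by elim: p x => //= y p IH x; rewrite addr_ge0. Qed.

Lemma vlen_polygon (a b : R) (gamma : R -> E) (s : seq R) :
  vlen (gamma a) (map gamma s) <= polygon_length a b gamma s.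
Proof.
elim: s a => [|y s IH] a /=; first by rewrite /polygon_length big_nil.
rewrite /polygon_length /= big_nat_recl//=; apply: lerD.
  by rewrite distrC; exact: le_enorm.
exact: IH.
Qed.

(** The domain condition rewritten in the sup norm, with cubes instead of the distance to the
    boundary; the comparisons of norms cost the factors d. *)
Lemma eps_curve eps (Omega : set E) x y : 0 < eps -> eps_infty_domain eps Omega ->
  Omega x -> Omega y -> x != y ->
  exists gamma : R -> E,
    [/\ {within `[0, 1]%classic, continuous gamma}, gamma 0 = x /\ gamma 1 = y,
      forall t, t \in `[0, 1] -> Omega (gamma t),
      forall s : seq R, itv_partition 0 1 s ->
        vlen x (map gamma s) <= eps^-1 * d * `|x - y| &
      forall t r, t \in `[0, 1] -> 0 <= r ->
        d * d * r * `|x - y| < eps * `|x - gamma t| * `|y - gamma t| ->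
        ccube (gamma t) r `<=` Omega].
Proof.
move=> e0 [oO dom] Ox Oy xy; have [gamma [cg [g0 g1] gO len dst]] := dom x y Ox Oy xy.
exists gamma; split=> // [s ps|t r t01 r0 H].
  have : (polygon_length 0 1 gamma s)%:E%E \is a fin_num by [].
  have : ((polygon_length 0 1 gamma s)%:E <= (eps^-1 * enorm (x - y))%:E)%E.
    by apply: le_trans len; apply: ereal_sup_ubound; exists s.
  rewrite lee_fin => H _; have := vlen_polygon 0 1 gamma s; rewrite g0 => /le_trans.
  by apply; rewrite (le_trans H)// -mulrA ler_pM2l ?invr_gt0// enorm_le.
have xy0 : 0 < enorm (x - y).
  by apply: lt_le_trans (le_enorm _); rewrite normr_gt0 subr_eq0.
apply: (@ccube_sub_dist _ _ (eps * enorm (x - gamma t) * enorm (y - gamma t) / enorm (x - y)) r) => //.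
- exact: gO.
- rewrite ltr_pdivlMr//; apply: (@le_lt_trans _ _ (d * d * r * `|x - y|)).
    by rewrite -!mulrA ler_pM2l// [leRHS]mulrCA ler_wpM2l// enorm_le.
  rewrite (lt_le_trans H)//; apply: ler_pM; rewrite ?le_enorm//.
    by rewrite mulr_ge0// ltW.
  by rewrite ler_pM2l// le_enorm.
- exact: dst.
Qed.

Lemma within_near (A : set R) (g : R -> E) t r : {within A, continuous g} -> A t -> 0 < r ->
  exists2 delta : R, 0 < delta & forall t', A t' -> `|t - t'| < delta -> `|g t - g t'| < r.
Proof.
move=> /subspace_continuousP cg At r0; have := cg t At.
move=> /cvgrPdist_lt/(_ _ r0); rewrite near_withinE => /nbhs_ballP[del /= del0 H].
by exists del => // t' At' tt'; apply: H => //; rewrite -ball_normE.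
Qed.

(* Intermediate values along the curve from y to y'. *)
Lemma reflect_point eps (Omega : set E) y y' sigma : 0 < eps -> eps_infty_domain eps Omega ->
  Omega y -> Omega y' -> 0 < sigma -> sigma <= `|y - y'| ->
  exists z, [/\ Omega z, `|z - y| = sigma / 2 & ccube z (eps / (8 * (d * d)) * sigma) `<=` Omega].
Proof.
move=> e0 dom Oy Oy' s0 syy'.
have yy' : y != y' by rewrite -subr_eq0 -normr_gt0 (lt_le_trans s0).
have [gamma [cg [g0 g1] gO _ gc]] := eps_curve e0 dom Oy Oy' yy'.
have cd : {within `[0, 1], continuous (fun t => `|gamma t - y|)}.
  apply/subspace_continuousP => t t01; apply: cvg_norm; apply: cvgB; last exact: cvg_cst.
  by move/subspace_continuousP : cg; apply.
have [|t t01 tE] := @IVT _ (fun t => `|gamma t - y|) 0 1 (sigma / 2) ler01 cd.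
  rewrite g0 g1 subrr normr0 distrC; apply/andP; split.
    by rewrite ge_min divr_ge0// ltW.
  by rewrite le_max orbC (le_trans _ syy')//; lra.
exists (gamma t); split=> //; first exact: gO.
apply: (gc t _ t01).
  by rewrite mulr_ge0 ?divr_ge0 ?mulr_ge0 ?ltW.
(* The point lies at distance sigma / 2 from y and at least |y - y'| / 2 from y', so the domain
   condition has eps * sigma / 4 available; the constant with 8 leaves room for the strict
   inequality. *)
have ty' : `|y - y'| / 2 <= `|y' - gamma t|.
  have := ler_distD (gamma t) y y'; rewrite [`|y - gamma t|]distrC tE [`|gamma t - y'|]distrC; lra.
rewrite [`|y - gamma t|]distrC tE.
have -> : d * d * (eps / (8 * (d * d)) * sigma) * `|y - y'| = eps * sigma / 8 * `|y - y'|.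
  by field; rewrite ?pnatr_eq0.
apply: (@lt_le_trans _ _ (eps * (sigma / 2) * (`|y - y'| / 2))).
  have : 0 < eps * sigma * `|y - y'| by rewrite !mulr_gt0// normr_gt0 subr_eq0.
  have -> : eps * (sigma / 2) * (`|y - y'| / 2) = eps * sigma * `|y - y'| / 4 by field.
  have -> : eps * sigma / 8 * `|y - y'| = eps * sigma * `|y - y'| / 8 by field.
  lra.
by rewrite ler_wpM2l// mulr_ge0 ?divr_ge0 ?ltW.
Qed.

(** Consider the supremum of the parameters that a chain of steps at most h can reach: continuity
    there shows that it is attained and equal to 1. *)
Lemma fine_partition (g : R -> E) h : {within `[0, 1], continuous g} -> 0 < h ->
  exists2 s, itv_partition 0 1 s & path (fun a b => `|g a - g b| <= h) 0 s.
Proof.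
move=> cg h0.
pose B := [set t : R | 0 <= t <= 1 /\ exists s : seq R, [/\ path <%O 0 s, last 0 s = t &
  path (fun a b => `|g a - g b| <= h) 0 s]].
have B0 : B 0 by split; [rewrite lexx ler01|exists [::]].
have ubB : ubound B 1 by move=> t [/andP[]].
have hB : has_sup B by split; [exists 0|exists 1].
pose c := sup B.
have c0 : 0 <= c by apply: sup_upper_bound.
have c1 : c <= 1 by apply: sup_le_ub => //; exists 0.
have cI : `[0, 1]%classic c by rewrite /= in_itv /= c0.
have [del del0 Hdel] := within_near cg cI (divr_gt0 h0 (ltr0Sn _ 1)).
have [t [/andP[t0 t1] [s [ps ls vs]]]] := sup_adherent del0 hB.
rewrite -/c => tc.
have tc' : t <= c by apply: sup_upper_bound => //; split; [rewrite t0|exists s].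
pose u := Num.min 1 (c + del / 2).
have u1 : u <= 1 by rewrite ge_min lexx.
have cu : c <= u by rewrite le_min c1 lerDl divr_ge0// ltW.
have ucd : u <= c + del / 2 by rewrite ge_min lexx orbT.
have uI : `[0, 1]%classic u by rewrite /= in_itv /= u1 (le_trans c0).
have tI : `[0, 1]%classic t by rewrite /= in_itv /= t0 t1.
have gtu : `|g t - g u| <= h.
  have H1 : `|g c - g t| < h / 2 by apply: Hdel => //; rewrite ger0_norm ?subr_ge0//; lra.
  have H2 : `|g c - g u| < h / 2 by apply: Hdel => //; rewrite distrC ger0_norm ?subr_ge0//; lra.
  by rewrite (le_trans (ler_distD (g c) _ _))// distrC; lra.
have Bu : B u.
  split; first by rewrite u1 (le_trans c0).
  have [->|tu] := eqVneq u t; first by exists s.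
  exists (rcons s u); rewrite last_rcons !rcons_path ls ps vs gtu lt_neqAle eq_sym tu.
  by rewrite (le_trans tc' cu).
have uc : u <= c by exact: sup_upper_bound.
have uE : u = 1.
  move: uc; rewrite /u minEle; case: ifP => // _; lra.
case: Bu => _ [s' [ps' ls' vs']]; exists s' => //; split=> //.
by rewrite ls' uE.
Qed.

(** Vertices are dropped until the length a accumulated since the last kept vertex x0 would exceed
    h. The number of vertices kept is then governed by the total length, not by the fineness of the
    partition. *)
Lemma thin_path (h : R) x0 x (p : seq E) (a : R) : 0 < h -> `|x0 - x| <= a -> a <= h ->
  path (fun v w => `|v - w| <= h) x p ->
  exists p' : seq E, [/\ path (fun v w => `|v - w| <= 2 * h) x0 p', last x0 p' = last x p,
    (size p')%:R * h <= vlen x p + a + h & {subset p' <= x :: p}].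
Proof.
move=> h0; elim: p x0 x a => [|y p IH] x0 x a xa ah /=.
  move=> _; have a0 : 0 <= a by exact: le_trans xa.
  exists [:: x]; split=> //=; [rewrite andbT; lra|lra].
move=> /andP[xy pp]; have a0 : 0 <= a by exact: le_trans xa.
have [ad|ad] := leP (a + `|x - y|) h.
  have [||//|p' [p1 p2 p3 p4]] := IH x0 y (a + `|x - y|).
  - by rewrite (le_trans (ler_distD x _ _))// lerD2r.
  - by [].
  exists p'; split=> //; first by rewrite (le_trans p3)//; lra.
  by move=> w /p4; rewrite !inE => ->; rewrite orbT.
have [||//|p' [p1 p2 p3 p4]] := IH y y 0; rewrite ?subrr ?normr0 ?(ltW h0)//.
exists (y :: p'); split=> //=.
- by rewrite p1 andbT (le_trans (ler_distD x _ _))//; lra.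
- by rewrite -natr1 mulrDl mul1r; lra.
- by move=> w; rewrite !inE => /orP[/eqP ->|/p4]; rewrite ?eqxx ?orbT// inE => ->; rewrite orbT.
Qed.

Lemma vlen_le x (p : seq E) : forall w, w \in p -> `|x - w| <= vlen x p.
Proof.
elim: p x => // y p IH x w; rewrite inE => /orP[/eqP ->|wp] /=.
  by rewrite lerDl vlen_ge0.
by rewrite (le_trans (ler_distD y _ _))// lerD2l IH.
Qed.

(** A fine partition of the curve, thinned out at step kappa * s. The bound on the length of the
    curve makes the number of points independent of s, z and z'. *)
Lemma chain_points eps (Omega : set E) (c C : R) : 0 < eps -> eps_infty_domain eps Omega ->
  0 < c -> 0 < C -> exists kappa C' : R, exists N1 : nat, [/\ 0 < kappa, 24 * kappa <= c, 0 < C' &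
  forall s z z', 0 < s -> Omega z -> Omega z' -> ccube z (c * s) `<=` Omega ->
    ccube z' (c * s) `<=` Omega -> `|z - z'| <= C * s ->
    exists p : seq E, [/\ path (fun v w => `|v - w| <= kappa * s) z p, last z p = z',
      (size p <= N1)%N & forall w, w \in z :: p ->
         `|z - w| <= C' * s /\ ccube w (3 * kappa * s) `<=` Omega]].
Proof.
move=> e0 dom c0 C0.
(* The first bound serves the points of the curve within c * s / 2 of an end, whose cube lies in
   that of the end; the second serves the others, where both distances in the domain condition
   exceed c * s / 2. *)
pose kap := Num.min (c / 24) (eps * c ^+ 2 / (24 * (d * d) * C)).
have k0 : 0 < kap.
  by rewrite lt_min divr_gt0//= divr_gt0 ?mulr_gt0 ?exprn_gt0.
have k6 : kap <= c / 24 by rewrite ge_min lexx.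
have kC : 24 * (d * d) * C * kap <= eps * c ^+ 2.
  rewrite mulrC -ler_pdivlMr ?mulr_gt0//; by rewrite ge_min lexx orbT.
pose C' := eps^-1 * d * C.
have C'0 : 0 < C' by rewrite !mulr_gt0 ?invr_gt0.
pose N1 := (Num.truncn (C' / (kap / 2) + 1)).+1.
exists kap, C', N1; split=> //; first by lra.
move=> s z z' s0 Oz Oz' cz cz' zz'.
have small w r : ccube w (c * s) `<=` Omega -> r <= c * s -> ccube w r `<=` Omega.
  by move=> wO rc q wq; apply: wO; exact: le_trans rc.
have ks : 3 * kap * s <= c * s / 2.
  have := ler_wpM2r (ltW s0) k6; have := mulr_gt0 c0 s0; lra.
have [<-|zz] := eqVneq z z'.
  exists [::]; split=> // w; rewrite inE => /eqP ->; rewrite subrr normr0; split.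
    by rewrite mulr_ge0 ?ltW.
  by apply: small cz _; rewrite (le_trans ks)// ler_pdivrMr//; have := mulr_gt0 c0 s0; lra.
have [gamma [cg [g0 g1] gO gl gc]] := eps_curve e0 dom Oz Oz' zz.
have h0 : 0 < kap * s / 2 by rewrite divr_gt0 ?mulr_gt0.
have [q [q01 q1] qv] := fine_partition cg h0.
have qI w : w \in map gamma q -> exists2 t, t \in `[0, 1] & w = gamma t.
  move=> /mapP[t tq ->]; exists t => //; rewrite in_itv /=.
  have := q01; rewrite lt_path_sortedE => /andP[/allP/(_ t tq) /ltW -> _] /=.
  have [k kq <-] := nthP 1 tq.
  by apply: (@itv_partition_nth_le _ _ 0 1 q k.+1) => //; split.
have cuG t : t \in `[0, 1] -> ccube (gamma t) (3 * kap * s) `<=` Omega.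
  move=> t01; have cs0 := mulr_gt0 c0 s0.
  have close w : ccube w (c * s) `<=` Omega -> `|w - gamma t| <= c * s / 2 ->
      ccube (gamma t) (3 * kap * s) `<=` Omega.
    move=> wO wt v; rewrite /ccube /= => vt; apply: wO; rewrite /ccube /=.
    rewrite (le_trans (ler_distD (gamma t) _ _))// [X in _ + X]distrC.
    by rewrite (le_trans (lerD vt wt))//; lra.
  have [/close|far] := leP `|z - gamma t| (c * s / 2); first exact.
  have [/close|far'] := leP `|z' - gamma t| (c * s / 2); first exact.
  apply: (gc t _ t01); first by rewrite !mulr_ge0 ?ltW.
  apply: (@le_lt_trans _ _ (eps * (c * s / 2) * (c * s / 2))); last first.
    have cs2 : 0 <= c * s / 2 by rewrite divr_ge0// ltW.
    by rewrite -[ltLHS]mulrA -[ltRHS]mulrA ltr_pM2l//; exact: ltr_pM.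
  have -> : eps * (c * s / 2) * (c * s / 2) = eps * c ^+ 2 * (s ^+ 2 / 4) by field.
  apply: (@le_trans _ _ (d * d * (3 * kap * s) * (C * s))).
    by rewrite ler_wpM2l// !mulr_ge0 ?ltW.
  have -> : d * d * (3 * kap * s) * (C * s) = 24 * (d * d) * C * kap * (s ^+ 2 / 8).
    by field.
  apply: (@le_trans _ _ (eps * c ^+ 2 * (s ^+ 2 / 8))).
    by rewrite ler_wpM2r// divr_ge0 ?sqr_ge0.
  by rewrite ler_pM2l ?mulr_gt0 ?exprn_gt0//; have := sqr_ge0 s; lra.
have vq : path (fun v w => `|v - w| <= kap * s / 2) z (map gamma q).
  by rewrite -g0 path_map.
have zz0 : `|z - z| <= 0 by rewrite subrr normr0.
have [p [p1 p2 p3 p4]] := thin_path h0 zz0 (ltW h0) vq.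
have vl : vlen z (map gamma q) <= C' * s.
  rewrite (le_trans (gl q _))//; rewrite /C' -!mulrA ler_pM2l ?invr_gt0// ler_pM2l//.
have pin w : w \in z :: p -> w = z \/ w \in map gamma q.
  rewrite inE => /orP[/eqP ->|/p4]; first by left.
  by rewrite inE => /orP[/eqP ->|->]; [left|right].
exists p; split.
- apply: sub_path p1 => v w; rewrite /= (_ : 2 * _ = kap * s)//; by field.
- by rewrite p2 -[z]g0 last_map (eqP q1) g1.
- rewrite -(ler_nat R) (le_trans _ (ltW (truncnS_gt _)))//.
  rewrite -(ler_pM2r h0) (le_trans p3)// addr0.
  rewrite mulrDl mul1r lerD2r (le_trans vl)//.
  rewrite (_ : C' / (kap / 2) * (kap * s / 2) = C' * s)//.
  by have := lt0r_neq0 k0; clearbody kap C'; move=> kn; field.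
move=> w /pin[->|wq].
  rewrite subrr normr0 mulr_ge0 ?ltW//; split=> //.
  by rewrite -g0; apply: cuG; rewrite in_itv /= lexx ler01.
split; first by rewrite (le_trans (vlen_le _ wq)).
by have [t t01 ->] := qI w wq; exact: cuG.
Qed.

End geometry.

Lemma lfsumE (R : nmodType) (I : choiceType) (t : seq I) (F : I -> R) :
  uniq t -> (forall i, i \notin t -> F i = 0) ->
  \sum_(i \in [set: I]) F i = \sum_(i <- t) F i.
Proof.
move=> ut F0; rewrite (fsbigE t)//; last by move=> i _; exact: F0.
by apply: eq_bigl => i; rewrite in_setT.
Qed.

Lemma near_all (T : topologicalType) (I : eqType) (t : seq I) (P : I -> T -> Prop) (x0 : T) :
  (forall i, i \in t -> \forall x \near x0, P i x) ->
  \forall x \near x0, forall i, i \in t -> P i x.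
Proof.
elim: t => [|i t IH] H; first exact: nearW.
have H1 := H i (mem_head i t).
have H2 : \forall x \near x0, forall i, i \in t -> P i x.
  by apply: IH => i' i't; apply: H; rewrite inE i't orbT.
by near=> x => i'; rewrite inE => /orP[/eqP ->|]; [near: x|move: i'; near: x].
Unshelve. all: by end_near. Qed.

(** * Local criterion of smoothness and bounds on all derivatives up to an order *)

Section smooth_extra.
Context {R : realType} {n : nat}.
Local Notation E := 'rV[R]_n.+1.
Implicit Types (u v : E -> R) (s : seq 'I_n.+1).

Lemma smooth_local u : (forall x0 : E, exists2 v, Smooth v & \forall x \near x0, u x = v x) ->
  Smooth u.
Proof.
move=> ul; apply: MkSmooth => s psi; rewrite {}/psi -DDE; split=> [x0|x0 i].
  have [v sv uv] := ul x0; have uv' := near_eq_DD s uv.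
  have cv := smooth_continuous (smooth_DD s sv).
  rewrite /continuous_at (nbhs_singleton uv'); apply: cvg_trans (cv x0).
  have H : \forall x \near x0, DD s v x = DD s u x by apply: filterS uv' => x ->.
  exact: near_eq_cvg H.
have [v sv uv] := ul x0; have uv' := near_eq_DD s uv.
apply: (near_eq_derivable (f := DD s v)); first by apply: filterS uv' => x ->.
exact: smooth_derivable (smooth_DD s sv).
Qed.

Lemma DD_bounded (m : nat) u (r : R) : Smooth u -> supp_in r u ->
  exists2 A : R, 1 <= A & forall s x, (size s <= m)%N -> `|DD s u x| <= A.
Proof.
elim: m u => [|m IH] u su ur.
  have [A A0 HA] := supp_bounded (smooth_continuous su) ur.
  exists (A + 1) => [|s x]; first by rewrite lerDr.
  by rewrite leqn0 size_eq0 => /eqP ->; rewrite (le_trans (HA x))// lerDl.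
have [A A0 HA] := supp_bounded (smooth_continuous su) ur.
have /fin_all_exists2[B B0 HB] i := IH _ (smooth_pderiv i su) (supp_inDD [:: i] ur).
exists (A + 1 + \sum_i B i).
  have : 0 <= \sum_i B i by apply: sumr_ge0 => i _; exact: le_trans (B0 i).
  lra.
move=> s x; case/lastP: s => [_|s i].
  rewrite (le_trans (HA x))// -addrA lerDl addr_ge0//; apply: sumr_ge0 => i _.
  exact: le_trans (B0 i).
rewrite size_rcons ltnS => sm; rewrite DD_rcons (le_trans (HB i s x sm))//.
rewrite (bigD1 i)//= [leRHS]addrCA lerDl addr_ge0 ?addr_ge0//.
by apply: sumr_ge0 => l _; exact: le_trans (B0 l).
Qed.

End smooth_extra.

(** * Dyadic partition of unity *)

Section grid.
Context {R : realType} {n : nat}.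
Local Notation E := 'rV[R]_n.+1.
Local Notation G := 'rV[int]_n.+1.
Implicit Types (k l : int) (j : G) (x y : E) (s : seq 'I_n.+1).

Definition sc k : R := 2 ^ (- k).

Lemma sc_gt0 k : 0 < sc k. Proof. exact: exprz_gt0. Qed.

Lemma sc_ge0 k : 0 <= sc k. Proof. exact: ltW (sc_gt0 k). Qed.

Lemma scS k : sc (k + 1) = sc k / 2.
Proof. by rewrite /sc opprD expfzDr. Qed.

Lemma sc_le k l : k <= l -> sc l <= sc k.
Proof. by move=> kl; apply: ler_weXz2l; rewrite ?ler1n// lerN2. Qed.

Lemma sc_unbounded (r : R) : exists k, r < sc k.
Proof.
exists (- (Num.truncn r).+1%:Z); rewrite /sc opprK -exprnP.
apply: (lt_le_trans (truncnS_gt r)); rewrite -natrX ler_nat.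
exact: ltnW (ltn_expl _ _).
Qed.

Lemma sc_small (r : R) : 0 < r -> exists k, forall l, k <= l -> sc l < r.
Proof.
move=> r0; have [k rk] := sc_unbounded r^-1; exists (- k) => l kl.
apply: (le_lt_trans (sc_le kl)); rewrite /sc opprK.
by move: rk; rewrite /sc -invr_expz ltf_pV2 ?posrE ?exprz_gt0.
Qed.

Definition ctr k j : E := \row_i (sc k * (j ord0 i)%:~R).

(** A product of hat functions, zero when |x| >= 1, whose integer translates add up to 1. *)
Definition phi0 x : R := \prod_i (step (x ord0 i + 1) - step (x ord0 i)).

Definition phi k j x : R := phi0 ((sc k)^-1 *: x - \row_i (j ord0 i)%:~R).

Lemma smooth_phi0 : Smooth phi0.
Proof.
apply: (@smooth_prod_coord _ _ (fun _ t => step (t + 1) - step t)) => _ k.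
apply: CkB; last exact: Coo_step.
have := Coo_affine 1 1 (@Coo_step R) k.
by under eq_fun do rewrite mul1r.
Qed.

Lemma phi0_eq0 x : 1 <= `|x| -> phi0 x = 0.
Proof.
move=> x1; have [i xi] : exists i, 1 <= `|x ord0 i|.
  apply: contrapT => H; move: x1; rewrite leNgt => /negP; apply.
  apply: normr_rV_lt => // i; rewrite ltNge; apply/negP => ?; apply: H.
  by exists i.
by rewrite /phi0 (bigD1 i)//= step_sub_eq0 ?mul0r.
Qed.

Lemma smooth_phi k j : Smooth (phi k j).
Proof. exact: (smooth_affine _ _ smooth_phi0). Qed.

Lemma phi_eq0 k j x : sc k <= `|x - ctr k j| -> phi k j x = 0.
Proof.
move=> kx; apply: phi0_eq0; have k0 := sc_gt0 k.
have -> : (sc k)^-1 *: x - \row_i (j ord0 i)%:~R = (sc k)^-1 *: (x - ctr k j).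
  by rewrite scalerBr; congr (_ - _); apply/rowP => i; rewrite !mxE mulKf ?lt0r_neq0.
by rewrite normrZ gtr0_norm ?invr_gt0// mulrC ler_pdivlMr// mul1r.
Qed.

Lemma phi_DD (m : nat) : exists2 A : R, 1 <= A &
  forall s k j x, (size s <= m)%N -> `|DD s (phi k j) x| <= A / sc k ^+ size s.
Proof.
have p0 : supp_in 1 phi0 by move=> x /ltW; exact: phi0_eq0.
have [A A1 HA] := DD_bounded m smooth_phi0 p0.
exists A => // s k j x sm; rewrite DD_affine; last exact: smooth_phi0.
have k0 := sc_ge0 k; have k0' : 0 <= (sc k)^-1 by rewrite invr_ge0.
rewrite normrM normrX ger0_norm// mulrC exprVn.
by rewrite ler_wpM2r ?HA// invr_ge0 exprn_ge0.
Qed.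

(** Six candidates per coordinate are enough for one list to contain all the cells that meet a whole
    neighbourhood of x, see [phi_out]. *)
Definition jl k x : seq G :=
  [seq \row_i (Num.floor ((sc k)^-1 * x ord0 i) - 2 + (f i : nat)%:Z) |
    f : {ffun 'I_n.+1 -> 'I_6} <- enum {: {ffun 'I_n.+1 -> 'I_6}}].

Lemma size_jl k x : size (jl k x) = (6 ^ n.+1)%N.
Proof. by rewrite size_map -cardE card_ffun !card_ord. Qed.

Lemma jl_uniq k x : uniq (jl k x).
Proof.
rewrite map_inj_uniq ?enum_uniq// => f g /rowP fg; apply/ffunP => i.
by have := fg i; rewrite !mxE => /addrI[/val_inj].
Qed.

Lemma jl_mem k j x : `|x - ctr k j| < 2 * sc k -> j \in jl k x.
Proof.
move=> xj; have k0 := sc_gt0 k.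
have H i : 0 <= j ord0 i - (Num.floor ((sc k)^-1 * x ord0 i) - 2) < 6.
  set u := (sc k)^-1 * x ord0 i.
  have uj : `|u - (j ord0 i)%:~R| < 2.
    have -> : u - (j ord0 i)%:~R = (sc k)^-1 * (x - ctr k j) ord0 i.
      by rewrite !mxE mulrBr mulKf ?lt0r_neq0.
    rewrite normrM gtr0_norm ?invr_gt0// mulrC ltr_pdivrMr//.
    by rewrite (le_lt_trans (normr_coord _ _)).
  have f1 := ge_floor u; have f2 := floorD1_gt u; rewrite intrD /= in f2.
  move: uj; rewrite ltr_norml => /andP[u1 u2].
  apply/andP; split; first by rewrite -(ler_int R) !intrB /=; lra.
  by rewrite -(ltr_int R) !intrB /=; lra.
apply/mapP; exists [ffun i => inord (absz (j ord0 i - (Num.floor ((sc k)^-1 * x ord0 i) - 2))%R)].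
  by rewrite mem_enum.
apply/rowP => i; rewrite !mxE ffunE; have /andP[H1 H2] := H i.
rewrite inordK; last by rewrite -ltz_nat gez0_abs.
by rewrite gez0_abs// addrC subrK.
Qed.

Lemma phi_out k j x x0 : `|x - x0| < sc k -> j \notin jl k x0 -> phi k j x = 0.
Proof.
move=> xx0 jx0; apply: phi_eq0; rewrite leNgt; apply: contra jx0 => xj.
apply: jl_mem; rewrite (le_lt_trans (ler_distD x _ _))// distrC.
by rewrite mulr_natl mulr2n ltrD.
Qed.

(** Distributivity turns the sum over the grid into a product of one-dimensional sums, each of which
    telescopes to 1 by [sum_step]. *)
Lemma sum_phi k x x0 : `|x - x0| < sc k -> \sum_(j <- jl k x0) phi k j x = 1.
Proof.
move=> xx0; have k0 := sc_gt0 k; rewrite big_map big_enum /=.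
pose u i := (sc k)^-1 * x ord0 i.
pose a i : R := (Num.floor ((sc k)^-1 * x0 ord0 i) - 2)%:~R.
rewrite (eq_bigr (fun f : {ffun 'I_n.+1 -> 'I_6} =>
   \prod_i (step (u i - a i - (f i)%:R + 1) - step (u i - a i - (f i)%:R)))); last first.
  move=> f _; rewrite /phi /phi0; apply: eq_bigr => i _; rewrite !mxE.
  by rewrite intrD opprD addrA.
rewrite -(bigA_distr_bigA (fun i (o : 'I_6) =>
   step (u i - a i - o%:R + 1) - step (u i - a i - o%:R))) /=.
apply: big1 => i _; rewrite sum_step.
have ux : `|u i - (sc k)^-1 * x0 ord0 i| < 1.
  have -> : u i - (sc k)^-1 * x0 ord0 i = (sc k)^-1 * (x - x0) ord0 i.
    by rewrite !mxE mulrBr.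
  rewrite normrM gtr0_norm ?invr_gt0// mulrC ltr_pdivrMr// mul1r.
  by rewrite (le_lt_trans (normr_coord _ _)).
have f1 := ge_floor ((sc k)^-1 * x0 ord0 i).
have f2 := floorD1_gt ((sc k)^-1 * x0 ord0 i).
move: ux; rewrite ltr_norml => /andP[u1 u2].
rewrite intrD /= in f2.
rewrite step1 ?step0 ?subr0// /a intrB /=; lra.
Qed.

End grid.

(** * The partition of unity adapted to Omega *)

Section partition_of_unity.
Context {R : realType} {n : nat}.
Local Notation E := 'rV[R]_n.+1.
Local Notation G := 'rV[int]_n.+1.
Local Notation sc := (@sc R).
Local Notation sc_gt0 := (@sc_gt0 R).
Implicit Types (k l : int) (K : int) (j : G) (x y : E) (s : seq 'I_n.+1) (i : int * G) (r : R).
Variable Omega : set E.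

Definition near_to r x : Prop := exists2 y, Omega y & `|x - y| < r.

Lemma near_toD r r' x x' : near_to r x -> `|x - x'| <= r' -> near_to (r + r') x'.
Proof.
move=> [y Oy xy] xx'; exists y => //; rewrite (le_lt_trans (ler_distD x _ _))//.
by rewrite [`|x' - x|]distrC; lra.
Qed.

Lemma near_to_le r r' x : r <= r' -> near_to r x -> near_to r' x.
Proof. by move=> rr' [y Oy xy]; exists y => //; exact: lt_le_trans rr'. Qed.

Lemma near_to_open r x : near_to r x -> \forall x' \near x, near_to r x'.
Proof.
move=> [y Oy xy]; have e0 : 0 < r - `|x - y| by rewrite subr_gt0.
apply/nbhs_ballP; exists (r - `|x - y|) => //= x'; rewrite -ball_normE /= => xx'.
by exists y => //; rewrite (le_lt_trans (ler_distD x _ _))// distrC -ltrBrDr.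
Qed.

(** As phi vanishes at distance 2^-k from its centre, the constant 3 makes [Hfun k] equal to 1 at
    distance less than 2 * 2^-k from Omega, and to 0 at distance at least 4 * 2^-k. *)
Definition Jset k : set G := [set j | exists2 y, Omega y & `|y - ctr k j| <= 3 * sc k].

(* A smooth step from 1 near Omega to 0, at distance comparable to 2^-k. *)
Definition Hfun k x : R := \sum_(j \in [set: G]) (j \in Jset k)%:R * phi k j x.

Lemma Hfun_local k x x0 : `|x - x0| < sc k ->
  Hfun k x = \sum_(j <- jl k x0) (j \in Jset k)%:R * phi k j x.
Proof.
move=> xx0; apply: lfsumE; first exact: jl_uniq.
by move=> j jx0; rewrite (phi_out xx0 jx0) mulr0.
Qed.

Lemma near_ball r x0 : 0 < r -> \forall x \near x0, `|x - x0| < r.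
Proof.
by move=> r0; apply/nbhs_ballP; exists r => //= x; rewrite -ball_normE /= distrC.
Qed.

Lemma Hfun_near k x0 : \forall x \near x0,
  Hfun k x = \sum_(j <- jl k x0) (j \in Jset k)%:R * phi k j x.
Proof. by apply: filterS (near_ball x0 (sc_gt0 k)) => x; exact: Hfun_local. Qed.

Lemma smooth_Hsum k x0 :
  Smooth (fun x => \sum_(j <- jl k x0) (j \in Jset k)%:R * phi k j x).
Proof. by apply: smooth_sum => j; apply: smoothZ; exact: smooth_phi. Qed.

Lemma smooth_Hfun k : Smooth (Hfun k).
Proof.
by apply: smooth_local => x0; eexists; [exact: smooth_Hsum|exact: Hfun_near].
Qed.

Lemma Hfun_DD (m : nat) : exists2 A : R, 1 <= A &
  forall s k x, (size s <= m)%N -> `|DD s (Hfun k) x| <= A / sc k ^+ size s.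
Proof.
have [A A1 HA] := @phi_DD R n m; exists ((6 ^ n.+1)%:R * A).
  by rewrite mulr_ege1// ler1n expn_gt0.
move=> s k x sm; rewrite (nbhs_singleton (near_eq_DD s (Hfun_near k x))).
rewrite DD_sum; last by move=> j; apply: smoothZ; exact: smooth_phi.
apply: (le_trans (ler_norm_sum _ _ _)).
apply: (@le_trans _ _ (\sum_(j <- jl k x) A / sc k ^+ size s)).
  apply: ler_sum => j _; rewrite DDZ; last exact: smooth_phi.
  rewrite normrM (le_trans _ (HA s k j x sm))// ler_piMl//.
  by case: (_ \in _); rewrite ?normr1 ?normr0.
by rewrite big_const_seq count_predT size_jl iter_addr_0 -mulrA mulr_natl.
Qed.

Lemma Hfun1 k x : near_to (2 * sc k) x -> Hfun k x = 1.
Proof.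
move=> [y Oy xy]; have k0 := sc_gt0 k.
have xx : `|x - x| < sc k by rewrite subrr normr0.
rewrite (Hfun_local xx) -[RHS](sum_phi xx); apply: eq_bigr => j _.
have [xj|xj] := leP (sc k) `|x - ctr k j|; first by rewrite (phi_eq0 xj) mulr0.
rewrite mem_set ?mul1r//; exists y => //.
rewrite (le_trans (ler_distD x _ _))// distrC; move: (ltW xy) (ltW xj); lra.
Qed.

Lemma Hfun0 k x : ~ near_to (4 * sc k) x -> Hfun k x = 0.
Proof.
move=> nx; have k0 := sc_gt0 k.
have xx : `|x - x| < sc k by rewrite subrr normr0.
rewrite (Hfun_local xx) big1// => j _.
have [xj|xj] := leP (sc k) `|x - ctr k j|; first by rewrite (phi_eq0 xj) mulr0.
rewrite memNset ?mul0r// => -[y Oy yj]; apply: nx; exists y => //.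
rewrite (le_lt_trans (ler_distD (ctr k j) _ _))// [X in _ + X]distrC; lra.
Qed.

(* The sum over k telescopes to [Hfun l] with l near -oo, where it is 1. *)
Definition theta K k : E -> R :=
  if k == K then Hfun k else
  if k < K then fun x => Hfun k x - Hfun (k + 1) x else fun=> 0.

Definition wt K i x : R := theta K i.1 x * phi i.1 i.2 x.

Lemma smooth_theta K k : Smooth (theta K k).
Proof.
rewrite /theta; case: ifP => _; first exact: smooth_Hfun.
case: ifP => _; last exact: smooth_cst.
by apply: smoothB; exact: smooth_Hfun.
Qed.

Lemma smooth_wt K i : Smooth (wt K i).
Proof. by apply: smoothM; [exact: smooth_theta|exact: smooth_phi]. Qed.

Lemma theta_DD (m : nat) : exists2 A : R, 1 <= A &
  forall s K k x, (size s <= m)%N -> `|DD s (theta K k) x| <= A / sc k ^+ size s.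
Proof.
have [A A1 HA] := Hfun_DD m; exists (A + A * 2 ^+ m).
  have : 0 <= A * 2 ^+ m by rewrite mulr_ge0 ?exprn_ge0//; exact: le_trans A1.
  lra.
move=> s K k x sm; have k0 := sc_gt0 k; have sk0 : 0 < sc k ^+ size s by rewrite exprn_gt0.
have A0 : 0 <= A by exact: le_trans A1.
have A2 : 0 <= A * 2 ^+ m by rewrite mulr_ge0 ?exprn_ge0.
rewrite /theta; case: ifP => _.
  by rewrite (le_trans (HA _ _ _ sm))// ler_pM2r ?invr_gt0// lerDl.
case: ifP => _; last by rewrite DD_cst0 normr0 divr_ge0 ?addr_ge0// ltW.
rewrite DDB; [|exact: smooth_Hfun|exact: smooth_Hfun].
rewrite (le_trans (ler_normB _ _))// mulrDl lerD ?HA//.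
rewrite (le_trans (HA _ _ _ sm))// scS expr_div_n invf_div mulrA ler_pM2r ?invr_gt0//.
by rewrite ler_wpM2l// ler_eXn2l ?ltr1n// ler_weXn2l ?ler1n.
Qed.

Lemma wt_DD (m : nat) : exists2 A : R, 1 <= A &
  forall s K i x, (size s <= m)%N -> `|DD s (wt K i) x| <= A / sc i.1 ^+ size s.
Proof.
have [A A1 HA] := theta_DD m; have [A' A1' HA'] := @phi_DD R n m.
exists (2 ^+ m * A * A').
  by rewrite mulr_ege1// mulr_ege1// exprn_ege1 ?ler1n.
move=> s K [k j] x sm /=.
have [A0 A0'] : 0 <= A /\ 0 <= A' by split; exact: le_trans (ler01) _.
have k0 := sc_gt0 k.
have := @DD_prod_le R n s (theta K k) (phi k j) x A A' (sc k) A0 A0' k0 (smooth_theta K k) (smooth_phi k j).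
move=> /(_ _ _)/le_trans; apply.
- by move=> t ts; apply: HA; exact: leq_trans sm.
- by move=> t ts; apply: HA'; exact: leq_trans sm.
rewrite ler_pM2r ?invr_gt0 ?exprn_gt0// ler_wpM2r// ler_wpM2r//.
by rewrite ler_weXn2l ?ler1n.
Qed.

(* A neighbourhood of the support of [wt K i]. *)
Definition Bset K i : set E := [set x | [/\ `|x - ctr i.1 i.2| <= sc i.1,
  near_to (5 * sc i.1) x & i.1 = K \/ (i.1 < K /\ ~ near_to (sc i.1) x)]].

Lemma Bset_le K i x : Bset K i x -> i.1 <= K.
Proof. by case=> _ _ [->//|[/ltW]]. Qed.

(** If i is not of the finest scale, x is at distance at least 2^-i.1 from Omega, but less than 5 *
    2^-i'.1. As 5 / 8 < 1, i' is at most two scales finer. *)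
Lemma Bset_comparable K i i' x : Bset K i x -> Bset K i' x -> i'.1 <= i.1 + 2.
Proof.
move=> [_ _ H] B'; have := Bset_le B'; case: H => [->|[_ nx]] kK.
  by rewrite (le_trans kK)// lerDl.
rewrite leNgt; apply/negP => ki; apply: nx; case: B' => _ + _; apply: near_to_le.
have : sc i'.1 <= sc (i.1 + 1 + 1 + 1).
  by apply: sc_le; lia.
rewrite !scS; have := sc_gt0 i.1; lra.
Qed.

Lemma wt_out K i x0 : ~ Bset K i x0 -> \forall x \near x0, wt K i x = 0.
Proof.
case: i => k j nB; have k0 := sc_gt0 k.
have [xj|xj] := leP `|x0 - ctr k j| (sc k); last first.
  have e0 : 0 < `|x0 - ctr k j| - sc k by rewrite subr_gt0.
  apply: filterS (near_ball x0 e0) => x xx0; rewrite /wt phi_eq0 ?mulr0//=.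
  have := ler_distD x x0 (ctr k j); rewrite [`|x0 - x|]distrC; lra.
have [kK|kK|kK] := ltgtP k K; last 2 first.
- by apply: filterS (near_ball x0 k0) => x _; rewrite /wt /theta /= gt_eqF// ltNge (ltW kK)/= mul0r.
- have n5 : ~ near_to (5 * sc k) x0 by move=> n5; apply: nB; split=> //; left.
  apply: filterS (near_ball x0 k0) => x xx0; rewrite /wt /theta /= kK eqxx Hfun0 ?mul0r//.
  move=> /near_toD/(_ (ltW xx0)) n4; apply: n5; apply: near_to_le n4; rewrite -kK; lra.
have [nk|nk] := pselect (near_to (sc k) x0).
  apply: filterS (near_to_open nk) => x nx; rewrite /wt /theta /= lt_eqF// kK.
  rewrite Hfun1; last by apply: near_to_le nx; lra.
  by rewrite Hfun1 ?subrr ?mul0r// scS; apply: near_to_le nx; lra.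
have n5 : ~ near_to (5 * sc k) x0 by move=> n5; apply: nB; split=> //; right.
apply: filterS (near_ball x0 k0) => x xx0; rewrite /wt /theta /= lt_eqF// kK.
have n4 : ~ near_to (4 * sc k) x.
  move=> /near_toD/(_ (ltW xx0)) n4; apply: n5; apply: near_to_le n4; lra.
rewrite Hfun0// Hfun0 ?subrr ?mul0r//.
by move=> n2; apply: n4; apply: near_to_le n2; rewrite scS; lra.
Qed.

Hypothesis Omega0 : Omega !=set0.

Lemma near_exists x K : exists L M, L + M%:Z = K /\ near_to (sc L) x.
Proof.
have [y Oy] := Omega0; have [L0 HL] := sc_unbounded `|x - y|.
have [LK|LK] := leP L0 K; last first.
  exists K, 0%N; rewrite addr0; split=> //; exists y => //.
  by rewrite (lt_le_trans HL)// sc_le// ltW.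
exists L0, `|K - L0|%N; split; last by exists y.
lia.
Qed.

Definition il (L : int) (M : nat) x : seq (int * G) :=
  [seq (k, j) | k <- [seq L + a%:Z | a : nat <- iota 0 M.+1], j <- jl k x].

Lemma il_uniq L M x : uniq (il L M x).
Proof.
apply: allpairs_uniq_dep.
- by rewrite map_inj_uniq ?iota_uniq// => a b /addrI[].
- by move=> k _; exact: jl_uniq.
by move=> [k j] [k' j'] _ _ /= [<- <-].
Qed.

Lemma size_il L M x : size (il L M x) = (M.+1 * 6 ^ n.+1)%N.
Proof.
rewrite /il size_allpairs_dep.
have H (ks : seq int) : sumn [seq size (jl k x) | k <- ks] = (size ks * 6 ^ n.+1)%N.
  by elim: ks => //= k ks ->; rewrite size_jl mulSn.
by rewrite H size_map size_iota.
Qed.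

Lemma mem_il L M x k j : (k, j) \in il L M x = [&& L <= k, k <= L + M%:Z & j \in jl k x].
Proof.
apply/idP/idP.
  move=> /allpairsPdep[k' [j' [/mapP[l]]]]; rewrite mem_iota /= add0n ltnS => lM -> jx [-> ->].
  by rewrite jx andbT; apply/andP; split; lia.
move=> /and3P[Lk kM jx]; apply/allpairsPdep; exists k, j; split=> //.
apply/mapP; exists `|k - L|%N; last by rewrite gez0_abs ?subr_ge0//; lia.
rewrite mem_iota /= add0n ltnS -lez_nat gez0_abs ?subr_ge0//.
by rewrite lerBlDl.
Qed.

Lemma wt_il L M K x0 : L + M%:Z = K -> near_to (sc L) x0 ->
  \forall x \near x0, forall i, i \notin il L M x0 -> wt K i x = 0.
Proof.
move=> LK nL; near=> x => -[k j]; rewrite mem_il LK => kj.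
have nx : near_to (sc L) x by near: x; exact: near_to_open.
have xx0 : `|x - x0| < sc K by near: x; exact: near_ball (sc_gt0 K).
have [kK|kK] := leP k K; last by rewrite /wt /theta /= gt_eqF// ltNge (ltW kK)/= mul0r.
move: kj; rewrite kK /=; have [Lk|Lk] := leP L k => /= kj.
  rewrite /wt /= (phi_out (x0 := x0)) ?mulr0//; exact: lt_le_trans (sc_le kK).
have kK' : k < K by rewrite (lt_le_trans Lk)// -LK lerDl.
rewrite /wt /theta /= lt_eqF// kK'.
have sL := sc_gt0 L.
rewrite Hfun1; last by apply: near_to_le nx; have := @sc_le R _ _ (ltW Lk); lra.
rewrite Hfun1 ?subrr ?mul0r//; apply: near_to_le nx.
have : sc L <= sc (k + 1) by apply: sc_le; lia.
by move: sL; lra.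
Unshelve. all: by end_near. Qed.

(** The cells of the scales from L to K form a finite list that depends on K; filtering it by [Bset]
    leaves a number of cells that does not, the active scales being comparable. *)
Lemma active_exists K x0 : exists t : seq (int * G),
  [/\ uniq t, (size t <= 5 * 6 ^ n.+1)%N, forall i, i \in t <-> Bset K i x0 &
    \forall x \near x0, forall i, i \notin t -> wt K i x = 0].
Proof.
have [L [M [LK nL]]] := near_exists x0 K.
pose t := [seq i <- il L M x0 | `[< Bset K i x0 >]].
have tB i : i \in t <-> Bset K i x0.
  rewrite mem_filter; split=> [/andP[/asboolP]//|Bi].
  have k0 := sc_gt0 i.1.
  rewrite (asboolT Bi) /=; case: i Bi k0 => k j Bi k0; rewrite mem_il LK (Bset_le Bi).
  case: Bi => /= xj _ H; rewrite jl_mem ?andbT; last by move: xj k0 => /=; lra.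
  case: H => [->|[kK nk]]; first by rewrite -LK lerDl.
  by rewrite leNgt; apply/negP => kL; apply: nk; apply: near_to_le nL; exact: sc_le (ltW kL).
have ut : uniq t by rewrite filter_uniq// il_uniq.
exists t; split=> //.
  case tE : t => [//|i1 t']; rewrite -tE.
  have i1t : i1 \in t by rewrite tE mem_head.
  (* All active scales lie between i1.1 - 2 and i1.1 + 2: five scales, with 6^(n+1) centres each. *)
  rewrite -(size_il (i1.1 - 2) 4 x0).
  apply: uniq_leq_size => // -[k j] /tB Bi; have B1 := (tB i1).1 i1t.
  rewrite mem_il; apply/and3P; split.
  - by rewrite lerBlDr; exact: Bset_comparable Bi B1.
  - by rewrite (le_trans (Bset_comparable B1 Bi))//= -addrA lerD2l.
  by apply: jl_mem; case: Bi => /= xj _ _; have := sc_gt0 k; lra.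
have H1 := wt_il LK nL.
have H2 : \forall x \near x0, forall i, i \in [seq i <- il L M x0 | i \notin t] -> wt K i x = 0.
  apply: near_all => i; rewrite mem_filter => /andP[/negP it _].
  by apply: wt_out => /tB.
near=> x => i it; have [iU|iU] := boolP (i \in il L M x0).
  have : i \in [seq i <- il L M x0 | i \notin t] by rewrite mem_filter it.
  by move: i {it iU}; near: x.
by move: i it iU; near: x; apply: filterS H1 => x H i _; exact: H.
Unshelve. all: by end_near. Qed.

Lemma sum_wt K x : \sum_(i \in [set: int * G]) wt K i x = 1.
Proof.
have [L [M [LK nL]]] := near_exists x K.
rewrite (lfsumE (il_uniq L M x) (nbhs_singleton (wt_il LK nL))).
rewrite big_allpairs_dep big_map.
have xx k : `|x - x| < sc k by rewrite subrr normr0 sc_gt0.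
rewrite (eq_bigr (fun l : nat => theta K (L + l%:Z) x)); last first.
  by move=> l _; rewrite /wt /= -mulr_sumr sum_phi// mulr1.
rewrite -[iota _ _]/(index_iota 0 M.+1) big_nat_recr//= /theta LK eqxx.
rewrite (eq_big_nat _ _ (F2 := fun l : nat => - (Hfun (L + l.+1%:Z) x - Hfun (L + l%:Z) x))); last first.
  move=> l /andP[_ lM]; have lK : L + l%:Z < K by rewrite -LK ltrD2l ltz_nat.
  by rewrite lt_eqF// lK opprB -addrA intS [1 + _]addrC.
rewrite sumrN (telescope_sumr (fun l : nat => Hfun (L + l%:Z) x))// addr0 LK opprB.
by rewrite subrK Hfun1//; apply: near_to_le nL; have := sc_gt0 L; lra.
Qed.

End partition_of_unity.

Ltac nng := repeat (first [ assumption | by apply: ltW | apply: mulr_ge0 | apply: divr_ge0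
  | apply: exprn_ge0 | apply: addr_ge0 | rewrite invr_ge0 | exact: normr_ge0 | exact: ler0n ]).

(** * Powers of comparable scales *)

Section comparable_scales.
Context {R : realType}.
Implicit Types (a b C : R) (k l p : nat).

(** The power of a with exponent k - l, kept as a quotient since k - l may be negative. *)
Definition Usc k l a : R := a ^+ k / a ^+ l.

Lemma Usc_ge0 k l a : 0 <= a -> 0 <= Usc k l a.
Proof. by move=> a0; rewrite divr_ge0 ?exprn_ge0. Qed.

Lemma Usc_le k l (C a b : R) : 1 <= C -> 0 < a -> 0 < b -> a <= C * b -> b <= C * a ->
  Usc k l a <= C ^+ (k + l) * Usc k l b.
Proof.
move=> C1 a0 b0 ab ba; have C0 : 0 < C by exact: lt_le_trans C1.
rewrite /Usc exprD -mulrA [leRHS](_ : _ = C ^+ k * b ^+ k * (C ^+ l / b ^+ l)); last first.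
  by rewrite -!mulrA; congr (_ * _); rewrite mulrCA.
apply: ler_pM; rewrite ?invr_ge0 ?exprn_ge0 ?(ltW a0)//.
  by rewrite -exprMn lerXn2r// nnegrE ?mulr_ge0 ?ltW.
rewrite -[X in X / _]invrK -invfM lef_pV2 ?posrE ?mulr_gt0 ?invr_gt0 ?exprn_gt0//.
by rewrite mulrC ler_pdivrMr ?exprn_gt0// mulrC -exprMn lerXn2r// nnegrE ?mulr_ge0 ?ltW.
Qed.

End comparable_scales.

(** * Inner parallel sets and local integrability *)

Section inner_sets.
Context {R : realType} {n : nat}.
Local Notation E := 'rV[R]_n.+1.
Local Notation mu := (@lebesgue_rV R n).
Implicit Types (x y z w p : E) (r : R) (Omega : set E).

(** The points at distance at least r from the complement. Such sets are closed, so their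
    intersections with cubes are compact, and for r > 0 they lie in Omega. *)
Definition inn Omega r : set E := ~` near_to (~` Omega) r.

Lemma closed_inn Omega r : closed (inn Omega r).
Proof.
rewrite /inn; apply: open_closedC; rewrite openE => x; exact: near_to_open.
Qed.

Lemma inn_sub Omega r : 0 < r -> inn Omega r `<=` Omega.
Proof.
move=> r0 y iy; apply: contrapT => Oy; apply: iy; exists y => //.
by rewrite subrr normr0.
Qed.

Lemma inn_le Omega r r' : r <= r' -> inn Omega r' `<=` inn Omega r.
Proof. by move=> rr y iy ny; apply: iy; exact: near_to_le ny. Qed.

Lemma inn_ccube Omega p r rho y : ccube p (r + rho) `<=` Omega -> ccube p r y ->
  inn Omega rho y.
Proof.
move=> pO py [w Ow wy]; apply: Ow; apply: pO; rewrite /ccube /=.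
rewrite (le_trans (ler_distD y _ _))// addrC distrC lerD//; last by rewrite distrC ltW.
by rewrite distrC.
Qed.

Lemma measurable_inn Omega r : measurable (inn Omega r).
Proof. by apply: closed_measurable_rV; exact: closed_inn. Qed.

Lemma compact_inn Omega c r rho : compact (ccube c r `&` inn Omega rho).
Proof.
apply: (@sub_closed_compact _ _ _ c r); last by move=> y [].
by apply: closedI; [exact: closed_ccube|exact: closed_inn].
Qed.

Lemma loc_integ Omega (h : E -> R) (K : set E) : measurable K -> compact K -> K `<=` Omega -> loc_integrable Omega h ->
  measurable Omega -> integ K h.
Proof.
move=> mK cK KO [mh hK] mO; apply: integP; last exact: hK.
exact: measurable_funS mh.
Qed.

Lemma loc_locint Omega (h : E -> R) : measurable Omega -> loc_integrable Omega h -> locint Omega h.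
Proof.
move=> mO lh; split; first by case: lh.
move=> p r pO; apply: loc_integ pO lh mO; [exact: measurable_ccube|exact: ccube_compact].
Qed.

Lemma Rint_subset (A B : set E) (h : E -> R) : measurable A -> measurable B -> A `<=` B -> integ B h ->
  (forall y, B y -> 0 <= h y) -> \int[mu]_(y in A) h y <= \int[mu]_(y in B) h y.
Proof.
move=> mA mB AB ih h0; have iA := integ_sub mA mB AB ih.
rewrite /Rintegral fine_le//.
- exact: integrable_fin_num (integ_integrable iA).
- exact: integrable_fin_num (integ_integrable ih).
apply: ge0_subset_integral => //.
by apply/measurable_EFinP; exact: integ_measurable ih.
Qed.

End inner_sets.

Lemma DD_sub_trans (R : realType) (n : nat) s (a b c : 'rV[R]_n.+1 -> R) x (u v : R) :
  Smooth a -> Smooth b -> Smooth c ->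
  `|DD s (fun y => a y - b y) x| <= u -> `|DD s (fun y => b y - c y) x| <= v ->
  `|DD s (fun y => a y - c y) x| <= u + v.
Proof.
move=> sa sb sc au bv.
rewrite (_ : (fun y => _) = fun y => (a y - b y) + (b y - c y)); last first.
  by apply/funext => y; rewrite subrKA.
rewrite (DDD s (smoothB sa sb) (smoothB sb sc)).
by rewrite (le_trans (ler_normD _ _))// lerD.
Qed.

(** * Linearity, invariance and normalization of the local polynomials *)

Section lpoly_extra.
Context {R : realType} {n : nat}.
Local Notation E := 'rV[R]_n.+1.
Local Notation mu := (@lebesgue_rV R n).
Variable Omega : set E.
Hypothesis mOmega : measurable Omega.
Implicit Types (f : E -> R) (x z p : E) (rho : R).

Lemma lpoly_lin m f f' (a : R) z rho x : locint Omega f -> locint Omega f' -> 0 < rho ->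
  ccube z rho `<=` Omega ->
  lpoly Omega m (fun y => a * f y + f' y) z rho x =
  a * lpoly Omega m f z rho x + lpoly Omega m f' z rho x.
Proof.
move=> fi fi' r0 zO; have tb : tst (ccube z rho) (taylor m x (bump z rho)).
  apply: tst_taylor; first exact: closed_ccube.
  by apply: tst_bump => //; rewrite subrr normr0 add0r.
have [i1 _] := locint_tst mOmega fi zO tb; have [i2 _] := locint_tst mOmega fi' zO tb.
rewrite /lpoly [a * _]mulrCA -mulrDr; congr (_ * _).
rewrite -RintZ// -RintD//; last exact: integZ.
by apply: eq_Rintegral => y _; rewrite mulrDl mulrA.
Qed.

(** The terms k > 0 of the Taylor weight are derivatives of compactly supported functions, hence
    have integral zero; the term k = 0 is the bump, which is normalized. *)
Lemma lpoly_cst m (c : R) z rho x : 0 < rho -> ccube z rho `<=` Omega ->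
  lpoly Omega m.+1 (fun=> c) z rho x = c.
Proof.
move=> r0 zO; have tb : tst (ccube z rho) (taylor m.+1 x (bump z rho)).
  apply: tst_taylor; first exact: closed_ccube.
  by apply: tst_bump => //; rewrite subrr normr0 add0r.
(* Used for Omega and for the whole space, to replace an integral over Omega by one over R^d, where
   [Rintegral_pd0] applies. *)
have lc (O : set E) : measurable O -> locint O (fun=> c).
  move=> mO; split; first exact: measurable_cst.
  move=> p r pO; apply: (@integ_bounded _ _ _ _ `|c|) => //.
  - exact: measurable_ccube.
  - exact: mu_ccube_fin.
have [_ e1] := locint_tst mOmega (lc _ mOmega) zO tb.
have [_ e2] := locint_tst measurableT (lc _ measurableT) (@subsetT _ _) tb.
have c0 := Rintegral_bump_gt0 z r0.
rewrite /lpoly e1 -e2.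
have sB k : Smooth (Bk k x (bump z rho)) by apply: smooth_Bk; exact: smooth_bump.
have suB k : supp_in (`|z| + rho) (Bk k x (bump z rho)).
  have tB : tst (ccube 0 (`|z| + rho)) (Bk k x (bump z rho)).
    apply: tst_Bk; first exact: closed_ccube.
    by apply: tst_bump => //; rewrite subr0.
  move=> y yr; apply: tB.2; rewrite /ccube /= subr0 => /(lt_le_trans yr).
  by rewrite ltxx.
have iB k : integ setT (Bk k x (bump z rho)).
  by apply: (integ_cs _ (suB k)); exact: smooth_continuous.
have it : integ setT (taylor m.+1 x (bump z rho)).
  by apply: integ_sum => // k; exact: integZ.
rewrite RintZ// mulrCA [X in _ * X](_ : _ = 1) ?mulr1//.
rewrite /taylor Rintegral_sum//; last by move=> k; exact: integZ.
rewrite big_ord_recl /= big1 ?addr0 ?expr0 ?fact0 ?divr1; last first.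
  move=> k _; rewrite -[X in \int[mu]_(x in _) (_ * X x)]/(Bk (0 + k).+1 x (bump z rho)).
  rewrite RintZ; [|exact: measurableT|exact: (iB (0 + k).+1)].
  rewrite [X in _ * X](_ : _ = 0) ?mulr0//=.
  have sm i : Smooth (Bk k x (mul_dcoord x i (bump z rho))).
    by apply: smooth_Bk; apply: smooth_mul_dcoord; exact: smooth_bump.
  have sup i : supp_in (`|z| + rho) (Bk k x (mul_dcoord x i (bump z rho))).
    have tB : tst (ccube 0 (`|z| + rho)) (Bk k x (mul_dcoord x i (bump z rho))).
      apply: tst_Bk; first exact: closed_ccube.
      apply: tstM; first exact: smooth_dcoord.
      by apply: tst_bump => //; rewrite subr0.
    move=> y yr; apply: tB.2; rewrite /ccube /= subr0 => /(lt_le_trans yr).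
    by rewrite ltxx.
  rewrite Rintegral_sum//; last first.
    move=> i; apply: (@integ_cs _ _ (`|z| + rho)); last exact: (supp_inDD [:: i]).
    exact: smooth_continuous (smooth_pderiv i (sm i)).
  by apply: big1 => i _; exact: Rintegral_pd0 (sm i) (sup i).
have -> : \int[mu]_y (1 * bump z rho y) = \int[mu]_y bump z rho y.
  by apply: eq_Rintegral => y _; rewrite mul1r.
by rewrite mulVf// gt_eqF.
Qed.

Lemma lpoly_ae m f f' z rho : measurable_fun Omega f -> measurable_fun Omega f' ->
  {ae mu, forall x, Omega x -> f x = f' x} -> lpoly Omega m f z rho = lpoly Omega m f' z rho.
Proof.
move=> mf mf' ff'; apply/funext => x; rewrite /lpoly; congr (_ * _).
have mt : measurable_fun Omega (taylor m x (bump z rho)).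
  apply: (@measurable_funS _ _ _ _ setT) => //.
  apply: continuous_measurable_rV; apply: smooth_continuous; apply: smooth_taylor.
  exact: smooth_bump.
rewrite /Rintegral; congr fine; apply: ae_eq_integral => //.
- by apply/measurable_EFinP; exact: measurable_funM.
- by apply/measurable_EFinP; exact: measurable_funM.
by apply: filterS ff' => y + Oy; move=> ->.
Qed.

End lpoly_extra.

(** * Comparison of two local polynomials along a chain of cubes *)

Section chain_estimate.
Context {R : realType} {n : nat}.
Local Notation E := 'rV[R]_n.+1.
Local Notation mu := (@lebesgue_rV R n).
Variables (Omega : set E) (eps c C0 C1 : R) (m' : nat).
Hypotheses (mOmega : measurable Omega) (eps0 : 0 < eps) (dom : eps_infty_domain eps Omega).
Hypotheses (c0 : 0 < c) (C00 : 0 < C0) (C10 : 0 < C1).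
Local Notation m := m'.+1.
Implicit Types (z x : E) (sigma rho : R) (s : seq 'I_n.+1).

(** All links use cubes of side kappa * sigma and are compared pairwise by [lpoly_sub_le]. Two more
    comparisons, with fixed corner, change the sides rho and rho' at the ends, whence the factor N1
    + 2. *)
Lemma chain_lpoly : exists kappa C2 C : R, [/\ 0 < kappa, 24 * kappa <= c, 0 < C2, 0 <= C &
  forall f D g, weak_data Omega m f D g -> loc_integrable Omega g ->
  forall sigma z z' rho rho' x s, (size s <= m)%N -> 0 < sigma -> Omega z -> Omega z' ->
    ccube z (c * sigma) `<=` Omega -> ccube z' (c * sigma) `<=` Omega ->
    `|z - z'| <= C0 * sigma -> kappa * sigma <= rho -> rho <= 4 * kappa * sigma ->
    kappa * sigma <= rho' -> rho' <= 4 * kappa * sigma -> `|x - z| <= C1 * sigma ->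
    `|DD s (fun x => lpoly Omega m f z rho x - lpoly Omega m f z' rho' x) x| <=
    C * Usc m' (n + size s) sigma *
      \int[mu]_(y in ccube z (C2 * sigma) `&` inn Omega (kappa * sigma)) g y].
Proof.
move: (C10) => C1p; have [kap [C' [N1 [k0 kc C'0 chain]]]] := chain_points eps0 dom c0 C00.
have [B B0 HB] := @lpoly_sub_le R n Omega mOmega m'.
pose C3 := C1 + C' + 4 * kap + 1.
have C31 : 1 <= C3 by rewrite /C3; lra.
have C30 : 0 <= C3 by exact: le_trans C31.
pose Q := (B + 1) ^+ m * B * (kap^-1 ^+ n * C3 ^+ m').
have Q0 : 0 <= Q.
  have kv : 0 <= kap^-1 ^+ n by rewrite exprn_ge0// invr_ge0 ltW.
  by rewrite /Q; nng.
exists kap, (C' + 4 * kap), (N1.+2%:R * Q); split=> //; first by lra.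
  by rewrite mulr_ge0.
move=> f D g W lg sigma z z' rho rho' x s sm s0 Oz Oz' cz cz' zz' r1 r2 r1' r2' xz.
pose A := ccube z ((C' + 4 * kap) * sigma) `&` inn Omega (kap * sigma).
have ks0 : 0 < kap * sigma by rewrite mulr_gt0.
have s00 := ltW s0.
have AO : A `<=` Omega by move=> y [_]; exact: inn_sub.
have mA : measurable A by apply: measurableI; [exact: measurable_ccube|exact: measurable_inn].
have iA : integ A g by apply: loc_integ AO lg mOmega => //; exact: compact_inn.
have g0 y : Omega y -> 0 <= g y.
  move=> Oy; have := weak_data_le W (s := nseq m ord0) (y := y).
  by rewrite size_nseq => /(_ erefl Oy); exact: le_trans.
have IA0 : 0 <= \int[mu]_(y in A) g y by apply: Rintegral_ge0 => y /AO; exact: g0.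
have U0 := @Usc_ge0 R m' (n + size s) _ s00.
pose lp w r := lpoly Omega m f w r.
have one p w w' q q' r : ccube p (r + kap * sigma) `<=` Omega ->
    `|w - p| + q <= r -> `|w' - p| + q' <= r ->
    kap * sigma <= q -> kap * sigma <= q' -> r <= 4 * kap * sigma -> `|z - p| <= C' * sigma ->
    `|DD s (fun x => lp w q x - lp w' q' x) x| <= Q * Usc m' (n + size s) sigma * \int[mu]_(y in A) g y.
  move=> pO wp wp' kq kq' rk zp.
  have sub : ccube p r `<=` ccube p (r + kap * sigma).
    by move=> y; rewrite /ccube /= => /le_trans; apply; rewrite lerDl ltW.
  have pA : ccube p r `<=` A.
    move=> y py; split; last exact: inn_ccube py.
    rewrite /ccube /= (le_trans (ler_distD p _ _))// [X in _ + X]distrC mulrDl.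
    by rewrite addrC lerD// (le_trans _ rk).
  have r'0 : 0 < C3 * sigma by rewrite mulr_gt0// (lt_le_trans ltr01).
  have xp : `|x - p| + r <= C3 * sigma.
    rewrite (le_trans (lerD (ler_distD z _ _) rk))//.
    by rewrite /C3 !mulrDl mul1r; move: (zp) (xz) s00; lra.
  have := HB f D g w w' q q' p r x (C3 * sigma) (kap * sigma) s W ks0 kq kq'
    (subset_trans sub pO) wp wp' r'0 xp.
  move=> /le_trans; apply.
  have Ip : \int[mu]_(y in ccube p r) g y <= \int[mu]_(y in A) g y.
    by apply: Rint_subset => //; [exact: measurable_ccube|move=> y /AO; exact: g0].
  have Ip0 : 0 <= \int[mu]_(y in ccube p r) g y by apply: Rintegral_ge0 => y /pA/AO; exact: g0.
  apply: ler_pM => //.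
    by nng.
  rewrite /Usc exprD invfM.
  have e1 : B ^+ size s <= (B + 1) ^+ m.
    apply: (@le_trans _ _ ((B + 1) ^+ size s)).
      by rewrite lerXn2r ?nnegrE ?addr_ge0// lerDl.
    by rewrite ler_weXn2l// lerDr.
  have e2 : ((C3 * sigma) ^+ size s)^-1 <= (sigma ^+ size s)^-1.
    rewrite lef_pV2 ?posrE ?exprn_gt0// lerXn2r ?nnegrE ?(ltW r'0)//.
    by rewrite ler_peMl.
  rewrite [(C3 * sigma) ^+ m']exprMn invfM exprMn.
  rewrite [leRHS](_ : _ = (B + 1) ^+ m * (B * (kap^-1 ^+ n * (sigma ^+ n)^-1) *
     (C3 ^+ m' * sigma ^+ m')) * (sigma ^+ size s)^-1); last first.
    by rewrite /Q; move: (kap^-1 ^+ n) (sigma ^+ n)^-1 (sigma ^+ size s)^-1 (C3 ^+ m') (sigma ^+ m') ((B + 1) ^+ m) => *; ring.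
  rewrite -exprVn -!mulrA; apply: ler_pM => //; rewrite ?exprn_ge0//.
    by nng.
  by rewrite !exprVn; do 5! (apply: ler_wpM2l; first by nng); exact: e2.
have slp w q r : ccube w r `<=` Omega -> 0 < q -> q <= r -> Smooth (lp w q).
  move=> wO q0 qr; apply: (@lpoly_polyd _ _ _ mOmega f m w q w r _ wO q0 _).1.
    exact: weak_data_f W.
  by rewrite subrr normr0 add0r.
have [p [p1 p2 p3 p4]] := chain sigma z z' s0 Oz Oz' cz cz' zz'.
set U := _ * \int[mu]_(y in _) _; pose V := Q * Usc m' (n + size s) sigma * \int[mu]_(y in A) g y.
have V0 : 0 <= V by rewrite /V mulr_ge0// mulr_ge0.
have k3 q : q <= 4 * kap * sigma -> q + kap * sigma <= c * sigma.
  by move=> qk; have := ler_wpM2r s00 kc; move: qk ks0; lra.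
have cubeS w q q' : q <= q' -> ccube w q' `<=` Omega -> ccube w q `<=` Omega.
  by move=> qq wO y wy; apply: wO; exact: le_trans qq.
have smid w : w \in z :: p -> Smooth (lp w (kap * sigma)).
  move=> /p4[_ wO]; apply: (slp _ _ _ wO ks0); move: (ks0); lra.
have chainb : forall q v, path (fun v w => `|v - w| <= kap * sigma) v q ->
    {subset v :: q <= z :: p} ->
    `|DD s (fun x => lp v (kap * sigma) x - lp (last v q) (kap * sigma) x) x| <= (size q)%:R * V.
  elim=> [v _ _|w q IH v /= /andP[vw wq] sub].
    rewrite (_ : (fun x => _) = fun=> 0); last by apply/funext => y; rewrite subrr.
    by rewrite DD_cst0 normr0 mul0r.
  have vin := sub v (mem_head _ _).
  have win : w \in z :: p by apply: sub; rewrite !inE eqxx orbT.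
  have lin : last w q \in z :: p by apply: sub; rewrite inE mem_last orbT.
  rewrite -natr1 mulrDl mul1r addrC.
  apply: (DD_sub_trans (smid v vin) (smid w win) (smid _ lin)); last first.
    by apply: IH => // y yq; apply: sub; rewrite inE yq orbT.
  have [zv vO] := p4 v vin.
  apply: (one v v w _ _ (2 * kap * sigma)) => //.
  - by apply: cubeS vO; lra.
  - by rewrite subrr normr0; move: ks0; lra.
  - by rewrite distrC; move: vw ks0; lra.
  - by move: ks0; lra.
have zin : z \in z :: p by exact: mem_head.
have zin' : z' \in z :: p by rewrite -p2 mem_last.
have sz : Smooth (lp z rho) by apply: (slp _ _ _ cz); [move: (ks0) r1; lra|have := k3 _ r2; move: (ks0); lra].
have sz' : Smooth (lp z' rho') by apply: (slp _ _ _ cz'); [move: (ks0) r1'; lra|have := k3 _ r2'; move: (ks0); lra].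
have -> : U = V + N1%:R * V + V.
  have nE : N1.+2%:R = N1%:R + 2 :> R by rewrite -addn2 natrD.
  by rewrite /U /V -/A nE; move: (\int[mu]_(y in A) g y) => I; ring.
have s1 := smid z zin; have s1' := smid z' zin'.
apply: (DD_sub_trans sz s1' sz'); last first.
  have [zz0 _] := p4 z' zin'.
  apply: (one z' z' z' _ _ rho'); rewrite ?subrr ?normr0 ?add0r//.
  exact: cubeS (k3 _ r2') cz'.
apply: (DD_sub_trans sz s1 s1').
  apply: (one z z z _ _ rho); rewrite ?subrr ?normr0 ?add0r//.
    exact: cubeS (k3 _ r2) cz.
  by rewrite mulr_ge0// ltW.
have := chainb p z p1 (fun _ => id); rewrite p2 => /le_trans; apply.
by rewrite ler_wpM2r// ler_nat.
Qed.

End chain_estimate.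

Lemma ltz_le2 (a b c : int) : c < b -> a <= c + 2 -> a <= b + 2.
Proof. by lia. Qed.

Lemma ltzB1_le2 (a b : int) : b - 1 < a -> b <= a + 2.
Proof. by lia. Qed.

(** * Reflected cubes and the polynomials attached to the cells *)

Section reflection.
Context {R : realType} {n : nat}.
Local Notation E := 'rV[R]_n.+1.
Local Notation G := 'rV[int]_n.+1.
Local Notation mu := (@lebesgue_rV R n).
Local Notation sc := (@sc R).
Local Notation sc_gt0 := (@sc_gt0 R).
Local Notation sc_le := (@sc_le R).
Variables (Omega : set E) (eps : R).
Hypotheses (eps0 : 0 < eps) (dom : eps_infty_domain eps Omega) (Omega0 : Omega !=set0).
Implicit Types (k l K : int) (x y z : E) (i : int * G) (s : seq 'I_n.+1).

Let oOmega : open Omega. Proof. by case: dom. Qed.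

Let mOmega : measurable Omega. Proof. exact: open_measurable_rV. Qed.

(* Scales at which every point near Omega has a reflected cube; coarser cells
   all use the same cube. *)
Definition good k : Prop := exists y y', [/\ Omega y, Omega y' & 2 * sc k <= `|y - y'|].

Lemma good_le k l : k <= l -> good k -> good l.
Proof.
move=> kl [y [y' [Oy Oy' yy']]]; exists y, y'; split=> //.
by rewrite (le_trans _ yy')// ler_pM2l// sc_le.
Qed.

Lemma good_exists : exists k, good k.
Proof.
have [y Oy] := Omega0.
have /nbhs_ballP[r /= r0 Hr] : nbhs y Omega by exact: open_nbhs_nbhs.
have [k /(_ k (lexx k)) kr] := @sc_small R (r / 4) (divr_gt0 r0 (ltr0Sn _ 3)).
have k0 := sc_gt0 k.
exists k, (y + const_mx (2 * sc k)), y.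
have nE : `|(const_mx (2 * sc k) : E)| = 2 * sc k.
  apply/eqP; rewrite eq_le; apply/andP; split.
    apply: normr_rV_le => [|i]; first by rewrite mulr_ge0// ltW.
    by rewrite mxE ger0_norm// mulr_ge0// ltW.
  have := normr_coord (const_mx (2 * sc k) : E) ord0; rewrite mxE.
  by apply: le_trans; rewrite ler_norm.
split=> //; last by rewrite addrAC subrr add0r nE.
apply: Hr; rewrite -ball_normE /= opprD addrA subrr sub0r normrN nE.
by move: kr; lra.
Qed.

Lemma not_good_le k y y' : ~ good k -> Omega y -> Omega y' -> `|y - y'| <= 2 * sc k.
Proof.
by move=> ng Oy Oy'; rewrite leNgt; apply/negP => /ltW yy; apply: ng; exists y, y'.
Qed.

Definition refl_cst : R := eps / (8 * (n.+1%:R * n.+1%:R)).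

Lemma refl_cst_gt0 : 0 < refl_cst.
Proof. by rewrite divr_gt0 ?mulr_gt0. Qed.

Lemma good_reflect k y : good k -> Omega y ->
  exists z, [/\ Omega z, `|z - y| = sc k / 2 & ccube z (refl_cst * sc k) `<=` Omega].
Proof.
move=> [y1 [y2 [q1 q2 yy]]] Oy; have k0 := sc_gt0 k.
have [y1k|y1k] := leP (sc k) `|y - y1|; first exact: reflect_point eps0 dom Oy q1 k0 y1k.
apply: (reflect_point eps0 dom Oy q2 k0).
have := ler_distD y y1 y2; rewrite [`|y1 - y|]distrC; lra.
Qed.

(** If some scale is bad, the good scales have a least element ks, and one cube of that scale will
    serve all coarser cells. If all scales are good the claim is vacuous. *)
Lemma star_exists : exists (zs : E) (ks : int), forall k, ~ good k ->
  [/\ k < ks, good ks, ~ good (ks - 1), Omega zs & ccube zs (refl_cst * sc ks) `<=` Omega].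
Proof.
have [[k0 ng]|ag] := pselect (exists k, ~ good k); last first.
  by exists 0, 0 => k ngk; exfalso; apply: ag; exists k.
have [l gl] := good_exists.
have ex : exists p : nat, `[< good (k0 + p%:Z) >].
  exists (absz (l - k0)); apply/asboolP; apply: good_le gl.
  by rewrite -lerBlDl; exact: lez_abs.
have [p /asboolP gp minp] := ex_minnP ex.
have [y Oy] := Omega0; have [z [Oz _ zO]] := good_reflect gp Oy.
have p0 : (0 < p)%N.
  by rewrite lt0n; apply/eqP => pE; apply: ng; move: gp; rewrite pE addr0.
have ngp : ~ good (k0 + p%:Z - 1).
  move=> gp'; have : (p <= p.-1)%N.
    by apply: minp; apply/asboolP; apply: good_le gp'; lia.
  by lia.
exists z, (k0 + p%:Z) => k ngk; split=> //.
by rewrite ltNge; apply/negP => kp; apply: ngk; exact: good_le gp.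
Qed.

(** [kk i] is the scale of the reflected cube: that of the cell when it is good, the common scale ks
    otherwise. *)
Lemma refl_data : exists (z : int * G -> E) (kk : int * G -> int), forall i,
  near_to Omega (6 * sc i.1) (ctr i.1 i.2) ->
  [/\ Omega (z i), ccube (z i) (refl_cst * sc (kk i)) `<=` Omega,
    good i.1 -> kk i = i.1 /\ `|z i - ctr i.1 i.2| <= 7 * sc i.1 &
    ~ good i.1 -> [/\ i.1 < kk i, ~ good (kk i - 1) & forall i',
      near_to Omega (6 * sc i'.1) (ctr i'.1 i'.2) -> ~ good i'.1 -> z i' = z i /\ kk i' = kk i]].
Proof.
have [zs [ks star]] := star_exists.
pose Q i (p : E * int) := near_to Omega (6 * sc i.1) (ctr i.1 i.2) ->
  [/\ Omega p.1, ccube p.1 (refl_cst * sc p.2) `<=` Omega,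
    good i.1 -> p.2 = i.1 /\ `|p.1 - ctr i.1 i.2| <= 7 * sc i.1 &
    ~ good i.1 -> p = (zs, ks)].
have [h Hh] : {h : int * G -> E * int & forall i, Q i (h i)}.
  apply: (@choice _ _ Q) => i; have [gi|ngi] := pselect (good i.1); last first.
    by exists (zs, ks) => _; have [_ _ _ Oz zO] := star _ ngi; split.
  have [[y Oy cy]|nn] := pselect (near_to Omega (6 * sc i.1) (ctr i.1 i.2)); last by exists (zs, ks).
  have [z [Oz zy zO]] := good_reflect gi Oy; exists (z, i.1) => _; split=> // _; split=> //=.
  rewrite (le_trans (ler_distD y _ _))// zy distrC; have := sc_gt0 i.1.
  by move: (ltW cy); lra.
exists (fun i => (h i).1), (fun i => (h i).2) => i ni; have [H1 H2 H3 H4] := Hh i ni.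
split=> // ngi; have := H4 ngi => ->; have [k1 k2 k3 _ _] := star _ ngi; split=> //= i' ni' ngi'.
by have [_ _ _ /(_ ngi') ->] := Hh i' ni'.
Qed.

Lemma sc_ge4 k l : k <= l + 2 -> sc l <= 4 * sc k.
Proof.
move=> kl; have := sc_le kl; rewrite (_ : l + 2 = l + 1 + 1); last by lia.
by rewrite !scS; lra.
Qed.

Variable m' : nat.
Local Notation m := m'.+1.

(* The part of Omega read by the polynomial of the cell i. *)
Definition Aset (Ca ca : R) i : set E :=
  ccube (ctr i.1 i.2) (Ca * sc i.1) `&` inn Omega (ca * sc i.1).

(** The conditions of [Bset] that do not involve K: the polynomial of a cell must not depend on
    K. *)
Definition cell i : set E :=
  [set x | `|x - ctr i.1 i.2| <= sc i.1 /\ near_to Omega (5 * sc i.1) x].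

Lemma Bset_cell K i x : Bset Omega K i x -> cell i x.
Proof. by case. Qed.

Lemma cell_near i x : cell i x -> near_to Omega (6 * sc i.1) (ctr i.1 i.2).
Proof.
move=> [xc nx]; have := near_toD nx xc; apply: near_to_le.
by have := sc_gt0 i.1; lra.
Qed.

Lemma DD_sub_sym s (a b : E -> R) x : Smooth a -> Smooth b ->
  `|DD s (fun y => a y - b y) x| = `|DD s (fun y => b y - a y) x|.
Proof.
move=> sa sb; rewrite (_ : (fun y => a y - b y) = fun y => -1 * (b y - a y)); last first.
  by apply/funext => y; rewrite mulN1r opprB.
by rewrite (DDZ s (-1) (smoothB sb sa)) mulN1r normrN.
Qed.

Lemma measurable_Aset Ca ca i : measurable (Aset Ca ca i).
Proof. by apply: measurableI; [exact: measurable_ccube|exact: measurable_inn]. Qed.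

Lemma Aset_sub Ca ca i : 0 < ca -> Aset Ca ca i `<=` Omega.
Proof. by move=> ca0 y [_]; apply: inn_sub; exact: mulr_gt0 ca0 (sc_gt0 _). Qed.

Lemma integ_Aset Ca ca i (h : E -> R) : 0 < ca -> loc_integrable Omega h ->
  integ (Aset Ca ca i) h.
Proof.
move=> ca0 lh; apply: loc_integ (@Aset_sub Ca ca i ca0) lh mOmega; last exact: compact_inn.
exact: measurable_Aset.
Qed.

(** Gathers what the sequel uses about the polynomials, so that curves and reflected cubes can be
    forgotten. The threshold k1 is a good scale, hence so are all finer ones. *)
Lemma extension_polys : exists (P : (E -> R) -> int * G -> E -> R) (Ca ca C : R) (k1 : int),
  [/\ 0 < Ca, 0 < ca, 0 <= C,
   (forall (f f' : E -> R) (a : R) i x, locint Omega f -> locint Omega f' -> cell i x ->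
      forall y, P (fun y => a * f y + f' y) i y = a * P f i y + P f' i y) /\
   (forall f f' : E -> R, measurable_fun Omega f -> measurable_fun Omega f' ->
      {ae mu, forall x, Omega x -> f x = f' x} -> P f = P f') &
   [/\ forall (a : R) i x, cell i x -> P (fun=> a) i = fun=> a,
    forall f i x, locint Omega f -> cell i x -> polyd m (P f i),
    forall (f : E -> R) i x, loc_integrable Omega f -> k1 <= i.1 -> cell i x ->
      `|P f i x| <= C / sc i.1 ^+ n.+1 * \int[mu]_(y in ccube (ctr i.1 i.2) (Ca * sc i.1) `&`
        inn Omega (ca * sc i.1)) `|f y|,
    forall (f : E -> R) i x, (forall (S : set E) u, compact S -> S `<=` Omega -> tst S u ->
        \int[mu]_(y in Omega) (f y * u y) = 0) -> cell i x -> P f i = fun=> 0 &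
    forall f D g, weak_data Omega m f D g -> loc_integrable Omega g ->
      forall i i' x s, cell i x -> cell i' x -> i'.1 <= i.1 + 2 -> i.1 <= i'.1 + 2 ->
      (size s <= m)%N ->
      `|DD s (fun y => P f i y - P f i' y) x| <= C * Usc m' (n + size s) (sc i.1) *
        (\int[mu]_(y in Aset Ca ca i) g y + \int[mu]_(y in Aset Ca ca i') g y)]].
Proof.
have [z [kk refl]] := refl_data.
(* For scales a and b of minimum sg, with a, b <= 4 * sg, one has |x - z| <= 8 * a <= 32 * sg and |z
   - z'| <= 8 * a + 8 * b <= 64 * sg, within the 160 allowed. *)
have C00 : 0 < (160 : R) by []. have C10 : 0 < (32 : R) by [].
have [kap [C2 [C [k0 kc C20 C0 chain]]]] :=
  chain_lpoly m' mOmega eps0 dom refl_cst_gt0 C00 C10.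
have r80 : 0 <= 8 / kap by rewrite divr_ge0// ltW.
have [C3 C30 HC3] := @lpoly_le R n Omega mOmega m (8 / kap) r80.
pose P f i := lpoly Omega m f (z i) (kap * sc (kk i)).
pose Ca := C2 + kap + 7; pose ca := kap / 4.
have Ca0 : 0 < Ca by rewrite /Ca; lra.
have ca0 : 0 < ca by rewrite /ca; lra.
have [k1 gk1] := good_exists.
pose C4 := C * 4 ^+ (m' + (n + m)).
have C40 : 0 <= C4 by rewrite /C4; nng.
pose C5 := C4 * 4 ^+ (m' + (n + m)) + C4.
have C50 : 0 <= C5 by rewrite /C5; nng.
pose C6 := C3 * kap^-1 ^+ n.+1.
have C60 : 0 <= C6 by rewrite /C6; nng.
have kpos i : 0 < kap * sc (kk i) by exact: mulr_gt0 k0 (sc_gt0 _).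
have zcube i x : cell i x -> ccube (z i) (kap * sc (kk i)) `<=` Omega.
  move=> /cell_near/refl[_ zO _ _] y zy; apply: zO; apply: le_trans zy _.
  by rewrite ler_pM2r ?sc_gt0//; lra.
exists P, Ca, ca, (C5 + C6), k1; split=> //.
- by rewrite addr_ge0.
- split=> [f f' a i x fi fi' Bi y|f f' mf mf' ff'].
    by apply: lpoly_lin => //; exact: zcube Bi.
  by apply/funext => i; exact: lpoly_ae.
split.
- move=> a i x Bi; apply/funext => y; apply: lpoly_cst => //; exact: zcube Bi.
- move=> f i x fi Bi; apply: (@lpoly_polyd _ _ _ mOmega f m _ _ (z i) (kap * sc (kk i))) => //.
    exact: zcube Bi.
  by rewrite subrr normr0 add0r.
- move=> f i x lf ki Bi; have fi := loc_locint mOmega lf; have [Oz zO /(_ (good_le ki gk1))[kE zc] _] := refl i (cell_near Bi).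
  have s0 := sc_gt0 i.1; have ks0 := kpos i; rewrite kE in ks0 zO.
  have xz : `|x - z i| <= 8 * sc i.1.
    case: Bi => xc _; rewrite (le_trans (ler_distD (ctr i.1 i.2) _ _))//.
    by rewrite [X in _ + X]distrC; move: xc zc; lra.
  have zO' := zcube _ _ Bi; rewrite kE in zO'.
  have := HC3 f x (z i) (kap * sc i.1) (z i) (kap * sc i.1) fi ks0 zO'.
  rewrite subrr normr0 add0r => /(_ (lexx _)).
  rewrite mulrA divfK ?gt_eqF// => /(_ xz); rewrite /P kE => /le_trans; apply.
  have sub : ccube (z i) (kap * sc i.1) `<=` Aset Ca ca i.
    move=> y zy; split.
      rewrite /ccube /= (le_trans (ler_distD (z i) _ _))//.
      rewrite (le_trans (lerD zy zc))// -mulrDl ler_pM2r// /Ca; lra.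
    apply: (@inn_ccube _ _ _ (z i) (kap * sc i.1)) => // w zw; apply: zO.
    by apply: le_trans zw _; rewrite -mulrDl ler_pM2r// /ca; lra.
  have iA : integ (Aset Ca ca i) f by exact: integ_Aset.
  have mA := measurable_Aset Ca ca i.
  have Is : \int[mu]_(y in ccube (z i) (kap * sc i.1)) `|f y| <=
      \int[mu]_(y in Aset Ca ca i) `|f y|.
    by apply: Rint_subset => //; [exact: measurable_ccube|exact: integ_norm].
  have I0 : 0 <= \int[mu]_(y in Aset Ca ca i) `|f y| by exact: Rintegral_ge0.
  apply: (@le_trans _ _ (C6 / sc i.1 ^+ n.+1 * \int[mu]_(y in Aset Ca ca i) `|f y|)).
    rewrite invfM exprMn exprVn [X in _ * (_ * X)]exprVn /C6 exprVn mulrA.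
    by apply: ler_wpM2l Is; nng.
  apply: ler_wpM2r => //; apply: ler_wpM2r; first by nng.
  by rewrite lerDr.
- move=> f i x f0 Bi; apply/funext => y; rewrite /P /lpoly.
  rewrite (f0 (ccube (z i) (kap * sc (kk i)))) ?mulr0//.
  - exact: ccube_compact.
  - exact: zcube Bi.
  apply: tst_taylor; first exact: closed_ccube.
  by apply: tst_bump => //; rewrite subrr normr0 add0r.
have diffg f D g : weak_data Omega m f D g -> loc_integrable Omega g ->
    forall i i' x s, cell i x -> cell i' x -> i'.1 <= i.1 + 2 -> i.1 <= i'.1 + 2 ->
      (size s <= m)%N -> good i.1 ->
    `|DD s (fun y => P f i y - P f i' y) x| <= C4 * Usc m' (n + size s) (sc i.1) *
      \int[mu]_(y in Aset Ca ca i) g y.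
  move=> W lg i i' x s Bi Bi' ii' i'i sm gi.
  have [Oz zO /(_ gi)[kE zc] _] := refl i (cell_near Bi).
  have [Oz' zO' gi' ngi'] := refl i' (cell_near Bi').
  (* A bad neighbour still has a cube of comparable scale: [kk i' - 1] is bad whereas i.1 is
     good. *)
  have [l1 l2] : kk i' <= i.1 + 2 /\ i.1 <= kk i' + 2.
    have [/gi'[-> _]|ng] := pselect (good i'.1); first by split.
    have [lt ngk _] := ngi' ng; split; last exact: ltz_le2 lt i'i.
    apply: ltzB1_le2; rewrite ltNge; apply/negP => le; apply: ngk; exact: good_le le gi.
  rewrite kE in zO.
  set a := sc i.1 in zc zO *; pose b := sc (kk i').
  have [a0 b0] : 0 < a /\ 0 < b by split; exact: sc_gt0.
  have ab : a <= 4 * b by exact: sc_ge4.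
  have ba : b <= 4 * a by exact: sc_ge4.
  pose sg := Num.min a b.
  have sg0 : 0 < sg by rewrite lt_min a0 b0.
  have [sga sgb] : sg <= a /\ sg <= b by rewrite !ge_min !lexx orbT.
  have [asg bsg] : a <= 4 * sg /\ b <= 4 * sg.
    by rewrite /sg; have [abl|bal] := leP a b; split; lra.
  have xz : `|x - z i| <= 8 * a.
    case: Bi => xc _; rewrite (le_trans (ler_distD (ctr i.1 i.2) _ _))//.
    by rewrite [X in _ + X]distrC; move: xc zc; rewrite -/a; lra.
  have zz : `|z i - z i'| <= 160 * sg.
    have [g'|ng] := pselect (good i'.1).
      have [kE' zc'] := gi' g'.
      have xz' : `|x - z i'| <= 8 * b.
        case: Bi' => xc _; rewrite (le_trans (ler_distD (ctr i'.1 i'.2) _ _))//.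
        by rewrite [X in _ + X]distrC /b kE'; move: xc zc'; lra.
      rewrite (le_trans (ler_distD x _ _))// [`|z i - x|]distrC.
      by move: xz xz' asg bsg sg0; lra.
    (* The scale [kk i' - 1] being bad bounds the diameter of Omega, so the common cube is close to
       every point of Omega. *)
    have [_ ngk _] := ngi' ng.
    have := not_good_le ngk Oz Oz'.
    have -> : sc (kk i' - 1) = 2 * b.
      by rewrite /b -[X in _ = 2 * sc X](subrK 1) scS; field.
    by move: bsg sg0; lra.
  have cz : ccube (z i) (refl_cst * sg) `<=` Omega.
    by move=> y zy; apply: zO; apply: le_trans zy _; rewrite ler_pM2l// refl_cst_gt0.
  have cz' : ccube (z i') (refl_cst * sg) `<=` Omega.
    by move=> y zy; apply: zO'; apply: le_trans zy _; rewrite ler_pM2l// refl_cst_gt0.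
  have kle u v : u <= v -> kap * u <= kap * v by move=> uv; rewrite ler_pM2l.
  have k4 u : u <= 4 * sg -> kap * u <= 4 * kap * sg.
    by move=> /kle; rewrite mulrCA mulrA.
  have xz32 : `|x - z i| <= 32 * sg by move: xz asg; lra.
  have kk1 : kap * sg <= kap * sc (kk i) by rewrite kE; exact: kle.
  have kk2 : kap * sc (kk i) <= 4 * kap * sg by rewrite kE; exact: k4.
  have main : `|DD s (fun y => P f i y - P f i' y) x| <= C * Usc m' (n + size s) sg *
      \int[mu]_(y in ccube (z i) (C2 * sg) `&` inn Omega (kap * sg)) g y.
    exact: (chain f D g W lg sg (z i) (z i') (kap * sc (kk i)) (kap * sc (kk i')) x s sm sg0 Oz Oz'
      cz cz' zz kk1 kk2 (kle _ _ sgb) (k4 _ bsg) xz32).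
  apply: (le_trans main) => {main}.
  have iA : integ (Aset Ca ca i) g by exact: integ_Aset.
  have mA := measurable_Aset Ca ca i.
  have g0 y : Omega y -> 0 <= g y.
    move=> Oy; have := weak_data_le W (s := nseq m ord0) (y := y).
    by rewrite size_nseq => /(_ erefl Oy); exact: le_trans.
  have Is : \int[mu]_(y in ccube (z i) (C2 * sg) `&` inn Omega (kap * sg)) g y <=
      \int[mu]_(y in Aset Ca ca i) g y.
    apply: Rint_subset => //; last by move=> y /(Aset_sub ca0); exact: g0.
      by apply: measurableI; [exact: measurable_ccube|exact: measurable_inn].
    move=> y [zy iy]; split.
      rewrite /ccube /= (le_trans (ler_distD (z i) _ _))// (le_trans (lerD zy zc))//.
      rewrite /Ca !mulrDl -/a; have := ler_wpM2l (ltW C20) sga; have := mulr_gt0 k0 a0; lra.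
    apply: (@inn_le _ _ _ (ca * a) (kap * sg)) iy.
    by rewrite /ca -mulrA ler_pM2l//; move: asg; lra.
  have U0 := @Usc_ge0 R m' (n + size s) _ (ltW sg0).
  have Ua0 := @Usc_ge0 R m' (n + size s) _ (ltW a0).
  have IA0 : 0 <= \int[mu]_(y in Aset Ca ca i) g y by apply: Rintegral_ge0 => y /(Aset_sub ca0); exact: g0.
  apply: (@le_trans _ _ (C * Usc m' (n + size s) sg * \int[mu]_(y in Aset Ca ca i) g y)).
    by apply: ler_wpM2l Is; rewrite mulr_ge0.
  apply: ler_wpM2r => //; rewrite /C4 -mulrA; apply: ler_wpM2l => //.
  have sga4 : sg <= 4 * a by move: sga a0; lra.
  have := @Usc_le R m' (n + size s) 4 sg a _ sg0 a0 sga4 asg.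
  rewrite ler1n => /(_ erefl)/le_trans; apply; apply: ler_wpM2r => //.
  by rewrite ler_weXn2l ?ler1n// leq_add2l leq_add2l.
move=> f D g W lg i i' x s Bi Bi' ii' i'i sm.
have fi := weak_data_f W.
have g0 y : Omega y -> 0 <= g y.
  move=> Oy; have := weak_data_le W (s := nseq m ord0) (y := y).
  by rewrite size_nseq => /(_ erefl Oy); exact: le_trans.
have IA0 j : 0 <= \int[mu]_(y in Aset Ca ca j) g y by apply: Rintegral_ge0 => y /(Aset_sub ca0); exact: g0.
have [I1 I2] := (IA0 i, IA0 i').
have U0 := @Usc_ge0 R m' (n + size s) _ (ltW (sc_gt0 i.1)).
have C45 : C4 <= C5 + C6 by rewrite /C5 addrAC lerDr; apply: addr_ge0 => //; nng.
have [gi|ngi] := pselect (good i.1).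
  apply: (le_trans (diffg f D g W lg i i' x s Bi Bi' ii' i'i sm gi)).
  apply: ler_pM => //; [exact: mulr_ge0|exact: ler_wpM2r|by rewrite lerDl].
have sP j : cell j x -> Smooth (P f j).
  move=> Bj; apply: (@lpoly_polyd _ _ _ mOmega f m _ _ (z j) (kap * sc (kk j)) fi _ _ _).1 => //.
    exact: zcube Bj.
  by rewrite subrr normr0 add0r.
have [gi'|ngi'] := pselect (good i'.1).
  rewrite (DD_sub_sym _ _ (sP _ Bi) (sP _ Bi')).
  apply: (le_trans (diffg f D g W lg i' i x s Bi' Bi i'i ii' sm gi')).
  have ss : sc i'.1 <= 4 * sc i.1 by exact: sc_ge4.
  have ss' : sc i.1 <= 4 * sc i'.1 by exact: sc_ge4.
  have := @Usc_le R m' (n + size s) 4 _ _ _ (sc_gt0 i'.1) (sc_gt0 i.1) ss ss'.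
  rewrite ler1n => /(_ erefl) UU.
  have U0' := @Usc_ge0 R m' (n + size s) _ (ltW (sc_gt0 i'.1)).
  apply: ler_pM => //; [exact: mulr_ge0| |by rewrite lerDr].
  apply: (@le_trans _ _ (C4 * 4 ^+ (m' + (n + m)) * Usc m' (n + size s) (sc i.1))).
    rewrite -mulrA; apply: ler_wpM2l => //; apply: (le_trans UU); apply: ler_wpM2r => //.
    by rewrite ler_weXn2l ?ler1n// leq_add2l leq_add2l.
  by apply: ler_wpM2r => //; rewrite /C5 -addrA lerDl addr_ge0.
(* Two bad cells share their cube, hence their polynomial. *)
have [_ _ _ /(_ ngi)[_ _ /(_ i' (cell_near Bi') ngi')[zE kE]]] := refl i (cell_near Bi).
rewrite (_ : (fun y => _) = fun=> 0); last by apply/funext => y; rewrite /P zE kE subrr.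
by rewrite DD_cst0 normr0 mulr_ge0 ?addr_ge0// mulr_ge0// addr_ge0.
Qed.

End reflection.

Section smooth_sums.
Context {R : realType} {n : nat}.
Local Notation E := 'rV[R]_n.+1.

Lemma DD_sum_seq s (T : eqType) (t : seq T) (F : T -> E -> R) :
  {in t, forall q, Smooth (F q)} ->
  DD s (fun x => \sum_(q <- t) F q x) = fun x => \sum_(q <- t) DD s (F q) x.
Proof.
elim: t => [|q t IH] sF.
  under eq_fun do rewrite big_nil; rewrite DD_cst0.
  by apply/funext => x; rewrite big_nil.
have sq : Smooth (F q) by apply: sF; rewrite mem_head.
have st : {in t, forall q, Smooth (F q)} by move=> p pt; apply: sF; rewrite inE pt orbT.
under eq_fun do rewrite big_cons.
rewrite (DDD s sq (smooth_sum_seq st)) IH//.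
by apply/funext => x; rewrite big_cons.
Qed.

End smooth_sums.

(** * The approximate extensions *)

Section extension_operator.
Context {R : realType} {n : nat}.
Local Notation E := 'rV[R]_n.+1.
Local Notation G := 'rV[int]_n.+1.
Local Notation I := (int * G)%type.
Local Notation mu := (@lebesgue_rV R n).
Local Notation sc := (@sc R).
Local Notation sc_gt0 := (@sc_gt0 R).
Local Notation sc_le := (@sc_le R).
Implicit Types (k l K : int) (x y z : E) (i : int * G) (s : seq 'I_n.+1).

(* [P f i] is the polynomial of the cell i; cells of scale at least k1
   are reflected at their own scale. *)
Record poly_data (Omega : set E) (m' : nat) (P : (E -> R) -> I -> E -> R)
    (Ca ca C : R) (k1 : int) : Prop := PolyData {
  pd_Ca : 0 < Ca ;
  pd_ca : 0 < ca ;
  pd_C : 0 <= C ;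
  pd_lin : forall (f f' : E -> R) (a : R) i x, locint Omega f -> locint Omega f' ->
    cell Omega i x -> forall y, P (fun y => a * f y + f' y) i y = a * P f i y + P f' i y ;
  pd_ae : forall f f' : E -> R, measurable_fun Omega f -> measurable_fun Omega f' ->
    {ae mu, forall x, Omega x -> f x = f' x} -> P f = P f' ;
  pd_cst : forall (a : R) i x, cell Omega i x -> P (fun=> a) i = fun=> a ;
  pd_poly : forall f i x, locint Omega f -> cell Omega i x -> polyd m'.+1 (P f i) ;
  pd_le : forall (f : E -> R) i x, loc_integrable Omega f -> k1 <= i.1 -> cell Omega i x ->
    `|P f i x| <= C / sc i.1 ^+ n.+1 * \int[mu]_(y in Aset Omega Ca ca i) `|f y| ;
  pd_zero : forall (f : E -> R) i x, (forall (S : set E) u, compact S -> S `<=` Omega -> tst S u ->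
    \int[mu]_(y in Omega) (f y * u y) = 0) -> cell Omega i x -> P f i = fun=> 0 ;
  pd_diff : forall f D g, weak_data Omega m'.+1 f D g -> loc_integrable Omega g ->
    forall i i' x s, cell Omega i x -> cell Omega i' x -> i'.1 <= i.1 + 2 -> i.1 <= i'.1 + 2 ->
    (size s <= m'.+1)%N ->
    `|DD s (fun y => P f i y - P f i' y) x| <= C * Usc m' (n + size s) (sc i.1) *
      (\int[mu]_(y in Aset Omega Ca ca i) g y + \int[mu]_(y in Aset Omega Ca ca i') g y) }.

Lemma poly_data_exists eps (Omega : set E) m' : 0 < eps -> eps_infty_domain eps Omega ->
  Omega !=set0 -> exists P Ca ca C k1, poly_data Omega m' P Ca ca C k1.
Proof.
move=> e0 dom O0.
have [P [Ca [ca [C [k1 [H1 H2 H3 [H4 H5] [H6 H7 H8 H9 H10]]]]]]] := extension_polys e0 dom O0 m'.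
by exists P, Ca, ca, C, k1; split.
Qed.

Variables (Omega : set E) (m' : nat) (P : (E -> R) -> I -> E -> R).
Variables (Ca ca C : R) (k1 : int).
Hypotheses (oO : open Omega) (O0 : Omega !=set0) (pdP : poly_data Omega m' P Ca ca C k1).
Local Notation m := m'.+1.
Local Notation A := (Aset Omega Ca ca).
Local Notation B := (Bset Omega).

Let mO : measurable Omega. Proof. exact: open_measurable_rV. Qed.

Definition FK K f : E -> R := fun x => \sum_(i \in [set: I]) wt Omega K i x * P f i x.

(** An average up to constants: the normalization is the volume of the cell, which the measure of
    [A i] need not be bounded below by. *)
Definition Mi i v : R := (\int[mu]_(y in A i) v y) / sc i.1 ^+ n.+1.

Definition TK K v : E -> R := fun x => \sum_(i \in [set: I]) (x \in B K i)%:R * Mi i v.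

Lemma integ_A i (h : E -> R) : loc_integrable Omega h -> integ (A i) h.
Proof.
move=> lh; apply: loc_integ (@Aset_sub _ _ _ Ca ca i (pd_ca pdP)) lh mO; last exact: compact_inn.
exact: measurable_Aset.
Qed.

Lemma Mi_ge0 i v : (forall y, Omega y -> 0 <= v y) -> 0 <= Mi i v.
Proof.
move=> v0; rewrite divr_ge0 ?exprn_ge0 ?(ltW (sc_gt0 _))//.
by apply: Rintegral_ge0 => y /(Aset_sub (pd_ca pdP)); exact: v0.
Qed.

(** Near x0 the functions FK K f, for all f at once, reduce to one finite sum over the cells active
    at x0, whose number is bounded independently of K. *)
Lemma FK_near K x0 : exists t : seq I,
  [/\ uniq t, (size t <= 5 * 6 ^ n.+1)%N, forall i, i \in t <-> B K i x0 &
    \forall x \near x0, \sum_(i <- t) wt Omega K i x = 1 /\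
      forall f, FK K f x = \sum_(i <- t) wt Omega K i x * P f i x].
Proof.
have [t [ut st tB nt]] := active_exists O0 K x0; exists t; split=> //.
apply: filterS nt => x H; split.
  by rewrite -(lfsumE ut H) sum_wt.
by move=> f; apply: lfsumE => // i /H ->; rewrite mul0r.
Qed.

Lemma TK_list K x v (t : seq I) : uniq t -> (forall i, i \in t <-> B K i x) ->
  TK K v x = \sum_(i <- t) Mi i v.
Proof.
move=> ut tB; rewrite /TK (lfsumE ut); last first.
  by move=> i it; rewrite memNset ?mul0r// => /tB; rewrite (negbTE it).
by rewrite big_seq [RHS]big_seq; apply: eq_bigr => i /tB Bi; rewrite mem_set// mul1r.
Qed.

Lemma TK_ge0 K x v : (forall y, Omega y -> 0 <= v y) -> 0 <= TK K v x.
Proof.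
move=> v0; have [t [ut _ tB _]] := active_exists O0 K x.
by rewrite (TK_list _ ut tB); apply: sumr_ge0 => i _; exact: Mi_ge0.
Qed.

Lemma smooth_P f K i x : locint Omega f -> B K i x -> Smooth (P f i).
Proof. by move=> fi /Bset_cell Bi; have [] := pd_poly pdP fi Bi. Qed.

Lemma smooth_FK K f : locint Omega f -> Smooth (FK K f).
Proof.
move=> fi; apply: smooth_local => x0; have [t [ut _ tB nt]] := FK_near K x0.
exists (fun x => \sum_(i <- t) wt Omega K i x * P f i x); last first.
  by apply: filterS nt => x [_]; exact.
apply: smooth_sum_seq => i /tB Bi; apply: smoothM; first exact: smooth_wt.
exact: smooth_P Bi.
Qed.

Lemma Mi_comparable i i' v : (forall y, Omega y -> 0 <= v y) -> sc i'.1 <= 4 * sc i.1 ->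
  (\int[mu]_(y in A i') v y) / sc i.1 ^+ n.+1 <= 4 ^+ n.+1 * Mi i' v.
Proof.
move=> v0 ss; have I0 : 0 <= \int[mu]_(y in A i') v y.
  by apply: Rintegral_ge0 => y /(Aset_sub (pd_ca pdP)); exact: v0.
rewrite /Mi mulrCA; apply: ler_wpM2l => //.
have [s0 s0'] := (sc_gt0 i.1, sc_gt0 i'.1).
rewrite ler_pdivlMr ?exprn_gt0// mulrC ler_pdivrMr ?exprn_gt0// -exprMn.
by rewrite lerXn2r// nnegrE ?mulr_ge0 ?ltW.
Qed.

Lemma weak_data_g0 f D g : weak_data Omega m f D g -> forall y, Omega y -> 0 <= g y.
Proof.
move=> W y Oy; have := weak_data_le W (s := nseq m ord0) (y := y).
by rewrite size_nseq => /(_ erefl Oy); exact: le_trans.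
Qed.

Lemma FK_DD_le : exists2 C2 : R, 0 <= C2 & forall f D g, weak_data Omega m f D g ->
  loc_integrable Omega g -> forall K s x, size s = m ->
  `|DD s (FK K f) x| <= C2 * TK K g x.
Proof.
have [Aw Aw1 HAw] := @wt_DD R n Omega m.
have Aw0 : 0 <= Aw by exact: le_trans Aw1.
have C0 := pd_C pdP.
pose C2 := 2 ^+ m * Aw * C * (1 + 4 ^+ n.+1).
have C20 : 0 <= C2 by rewrite /C2; nng.
exists ((5 * 6 ^ n.+1)%:R * C2); first by rewrite mulr_ge0.
move=> f D g W lg K s x sm; have fi := weak_data_f W; have g0 := weak_data_g0 W.
have [t [ut st tB nt]] := FK_near K x.
rewrite (TK_list _ ut tB); case tE : t => [|i0 t'].
  by have [] := nbhs_singleton nt; rewrite tE big_nil => /esym/eqP; rewrite oner_eq0.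
rewrite -tE; have i0t : i0 \in t by rewrite tE mem_head.
have B0 := (tB i0).1 i0t.
have sP i : i \in t -> Smooth (P f i) by move=> /tB; exact: smooth_P.
have sD i : i \in t -> Smooth (fun y => P f i y - P f i0 y).
  by move=> it; apply: smoothB; exact: sP.
have sWD i : i \in t -> Smooth (fun y => wt Omega K i y * (P f i y - P f i0 y)).
  by move=> it; apply: smoothM; [exact: smooth_wt|exact: sD].
(* Since the weights add up to 1, one polynomial can be subtracted from all the others; its
   derivatives of order m vanish, and only differences of neighbours remain. *)
have e : \forall y \near x, FK K f y =
    \sum_(i <- t) wt Omega K i y * (P f i y - P f i0 y) + P f i0 y.
  apply: filterS nt => y [w1 ->].
  under [in RHS]eq_bigr do rewrite mulrBr.
  by rewrite sumrB -mulr_suml w1 mul1r subrK.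
rewrite (nbhs_singleton (near_eq_DD s e)).
rewrite (DDD s (smooth_sum_seq sWD) (sP i0 i0t)) (DD_sum_seq _ sWD).
have [_ ->] := pd_poly pdP fi (Bset_cell B0); last by rewrite sm.
rewrite addr0 (le_trans (ler_norm_sum _ _ _))//.
pose T := \sum_(i <- t) Mi i g.
have MT i : i \in t -> Mi i g <= T.
  move=> it; rewrite /T (bigD1_seq i)//= lerDl; apply: sumr_ge0 => j _; exact: Mi_ge0.
apply: (@le_trans _ _ (\sum_(i <- t) C2 * T)); last first.
  rewrite big_const_seq count_predT iter_addr_0 -[leLHS]mulr_natl -mulrA.
  apply: ler_wpM2r; last by rewrite ler_nat.
  by rewrite mulr_ge0// /T; apply: sumr_ge0 => j _; exact: Mi_ge0.
rewrite big_seq [leRHS]big_seq; apply: ler_sum => i it.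
have Bi := (tB i).1 it.
have c1 := Bset_comparable Bi B0; have c2 := Bset_comparable B0 Bi.
have s0 := sc_gt0 i.1.
have IA0 j : 0 <= \int[mu]_(y in A j) g y.
  by apply: Rintegral_ge0 => y /(Aset_sub (pd_ca pdP)); exact: g0.
pose Bd := C * (sc i.1 ^+ m' / sc i.1 ^+ n) *
  (\int[mu]_(y in A i) g y + \int[mu]_(y in A i0) g y).
have Bd0 : 0 <= Bd by rewrite /Bd; have := IA0 i; have := IA0 i0; have := ltW s0; move=> ? ? ?; nng.
have := @DD_prod_le R n s (wt Omega K i) (fun y => P f i y - P f i0 y) x Aw Bd (sc i.1)
  Aw0 Bd0 s0 (smooth_wt _ _ _) (sD i it).
move=> /(_ _ _)/le_trans; apply.
- by move=> u us; apply: HAw; rewrite -sm.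
- move=> u us; rewrite sm in us.
  apply: (le_trans (pd_diff pdP W lg (Bset_cell Bi) (Bset_cell B0) c1 c2 us)).
  rewrite /Bd /Usc exprD invfM.
  by rewrite [leRHS](_ : _ = C * (sc i.1 ^+ m' * ((sc i.1 ^+ n)^-1 * (sc i.1 ^+ size u)^-1)) *
    (\int[mu]_(y in A i) g y + \int[mu]_(y in A i0) g y))//;
    move: (sc i.1 ^+ m') (_^-1) (_^-1) => *; ring.
have si : sc i.1 != 0 by rewrite gt_eqF.
(* The powers of the scale balance: m' - n - m = - (n + 1) is the normalization of [Mi]. *)
have -> : 2 ^+ size s * Aw * Bd / sc i.1 ^+ size s = 2 ^+ m * Aw * C *
    (Mi i g + (\int[mu]_(y in A i0) g y) / sc i.1 ^+ n.+1).
  rewrite sm /Bd /Mi -mulrDl; move: (_ + _) => J; rewrite !exprS.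
  have : sc i.1 ^+ m' != 0 by rewrite expf_neq0.
  have : sc i.1 ^+ n != 0 by rewrite expf_neq0.
  move: (sc i.1 ^+ m') (sc i.1 ^+ n) => a b a0 b0; field.
  by rewrite a0 b0 si.
rewrite /C2 -[leRHS]mulrA; apply: ler_wpM2l; first by nng.
rewrite mulrDl mul1r; apply: lerD; first exact: MT.
have ss : sc i0.1 <= 4 * sc i.1 by exact: sc_ge4.
apply: (le_trans (Mi_comparable g0 ss)).
by apply: ler_wpM2l; [nng|exact: MT].
Qed.

Lemma Bset_Omega K i x : Omega x -> B K i x -> i.1 = K.
Proof.
move=> Ox [_ _ []// [_ nx]]; exfalso; apply: nx; exists x => //.
by rewrite subrr normr0 sc_gt0.
Qed.

Lemma Bset_near2 K i x : near_to Omega (2 * sc K) x -> B K i x -> i.1 = K.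
Proof.
move=> n2 [_ _ []// [iK ni]]; exfalso; apply: ni; apply: near_to_le n2.
have : sc K <= sc (i.1 + 1) by apply: sc_le; lia.
by rewrite scS; lra.
Qed.

(** Passing from K to K + 1 only changes the weights where [Hfun (K + 1)] is nonzero, that is,
    within 4 * 2^-(K+1) of Omega. *)
Lemma FK_stable K f x : ~ near_to Omega (2 * sc K) x -> FK (K + 1) f x = FK K f x.
Proof.
move=> n2; have h0 : Hfun Omega (K + 1) x = 0.
  by apply: Hfun0; rewrite scS => n4; apply: n2; apply: near_to_le n4; lra.
apply: eq_fsbigr => -[k j] _; rewrite /wt /=; congr (_ * _ * _).
have K1 : K < K + 1 by rewrite ltrDl.
rewrite /theta; have [kK|Kk|->] := ltgtP k K; last 1 first.
- by rewrite lt_eqF// K1 h0 subr0.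
- by rewrite lt_eqF ?(lt_trans kK)// (lt_trans kK).
have [->|kK1] := eqVneq k (K + 1); first by rewrite h0.
by rewrite ltNge (_ : K + 1 <= k)//; lia.
Qed.

Lemma wt_le : exists2 Aw : R, 1 <= Aw & forall K i x, `|wt Omega K i x| <= Aw.
Proof.
have [Aw Aw1 HAw] := @wt_DD R n Omega 0; exists Aw => // K i x.
by have := HAw [::] K i x (leqnn 0); rewrite expr0 divr1.
Qed.

(** Both values are averages of polynomials with weights of sum 1, so their difference is a double
    sum of differences of polynomials of comparable cells. Without derivatives, each difference
    gains the m-th power of the scale. *)
Lemma FK_sub_le : exists2 C3 : R, 0 <= C3 & forall f D g, weak_data Omega m f D g ->
  loc_integrable Omega g -> forall K x,
  `|FK (K + 1) f x - FK K f x| <= C3 * sc K ^+ m * (TK (K + 1) g x + TK K g x).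
Proof.
have [Aw Aw1 HAw] := wt_le.
have Aw0 : 0 <= Aw by exact: le_trans Aw1.
have C0 := pd_C pdP.
pose C3 := Aw * Aw * C * 4 ^+ n.+1.
have C30 : 0 <= C3 by rewrite /C3; nng.
exists ((5 * 6 ^ n.+1)%:R * C3); first by rewrite mulr_ge0.
move=> f D g W lg K x; have fi := weak_data_f W; have g0 := weak_data_g0 W.
have s0 := sc_gt0 K.
have [n2|n2] := pselect (near_to Omega (2 * sc K) x); last first.
  rewrite (FK_stable f n2) subrr normr0 mulr_ge0//.
    by rewrite !mulr_ge0 ?exprn_ge0// ltW.
  by rewrite addr_ge0// TK_ge0.
have [t [ut st tB /nbhs_singleton[w1 ->]]] := FK_near K x.
have [t' [ut' st' tB' /nbhs_singleton[w1' ->]]] := FK_near (K + 1) x.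
rewrite (TK_list _ ut tB) (TK_list _ ut' tB').
have -> : \sum_(i <- t') wt Omega (K + 1) i x * P f i x - \sum_(i <- t) wt Omega K i x * P f i x =
    \sum_(i' <- t') \sum_(i <- t) wt Omega (K + 1) i' x * (wt Omega K i x * (P f i' x - P f i x)).
  under [RHS]eq_bigr do rewrite -mulr_sumr.
  under [RHS]eq_bigr do under eq_bigr do rewrite mulrBr.
  under [RHS]eq_bigr do rewrite sumrB -mulr_suml w1 mul1r mulrBr.
  by rewrite sumrB -mulr_suml w1' mul1r.
apply: (@le_trans _ _ (\sum_(i' <- t') \sum_(i <- t) C3 * sc K ^+ m * (Mi i' g + Mi i g))).
  apply: (le_trans (ler_norm_sum _ _ _)); rewrite big_seq [leRHS]big_seq; apply: ler_sum => i' it'.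
  apply: (le_trans (ler_norm_sum _ _ _)); rewrite big_seq [leRHS]big_seq; apply: ler_sum => i it.
  have Bi := (tB i).1 it; have Bi' := (tB' i').1 it'.
  have iK := Bset_near2 n2 Bi.
  (* Within 2 * 2^-K of Omega, the active cells of level K have scale K and those of level K + 1
     have scale K or K + 1. *)
  have Ki' : K <= i'.1.
    case: Bi' => _ _ [->|[_ ni]]; first by rewrite lerDl.
    rewrite leNgt; apply/negP => iK'; apply: ni; apply: near_to_le n2.
    have : sc K <= sc (i'.1 + 1) by apply: sc_le; lia.
    by rewrite scS; lra.
  have i'K := Bset_le Bi'.
  have c1 : i.1 <= i'.1 + 2 by rewrite iK; lia.
  have c2 : i'.1 <= i.1 + 2 by rewrite iK (le_trans i'K)// lerD2l.
  have := pd_diff pdP W lg (s := [::]) (Bset_cell Bi') (Bset_cell Bi) c1 c2 isT.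
  rewrite /= addn0 => dP.
  rewrite (normrM (wt Omega (K + 1) i' x)) (normrM (wt Omega K i x)) (_ : C3 * _ * _ = Aw * (Aw * (C * (4 ^+ n.+1 * (sc K ^+ m * (Mi i' g + Mi i g)))))); last first.
    by rewrite /C3 !mulrA.
  apply: ler_pM => //; apply: ler_pM => //.
  apply: (le_trans dP); rewrite -[leLHS]mulrA; apply: ler_wpM2l => //.
  have s'0 := sc_gt0 i'.1.
  have -> : Usc m' n (sc i'.1) * (\int[mu]_(y in A i') g y + \int[mu]_(y in A i) g y) =
     sc i'.1 ^+ m * (Mi i' g + (\int[mu]_(y in A i) g y) / sc i'.1 ^+ n.+1).
    rewrite /Usc /Mi -mulrDl; move: (_ + _) => J; rewrite !exprS.
    have si : sc i'.1 != 0 by rewrite gt_eqF.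
    have : sc i'.1 ^+ n != 0 by rewrite expf_neq0.
    move: (sc i'.1 ^+ m') (sc i'.1 ^+ n) => a b b0; field.
    by rewrite b0 si.
  rewrite [leRHS]mulrCA; apply: ler_pM.
  - by rewrite exprn_ge0// ltW.
  - by rewrite addr_ge0 ?Mi_ge0// divr_ge0 ?exprn_ge0 ?(ltW s'0)//; apply: Rintegral_ge0 => y /(Aset_sub (pd_ca pdP)); exact: g0.
  - by rewrite lerXn2r ?nnegrE ?(ltW s0) ?(ltW s'0)// sc_le.
  rewrite mulrDr; apply: lerD; first by rewrite ler_peMl ?Mi_ge0// exprn_ege1// ler1n.
  by apply: Mi_comparable => //; exact: sc_ge4.
have C3s : 0 <= C3 * sc K ^+ m by rewrite mulr_ge0// exprn_ge0// ltW.
under eq_bigr do rewrite -mulr_sumr; rewrite -mulr_sumr.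
have eR (a b c d : R) : a * b * c * d = b * c * (a * d) by ring.
rewrite [leRHS]eR; apply: ler_wpM2l => //.
have -> : \sum_(i' <- t') \sum_(i <- t) (Mi i' g + Mi i g) =
    (size t)%:R * (\sum_(i' <- t') Mi i' g) + (size t')%:R * \sum_(i <- t) Mi i g.
  under eq_bigr do rewrite big_split /= big_const_seq count_predT iter_addr_0 -mulr_natl.
  rewrite big_split /= -mulr_sumr big_const_seq count_predT iter_addr_0.
  by rewrite -[(\sum_(i <- t) Mi i g) *+ _]mulr_natl.
rewrite mulrDr; apply: lerD.
  by apply: ler_wpM2r; [apply: sumr_ge0 => j _; exact: Mi_ge0|rewrite ler_nat].
by apply: ler_wpM2r; [apply: sumr_ge0 => j _; exact: Mi_ge0|rewrite ler_nat].
Qed.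

(** Close enough to Omega no active cell is coarser than k1, so that each one reads f at its own
    scale. *)
Lemma FK_le : exists2 C1 : R, 0 <= C1 & forall f, loc_integrable Omega f ->
  forall K x, k1 <= K -> near_to Omega (sc k1) x ->
  `|FK K f x| <= C1 * TK K (fun y => `|f y|) x.
Proof.
have [Aw Aw1 HAw] := wt_le; have C0 := pd_C pdP.
have Aw0 : 0 <= Aw by exact: le_trans Aw1.
exists (Aw * C) => [|f lf K x kK nx]; first exact: mulr_ge0.
have [t [ut st tB /nbhs_singleton[w1 ->]]] := FK_near K x.
rewrite (TK_list _ ut tB) (le_trans (ler_norm_sum _ _ _))// mulr_sumr.
rewrite big_seq [leRHS]big_seq; apply: ler_sum => i /tB Bi.
have ki : k1 <= i.1.
  case: Bi => _ _ [->//|[_ ni]]; rewrite leNgt; apply/negP => ik; apply: ni.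
  by apply: near_to_le nx; exact: sc_le (ltW ik).
rewrite normrM -mulrA; apply: ler_pM => //.
apply: (le_trans (pd_le pdP lf ki (Bset_cell Bi))).
by rewrite /Mi -!mulrA [X in _ * X]mulrC.
Qed.

Lemma FK_lin K f f' (a : R) : locint Omega f -> locint Omega f' ->
  FK K (fun y => a * f y + f' y) = fun x => a * FK K f x + FK K f' x.
Proof.
move=> fi fi'; apply/funext => x.
have [t [ut st tB /nbhs_singleton[w1 H]]] := FK_near K x; rewrite !H.
rewrite mulr_sumr -big_split /= big_seq [RHS]big_seq; apply: eq_bigr => i /tB Bi.
by rewrite (pd_lin pdP _ fi fi' (Bset_cell Bi)) mulrDr mulrCA.
Qed.

Lemma FK_zero K f : (forall (S : set E) u, compact S -> S `<=` Omega -> tst S u ->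
  \int[mu]_(y in Omega) (f y * u y) = 0) -> FK K f = fun=> 0.
Proof.
move=> f0; apply/funext => x; have [t [ut st tB /nbhs_singleton[_ ->]]] := FK_near K x.
rewrite big_seq big1// => i /tB Bi.
by rewrite (pd_zero pdP f0 (Bset_cell Bi)) mulr0.
Qed.

Lemma FK_ae K f f' : measurable_fun Omega f -> measurable_fun Omega f' ->
  {ae mu, forall x, Omega x -> f x = f' x} -> FK K f = FK K f'.
Proof. by move=> mf mf' ff'; rewrite /FK (pd_ae pdP mf mf' ff'). Qed.

Lemma loc_integrable_lin f f' (a : R) : loc_integrable Omega f -> loc_integrable Omega f' ->
  loc_integrable Omega (fun y => a * f y + f' y).
Proof.
move=> lf lf'; split.
  apply: measurable_funD; last by case: lf'.
  by apply: measurable_funM; [exact: measurable_cst|case: lf].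
move=> K cK KO; have mK : measurable K.
  by apply: closed_measurable_rV; apply: compact_closed.
have i1 := loc_integ mK cK KO lf mO; have i2 := loc_integ mK cK KO lf' mO.
by apply: integ_fin; apply: integD => //; exact: integZ.
Qed.

Lemma loc_integrable_cst (a : R) : loc_integrable Omega (fun=> a).
Proof.
split; first exact: measurable_cst.
move=> K cK _; have mK : measurable K.
  by apply: closed_measurable_rV; apply: compact_closed.
have [r r0 Kr] := compact_ccube cK.
apply: integ_fin; apply: (integ_sub mK (measurable_ccube 0 r) Kr).
apply: (@integ_bounded _ _ _ _ `|a|) => //; first exact: measurable_ccube.
exact: mu_ccube_fin.
Qed.

Lemma FK_cst K (a : R) : FK K (fun=> a) = fun=> a.
Proof.
apply/funext => x; have [t [ut st tB /nbhs_singleton[w1 ->]]] := FK_near K x.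
rewrite -[RHS]mul1r -w1 mulr_suml big_seq [RHS]big_seq; apply: eq_bigr => i /tB Bi.
by rewrite (pd_cst pdP _ (Bset_cell Bi)).
Qed.

(** FK reproduces constants, so [FK_le] can be applied to h - h(x), which is at most w on all the
    sets read at x. *)
Lemma FK_approx : exists2 C4 : R, 0 <= C4 & forall h, loc_integrable Omega h ->
  forall K x (w : R), k1 <= K -> Omega x -> 0 <= w ->
  (forall y, `|y - x| <= (Ca + 1) * sc K -> Omega y -> `|h y - h x| <= w) ->
  `|FK K h x - h x| <= C4 * w.
Proof.
have [C1 C10 H1] := FK_le; have Ca0 := pd_Ca pdP; have ca0 := pd_ca pdP.
pose V := (3 * Ca) ^+ n.+1.
have V0 : 0 <= V by rewrite exprn_ge0// mulr_ge0// ltW.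
exists (C1 * ((5 * 6 ^ n.+1)%:R * V)) => [|h lh K x w kK Ox w0 Hw]; first by nng.
have lc := loc_integrable_cst (- h x).
have nx : near_to Omega (sc k1) x by exists x => //; rewrite subrr normr0 sc_gt0.
have e : FK K h x - h x = FK K (fun y => 1 * h y + (- h x)) x.
  by rewrite (FK_lin _ _ (loc_locint mO lh) (loc_locint mO lc)) FK_cst mul1r.
rewrite e (le_trans (H1 _ (loc_integrable_lin 1 lh lc) K x kK nx))// -!mulrA.
apply: ler_wpM2l => //.
have [t [ut st tB _]] := FK_near K x; rewrite (TK_list _ ut tB).
apply: (@le_trans _ _ (\sum_(i <- t) V * w)); last first.
  rewrite big_const_seq count_predT iter_addr_0 -[leLHS]mulr_natl.
  by apply: ler_wpM2r; [exact: mulr_ge0|rewrite ler_nat].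
rewrite big_seq [leRHS]big_seq; apply: ler_sum => i /tB Bi.
have s0 := sc_gt0 i.1; have iK := Bset_Omega Ox Bi.
rewrite /Mi ler_pdivrMr ?exprn_gt0//.
have mA := @measurable_Aset R n Omega Ca ca i.
have fA : (mu (A i) <= ((3 * (Ca * sc i.1)) ^+ n.+1)%:E)%E.
  apply: le_trans (mu_ccube (ctr i.1 i.2) (mulr_gt0 Ca0 s0)).
  by apply: le_lebesgue_outer => y [].
have iA := integ_A i (loc_integrable_lin 1 lh lc).
have bA y : A i y -> `|1 * h y + - h x| <= w.
  move=> Ay; rewrite mul1r; apply: Hw; last exact: Aset_sub Ay.
  case: Ay => yc _; case: Bi => xc _ _; rewrite iK in yc xc.
  rewrite (le_trans (ler_distD (ctr i.1 i.2) _ _))// iK [X in _ + X]distrC.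
  by rewrite mulrDl mul1r lerD.
have fin : mu (A i) \is a fin_num.
  by rewrite ge0_fin_numE//; apply: (le_lt_trans fA); rewrite ltry.
apply: (@le_trans _ _ (\int[mu]_(y in A i) w)).
  apply: le_Rint => //; first exact: integ_norm.
  apply: (@integ_bounded _ _ _ _ w) => //; first by rewrite ltey_eq fin.
  by move=> y _; rewrite ger0_norm.
rewrite Rintegral_cst// mulrC -[leRHS]mulrAC; apply: ler_wpM2r => //.
by rewrite /V -exprMn -mulrA -lee_fin fineK.
Qed.

End extension_operator.

(** * Lists of grid points within a given number of cells *)

Section wide_lists.
Context {R : realType} {n : nat}.
Local Notation E := 'rV[R]_n.+1.
Local Notation G := 'rV[int]_n.+1.
Local Notation sc := (@sc R).
Implicit Types (k : int) (j : G) (x y : E).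

Definition jw (w : nat) k y : seq G :=
  [seq \row_i (Num.floor ((sc k)^-1 * y ord0 i) - w%:Z + (f i : nat)%:Z) |
    f : {ffun 'I_n.+1 -> 'I_(w + w).+2} <- enum {: {ffun 'I_n.+1 -> 'I_(w + w).+2}}].

Lemma size_jw w k y : size (jw w k y) = ((w + w).+2 ^ n.+1)%N.
Proof. by rewrite size_map -cardE card_ffun !card_ord. Qed.

Lemma jw_mem w k j y : `|y - ctr k j| <= w%:R * sc k -> j \in jw w k y.
Proof.
move=> yj; have k0 := @sc_gt0 R k.
have H i : 0 <= j ord0 i - (Num.floor ((sc k)^-1 * y ord0 i) - w%:Z) < (w + w).+2%:Z.
  set u := (sc k)^-1 * y ord0 i.
  have uj : `|u - (j ord0 i)%:~R| <= w%:R.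
    have -> : u - (j ord0 i)%:~R = (sc k)^-1 * (y - ctr k j) ord0 i.
      by rewrite !mxE mulrBr mulKf ?lt0r_neq0.
    rewrite normrM gtr0_norm ?invr_gt0// mulrC ler_pdivrMr//.
    by rewrite (le_trans (normr_coord _ _)).
  have f1 := ge_floor u; have f2 := floorD1_gt u; rewrite intrD /= in f2.
  move: uj; rewrite ler_norml => /andP[u1 u2].
  have H1 : (Num.floor u)%:~R - w%:R <= (j ord0 i)%:~R :> R by lra.
  have H2 : (j ord0 i)%:~R < (Num.floor u)%:~R + w%:R + 1 :> R by lra.
  move: (Num.floor u) H1 H2 => F H1 H2.
  have H1' : F - w%:Z <= j ord0 i by rewrite -(ler_int R) intrB.
  have H2' : j ord0 i < F + w%:Z + 1 by rewrite -(ltr_int R) !intrD.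
  by lia.
apply/mapP; exists [ffun i => inord (absz (j ord0 i - (Num.floor ((sc k)^-1 * y ord0 i) - w%:Z))%R)].
  by rewrite mem_enum.
apply/rowP => i; rewrite !mxE ffunE; have /andP[H1 H2] := H i.
rewrite inordK; last by rewrite -ltz_nat gez0_abs.
by rewrite gez0_abs// addrC subrK.
Qed.

Lemma sc_addn k (p : nat) : sc (k + p%:Z) = sc k / 2 ^+ p.
Proof.
elim: p => [|p IH]; first by rewrite addr0 divr1.
by rewrite -addn1 PoszD addrA scS IH addn1 exprS invfM -mulrA [_ * 2^-1]mulrC.
Qed.

End wide_lists.

(** * Bounded overlap of the sets read by the cells *)

Section overlap.
Context {R : realType} {n : nat}.
Local Notation E := 'rV[R]_n.+1.
Local Notation G := 'rV[int]_n.+1.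
Local Notation I := (int * G)%type.
Local Notation mu := (@lebesgue_rV R n).
Local Notation sc := (@sc R).
Local Notation sc_gt0 := (@sc_gt0 R).
Local Notation sc_le := (@sc_le R).
Variables (Omega : set E) (Ca ca : R).
Hypotheses (oO : open Omega) (O0 : Omega !=set0) (Ca0 : 0 < Ca) (ca0 : 0 < ca).
Implicit Types (k l K : int) (x y z : E) (i : I).
Local Notation A := (Aset Omega Ca ca).
Local Notation B := (Bset Omega).

(** A cell i not of scale K has a point outside Omega within (Ca + 1) * 2^-i.1 of y, whereas y in
    [A i'] is at distance at least ca * 2^-i'.1 from the complement. So the scales seen from y,
    apart from K, are comparable, and each of them has boundedly many cells. *)
Lemma overlap_bound : exists N2 : nat, forall K y (U : seq I), uniq U ->
  (forall i, i \in U -> B K i !=set0) -> (size [seq i <- U | y \in A i] <= N2)%N.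
Proof.
pose w := (Num.truncn Ca).+1.
have Cw : Ca <= w%:R by exact: ltW (truncnS_gt _).
pose L0 := (Num.truncn ((Ca + 1) / ca)).+1.
have HL : (Ca + 1) / ca < 2 ^+ L0.
  apply: (lt_le_trans (truncnS_gt _)); rewrite -natrX ler_nat.
  exact: ltnW (ltn_expl _ _).
clearbody w L0.
exists ((L0 + L0).+2 * (w + w).+2 ^ n.+1)%N => K y U uU BU.
pose V := [seq i <- U | y \in A i].
have VP i : i \in V -> [/\ i \in U, A i y & B K i !=set0].
  by rewrite mem_filter => /andP[/set_mem Ai iU]; split=> //; exact: BU.
have cmp i i' : i \in V -> i' \in V -> i.1 != K -> i.1 <= i'.1 + L0%:Z.
  move=> /VP[_ [yi _] [x Bx]] /VP[_ [_ ii'] _] iK; case: Bx => xc _ [/eqP|[_ nx]].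
    by rewrite (negbTE iK).
  rewrite leNgt; apply/negP => lt; apply: ii'; exists x.
    by move=> Ox; apply: nx; exists x => //; rewrite subrr normr0 sc_gt0.
  have xy : `|x - y| <= (Ca + 1) * sc i.1.
    rewrite (le_trans (ler_distD (ctr i.1 i.2) _ _))// addrC mulrDl mul1r lerD//.
    by rewrite distrC.
  rewrite distrC (le_lt_trans xy)//.
  have : sc i.1 <= sc (i'.1 + L0%:Z) by apply: sc_le; exact: ltW.
  rewrite sc_addn => s1; have s0 := sc_gt0 i'.1; have p0 : 0 < 2 ^+ L0 :> R by rewrite exprn_gt0.
  rewrite ltr_pdivrMr// in HL.
  have c10 : 0 < Ca + 1 by rewrite addr_gt0.
  apply: (le_lt_trans (ler_wpM2l (ltW c10) s1)).
  by rewrite mulrA ltr_pdivrMr// [ltRHS]mulrAC ltr_pM2r// [ltRHS]mulrC.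
suff [k0 Hk] : exists k0 : int, forall i, i \in V -> i.1 = K \/ k0 <= i.1 <= k0 + (L0 + L0)%:Z.
  pose ks := K :: [seq k0 + a%:Z | a : nat <- iota 0 (L0 + L0).+1].
  pose W := [seq (k, j) | k <- ks, j <- jw w k y].
  have -> : ((L0 + L0).+2 * (w + w).+2 ^ n.+1)%N = size W.
    rewrite /W size_allpairs_dep.
    have H (t : seq int) : sumn [seq size (jw w k y) | k <- t] = (size t * (w + w).+2 ^ n.+1)%N.
      by elim: t => //= k t ->; rewrite size_jw mulSn.
    by rewrite H /= size_map size_iota.
  apply: uniq_leq_size; first by rewrite filter_uniq.
  move=> -[k j] iV; have [_ [yi _] _] := VP _ iV; apply/allpairsPdep; exists k, j; split=> //.
    rewrite /ks inE; have [kE|/andP[k1 k2]] := Hk _ iV; first by rewrite (kE : k = K) eqxx.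
    rewrite /= in k1 k2.
    apply/orP; right; apply/mapP; exists (absz (k - k0)%R).
      by rewrite mem_iota /= add0n; lia.
    by rewrite gez0_abs ?subr_ge0//; lia.
  apply: jw_mem; rewrite (le_trans yi)//=.
  by rewrite ler_wpM2r// ltW// sc_gt0.
case VE : [seq i <- V | i.1 != K] => [|i1 V'].
  exists 0 => i iV; left; apply/eqP; apply/negPn/negP => iK.
  have : i \in [seq i <- V | i.1 != K] by rewrite mem_filter iK.
  by rewrite VE.
have : i1 \in [seq i <- V | i.1 != K] by rewrite VE mem_head.
rewrite mem_filter => /andP[i1K i1V].
exists (i1.1 - L0%:Z) => i iV; have [->|iK] := eqVneq i.1 K; first by left.
right; have c1 := cmp _ _ iV i1V iK; have c2 := cmp _ _ i1V iV i1K.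
by rewrite lerBlDr c2 PoszD addrA subrK c1.
Qed.

Lemma measurable_Bset K i : measurable (B K i).
Proof.
have no r : measurable (near_to Omega r).
  by apply: open_measurable_rV; rewrite openE => x; exact: near_to_open.
have mc := measurable_ccube (ctr i.1 i.2) (sc i.1).
have e : [set x | `|x - ctr i.1 i.2| <= sc i.1] = ccube (ctr i.1 i.2) (sc i.1) by [].
have [iK|iK] := pselect (i.1 = K).
  rewrite (_ : B K i = ccube (ctr i.1 i.2) (sc i.1) `&` near_to Omega (5 * sc i.1)).
    by apply: measurableI; [exact: mc|exact: no].
  by apply/seteqP; split => [x []//|x [? ?]]; split=> //; left.
have [lt|nlt] := pselect (i.1 < K); last first.
  rewrite (_ : B K i = set0); first exact: measurable0.
  by apply/seteqP; split => [x [_ _ [//|[]//]]|].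
rewrite (_ : B K i = (ccube (ctr i.1 i.2) (sc i.1) `&` near_to Omega (5 * sc i.1)) `&`
    ~` near_to Omega (sc i.1)).
  apply: measurableI; last by apply: measurableC; exact: no.
  by apply: measurableI; [exact: mc|exact: no].
by apply/seteqP; split => [x [xc nx [//|[_ nn]]]//|x [[? ?] ?]]; split=> //; right.
Qed.

Lemma Bset_family (K : int) (r : R) : 0 < r -> exists U : seq I, [/\ uniq U,
  forall i, i \in U -> B K i !=set0 & forall i x, ccube 0 r x -> B K i x -> i \in U].
Proof.
move=> r0; have [y Oy] := O0.
have [L0 HL] := @sc_unbounded R (r + `|y|).
have near_L k x : k <= L0 -> ccube 0 r x -> near_to Omega (sc k) x.
  move=> kL; rewrite /ccube /= subr0 => xr; exists y => //.
  rewrite (le_lt_trans (ler_normB _ _))//; apply: lt_le_trans (sc_le kL).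
  by apply: le_lt_trans HL; rewrite lerD2r.
pose L := if L0 <= K then L0 else K.
have LK : L <= K by rewrite /L; case: ifP.
have LL0 : L <= L0 by rewrite /L; case: ifP => // /negbT; rewrite -ltNge => /ltW.
pose w := (Num.truncn (r / sc K + 1)).+1.
have Hw : r / sc K + 1 <= w%:R by exact: ltW (truncnS_gt _).
pose W := [seq (k, j) | k <- [seq L + a%:Z | a : nat <- iota 0 (absz (K - L)%R).+1], j <- jw w k (0 : E)].
exists (undup [seq i <- W | `[< B K i !=set0 >]]); split; first exact: undup_uniq.
  by move=> i; rewrite mem_undup mem_filter => /andP[/asboolP].
move=> i x xr Bx; rewrite mem_undup mem_filter; apply/andP; split.
  by apply/asboolP; exists x.
have iK := Bset_le Bx.
have Li : L <= i.1.
  case: Bx => _ _ [->//|[_ nx]]; rewrite leNgt; apply/negP => iL; apply: nx.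
  by apply: near_L => //; rewrite (le_trans (ltW iL)).
case: i Bx iK Li => k j [/= xc _ _] kK Lk; apply/allpairsPdep; exists k, j; split=> //.
  apply/mapP; exists (absz (k - L)%R); first by rewrite mem_iota /= add0n; lia.
  by rewrite gez0_abs ?subr_ge0//; lia.
apply: jw_mem; rewrite (le_trans (ler_distD x _ _))//.
have s0 := sc_gt0 k; have sK := sc_gt0 K; have sKk := sc_le kK.
move: xr; rewrite /ccube /= distrC => xr.
rewrite (le_trans (lerD xr xc))//; apply: (le_trans (_ : _ <= (r / sc K + 1) * sc k)).
  rewrite mulrDl mul1r lerD2r -mulrA ler_peMr ?(ltW r0)//.
  by rewrite mulrC ler_pdivlMr// mul1r.
by rewrite ler_wpM2r// ltW.
Qed.

Lemma integ_congr (D : set E) (f g : E -> R) : measurable D -> (forall x, D x -> f x = g x) ->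
  integ D g -> integ D f.
Proof.
move=> mD fg ig; apply: (integ_le mD _ ig); last by move=> x Dx; rewrite fg.
apply: eq_measurable_fun (integ_measurable ig) => x /set_mem Dx.
by rewrite fg.
Qed.

Let mO : measurable Omega. Proof. exact: open_measurable_rV. Qed.

Lemma mu_Bset_le K i D : measurable D -> (mu (B K i `&` D) <= ((3 * sc i.1) ^+ n.+1)%:E)%E.
Proof.
move=> mD; apply: le_trans (mu_ccube (ctr i.1 i.2) (sc_gt0 i.1)).
by apply: le_lebesgue_outer => x [[]].
Qed.

Lemma sum_Aset_le : exists2 N2 : nat, (0 < N2)%N & forall (v : E -> R) K (U : seq I) (S : set E),
  measurable S -> integ S v -> (forall y, S y -> 0 <= v y) -> uniq U ->
  (forall i, i \in U -> B K i !=set0 /\ A i `<=` S) ->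
  \sum_(i <- U) \int[mu]_(y in A i) v y <= N2%:R * \int[mu]_(y in S) v y.
Proof.
have [N2 HN2] := overlap_bound; exists N2.+1 => // v K U S mS iv v0 uU HU.
have mA i : measurable (A i) by exact: measurable_Aset.
have mi i : measurable_fun S (\1_(A i) : E -> R).
  by apply: (@measurable_funS _ _ _ _ setT) => //; exact: measurable_indic.
have b1 i x : `|(\1_(A i) : E -> R) x| <= 1.
  by rewrite indicE; case: (_ \in _); rewrite ?normr1 ?normr0.
have i1 i : integ S (fun y => v y * \1_(A i) y) by apply: (integM mS iv (mi i)) => x _; exact: b1.
have e i : i \in U -> \int[mu]_(y in A i) v y = \int[mu]_(y in S) (v y * \1_(A i) y).
  move=> /HU[_ AS].
  have iA := integ_sub (mA i) mS AS iv.
  have [|_ ->] := integ_supp mS (mA i) AS iA (integ_measurable iv) (mi i) (b1 i).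
    by move=> x _ xA; rewrite indicE memNset.
  by apply: eq_Rintegral => y Ay; rewrite indicE Ay mulr1.
rewrite big_seq (eq_bigr _ e) -big_seq -Rintegral_sum// -RintZ//.
apply: le_Rint => //; [exact: integ_sum|exact: integZ|].
move=> y Sy; rewrite -mulr_sumr mulrC; apply: ler_wpM2r; first exact: v0.
rewrite (eq_bigr (fun i => (y \in A i)%:R)); last by move=> i _; rewrite indicE.
rewrite -natr_sum ler_nat; apply: leq_trans (leqnSn _).
have := HN2 K y U uU (fun i iU => (HU i iU).1).
by rewrite size_filter -sum1_count big_mkcond.
Qed.

(** The measure of a cell cancels the normalization of [Mi], then the overlap is bounded. S stands
    for any set containing what the cells active on D read; it will be a ball, an inner set or a
    collar. *)
Lemma TK_integ : exists2 C5 : R, 0 <= C5 & forall (v : E -> R) K r (D S : set E),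
  0 < r -> measurable D -> D `<=` ccube 0 r -> measurable S -> integ S v ->
  (forall y, S y -> 0 <= v y) ->
  (forall i x, B K i x -> D x -> A i `<=` S) ->
  integ D (TK Omega Ca ca K v) /\
  \int[mu]_(x in D) TK Omega Ca ca K v x <= C5 * \int[mu]_(y in S) v y.
Proof.
have [N2 N20 HN2] := sum_Aset_le; exists (3 ^+ n.+1 * N2%:R).
  by rewrite mulr_ge0 ?exprn_ge0.
move=> v K r D S r0 mD Dr mS iv v0 AS.
have [U [uU HU UD]] := Bset_family K r0.
pose V := [seq i <- U | `[< exists2 x, D x & B K i x >]].
have VU i : i \in V -> B K i !=set0 /\ A i `<=` S.
  by rewrite mem_filter => /andP[/asboolP[x Dx Bx] iU]; split; [exists x|exact: AS Bx Dx].
have uV : uniq V by rewrite filter_uniq.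
have mB i : measurable (B K i) by exact: measurable_Bset.
have fB i : (mu (B K i) < +oo)%E.
  have := mu_Bset_le K i measurableT; rewrite setIT => /le_lt_trans; apply.
  by rewrite ltry.
have eD x : D x -> TK Omega Ca ca K v x = \sum_(i <- V) Mi Omega Ca ca i v * \1_(B K i) x.
  move=> Dx; rewrite /TK (lfsumE uV); last first.
    move=> i iV; rewrite memNset ?mul0r// => Bx; move: iV; rewrite mem_filter (UD _ _ (Dr _ Dx) Bx) andbT.
    by move=> /negP; apply; apply/asboolP; exists x.
  by apply: eq_bigr => i _; rewrite indicE mulrC.
have iB i : integ D (\1_(B K i) : E -> R).
  by apply: (integ_sub mD measurableT (@subsetT _ _)); exact: integ_indic.
have iBM i : integ D (fun x => Mi Omega Ca ca i v * \1_(B K i) x) by exact: integZ.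
split; first by apply: integ_congr eD _ => //; exact: integ_sum.
rewrite (_ : \int[mu]_(x in D) _ = \int[mu]_(x in D) \sum_(i <- V) Mi Omega Ca ca i v * \1_(B K i) x); last first.
  by apply: eq_Rintegral => x /set_mem; exact: eD.
rewrite Rintegral_sum// -mulrA; apply: le_trans (ler_wpM2l _ (HN2 v K V S mS iv v0 uV VU)); last exact: exprn_ge0.
rewrite mulr_sumr big_seq [leRHS]big_seq; apply: ler_sum => i /VU[_ AiS].
rewrite RintZ//.
have -> : \int[mu]_(x in D) \1_(B K i) x = fine (mu (B K i `&` D)).
  by rewrite /Rintegral integral_indic.
have s0 := sc_gt0 i.1.
have m1 : fine (mu (B K i `&` D)) <= (3 * sc i.1) ^+ n.+1.
  rewrite -lee_fin fineK; first exact: mu_Bset_le.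
  by rewrite ge0_fin_numE// (le_lt_trans (mu_Bset_le K i mD))// ltry.
have I0 : 0 <= \int[mu]_(y in A i) v y by apply: Rintegral_ge0 => y /AiS; exact: v0.
rewrite /Mi mulrAC ler_pdivrMr ?exprn_gt0// mulrC -[leRHS]mulrAC -exprMn.
exact: ler_wpM2r.
Qed.

End overlap.

(** * Passage to the limit *)

Section limits.
Context {R : realType} {n : nat}.
Local Notation E := 'rV[R]_n.+1.
Local Notation mu := (@lebesgue_rV R n).
Implicit Types (D : set E) (F : nat -> E -> R) (x : E).

(* The upper limit, so that measurability does not depend on convergence. *)
Definition llim F x : R := fine (limn_esup (fun p => (F p x)%:E)).

Lemma llimE F x (l : R) : F ^~ x @ \oo --> l -> llim F x = l.
Proof.
move=> Fl; rewrite /llim; have H : ((F p x)%:E @[p --> \oo] --> l%:E)%E.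
  by apply: cvg_EFin => //; exact: nearW.
by rewrite (cvg_limn_einf_sup H).2.
Qed.

Lemma llim_stable F x (p0 : nat) : (forall p, (p0 <= p)%N -> F p.+1 x = F p x) ->
  llim F x = F p0 x.
Proof.
move=> H; apply: llimE; have e p : (p0 <= p)%N -> F p x = F p0 x.
  elim: p => [|p IH]; first by rewrite leqn0 => /eqP ->.
  by rewrite leq_eqVlt => /predU1P[->//|]; rewrite ltnS => p0p; rewrite H// IH.
have : \forall p \near \oo, F p0 x = F p x by exists p0 => // p /= ?; rewrite (e p).
by move=> /near_eq_cvg/cvg_trans; apply; exact: cvg_cst.
Qed.

Lemma measurable_llim D F : (forall p, measurable_fun D (F p)) -> measurable_fun D (llim F).
Proof.
move=> mF; apply: (@measurableT_comp _ _ _ _ _ _ fine); first exact: fine_measurable.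
by apply: measurable_fun_limn_esup => p; apply/measurable_EFinP.
Qed.

(** Completeness of L^1 for summable increments: the series of |F p.+1 - F p| is integrable, so F
    converges almost everywhere and is dominated, hence converges in L^1. *)
Lemma L1_lim D F (c : nat -> R) (M : R) : measurable D -> (forall p, integ D (F p)) ->
  (forall p, \int[mu]_(x in D) `|F p.+1 x - F p x| <= c p) ->
  (forall p, \sum_(k < p) c k <= M) ->
  [/\ {ae mu, forall x, D x -> F ^~ x @ \oo --> llim F x}, integ D (llim F) &
      \int[mu]_(x in D) `|F p x - llim F x| @[p --> \oo] --> (0 : R)].
Proof.
move=> mD iF Fc cM.
have id p : integ D (fun x => F p.+1 x - F p x) by exact: integB.
have ind p : integ D (fun x => `|F p.+1 x - F p x|) by exact: integ_norm.
pose h x := (\sum_(p <oo) `|F p.+1 x - F p x|%:E)%E.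
have h0 x : (0 <= h x)%E by apply: nneseries_ge0 => p _ _; rewrite lee_fin.
have mh : measurable_fun D h.
  by apply: ge0_emeasurable_sum => [p x Dx _|p _]; [rewrite lee_fin|
    apply/measurable_EFinP; exact: integ_measurable].
have ih : mu.-integrable D h.
  apply/integrableP; split=> //; under eq_integral do rewrite gee0_abs//.
  rewrite integral_nneseries; [|exact: mD|by move=> p; apply/measurable_EFinP; exact: integ_measurable|by []].
  apply: (@le_lt_trans _ _ M%:E); last exact: ltry.
  apply: lime_le.
    by apply: is_cvg_nneseries => p _ _; apply: integral_ge0 => x _; rewrite lee_fin.
  apply: nearW => p; rewrite big_mkord; apply: le_trans (_ : (\sum_(k < p) (c k)%:E <= _)%E).
    apply: lee_sum => k _; apply: le_trans (_ : ((c k)%:E <= _)%E) => //.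
    by rewrite -(fineK (integrable_fin_num mD (integ_integrable (ind k)))) lee_fin Fc.
  by rewrite sumEFin lee_fin.
have hle x p : (\sum_(k < p) `|F k.+1 x - F k x|%:E <= h x)%E.
  have := @nneseries_lim_ge R (fun k => `|F k.+1 x - F k x|%:E) xpredT 0%N p.
  rewrite big_mkord; apply => k _; by rewrite lee_fin.
have Fb x p : (`|F p x|%:E <= `|F 0%N x|%:E + h x)%E.
  apply: le_trans (leeD2l _ (hle x p)); rewrite sumEFin -EFinD lee_fin.
  have := @telescope_sumr R 0 p (fun k => F k x) (leq0n p); rewrite big_mkord => e.
  rewrite -[F p x](subrK (F 0%N x)) -e addrC (le_trans (ler_normD _ _))// lerD2l.
  exact: ler_norm_sum.
have cv : {ae mu, forall x, D x -> F ^~ x @ \oo --> llim F x}.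
  apply: filterS (integrable_ae mD ih) => x hx Dx; have {}hx := hx Dx.
  suff : cvgn (F ^~ x) by move=> c0; rewrite (llimE c0).
  have : cvgn (series (fun k => F k.+1 x - F k x)).
    apply: normed_cvg; apply: nondecreasing_is_cvgn.
      by apply: nondecreasing_series => k _ _; exact: normr_ge0.
    exists (fine (h x)) => _ [p _ <-]; rewrite /= /series/= big_mkord -lee_fin fineK//.
    by rewrite -sumEFin.
  move=> c1; have : cvgn (fun p => series (fun k => F k.+1 x - F k x) p + F 0%N x).
    by apply: is_cvgD => //; exact: is_cvg_cst.
  rewrite (_ : (fun p => _) = F ^~ x)//; apply/funext => p.
  by rewrite /series /= telescope_sumr// subrK.
have mF p : measurable_fun D (F p) by exact: integ_measurable.
have [] := @dominated_convergence _ E R mu D mD (fun k => EFin \o F k) (EFin \o llim F)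
   (fun x => `|F 0%N x|%:E + h x)%E.
- by move=> k; exact/measurable_EFinP.
- by apply/measurable_EFinP; exact: measurable_llim.
- apply: filterS cv => x cx Dx; apply: cvg_EFin; [exact: nearW|exact: cx].
- apply: integrableD => //; have [H] := integ_norm mD (iF 0%N); exact: H.
- by apply: aeW => x p _; exact: Fb.
move=> li H1 _; split; [exact: cv|by split|].
by apply: fine_cvg; apply: cvg_trans H1; apply: near_eq_cvg; exact: nearW.
Qed.

End limits.

(** * Small scales, uniform continuity and geometric sums *)

Section limit_prelim.
Context {R : realType} {n : nat}.
Local Notation E := 'rV[R]_n.+1.
Local Notation mu := (@lebesgue_rV R n).
Local Notation sc := (@sc R).
Local Notation sc_gt0 := (@sc_gt0 R).
Implicit Types (D K Omega : set E) (x y : E) (u f : E -> R).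

Lemma sc_nat (p : nat) : sc p%:Z = 1 / 2 ^+ p.
Proof. by have := @sc_addn R 0 p; rewrite add0r => ->; rewrite /sc oppr0 expr0z. Qed.

Lemma near_sc (b e : R) : 0 < e -> \forall p \near \oo, b * sc p%:Z < e.
Proof.
move=> e0; have b0 : 0 < `|b| + 1 by rewrite ltr_wpDl.
have [k Hk] := @sc_small R _ (divr_gt0 e0 b0).
exists (absz k) => // p /= kp; have := Hk p%:Z; rewrite ltr_pdivlMr// => H.
apply: le_lt_trans (H _); last by rewrite (le_trans (lez_abs k)).
rewrite mulrC ler_wpM2l ?(ltW (sc_gt0 _))// (le_trans (ler_norm _))//.
by rewrite lerDl.
Qed.

Lemma near_int_ge (k : int) : \forall p \near \oo, k <= p%:Z.
Proof. by exists (absz k) => // p /= kp; rewrite (le_trans (lez_abs k)). Qed.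

Lemma uniform_continuity K u (w b : R) : compact K -> continuous u -> 0 < w ->
  \forall p \near \oo, forall x, K x -> forall y, `|y - x| <= b * sc p%:Z -> `|u y - u x| <= w.
Proof.
move=> cK cu w0.
pose P (p : nat) x := forall y, `|y - x| <= b * sc p%:Z -> `|u y - u x| <= w.
apply: (proj1 (compact_near_coveringP K) cK nat \oo P _) => x Kx.
have w2 : 0 < w / 2 by rewrite divr_gt0.
have /cvgrPdist_lt/(_ _ w2) := cu x; rewrite nearE => /nbhs_ballP[e /= e0 He].
have e2 : 0 < e / 2 by rewrite divr_gt0.
exists (ball x (e / 2), [set p : nat | b * sc p%:Z < e / 2]) => /=.
  by split; [exact: nbhsx_ballx|exact: near_sc].
move=> [x' p] /=; rewrite -ball_normE /= => -[xx' bp] y yx'.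
have h1 : `|u x - u x'| < w / 2.
  by apply: He; rewrite -ball_normE /= (lt_trans xx')// ltr_pdivrMr// ltr_pMr// ltr1n.
have h2 : `|u x - u y| < w / 2.
  apply: He; rewrite -ball_normE /= (le_lt_trans (ler_distD x' _ _))//.
  rewrite [ltRHS]splitr ltrD// distrC; exact: le_lt_trans bp.
rewrite (le_trans (ler_distD (u x) _ _))// distrC [leRHS]splitr lerD// ltW//.
Qed.

Lemma integ_continuous u c (r : R) : continuous u -> integ (ccube c r) u.
Proof.
move=> cu; have [C C0 HC] := continuous_bounded_ccube c r cu.
apply: (@integ_bounded _ _ _ _ C); [exact: measurable_ccube|exact: mu_ccube_fin| |exact: HC].
apply: (@measurable_funS _ _ _ _ setT) => //.
exact: continuous_measurable_rV.
Qed.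

Lemma geometric_partial_sums (c : nat -> R) (Q : R) (p0 : nat) : (forall p, 0 <= c p) -> 0 <= Q ->
  (forall p, (p0 <= p)%N -> c p <= Q * sc p%:Z) -> exists M, forall p, \sum_(k < p) c k <= M.
Proof.
move=> c0 Q0 cQ; exists (\sum_(k < p0) c k + Q * (2 * sc p0%:Z)) => p.
have s0 l : 0 <= sc l by exact: ltW (sc_gt0 _).
have [pp0|/ltnW pp0] := leqP p p0.
  rewrite -[\sum_(k < p) _]addr0 lerD ?mulr_ge0//.
  rewrite -[\sum_(k < p) _](big_mkord xpredT) -[\sum_(k < p0) _](big_mkord xpredT).
  rewrite (@big_cat_nat _ _ _ p 0 p0)//= lerDl.
  by apply: sumr_ge0.
rewrite -(subnKC pp0); move: (p - p0)%N => q.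
suff : \sum_(k < p0 + q) c k <= \sum_(k < p0) c k + Q * (2 * sc p0%:Z - 2 * sc (p0 + q)%:Z).
  move=> /le_trans; apply; rewrite lerD2l ler_wpM2l// gerBl mulr_ge0//.
elim: q => [|q IH]; first by rewrite addn0 subrr mulr0 addr0.
rewrite addnS big_ord_recr /= (le_trans (lerD IH (cQ _ (leq_addr _ _))))//.
have -> : sc (p0 + q).+1%:Z = sc (p0 + q)%:Z / 2 by rewrite -addn1 PoszD scS.
rewrite -addrA -mulrDr lerD2l ler_wpM2l//.
have := s0 (p0 + q)%:Z; lra.
Qed.

Lemma ae_zero_norm D f : measurable D -> integ D f -> \int[mu]_(x in D) `|f x| = 0 ->
  {ae mu, forall x, D x -> f x = 0}.
Proof.
move=> mD fi f0; have [ifi] := fi.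
have H : (\int[mu]_(x in D) `|(EFin \o f) x| = 0)%E.
  by have [inf] := integ_norm mD fi; rewrite -(fineK (integrable_fin_num mD inf)); congr EFin.
have := (ae_eq_integral_abs mu mD (measurable_int _ ifi)).1 H.
by apply: filterS => x /= Hx Dx; case: (Hx Dx).
Qed.

End limit_prelim.

(** * Convergence of FK and its limit on Omega *)

Section limit_operator.
Context {R : realType} {n : nat}.
Local Notation E := 'rV[R]_n.+1.
Local Notation G := 'rV[int]_n.+1.
Local Notation I := (int * G)%type.
Local Notation mu := (@lebesgue_rV R n).
Local Notation sc := (@sc R).
Local Notation sc_gt0 := (@sc_gt0 R).
Local Notation sc_ge0 := (@sc_ge0 R).
Local Notation sc_le := (@sc_le R).
Variables (Omega : set E) (m' : nat) (P : (E -> R) -> I -> E -> R) (Ca ca C : R) (k1 : int).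
Hypotheses (oO : open Omega) (O0 : Omega !=set0) (pdP : poly_data Omega m' P Ca ca C k1).
Implicit Types (k l K : int) (x y z : E) (i : I).
Local Notation A := (Aset Omega Ca ca).
Local Notation B := (Bset Omega).
Local Notation FK := (FK Omega P).
Local Notation TK := (TK Omega Ca ca).

Let mO : measurable Omega. Proof. exact: open_measurable_rV. Qed.

(** On a fixed ball the active cells have side at most 2^-L with L independent of K, so that they
    read Omega inside a fixed larger ball. *)
Lemma active_Aset (r : R) : 0 < r -> exists (r' : R) (L : int), 0 < r' /\
  forall K i x, L <= K -> B K i x -> ccube 0 r x ->
    L <= i.1 /\ A i `<=` Omega `&` ccube 0 r'.
Proof.
move=> r0; have [y Oy] := O0; have Ca0 := pd_Ca pdP; have ca0 := pd_ca pdP.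
have [L HL] := @sc_unbounded R (r + `|y|); have sL := sc_gt0 L.
exists (r + (Ca + 1) * sc L), L; split=> [|K i x LK Bx xr].
  by rewrite addr_gt0// mulr_gt0// addr_gt0.
have Li : L <= i.1.
  case: Bx => _ _ [->//|[_ nx]]; rewrite leNgt; apply/negP => iL; apply: nx.
  move: xr; rewrite /ccube /= subr0 => xr; exists y => //.
  rewrite (le_lt_trans (ler_normB _ _))//; apply: lt_le_trans (sc_le (ltW iL)).
  by apply: le_lt_trans HL; rewrite lerD2r.
split=> // z Az; split; first exact: Aset_sub Az.
case: Az => zc _; case: Bx => xc _ _; move: xr; rewrite /ccube /= !subr0 => xr.
have si := sc_gt0 i.1; have siL := sc_le Li.
rewrite -(subrK x z) (le_trans (ler_normD _ _))// addrC lerD//.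
rewrite (le_trans (ler_distD (ctr i.1 i.2) _ _))// mulrDl mul1r lerD//.
  by rewrite (le_trans zc)// ler_wpM2l// ltW.
by rewrite distrC (le_trans xc).
Qed.

Section with_weak_data.
Variables (f : E -> R) (D : seq 'I_n.+1 -> E -> R) (g : E -> R).
Hypotheses (wd : weak_data Omega m'.+1 f D g) (lg : loc_integrable Omega g)
  (gb : forall r, integ (Omega `&` ccube 0 r) g).

Let g0 y : Omega y -> 0 <= g y. Proof. exact: weak_data_g0 wd _. Qed.

Lemma continuous_FK K : continuous (FK K f).
Proof. exact/smooth_continuous/(smooth_FK O0 pdP K (weak_data_f wd)). Qed.

Lemma TK_ball (r : R) : 0 < r -> exists (Q : R) (L : int), 0 <= Q /\
  forall K, L <= K -> integ (ccube 0 r) (TK K g) /\ \int[mu]_(x in ccube 0 r) TK K g x <= Q.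
Proof.
move=> r0; have [r' [L [r'0 HL]]] := active_Aset r0.
have [C5 C50 H5] := TK_integ O0 (pd_Ca pdP) (pd_ca pdP).
have mOB : measurable (Omega `&` ccube 0 r') by apply: measurableI => //; exact: measurable_ccube.
exists (C5 * \int[mu]_(y in Omega `&` ccube 0 r') g y), L; split=> [|K LK].
  by rewrite mulr_ge0//; apply: Rintegral_ge0 => y [/g0].
apply: (H5 g K r (ccube 0 r) (Omega `&` ccube 0 r')) => //; first exact: measurable_ccube.
  by move=> y [/g0].
by move=> i x Bx xr; have [] := HL K i x LK Bx xr.
Qed.

Lemma FK_step_L1 (r : R) : 0 < r -> exists (Q : R) (L : int), 0 <= Q /\
  forall K, L <= K -> \int[mu]_(x in ccube 0 r) `|FK (K + 1) f x - FK K f x| <= Q * sc K.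
Proof.
move=> r0; have [Q [L [Q0 HQ]]] := TK_ball r0; have [C3 C30 H3] := FK_sub_le O0 pdP.
exists (C3 * sc L ^+ m' * (Q + Q)), L; split=> [|K LK].
  by rewrite !mulr_ge0 ?addr_ge0 ?exprn_ge0 ?sc_ge0.
have LK1 : L <= K + 1 by rewrite (le_trans LK)// lerDl.
have [iT1 T1] := HQ _ LK1; have [iT T] := HQ _ LK.
have mc := measurable_ccube (0 : E) r.
have iTT : integ (ccube 0 r) (fun x => TK (K + 1) g x + TK K g x) by exact: integD.
apply: (@le_trans _ _ (\int[mu]_(x in ccube 0 r) (C3 * sc K ^+ m'.+1 * (TK (K + 1) g x + TK K g x)))).
  apply: le_Rint => //; last by move=> x _; exact: H3 wd lg K x.
    by apply: integ_norm => //; apply: integB => //; apply: integ_continuous; exact: continuous_FK.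
  exact: integZ.
rewrite RintZ// RintD//.
have sK := sc_ge0 K; have sL := sc_ge0 L; have sKL := sc_le LK.
have T0 (K' : int) : 0 <= \int[mu]_(x in ccube 0 r) TK K' g x.
  by apply: Rintegral_ge0 => x _; exact: (TK_ge0 O0 pdP).
(* Of the m = m' + 1 powers of 2^-K one is kept, for summability over K; the others are bounded by
   powers of 2^-L. *)
rewrite exprSr -!mulrA; apply: ler_wpM2l => //.
rewrite [leRHS]mulrA [leRHS]mulrC [leLHS]mulrCA; apply: ler_wpM2l => //.
apply: ler_pM; [exact: exprn_ge0|exact: addr_ge0| |exact: lerD].
by apply: lerXn2r; rewrite ?nnegrE.
Qed.

Lemma FK_limit (r : R) : 0 < r ->
  [/\ {ae mu, forall x, ccube 0 r x -> (fun p : nat => FK p%:Z f x) @ \oo --> llim (fun p => FK p%:Z f) x},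
      integ (ccube 0 r) (llim (fun p => FK p%:Z f)) &
      \int[mu]_(x in ccube 0 r) `|FK p%:Z f x - llim (fun p => FK p%:Z f) x| @[p --> \oo] --> (0 : R)].
Proof.
move=> r0; have [Q [L [Q0 HQ]]] := FK_step_L1 r0.
have mc := measurable_ccube (0 : E) r.
have iF (p : nat) : integ (ccube 0 r) (FK p%:Z f).
  by apply: integ_continuous; exact: continuous_FK.
pose c (p : nat) := \int[mu]_(x in ccube 0 r) `|FK p.+1%:Z f x - FK p%:Z f x|.
have [M HM] : exists M, forall p, \sum_(k < p) c k <= M.
  apply: (geometric_partial_sums (c := c) (Q := Q) (p0 := absz L)) => // p; first exact: Rintegral_ge0.
  have eS : p.+1%:Z = p%:Z + 1 by rewrite -addn1 PoszD.
  by move=> Lp; rewrite /c eS; apply: HQ; rewrite (le_trans (lez_abs L)).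
exact: (L1_lim mc iF (c := c) _ HM).
Qed.

End with_weak_data.

(** Approximate f in L^1 on S' by a smooth phi. Uniform continuity makes FK phi close to phi, and FK
    of f - phi is controlled in L^1 through TK. S' is a neighbourhood of S containing all that is
    read from S once p is large. *)
Lemma FK_dense f (r rho : R) : 0 < r -> 0 < rho -> loc_integrable Omega f ->
  \int[mu]_(x in ccube 0 r `&` inn Omega rho) `|FK p%:Z f x - f x| @[p --> \oo] --> (0 : R).
Proof.
move=> r0 rho0 lf; have [C1 C10 H1] := FK_le O0 pdP.
have [C4 C40 H4] := FK_approx oO O0 pdP.
have [C5 C50 H5] := TK_integ O0 (pd_Ca pdP) (pd_ca pdP).
have Ca0 := pd_Ca pdP; have ca0 := pd_ca pdP.
set S := ccube 0 r `&` inn Omega rho; pose S' := ccube (0 : E) (r + 1) `&` inn Omega (rho / 2).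
have rho2 : 0 < rho / 2 by rewrite divr_gt0.
have mS : measurable S by apply: measurableI; [exact: measurable_ccube|exact: measurable_inn].
have mS' : measurable S' by apply: measurableI; [exact: measurable_ccube|exact: measurable_inn].
have SO : S `<=` Omega by move=> x [_]; exact: inn_sub.
have SO' : S' `<=` Omega by move=> x [_]; exact: inn_sub.
have SS' : S `<=` S'.
  move=> x [xr xi]; split; first by move: xr; rewrite /ccube /= => /le_trans; apply; rewrite lerDl.
  by apply: inn_le xi; lra.
have ifS' : integ S' f by apply: loc_integ SO' lf mO => //; exact: compact_inn.
have ifS := integ_sub mS mS' SS' ifS'.
pose f1 x := f x * \1_S' x.
have if1 : integ setT f1.
  split; have -> : EFin \o f1 = (EFin \o f) \_ S'.
    by apply/funext => x; rewrite /f1 /= patchE indicE; case: ifP => _; rewrite ?mulr1 ?mulr0.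
  by apply/(integrable_mkcond _ mS').1; case: ifS'.
apply/cvgrPdist_le => e e0.
pose V := fine (mu (ccube (0 : E) r)); have V0 : 0 <= V by exact: fine_ge0.
have e3 : 0 < e / 3 by rewrite divr_gt0.
have e3e : e / 3 + e / 3 <= e by move: (e0) => e0'; lra.
have C15 : 0 < C1 * C5 + 1 by rewrite ltr_wpDl// mulr_ge0.
have [_ /(_ _ (divr_gt0 e3 C15))[phi [rp [sphi php Hphi]]]] := approximable_integ if1.
have C4V : 0 < C4 * V + 1 by rewrite ltr_wpDl// mulr_ge0.
have cphi := smooth_continuous sphi.
have iphi : integ setT phi by exact: integ_cs cphi php.
have lphi : loc_integrable Omega phi.
  split; first by apply: (@measurable_funS _ _ _ _ setT) => //; exact: continuous_measurable_rV.
  move=> K cK _; have mK : measurable K by apply: closed_measurable_rV; exact: compact_closed.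
  by apply: integ_fin; exact: integ_sub mK measurableT (@subsetT _ _) iphi.
pose h y := -1 * phi y + f y.
have lh : loc_integrable Omega h by exact: loc_integrable_lin.
have ih : integ S' (fun y => `|h y|).
  by apply: integ_norm => //; apply: loc_integ SO' lh mO => //; exact: compact_inn.
have Ih : \int[mu]_(x in S') `|h x| <= e / 3 / (C1 * C5 + 1).
  apply: le_trans Hphi; rewrite (_ : \int[mu]_(x in S') _ = \int[mu]_(x in S') `|f1 x - phi x|).
    apply: Rint_subset => //; apply: integ_norm => //; exact: integB.
  apply: eq_Rintegral => x xS; rewrite /h /f1 indicE xS mulr1 mulN1r addrC//.
have Ih0 : 0 <= \int[mu]_(x in S') `|h x| by exact: Rintegral_ge0.
have uc := @uniform_continuity R n (ccube 0 r) phi (e / 3 / (C4 * V + 1)) (Ca + 1)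
  (@ccube_compact _ _ _ _) cphi (divr_gt0 e3 C4V).
have ns := @near_sc R (Ca + 1) (Num.min 1 (rho / 2)) _.
near=> p.
have Hu : forall x, ccube 0 r x -> forall y, `|y - x| <= (Ca + 1) * sc p%:Z ->
    `|phi y - phi x| <= e / 3 / (C4 * V + 1) by near: p; exact: uc.
have Hs : (Ca + 1) * sc p%:Z < Num.min 1 (rho / 2).
  by near: p; apply: ns; rewrite lt_min ltr01.
have kp : k1 <= p%:Z by near: p; exact: near_int_ge.
rewrite lt_min in Hs; have /andP[Hs1 Hs2] := Hs.
have AS' i x : B p%:Z i x -> S x -> A i `<=` S'.
  move=> Bx Sx z [zc _]; have iK := Bset_Omega (SO _ Sx) Bx.
  case: Bx => xc _ _; case: Sx => xr xi; rewrite iK in zc xc.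
  have zx : `|z - x| <= (Ca + 1) * sc p%:Z.
    rewrite (le_trans (ler_distD (ctr p%:Z i.2) _ _))// [X in _ + X]distrC.
    by rewrite mulrDl mul1r lerD.
  split.
    rewrite /ccube /= in xr *; rewrite (le_trans (ler_distD x _ _))// addrC lerD//.
    exact: le_trans zx (ltW Hs1).
  move=> nz; apply: xi; have := near_toD nz (le_trans zx (ltW Hs2)).
  by rewrite -splitr.
have [iT TT] := H5 (fun y => `|h y|) p%:Z r S S' r0 mS (@subIsetl _ _ _) mS' ih
  (fun y _ => normr_ge0 _) AS'.
have bound x : S x -> `|FK p%:Z f x - f x| <= e / 3 / (C4 * V + 1) * C4 + C1 * TK p%:Z (fun y => `|h y|) x + `|h x|.
  move=> Sx; have Ox := SO _ Sx.
  have fE : f = fun y => 1 * phi y + h y by apply/funext => y; rewrite /h mul1r mulN1r addrA subrr add0r.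
  have -> : FK p%:Z f x - f x = (FK p%:Z phi x - phi x) + FK p%:Z h x - h x.
    have : FK p%:Z f x = FK p%:Z phi x + FK p%:Z h x.
      by rewrite {1}fE (FK_lin O0 pdP _ 1 (loc_locint mO lphi) (loc_locint mO lh)) mul1r.
    have : h x = - phi x + f x by rewrite /h mulN1r.
    move: (FK p%:Z f x) (FK p%:Z phi x) (FK p%:Z h x) (h x) => a b c' d' -> ->; ring.
  rewrite (le_trans (ler_normB _ _))// lerD2r (le_trans (ler_normD _ _))// lerD//.
    rewrite mulrC; apply: (H4 _ lphi _ _ _ kp Ox); first by rewrite ltW// divr_gt0.
    by move=> y yx _; apply: Hu => //; case: Sx.
  by apply: (H1 _ lh _ _ kp); exists x => //; rewrite subrr normr0 sc_gt0.
have iFf : integ S (fun x => `|FK p%:Z f x - f x|).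
  apply: integ_norm => //; apply: integB => //.
  apply: integ_sub mS (measurable_ccube _ _) (@subIsetl _ _ _) _.
  apply: integ_continuous; apply/smooth_continuous/(smooth_FK O0 pdP _).
  exact: loc_locint.
rewrite sub0r normrN ger0_norm; last exact: Rintegral_ge0.
have fS : (mu S < +oo)%E by exact: le_lt_trans (le_lebesgue_outer (@subIsetl _ _ _)) (mu_ccube_fin 0 r).
have icst a : integ S (fun=> a).
  by apply: (@integ_bounded _ _ _ _ `|a|) => //.
have ihS : integ S (fun x => `|h x|) by exact: integ_sub SS' ih.
have iTZ : integ S (fun x => C1 * TK p%:Z (fun y => `|h y|) x) by exact: integZ.
have icT : integ S (fun x => e / 3 / (C4 * V + 1) * C4 + C1 * TK p%:Z (fun y => `|h y|) x) by exact: integD.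
apply: (le_trans (le_Rint mS iFf _ bound)); first exact: integD.
rewrite RintD// RintD// RintZ// Rintegral_cst//.
have hS : \int[mu]_(x in S) `|h x| <= \int[mu]_(x in S') `|h x| by exact: Rint_subset.
have mSV : fine (mu S) <= V.
  apply: fine_le; rewrite ?ge0_fin_numE//; last exact: (le_lebesgue_outer (@subIsetl _ _ _)).
  exact: mu_ccube_fin.
have c1 : e / 3 / (C4 * V + 1) * C4 * fine (mu S) <= e / 3.
  rewrite -mulrA mulrAC ler_pdivrMr// ler_pM2l//.
  by rewrite (le_trans (ler_wpM2l C40 mSV))// lerDl.
have c2 : C1 * \int[mu]_(x in S) TK p%:Z (fun y => `|h y|) x + \int[mu]_(x in S) `|h x| <= e / 3.
  apply: (@le_trans _ _ ((C1 * C5 + 1) * \int[mu]_(x in S') `|h x|)).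
    by rewrite mulrDl mul1r lerD// -mulrA ler_wpM2l.
  by rewrite mulrC -ler_pdivlMr.
by rewrite -addrA (le_trans (lerD c1 c2)).
Unshelve. all: by end_near. Qed.

Lemma inn_exhaust x : Omega x -> exists l : nat, (ccube 0 l.+1%:R `&` inn Omega (sc l%:Z)) x.
Proof.
move=> Ox; have : nbhs x Omega by apply: open_nbhs_nbhs; split.
move=> /nbhs_ballP[e /= e0 He].
suff : \forall l \near \oo, (ccube 0 l.+1%:R `&` inn Omega (sc l%:Z)) x.
  by case=> l _ /(_ l (leqnn l)) H; exists l.
near=> l; split.
  rewrite /ccube /= subr0; apply: (le_trans (_ : _ <= l%:R)); last by rewrite ler_nat.
  near: l; exact: nat_large.
move=> [y Oy xy]; apply: Oy; apply: He; rewrite -ball_normE /=; apply: (lt_le_trans xy).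
by rewrite -[leLHS]mul1r ltW//; near: l; exact: near_sc.
Unshelve. all: by end_near. Qed.

Lemma ae_Omega f f' : (forall (l : nat), {ae mu, forall x, (ccube 0 l.+1%:R `&` inn Omega (sc l%:Z)) x -> f x = f' x}) ->
  {ae mu, forall x, Omega x -> f x = f' x :> R}.
Proof.
move=> H; have : {ae mu, forall x, forall l : nat, (ccube 0 l.+1%:R `&` inn Omega (sc l%:Z)) x -> f x = f' x}.
  exact: ae_foralln.
by apply: filterS => x Hx /inn_exhaust[l]; exact: Hx.
Qed.

Lemma ae_llim f D g : weak_data Omega m'.+1 f D g -> loc_integrable Omega f ->
  loc_integrable Omega g -> (forall r, integ (Omega `&` ccube 0 r) g) ->
  {ae mu, forall x, Omega x -> llim (fun p => FK p%:Z f) x = f x}.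
Proof.
move=> wd lf lg gb; apply: ae_Omega => l; set S := _ `&` _.
have mc := measurable_ccube (0 : E) l.+1%:R.
have mS : measurable S by apply: measurableI; [exact: measurable_ccube|exact: measurable_inn].
have [_ iL L0] := FK_limit wd lg gb (ltr0Sn R l).
have D0 := FK_dense (ltr0Sn R l) (sc_gt0 l%:Z) lf.
have Sc : S `<=` ccube 0 l.+1%:R by exact: subIsetl.
have iLS := integ_sub mS mc Sc iL.
have ifS : integ S f.
  by apply: loc_integ lf mO => //; [exact: compact_inn|move=> x [_]; by apply: inn_sub; exact: sc_gt0].
suff : {ae mu, forall x, S x -> llim (fun p => FK p%:Z f) x - f x = 0}.
  by apply: filterS => x Hx /Hx /eqP; rewrite subr_eq0 => /eqP.
apply: ae_zero_norm => //; first exact: integB.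
apply/eqP; rewrite eq_le Rintegral_ge0 ?andbT//.
have cvgD0 (u v : nat -> R) : u @ \oo --> (0 : R) -> v @ \oo --> (0 : R) ->
    (fun p => u p + v p) @ \oo --> (0 : R).
  by move=> u0 v0; rewrite -[X in _ --> X]addr0; exact: cvgD.
have H := cvgD0 _ _ L0 D0.
rewrite -(cvg_lim (@Rhausdorff R) H); apply: limr_ge; first by apply/cvg_ex; exists 0.
apply: nearW => p.
have iF : integ (ccube 0 l.+1%:R) (FK p%:Z f) by apply: integ_continuous; exact: continuous_FK wd _.
have iFS := integ_sub mS mc Sc iF.
have i1 : integ (ccube 0 l.+1%:R) (fun x => `|FK p%:Z f x - llim (fun p => FK p%:Z f) x|).
  by apply: integ_norm => //; exact: integB.
have i1S := integ_sub mS mc Sc i1.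
have i2 : integ S (fun x => `|FK p%:Z f x - f x|) by apply: integ_norm => //; exact: integB.
apply: (@le_trans _ _ (\int[mu]_(x in S) `|FK p%:Z f x - llim (fun p => FK p%:Z f) x| +
   \int[mu]_(x in S) `|FK p%:Z f x - f x|)); last by rewrite lerD2r; exact: Rint_subset.
rewrite -RintD//; apply: le_Rint => //; [by apply: integ_norm => //; exact: integB|exact: integD|].
move=> x _; rewrite (le_trans (ler_distD (FK p%:Z f x) _ _))// distrC//.
Qed.

(** The fundamental lemma of the calculus of variations: FK f only depends on integrals of f against
    test functions, hence is 0, and it tends to f. *)
Lemma ae_zero_test f : loc_integrable Omega f ->
  (forall S u, compact S -> S `<=` Omega -> tst S u -> \int[mu]_(y in Omega) (f y * u y) = 0) ->
  {ae mu, forall x, Omega x -> f x = 0}.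
Proof.
move=> lf f0; apply: ae_Omega => l; set S := _ `&` _.
have mS : measurable S by apply: measurableI; [exact: measurable_ccube|exact: measurable_inn].
have D0 := FK_dense (ltr0Sn R l) (sc_gt0 l%:Z) lf.
have ifS : integ S f.
  by apply: loc_integ lf mO => //; [exact: compact_inn|move=> x [_]; by apply: inn_sub; exact: sc_gt0].
apply: ae_zero_norm => //.
have e (p : nat) : \int[mu]_(x in S) `|FK p%:Z f x - f x| = \int[mu]_(x in S) `|f x|.
  by rewrite (FK_zero O0 pdP p%:Z f0); apply: eq_Rintegral => x _; rewrite sub0r normrN.
move: D0; rewrite (_ : (fun p => _) = fun=> \int[mu]_(x in S) `|f x|).
  by move=> /cvg_lim <-//; rewrite lim_cst.
by apply/funext => p; exact: e.
Qed.

End limit_operator.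

Lemma absz_le_int (L : int) (p : nat) : (absz L <= p)%N -> L <= p%:Z.
Proof. by move=> Lp; rewrite (le_trans (lez_abs L)). Qed.

(** * Integrability along an exhaustion *)

Section exhaustion.
Context {R : realType} {n : nat}.
Local Notation E := 'rV[R]_n.+1.
Local Notation mu := (@lebesgue_rV R n).
Implicit Types (D A B : set E) (x : E) (f : E -> R).

Lemma integ_setU A B f : measurable A -> measurable B -> measurable_fun setT f ->
  integ A f -> integ (B `\` A) f -> integ (A `|` B) f.
Proof.
move=> mA mB mf iA iB; have mBA : measurable (B `\` A) by exact: measurableD.
apply: integP; first exact: (@measurable_funS _ _ _ _ setT).
have -> : A `|` B = A `|` (B `\` A).
  apply/seteqP; split=> x [Ax|]; [by left| |by left|by move=> []; right].
  by have [?|?] := pselect (A x); [left|right].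
rewrite ge0_integral_setU//; first by apply: lte_add_pinfty; exact: integ_fin.
- apply/measurable_EFinP; apply: measurableT_comp => //.
  exact: (@measurable_funS _ _ _ _ setT).
- by apply/disj_set2P; rewrite setDE setICA setICr setI0.
Qed.

(** Fatou's lemma for |f| cut to the sets Z; f vanishes on what they do not exhaust. *)
Lemma integ_exhaust D f (Z : nat -> set E) (q : R) (p0 : nat) : measurable D ->
  measurable_fun D f -> (forall p, measurable (Z p)) -> (forall p, Z p `<=` Z p.+1) ->
  (forall x, D x -> (forall p, ~ Z p x) -> f x = 0) ->
  (forall p, (p0 <= p)%N -> integ (D `&` Z p) f /\ \int[mu]_(x in D `&` Z p) `|f x| <= q) ->
  integ D f /\ \int[mu]_(x in D) `|f x| <= q.
Proof.
move=> mD mf mZ ZS f0 fq.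
have Zle p p' : (p <= p')%N -> Z p `<=` Z p'.
  move=> /subnKC <-; elim: (p' - p)%N => [|l IH]; first by rewrite addn0.
  by rewrite addnS => x /IH; exact: ZS.
pose h (p : nat) x := (`|f x| * \1_(Z (p0 + p)%N) x)%:E.
have hc x : D x -> h ^~ x @ \oo --> `|f x|%:E.
  move=> Dx; apply: cvg_EFin; first exact: nearW.
  have [[p Zp]|nZ] := pselect (exists p, Z p x).
    have : \forall p' \near \oo, `|f x| = `|f x| * \1_(Z (p0 + p')%N) x.
      exists p => // p' /= pp'; rewrite indicE mem_set ?mulr1//.
      by apply: Zle Zp; exact: leq_trans (leq_addl _ _).
    by move=> /near_eq_cvg/cvg_trans; apply; exact: cvg_cst.
  rewrite f0//; last by move=> p Zp; apply: nZ; exists p.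
  rewrite (_ : _ \o _ = fun=> (0 : R)); first by rewrite normr0; exact: cvg_cst.
  by apply/funext => p /=; rewrite f0 ?normr0 ?mul0r// => p' Zp; apply: nZ; exists p'.
have mnf : measurable_fun D (fun x => `|f x|) by exact: measurableT_comp.
have mh p : measurable_fun D (h p).
  by apply/measurable_EFinP; apply: measurable_funM.
have h0 p x : D x -> (0 <= h p x)%E by move=> _; rewrite lee_fin mulr_ge0.
have hq p : (\int[mu]_(x in D) h p x <= q%:E)%E.
  have [ifp fpq] := fq _ (leq_addr p p0).
  have mDZ : measurable (D `&` Z (p0 + p)%N) by exact: measurableI.
  have [inf] := integ_norm mDZ ifp.
  rewrite (_ : \int[mu]_(x in D) h p x = \int[mu]_(x in D `&` Z (p0 + p)%N) (EFin \o (fun x => `|f x|%R)) x)%E.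
    rewrite -(fineK (integrable_fin_num mDZ inf)) lee_fin; exact: fpq.
  rewrite integral_mkcondr; apply: eq_integral => x _; rewrite /h patchE indicE /=.
  by case: ifP => _; rewrite ?mulr1 ?mulr0.
have H : (\int[mu]_(x in D) `|f x|%:E <= q%:E)%E.
  have := fatou mu mD mh h0.
  have -> : (\int[mu]_(x in D) limn_einf (h ^~ x) = \int[mu]_(x in D) `|f x|%:E)%E.
    apply: eq_integral => x /set_mem Dx.
    by rewrite (cvg_limn_einf_sup (hc x Dx)).1.
  move=> /le_trans; apply; rewrite limn_einf_lim; apply: lime_le; first exact: is_cvg_einfs.
  apply: nearW => p; apply: le_trans (hq p); apply: ereal_inf_lbound.
  by exists p => //=.
have fi : integ D f by apply: integP => //; apply: le_lt_trans H _; rewrite ltry.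
split=> //; have [inf] := integ_norm mD fi.
by rewrite -lee_fin /Rintegral fineK//; exact: (integrable_fin_num mD inf).
Qed.

End exhaustion.

Lemma Rintegral_zero_out (R : realType) (n : nat) (A : set 'rV[R]_n.+1) (f : 'rV[R]_n.+1 -> R) :
  (forall x, ~ A x -> f x = 0) ->
  \int[lebesgue_rV]_x f x = \int[lebesgue_rV]_(x in A) f x.
Proof.
move=> f0; rewrite /Rintegral [in RHS]integral_mkcond; congr fine.
apply: eq_integral => x _; rewrite patchE; case: ifPn => // /negP xA.
by rewrite f0// => Ax; apply: xA; exact/mem_set.
Qed.

(** * Smooth cutoff functions inside Omega *)

Section cutoff.
Context {R : realType} {n : nat}.
Local Notation E := 'rV[R]_n.+1.
Local Notation sc := (@sc R).
Local Notation sc_gt0 := (@sc_gt0 R).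
Implicit Types (x y : E) (Omega : set E).

Lemma phi_ge0 k (j : 'rV[int]_n.+1) x : 0 <= phi k j x.
Proof. by apply: prodr_ge0 => i _; exact: step_sub_ge0. Qed.

(** The sum of the [phi k j] over the cells whose doubled cube lies in Omega; only the finitely many
    centres relevant to the cube of radius r are kept. *)
Lemma interior_cutoff Omega k (r : R) : 0 < r -> exists chi : E -> R,
  [/\ Smooth chi, forall x, 0 <= chi x <= 1, forall x, ~ inn Omega (sc k) x -> chi x = 0 &
      forall x, ccube 0 r x -> inn Omega (4 * sc k) x -> chi x = 1].
Proof.
move=> r0; have k0 := sc_gt0 k.
pose w := (Num.truncn (r / sc k + 1)).+1.
have Hw : r / sc k + 1 <= w%:R by exact: ltW (truncnS_gt _).
pose J := [seq j <- undup (jw w k (0 : E)) | `[< ccube (ctr k j) (sc k + sc k) `<=` Omega >]].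
have uJ : uniq J by rewrite filter_uniq ?undup_uniq.
have xx x : `|x - x| < sc k by rewrite subrr normr0.
have chiE x : \sum_(j <- J) phi k j x = \sum_(j <- jl k x) (j \in J)%:R * phi k j x.
  rewrite -(lfsumE (t := jl k x) (F := fun j => (j \in J)%:R * phi k j x)) ?jl_uniq//; last first.
    by move=> j jx; rewrite (phi_out (xx x) jx) mulr0.
  rewrite (lfsumE (t := J))//; last by move=> j /negbTE ->; rewrite mul0r.
  by rewrite big_seq [RHS]big_seq; apply: eq_bigr => j ->; rewrite mul1r.
exists (fun x => \sum_(j <- J) phi k j x); split.
- by apply: smooth_sum => j; exact: smooth_phi.
- move=> x; rewrite sumr_ge0 => [/=|j _]; last exact: phi_ge0.
  rewrite chiE -[leRHS](sum_phi (xx x)); apply: ler_sum => j _.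
  by case: (_ \in _); rewrite ?mul1r ?mul0r ?phi_ge0.
- move=> x nx; rewrite big_seq big1// => j; rewrite mem_filter => /andP[/asboolP jO _].
  apply: phi_eq0; rewrite leNgt; apply/negP => xj; apply: nx.
  by apply: inn_ccube jO _; exact: ltW.
move=> x xr xi; rewrite chiE -[RHS](sum_phi (xx x)); apply: eq_bigr => j _.
have [jJ|jJ] := boolP (j \in J); first by rewrite mul1r.
rewrite mul0r; apply/esym/phi_eq0; rewrite leNgt; apply: contra jJ => xj.
rewrite mem_filter mem_undup; apply/andP; split.
  apply/asboolP => y; rewrite /ccube /= => yj; apply: contrapT => Oy; apply: xi; exists y => //.
  rewrite (le_lt_trans (ler_distD (ctr k j) _ _))// distrC.
  rewrite distrC [X in _ + X]distrC; apply: (lt_le_trans (ltr_leD xj yj)); lra.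
apply: jw_mem; rewrite (le_trans (ler_distD x _ _))//.
move: xr; rewrite /ccube /= distrC => xr.
apply: (le_trans (lerD xr (ltW xj))); rewrite -ler_pdivrMr// mulrDl divff ?lt0r_neq0//.
Qed.

End cutoff.

(** * Weak derivatives of the limit across the boundary *)

Section weak_derivatives.
Context {R : realType} {n : nat}.
Local Notation E := 'rV[R]_n.+1.
Local Notation G := 'rV[int]_n.+1.
Local Notation I := (int * G)%type.
Local Notation mu := (@lebesgue_rV R n).
Local Notation sc := (@sc R).
Local Notation sc_gt0 := (@sc_gt0 R).
Local Notation sc_ge0 := (@sc_ge0 R).
Local Notation sc_le := (@sc_le R).
Variables (Omega : set E) (m' : nat) (P : (E -> R) -> I -> E -> R) (Ca ca C : R) (k1 : int).
Hypotheses (oO : open Omega) (O0 : Omega !=set0) (pdP : poly_data Omega m' P Ca ca C k1).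
Implicit Types (k l K : int) (x y z : E) (i : I).
Local Notation A := (Aset Omega Ca ca).
Local Notation B := (Bset Omega).
Local Notation FK := (FK Omega P).
Local Notation TK := (TK Omega Ca ca).

Definition outer_set (p : nat) : set E := ~` near_to Omega (5 * sc p%:Z).

(* On [outer_set p], the functions FK no longer depend on K from p on. *)
Definition ext_deriv f (D : seq 'I_n.+1 -> E -> R) s x : R :=
  if x \in Omega then D s x
  else llim (fun (p : nat) y => \1_(outer_set p) y * DD s (FK p%:Z f) y) x.

Local Notation Z := outer_set.

Let mO : measurable Omega. Proof. exact: open_measurable_rV. Qed.

Lemma measurable_outer p : measurable (Z p).
Proof.
apply: measurableC; apply: open_measurable_rV; rewrite openE => x; exact: near_to_open.
Qed.

Lemma outer_le p p' : (p <= p')%N -> Z p `<=` Z p'.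
Proof.
move=> pp' x nx xn; apply: nx; apply: near_to_le xn.
by rewrite ler_wpM2l// sc_le// lez_nat.
Qed.

Lemma outer_out p x : Z p x -> x \in Omega = false.
Proof.
move=> nx; apply/negbTE/negP => /set_mem Ox; apply: nx; exists x => //.
by rewrite subrr normr0 mulr_gt0// sc_gt0.
Qed.

Variables (f : E -> R) (D : seq 'I_n.+1 -> E -> R) (g : E -> R).
Hypotheses (wd : weak_data Omega m'.+1 f D g) (lg : loc_integrable Omega g)
  (gb : forall r, integ (Omega `&` ccube 0 r) g).
Variables (s : seq 'I_n.+1) (C2 : R).
Hypotheses (ss : size s = m'.+1) (C20 : 0 <= C2)
  (FKg : forall K x, `|DD s (FK K f) x| <= C2 * TK K g x).
Local Notation Gs := (ext_deriv f D s).

Let g0 y : Omega y -> 0 <= g y. Proof. exact: weak_data_g0 wd _. Qed.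

Let sFK K : Smooth (FK K f). Proof. exact: (smooth_FK O0 pdP K (weak_data_f wd)). Qed.

Lemma ext_deriv_in x : Omega x -> Gs x = D s x.
Proof. by move=> Ox; rewrite /ext_deriv mem_set. Qed.

Lemma DD_FK_stable (p : nat) x : Z p x -> DD s (FK p.+1%:Z f) x = DD s (FK p%:Z f) x.
Proof.
move=> nx; have s0 := sc_gt0 p%:Z.
have : \forall y \near x, FK p.+1%:Z f y = FK p%:Z f y.
  apply/nbhs_ballP; exists (sc p%:Z) => //= y; rewrite -ball_normE /= => xy.
  have eS : p.+1%:Z = p%:Z + 1 by rewrite -addn1 PoszD.
  rewrite eS; apply: FK_stable => ny; apply: nx.
  have := near_toD ny (_ : `|y - x| <= sc p%:Z); rewrite distrC ltW// => /(_ isT).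
  by apply: near_to_le; lra.
by move=> /(near_eq_DD s)/nbhs_singleton.
Qed.

Lemma ext_deriv_out (p : nat) x : Z p x -> Gs x = DD s (FK p%:Z f) x.
Proof.
move=> Zx; rewrite /ext_deriv (outer_out Zx) (@llim_stable _ _ _ x p).
  by rewrite indicE mem_set// mul1r.
move=> q pq; have Zq := outer_le pq Zx; have Zq1 := outer_le (leqW pq) Zx.
by rewrite !indicE !mem_set// !mul1r DD_FK_stable.
Qed.

(** On the remaining points, those of the closure outside Omega, all terms of the sequence vanish.
    This set may have positive measure, so a value has to be fixed there. *)
Lemma ext_deriv_boundary x : ~ Omega x -> (forall p, ~ Z p x) -> Gs x = 0.
Proof.
move=> Ox Zx; rewrite /ext_deriv memNset//; apply: llimE.
rewrite (_ : (fun p => _) = fun=> (0 : R)); first exact: cvg_cst.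
by apply/funext => p; rewrite indicE memNset ?mul0r.
Qed.

Lemma measurable_ext_deriv : measurable_fun setT Gs.
Proof.
rewrite -(setUv Omega); apply/measurable_funU => //; first exact: measurableC.
split.
  apply: eq_measurable_fun (weak_data_D wd ss).1 => x /set_mem Ox.
  by rewrite ext_deriv_in.
apply: (@eq_measurable_fun _ _ _ _ _
  (llim (fun (p : nat) y => \1_(outer_set p) y * DD s (FK p%:Z f) y))).
  by move=> x /set_mem Ox; rewrite /ext_deriv memNset.
apply: measurable_llim => p; apply: (@measurable_funS _ _ _ _ setT); [exact: measurableT|exact: subsetT|].
apply: measurable_funM; first by apply: measurable_indic; exact: measurable_outer.
by apply: continuous_measurable_rV; apply: smooth_continuous; exact: smooth_DD.
Qed.

Lemma integ_ext_deriv_out T (q r : R) (p0 : nat) : measurable T -> T `<=` ccube 0 r ->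
  (forall x, T x -> ~ Omega x) ->
  (forall p, (p0 <= p)%N -> integ T (TK p%:Z g) /\ \int[mu]_(x in T) TK p%:Z g x <= q) ->
  integ T Gs /\ \int[mu]_(x in T) `|Gs x| <= C2 * q.
Proof.
move=> mT Tr TO Hq; have mG := measurable_ext_deriv.
apply: (integ_exhaust (Z := Z) (p0 := p0)) => //.
- exact: (@measurable_funS _ _ _ _ setT).
- exact: measurable_outer.
- by move=> p; exact: outer_le.
- by move=> x Tx; apply: ext_deriv_boundary; exact: TO.
move=> p pp; have [iT Tq] := Hq p pp.
have mTZ : measurable (T `&` Z p) by apply: measurableI => //; exact: measurable_outer.
have iCT : integ T (fun x => C2 * TK p%:Z g x) by exact: integZ.
have sub : T `&` Z p `<=` T by exact: subIsetl.
have iCTZ := integ_sub mTZ mT sub iCT.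
have le x : (T `&` Z p) x -> `|Gs x| <= C2 * TK p%:Z g x.
  by move=> [_ Zx]; rewrite (ext_deriv_out Zx).
have T0 x : 0 <= TK p%:Z g x by exact: (TK_ge0 O0 pdP).
have iG : integ (T `&` Z p) Gs.
  apply: integ_le iCTZ _ => //; first exact: (@measurable_funS _ _ _ _ setT).
  by move=> x /le /le_trans; apply; exact: ler_norm.
split=> //; apply: (le_trans (le_Rint mTZ (integ_norm mTZ iG) iCTZ le)).
apply: (le_trans (Rint_subset mTZ mT sub iCT _)); first by move=> y _; exact: mulr_ge0.
by rewrite RintZ// ler_wpM2l.
Qed.

Lemma integ_ext_deriv (r : R) : 0 < r -> integ (ccube 0 r) Gs.
Proof.
move=> r0; have [Q [L [Q0 HQ]]] := TK_ball oO O0 pdP wd gb r0.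
have mc := measurable_ccube (0 : E) r.
have mOc : measurable (Omega `&` ccube 0 r) by exact: measurableI.
have mcO : measurable (ccube 0 r `\` Omega) by exact: measurableD.
have -> : ccube 0 r = (Omega `&` ccube 0 r) `|` ccube 0 r.
  by apply/seteqP; split=> x; [right|case=> [[]|]].
apply: integ_setU => //; first exact: measurable_ext_deriv.
  apply: integ_le (gb r) _ => //.
    by apply: (@measurable_funS _ _ _ _ setT) => //; exact: measurable_ext_deriv.
  move=> x [Ox _]; rewrite ext_deriv_in// (le_trans (weak_data_le wd ss Ox))//.
  exact: ler_norm.
have sub : ccube 0 r `\` (Omega `&` ccube 0 r) `<=` ccube 0 r `\` Omega.
  by move=> x [xr nx]; split=> // Ox; apply: nx.
apply: (integ_sub _ mcO sub); first exact: measurableD.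
have [] := @integ_ext_deriv_out (ccube 0 r `\` Omega) Q r (absz L) mcO => //.
  by move=> x [].
move=> p Lp; have [iT TQ] := HQ p%:Z (absz_le_int Lp).
have sub2 : ccube 0 r `\` Omega `<=` ccube 0 r by move=> x [].
split; first exact: integ_sub mcO mc sub2 iT.
apply: le_trans TQ; apply: (Rint_subset mcO mc sub2 iT) => y _.
exact: (TK_ge0 O0 pdP).
Qed.

(* Outside the strip, either FK has stabilized or the cutoff function is 1. *)
Definition strip (r : R) k : set E :=
  [set x | [/\ ccube 0 r x, near_to Omega (5 * sc k) x & ~ inn Omega (4 * sc k) x]].

Lemma measurable_strip r k : measurable (strip r k).
Proof.
rewrite (_ : strip r k = ccube 0 r `&` near_to Omega (5 * sc k) `&` ~` inn Omega (4 * sc k)).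
  apply: measurableI; last by apply: measurableC; exact: measurable_inn.
  apply: measurableI; first exact: measurable_ccube.
  by apply: open_measurable_rV; rewrite openE => x; exact: near_to_open.
by apply/seteqP; split => x; [move=> [? ? ?]; split|move=> [[? ?] ?]; split].
Qed.

(** Cells active on the strip have side at most 5 * 2^-k, so they read points within (Ca + 1) * 5 *
    2^-k of x, itself less than 4 * 2^-k away from the complement. *)
Lemma strip_Aset r k K i x : k <= K -> strip r k x -> B K i x ->
  A i `<=` ~` inn Omega (5 * (Ca + 2) * sc k).
Proof.
move=> kK [xr nx ix] [xc _ xi] y [yc _] iy; have s0 := sc_gt0 k; have si0 := sc_gt0 i.1.
have Ca0 := pd_Ca pdP.
have si : sc i.1 <= 5 * sc k.
  case: xi => [->|[_ nn]]; first by rewrite (le_trans (sc_le kK))// ler_peMl ?ltW// ltr1n.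
  by rewrite leNgt; apply/negP => lt; apply: nn; apply: near_to_le nx; exact: ltW.
move: ix => /contrapT[w Ow xw]; apply: iy; exists w => //.
rewrite (le_lt_trans (ler_distD x _ _))//.
have yx : `|y - x| <= (Ca + 1) * (5 * sc k).
  rewrite (le_trans (ler_distD (ctr i.1 i.2) _ _))// [X in _ + X]distrC.
  apply: (le_trans (lerD yc xc)); rewrite -{2}[sc i.1]mul1r -mulrDl ler_wpM2l//.
  by rewrite addr_ge0// ltW.
apply: (lt_le_trans (ler_ltD yx xw)).
have -> : 5 * (Ca + 2) * sc k = (Ca + 1) * (5 * sc k) + 5 * sc k by ring.
by rewrite lerD2l ler_wpM2r ?ler_nat// ltW.
Qed.

(** Omega being open, each of its points eventually leaves the collar; dominated convergence applies
    because g is integrable up to the boundary on bounded sets. *)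
Lemma collar_small (r' a : R) :
  \int[mu]_(y in (Omega `&` ccube 0 r') `&` ~` inn Omega (a * sc p%:Z)) g y @[p --> \oo] --> (0 : R).
Proof.
set O' := Omega `&` ccube 0 r'.
have mO' : measurable O' by apply: measurableI => //; exact: measurable_ccube.
have mi p : measurable (~` inn Omega (a * sc p%:Z)) by apply: measurableC; exact: measurable_inn.
pose F (p : nat) y := g y * \1_(~` inn Omega (a * sc p%:Z)) y.
have mF p : measurable_fun O' (F p).
  apply: measurable_funM; first exact: integ_measurable (gb r').
  by apply: (@measurable_funS _ _ _ _ setT) => //; exact: measurable_indic.
have cF y : O' y -> F ^~ y @ \oo --> (0 : R).
  move=> [Oy _]; have [e e0 He] : exists2 e : R, 0 < e & inn Omega e y.
    have /nbhs_ballP[e /= e0 He] : nbhs y Omega by apply: open_nbhs_nbhs; split.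
    by exists e => // -[w Ow yw]; apply: Ow; apply: He; rewrite -ball_normE.
  have : \forall p \near \oo, 0 = F p y.
    near=> p; rewrite /F indicE memNset ?mulr0//; apply; apply: inn_le He; apply: ltW.
    by near: p; exact: near_sc.
  by move=> /near_eq_cvg/cvg_trans; apply; exact: cvg_cst.
have Fg p y : O' y -> `|F p y| <= g y.
  move=> [Oy _]; rewrite /F indicE; have gy := g0 Oy.
  by case: (_ \in _); rewrite ?mulr1 ?mulr0 ?normr0// ger0_norm.
have [_ _] := cvg_Rintegral mO' mF (measurable_cst _) (gb r') cF Fg.
rewrite Rintegral_cst// mul0r; apply: cvg_trans.
apply: near_eq_cvg; apply: nearW => p; rewrite /F.
have mOi : measurable (O' `&` ~` inn Omega (a * sc p%:Z)) by exact: measurableI.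
have mi1 : measurable_fun O' (\1_(~` inn Omega (a * sc p%:Z)) : E -> R).
  by apply: (@measurable_funS _ _ _ _ setT) => //; exact: measurable_indic.
have b1 x : `|(\1_(~` inn Omega (a * sc p%:Z)) : E -> R) x| <= 1.
  by rewrite indicE; case: (_ \in _); rewrite ?normr1 ?normr0.
have sub : O' `&` ~` inn Omega (a * sc p%:Z) `<=` O' by exact: subIsetl.
have [|_ ->] := integ_supp mO' mOi sub (integ_sub mOi mO' sub (gb r'))
    (integ_measurable (gb r')) mi1 b1.
  by move=> x Ox nx; rewrite indicE memNset// => ix; apply: nx.
by apply: eq_Rintegral => y /set_mem[_ iy]; rewrite indicE mem_set// mulr1.
Unshelve. all: by end_near. Qed.

(* The averages seen from the strip only read g in a collar of Omega. *)
Lemma strip_bound (r : R) : 0 < r -> exists W : nat -> R, W @ \oo --> (0 : R) /\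
  exists k0 : nat, forall k p : nat, (k0 <= k)%N -> (k <= p)%N ->
    \int[mu]_(x in strip r k%:Z) (`|DD s (FK p%:Z f) x| + `|Gs x|) <= W k.
Proof.
move=> r0; have [r' [L [r'0 HL]]] := active_Aset O0 pdP r0.
have [C5 C50 H5] := TK_integ O0 (pd_Ca pdP) (pd_ca pdP).
pose S (k : nat) := (Omega `&` ccube 0 (r + r')) `&` ~` inn Omega (5 * (Ca + 2) * sc k%:Z).
pose q (k : nat) := \int[mu]_(y in S k) g y.
(* The first C2 * C5 bounds the derivative of FK. For Gs, the 1 is the part in Omega, where it is at
   most g, and C2 * C5 the part outside. *)
exists (fun k : nat => (C2 * C5 + (1 + C2 * C5)) * q k); split.
  rewrite -[X in _ --> X](mulr0 (C2 * C5 + (1 + C2 * C5))); apply: cvgMr.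
  exact: collar_small.
exists (absz L) => k p Lk kp; set T := strip r k%:Z.
have mT : measurable T by exact: measurable_strip.
have mO' : measurable (Omega `&` ccube 0 (r + r')) by apply: measurableI => //; exact: measurable_ccube.
have mS : measurable (S k) by apply: measurableI => //; apply: measurableC; exact: measurable_inn.
have igS : integ (S k) g by exact: integ_sub mS mO' (@subIsetl _ _ _) (gb (r + r')).
have Tr : T `<=` ccube 0 r by move=> x [].
have gS0 y : S k y -> 0 <= g y by move=> [[/g0]].
have TKp (T' : set E) (p' : nat) : measurable T' -> T' `<=` T -> (k <= p')%N -> integ T' (TK p'%:Z g) /\ \int[mu]_(x in T') TK p'%:Z g x <= C5 * q k.
  move=> mT' T'T kp'; apply: (H5 g p'%:Z r T' (S k) r0 mT') => //.
    by move=> x /T'T /Tr.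
  move=> i x Bx /T'T Tx y Ay.
  have [_ /(_ y Ay)[Oy yr]] := HL p'%:Z i x (absz_le_int (leq_trans Lk kp')) Bx (Tr _ Tx).
  split; first by split=> //; move: yr => /le_trans; apply; rewrite lerDr ltW.
  apply: (@strip_Aset r k%:Z p'%:Z i x) Ay => //.
have [iTK TKq] := TKp T p mT (@subset_refl _ _) kp.
have mc := measurable_ccube (0 : E) r.
have iG : integ T Gs by apply: (integ_sub mT mc Tr); exact: integ_ext_deriv.
have iD : integ T (DD s (FK p%:Z f)).
  apply: (integ_sub mT mc Tr); apply: integ_continuous; apply: smooth_continuous; exact: smooth_DD.
rewrite RintD//; [|exact: integ_norm|exact: integ_norm].
rewrite mulrDl lerD//.
  apply: (@le_trans _ _ (\int[mu]_(x in T) (C2 * TK p%:Z g x))).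
    by apply: le_Rint => //; [exact: integ_norm|exact: integZ].
  by rewrite RintZ// -mulrA ler_wpM2l.
have mTO : measurable (T `&` Omega) by exact: measurableI.
have mTO' : measurable (T `\` Omega) by exact: measurableD.
have e : T = (T `&` Omega) `|` (T `\` Omega) by rewrite setUIDK.
rewrite [X in Rintegral _ X](_ : _ = (T `&` Omega) `|` (T `\` Omega))//.
rewrite Rintegral_setU//; last 2 first.
- by rewrite -e; have [] := integ_norm mT iG.
- by apply/disj_set2P; rewrite setDE setIACA setICr setI0.
rewrite mulrDl mul1r lerD//.
  have TS : T `&` Omega `<=` S k.
    move=> x [[xr nx ix] Ox]; split.
      by split=> //; move: xr => /le_trans; apply; rewrite lerDl ltW.
    apply: contrapT; rewrite notK => ii; apply: ix; apply: inn_le ii.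
    have Ca0 := pd_Ca pdP; have sk := sc_gt0 k%:Z; rewrite ler_wpM2r ?ltW//; lra.
  have igT := integ_sub mTO mS TS igS.
  apply: (@le_trans _ _ (\int[mu]_(x in T `&` Omega) g x)); last exact: (Rint_subset mTO mS TS igS).
  apply: le_Rint => //.
    by apply: integ_norm => //; exact: integ_sub mTO mT (@subIsetl _ _ _) iG.
  by move=> x [_ Ox]; rewrite ext_deriv_in// (weak_data_le wd ss).
have [] := @integ_ext_deriv_out (T `\` Omega) (C5 * q k) r k mTO' => //.
- by move=> x [/Tr].
- by move=> x [].
- by move=> p' kp'; apply: TKp => // x [].
by rewrite -mulrA.
Qed.

Hypothesis lf : loc_integrable Omega f.
Local Notation Lam := (llim (fun p : nat => FK p%:Z f)).

Let mLam : measurable_fun setT Lam.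
Proof.
by apply: measurable_llim => p; apply: continuous_measurable_rV; exact: smooth_continuous.
Qed.

Lemma FK_test_limit u (r : R) : 0 < r -> Smooth u -> supp_in r u ->
  \int[mu]_x (DD s (FK p%:Z f) x * u x) @[p --> \oo] -->
  (-1) ^+ m'.+1 * \int[mu]_x (Lam x * DD s u x).
Proof.
move=> r0 su ur; have [_ iL L0] := FK_limit oO O0 pdP wd lg gb r0.
have mc := measurable_ccube (0 : E) r.
have e (p : nat) : \int[mu]_x (DD s (FK p%:Z f) x * u x) = (-1) ^+ m'.+1 * \int[mu]_x (FK p%:Z f x * DD s u x).
  rewrite (integration_by_parts s su (sFK p%:Z) ur) ss mulrA -expr2 sqrr_sign mul1r.
  by rewrite (DD_perm (sFK p%:Z) (_ : perm_eq (rev s) s)) ?perm_rev.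
rewrite (_ : (fun p : nat => _) = fun p : nat => (-1) ^+ m'.+1 * \int[mu]_x (FK p%:Z f x * DD s u x)); last first.
  by apply/funext.
apply: cvgMr; have dsu := smooth_continuous (smooth_DD s su); have dsur := supp_inDD s ur.
have [A0 A00 HA] := supp_bounded dsu dsur.
have mdsu : measurable_fun (ccube 0 r) (DD s u).
  by apply: (@measurable_funS _ _ _ _ setT) => //; exact: continuous_measurable_rV.
have z0 h : \int[mu]_x (h x * DD s u x) = \int[mu]_(x in ccube 0 r) (h x * DD s u x).
  apply: Rintegral_zero_out => x nx; rewrite dsur ?mulr0//.
  by rewrite ltNge; apply/negP => xr; apply: nx; rewrite /ccube /= subr0.
have iF (p : nat) : integ (ccube 0 r) (FK p%:Z f) by apply: integ_continuous; exact: smooth_continuous.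
have iLu := integM mc iL mdsu (fun x _ => HA x).
apply/cvgrPdist_le => e0 e00; have A1 : 0 < A0 + 1 by rewrite ltr_wpDl.
move/cvgrPdist_le : L0 => /(_ _ (divr_gt0 e00 A1)); apply: filterS => p.
rewrite sub0r normrN ger0_norm; last exact: Rintegral_ge0.
rewrite ler_pdivlMr// => Hp; rewrite !z0 distrC.
have iFu := integM mc (iF p) mdsu (fun x _ => HA x).
have ib : integ (ccube 0 r) (fun x => `|FK p%:Z f x - Lam x|) by apply: integ_norm => //; exact: integB.
rewrite -RintB//; have iB := integB mc iFu iLu.
apply: (le_trans (le_norm_Rint mc iB)); apply: le_trans Hp; rewrite mulrC -RintZ//.
apply: le_Rint => //; [exact: integ_norm|exact: integZ|] => x _.
rewrite -mulrBl normrM mulrC ler_wpM2r// (le_trans (HA x))// lerDl//.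
Qed.

Lemma ext_deriv_local u (K : set E) : compact K -> K `<=` Omega -> tst K u ->
  (-1) ^+ m'.+1 * \int[mu]_x (Lam x * DD s u x) = \int[mu]_x (Gs x * u x).
Proof.
move=> cK KO tu; have [su u0] := tu; have clK := compact_closed (@norm_hausdorff _ _) cK.
have [sdu du0] := tst_DD s clK tu.
have OA h v : (forall x, ~ K x -> v x = 0) -> \int[mu]_x (h x * v x) = \int[mu]_(x in Omega) (h x * v x).
  by move=> v0; apply: Rintegral_zero_out => x Ox; rewrite v0 ?mulr0// => /KO.
rewrite (OA Lam _ du0) (OA Gs _ u0).
have -> : \int[mu]_(x in Omega) (Gs x * u x) = \int[mu]_(x in Omega) (D s x * u x).
  by apply: eq_Rintegral => x /set_mem Ox; rewrite ext_deriv_in.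
have -> : \int[mu]_(x in Omega) (Lam x * DD s u x) = \int[mu]_(x in Omega) (f x * DD s u x).
  have mdu : measurable_fun Omega (DD s u).
    by apply: (@measurable_funS _ _ _ _ setT) => //; apply: continuous_measurable_rV; exact: smooth_continuous.
  rewrite /Rintegral; congr fine; apply: ae_eq_integral => //.
  - apply/measurable_EFinP; apply: measurable_funM => //.
    exact: (@measurable_funS _ _ _ _ setT).
  - by apply/measurable_EFinP; apply: measurable_funM => //; case: lf.
  - by apply: filterS (ae_llim oO O0 pdP wd lf lg gb) => x Hx Ox; rewrite Hx.
by rewrite (weak_data_eq wd cK KO tu ss) mulrA -expr2 sqrr_sign mul1r.
Qed.

(** Split phi with an interior cutoff chi of scale k. For chi * phi, a test function on Omega, the
    identity is that of f. For the rest, integrate by parts with FK p, p >= k: off the strip its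
    derivative equals Gs or chi is 1, and on the strip both are small in L^1. Let p, then k, tend to
    infinity. *)
Lemma ext_weak_deriv phi (r : R) : 0 < r -> Smooth phi -> supp_in r phi ->
  \int[mu]_x (Lam x * DD s phi x) = (-1) ^+ m'.+1 * \int[mu]_x (Gs x * phi x).
Proof.
move=> r0 sphi phir; have [W [W0 [k0 HW]]] := strip_bound r0.
have mc := measurable_ccube (0 : E) r.
have [A0 A00 HA] := supp_bounded (smooth_continuous sphi) phir.
set l := \int[mu]_x (Lam x * _); set l' := \int[mu]_x (Gs x * _).
suff H (k : nat) : (k0 <= k)%N -> `|(-1) ^+ m'.+1 * l - l'| <= A0 * W k.
  have : `|(-1) ^+ m'.+1 * l - l'| <= 0.
    have AW : (fun k : nat => A0 * W k) @ \oo --> (0 : R).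
      by rewrite -[X in _ --> X](mulr0 A0); exact: cvgMr.
    rewrite -(cvg_lim (@Rhausdorff R) AW); apply: limr_ge; first by apply/cvg_ex; exists 0.
    by exists k0.
  rewrite normr_le0 subr_eq0 => /eqP <-.
  by rewrite mulrA -expr2 sqrr_sign mul1r.
move=> k0k; have [chi [schi chi01 chi0 chi1]] := interior_cutoff Omega k%:Z r0.
pose u x := chi x * phi x.
have su : Smooth u by exact: smoothM.
have ur : supp_in r u by exact: supp_inM.
have cut x : ~ ccube 0 r x -> phi x = 0.
  move=> nx; apply: phir; rewrite ltNge; apply/negP => xr; apply: nx.
  by rewrite /ccube /= subr0.
have tu : tst (ccube 0 r `&` inn Omega (sc k%:Z)) u.
  split=> // x nx; rewrite /u; have [xr|/cut ->] := pselect (ccube 0 r x); last by rewrite mulr0.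
  by rewrite chi0 ?mul0r// => xi; apply: nx.
have KO : ccube 0 r `&` inn Omega (sc k%:Z) `<=` Omega.
  by move=> x [_]; apply: inn_sub; exact: sc_gt0.
have Lu := ext_deriv_local (@compact_inn _ _ _ _ _ _) KO tu.
have c1 := FK_test_limit r0 sphi phir.
have c2 := FK_test_limit r0 su ur.
rewrite Lu in c2; rewrite -/l in c1.
have c3 : `|\int[mu]_x (DD s (FK p%:Z f) x * phi x) - \int[mu]_x (DD s (FK p%:Z f) x * u x) -
    (l' - \int[mu]_x (Gs x * u x))| @[p --> \oo] -->
    `|(-1) ^+ m'.+1 * l - \int[mu]_x (Gs x * u x) - (l' - \int[mu]_x (Gs x * u x))|.
  by apply: cvg_norm; apply: cvgB; [exact: cvgB|exact: cvg_cst].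
have -> : (-1) ^+ m'.+1 * l - l' = (-1) ^+ m'.+1 * l - \int[mu]_x (Gs x * u x) - (l' - \int[mu]_x (Gs x * u x)).
  by rewrite opprB addrA subrK.
rewrite -(cvg_lim (@Rhausdorff R) c3); apply: limr_le; first by apply/cvg_ex; eexists; exact: c3.
exists k => // p /= kp; set F := DD s (FK p%:Z f).
have cF : continuous F by apply: smooth_continuous; exact: smooth_DD.
have iF : integ (ccube 0 r) F by exact: integ_continuous.
have iG : integ (ccube 0 r) Gs by exact: integ_ext_deriv.
have z0 h v : (forall x, ~ ccube 0 r x -> v x = 0) -> \int[mu]_x (h x * v x) = \int[mu]_(x in ccube 0 r) (h x * v x).
  by move=> v0; apply: Rintegral_zero_out => x nx; rewrite v0 ?mulr0.
have cutu x : ~ ccube 0 r x -> u x = 0 by move=> /cut; rewrite /u => ->; rewrite mulr0.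
rewrite /l' !(z0 _ _ cut) !(z0 _ _ cutu).
have uA x : `|u x| <= A0.
  have /andP[x0 x1] := chi01 x; rewrite normrM (ger0_norm x0).
  by rewrite (le_trans (ler_piMl _ x1)).
have mS (v : E -> R) : Smooth v -> measurable_fun (ccube 0 r) v.
  move=> sv; apply: (@measurable_funS _ _ _ _ setT) => //.
  by apply: continuous_measurable_rV; exact: smooth_continuous.
have i1 := integM mc iF (mS _ sphi) (fun x _ => HA x).
have i2 := integM mc iF (mS _ su) (fun x _ => uA x).
have i3 := integM mc iG (mS _ sphi) (fun x _ => HA x).
have i4 := integM mc iG (mS _ su) (fun x _ => uA x).
have i12 := integB mc i1 i2; have i34 := integB mc i3 i4.
rewrite -!RintB//; have iA := integB mc i12 i34.
apply: (le_trans (le_norm_Rint mc iA)).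
have mst := measurable_strip r k%:Z.
have mi : measurable_fun (ccube 0 r) (\1_(strip r k%:Z) : E -> R).
  by apply: (@measurable_funS _ _ _ _ setT) => //; exact: measurable_indic.
have b1 x : `|(\1_(strip r k%:Z) : E -> R) x| <= 1.
  by rewrite indicE; case: (_ \in _); rewrite ?normr1 ?normr0.
have iFG : integ (ccube 0 r) (fun x => `|F x| + `|Gs x|) by apply: integD => //; exact: integ_norm.
have iFG1 := integM mc iFG mi (fun x _ => b1 x).
have sub : strip r k%:Z `<=` ccube 0 r by move=> x [].
apply: (@le_trans _ _ (\int[mu]_(x in ccube 0 r) (A0 * ((`|F x| + `|Gs x|) * \1_(strip r k%:Z) x)))).
  apply: le_Rint => //; [exact: integ_norm|exact: integZ|] => x xr.
  have -> : F x * phi x - F x * u x - (Gs x * phi x - Gs x * u x) = phi x * ((F x - Gs x) * (1 - chi x)).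
    by rewrite /u; ring.
  rewrite normrM; apply: ler_pM => //; rewrite indicE.
  have [xs|xs] := boolP (x \in strip r k%:Z).
    rewrite mulr1 normrM -[leRHS]mulr1; apply: ler_pM => //; first exact: ler_normB.
    by have /andP[x0 x1] := chi01 x; rewrite ger0_norm ?subr_ge0// gerBl.
  rewrite mulr0; have [Zx|nZ] := pselect (Z k x).
    by rewrite (ext_deriv_out (outer_le kp Zx)) subrr mul0r normr0.
  rewrite chi1// ?subrr ?mulr0 ?normr0//; apply: contrapT => ni; move/negP: xs; apply.
  by apply/mem_set; split=> //; apply: contrapT => nn; apply: nZ.
rewrite RintZ//; apply: ler_wpM2l => //; apply: le_trans (HW k p k0k kp).
have [|_ ->] := integ_supp mc mst sub (integ_sub mst mc sub iFG) (integ_measurable iFG) mi b1.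
  by move=> x _ nx; rewrite indicE memNset.
rewrite le_eqVlt; apply/orP; left; apply/eqP.
by apply: eq_Rintegral => x xs; rewrite indicE xs mulr1.
Qed.

End weak_derivatives.

Lemma parallelogram_bound (R : realType) (a b d x y z : R) : b <= a -> d <= z ->
  x <= d + a -> y <= d + b -> 2 * y + 2 * x - 4 * z <= 4 * a.
Proof. by lra. Qed.

Lemma variation_bound (R : realType) (a b d j : R) : j <= d -> d <= j - a + b -> a <= b.
Proof. by lra. Qed.

(** * Norming functions and averages on the function space *)

Section hilbert_projection.
Context {R : realType} {n : nat}.
Local Notation E := 'rV[R]_n.+1.
Local Notation mu := (@lebesgue_rV R n).
Variable D : set E.
Hypotheses (mD : measurable D) (fD : (mu D < +oo)%E).
Implicit Types (f g w : E -> R) (S : set (E -> R)).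

Definition sq_integ f : Prop := measurable_fun D f /\ integ D (fun x => f x ^+ 2).

Lemma sq_integM f g : sq_integ f -> sq_integ g -> integ D (fun x => f x * g x).
Proof.
move=> [mf f2] [mg g2]; apply: (@integ_le _ _ _ _ (fun x => f x ^+ 2 + g x ^+ 2)); [exact: mD| | |].
- exact: measurable_funM.
- exact: integD.
move=> x _; rewrite [leRHS]ger0_norm ?addr_ge0 ?sqr_ge0// normrM.
rewrite -(real_normK (num_real (f x))) -(real_normK (num_real (g x))).
move: (normr_ge0 (f x)) (normr_ge0 (g x)); move: `|f x| `|g x| => a b a0 b0.
rewrite -subr_ge0 (_ : _ - _ = (a - b) ^+ 2 + a * b); last by ring.
by rewrite addr_ge0 ?sqr_ge0// mulr_ge0.
Qed.

Lemma sq_integ_lin (a b : R) f g : sq_integ f -> sq_integ g ->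
  sq_integ (fun x => a * f x + b * g x).
Proof.
move=> sf sg; have fg := sq_integM sf sg; case: sf sg => [mf f2] [mg g2]; split.
  by apply: measurable_funD; apply: measurable_funM => //; exact: measurable_cst.
apply: (@integ_congr _ _ _ _ (fun x => a ^+ 2 * f x ^+ 2 + ((2 * a * b) * (f x * g x) + b ^+ 2 * g x ^+ 2))) => //.
  by move=> x _; ring.
by apply: integD => //; [exact: integZ|apply: integD => //; exact: integZ].
Qed.

Lemma sq_integB f g : sq_integ f -> sq_integ g -> sq_integ (fun x => f x - g x).
Proof.
move=> sf sg; have := sq_integ_lin 1 (-1) sf sg.
by under eq_fun do rewrite mul1r mulN1r.
Qed.

(** The classical minimizing sequence, with the parallelogram identity. Closedness of S is asked
    under convergence almost everywhere, the form in which a function norm provides it. *)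
Lemma hilbert_projection S w : sq_integ w -> S !=set0 -> (forall f, S f -> sq_integ f) ->
  (forall f g (t : R), S f -> S g -> 0 <= t <= 1 -> S (fun x => t * f x + (1 - t) * g x)) ->
  (forall u : nat -> E -> R, (forall k, S (u k)) ->
    {ae mu, forall x, D x -> u ^~ x @ \oo --> llim u x} -> sq_integ (llim u) -> S (llim u)) ->
  exists2 f0, S f0 & forall f, S f -> \int[mu]_(x in D) ((w x - f0 x) * (f x - f0 x)) <= 0.
Proof.
move=> sw [f1 Sf1] Ssq conv closed.
pose J f := \int[mu]_(x in D) (w x - f x) ^+ 2.
have J0 f : 0 <= J f by apply: Rintegral_ge0 => x _; exact: sqr_ge0.
pose d2 := inf [set J f | f in S].
have hinf : has_inf [set J f | f in S].
  by split; [exists (J f1); exists f1|exists 0 => _ [f _ <-]].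
have Jd f : S f -> d2 <= J f by move=> Sf; apply: ge_inf; [case: hinf|exists f].
(* An excess of 4^-k makes consecutive terms differ by O(2^-k) in L^2, hence the increments summable
   in L^1: the whole sequence converges almost everywhere. *)
have [u Hu] : exists u : nat -> E -> R, forall k, S (u k) /\ J (u k) <= d2 + sc k%:Z ^+ 2.
  have H (k : nat) : exists f, S f /\ J f <= d2 + sc k%:Z ^+ 2.
    have [_ [f Sf <-] /ltW] := inf_adherent (exprn_gt0 2 (@sc_gt0 R k%:Z)) hinf.
    by exists f.
  by have [u Hu] := choice H; exists u.
have Su k : S (u k) := (Hu k).1.
have squ k : sq_integ (u k) := Ssq _ (Su k).
have sqwu f : sq_integ f -> sq_integ (fun x => w x - f x) by exact: sq_integB.
have par k : \int[mu]_(x in D) (u k.+1 x - u k x) ^+ 2 <= 4 * sc k%:Z ^+ 2.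
  pose v x := 2^-1 * u k.+1 x + (1 - 2^-1) * u k x.
  have Sv : S v by apply: conv => //; rewrite invr_ge0 ler0n invf_le1// ler1n.
  have i1 := (sqwu _ (squ k.+1)).2; have i2 := (sqwu _ (squ k)).2; have i3 := (sqwu _ (Ssq _ Sv)).2.
  have -> : \int[mu]_(x in D) (u k.+1 x - u k x) ^+ 2 =
    \int[mu]_(x in D) (2 * (w x - u k.+1 x) ^+ 2 + 2 * (w x - u k x) ^+ 2 - 4 * (w x - v x) ^+ 2).
    by apply: eq_Rintegral => x _; rewrite /v; field.
  have j1 := integZ 2 mD i1; have j2 := integZ 2 mD i2; have j3 := integZ 4 mD i3.
  rewrite RintB//; last exact: integD.
  rewrite RintD// !RintZ//.
  have := (Hu k.+1).2; have := (Hu k).2; have := Jd _ Sv; rewrite /J.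
  have : sc k.+1%:Z ^+ 2 <= sc k%:Z ^+ 2 :> R.
    have sk : sc k.+1%:Z <= sc k%:Z :> R by apply: sc_le; rewrite lez_nat.
    by rewrite lerXn2r// nnegrE sc_ge0.
  exact: parallelogram_bound.
have mu_u k : measurable_fun D (u k) := (squ k).1.
have fineD : 0 <= fine (mu D) by exact: fine_ge0.
have ic a : integ D (fun=> a).
  by apply: (@integ_bounded _ _ _ _ `|a|) => //; exact: measurable_cst.
have iu1 f : sq_integ f -> integ D f.
  move=> [mf f2]; apply: (@integ_le _ _ _ _ (fun x => 1 + f x ^+ 2)) => //; first exact: integD.
  move=> x _; rewrite [leRHS]ger0_norm ?addr_ge0 ?sqr_ge0//.
  rewrite -(real_normK (num_real (f x))); move: `|f x| => a.
  by rewrite -subr_ge0 (_ : _ - _ = (a - 2^-1) ^+ 2 + 3 / 4) ?addr_ge0 ?sqr_ge0//; field.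
have step1 k : \int[mu]_(x in D) `|u k.+1 x - u k x| <= (fine (mu D) + 4) * sc k%:Z.
  have s0 := @sc_gt0 R k%:Z; have sqd := sq_integB (squ k.+1) (squ k).
  (* From |a| <= s + a^2 / s with s = 2^-k, in place of the Cauchy-Schwarz inequality. *)
  apply: (@le_trans _ _ (\int[mu]_(x in D) (sc k%:Z + (sc k%:Z)^-1 * (u k.+1 x - u k x) ^+ 2))).
    apply: le_Rint => //.
    - by apply: integ_norm => //; exact: iu1.
    - by apply: integD => //; apply: integZ => //; case: sqd.
    move=> x _; rewrite -(real_normK (num_real (u k.+1 x - u k x))); move: `|_| => a.
    rewrite -subr_ge0 (_ : _ - _ = ((a - sc k%:Z / 2) ^+ 2 + 3 / 4 * sc k%:Z ^+ 2) / sc k%:Z).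
      by rewrite divr_ge0 ?addr_ge0 ?sqr_ge0 ?mulr_ge0 ?exprn_ge0// ltW.
    by field; rewrite gt_eqF.
  rewrite RintD//; last by apply: integZ => //; case: sqd.
  rewrite RintZ//; last by case: sqd.
  rewrite Rintegral_cst// [leRHS]mulrDl mulrC lerD2l mulrC ler_pdivrMr//.
  by rewrite -mulrA -expr2; exact: par.
pose cc (k : nat) : R := (fine (mu D) + 4) * sc k%:Z.
have [M HM] : exists M, forall p, \sum_(k < p) cc k <= M.
  apply: (geometric_partial_sums (c := cc) (Q := fine (mu D) + 4) (p0 := 0)) => //.
  - by move=> p; rewrite mulr_ge0 ?addr_ge0 ?sc_ge0.
  - by rewrite addr_ge0.
have [cu il _] := L1_lim mD (fun k => iu1 _ (squ k)) (c := cc) step1 HM.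
set f0 := llim u in cu il.
have mf0 := integ_measurable il.
have Jf0 : (\int[mu]_(x in D) ((w x - f0 x) ^+ 2)%:E <= d2%:E)%E.
  pose h (k : nat) x := ((w x - u k x) ^+ 2)%:E.
  have mh k : measurable_fun D (h k) by apply/measurable_EFinP; exact: integ_measurable (sqwu _ (squ k)).2.
  have h0 k x : D x -> (0 <= h k x)%E by move=> _; rewrite lee_fin sqr_ge0.
  have := fatou mu mD mh h0.
  have -> : (\int[mu]_(x in D) limn_einf (h ^~ x) = \int[mu]_(x in D) ((w x - f0 x) ^+ 2)%:E)%E.
    apply: ae_eq_integral; [exact: mD| | |].
    - apply: (@measurableT_comp _ _ _ _ _ _ oppe); first exact: oppe_measurable.
      apply: measurable_fun_limn_esup => k; apply: (@measurableT_comp _ _ _ _ _ _ oppe) => //.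
    - apply/measurable_EFinP; apply: measurable_funX; apply: measurable_funB => //.
      by case: sw.
    apply: filterS cu => x cx Dx.
    have : h ^~ x @ \oo --> ((w x - f0 x) ^+ 2)%:E.
      apply: cvg_EFin; first exact: nearW.
      have c1 : (fun k => w x - u k x) @ \oo --> w x - f0 x.
        by apply: cvgB; [exact: cvg_cst|exact: cx].
      have : (fun k => (w x - u k x) * (w x - u k x)) @ \oo --> (w x - f0 x) * (w x - f0 x) by exact: cvgM.
      by under eq_fun do rewrite -expr2; rewrite -expr2.
    by move=> /cvg_limn_einf_sup[-> _].
  move=> /le_trans; apply.
  have le k : (\int[mu]_(x in D) h k x <= (d2 + sc k%:Z ^+ 2)%:E)%E.
    have [i1] := (sqwu _ (squ k)).2.
    by rewrite -(fineK (integrable_fin_num mD i1)) lee_fin; exact: (Hu k).2.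
  have cd : (fun k : nat => (d2 + sc k%:Z ^+ 2)%:E) @ \oo --> d2%:E.
    apply: cvg_EFin; first exact: nearW.
    rewrite -[X in _ --> X]addr0; apply: cvgD; first exact: cvg_cst.
    apply/cvgrPdist_le => e e0; near=> k; rewrite sub0r normrN ger0_norm ?exprn_ge0 ?sc_ge0//.
    have k1 : sc k%:Z <= 1 :> R by rewrite sc_nat div1r invf_le1 ?exprn_gt0// exprn_ege1// ler1n.
    apply: (@le_trans _ _ (sc k%:Z)); first by rewrite expr2 ler_piMr// sc_ge0.
    by rewrite -[leLHS]mul1r ltW//; near: k; exact: near_sc.
  rewrite -(cvg_limn_einf_sup cd).1 !limn_einf_lim.
  apply: lee_lim; [exact: is_cvg_einfs|exact: is_cvg_einfs|].
  apply: nearW => k; apply: le_ereal_inf_tmp => _ [j /= kj <-].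
  by apply: le_trans (le j); apply: ereal_inf_lbound; exists j.
have iJ0 : integ D (fun x => (w x - f0 x) ^+ 2).
  apply: integP.
    by apply: measurable_funX; apply: measurable_funB => //; case: sw.
  under eq_integral do rewrite ger0_norm ?sqr_ge0//.
  by rewrite (le_lt_trans Jf0)// ltry.
have sqf0 : sq_integ f0.
  have sqd : sq_integ (fun x => w x - f0 x).
    by split; [apply: measurable_funB => //; case: sw|exact: iJ0].
  have := sq_integB sw sqd; rewrite (_ : (fun x => _) = f0)//.
  by apply/funext => x; rewrite opprB addrC subrK.
have Sf0 : S f0 by exact: closed.
exists f0 => // f Sf.
have Jle : J f0 <= d2.
  have [i1] := iJ0.
  by rewrite -lee_fin /J /Rintegral fineK//; exact: (integrable_fin_num mD i1).
have sqff := sq_integB (Ssq _ Sf) sqf0; have sqwf := sq_integB sw sqf0.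
set I := \int[mu]_(x in D) _.
pose Q := \int[mu]_(x in D) (f x - f0 x) ^+ 2.
have Q0 : 0 <= Q by apply: Rintegral_ge0 => x _; exact: sqr_ge0.
have var t : 0 <= t <= 1 -> 2 * t * I <= t ^+ 2 * Q.
  move=> t01; have Sv := conv _ _ _ Sf Sf0 t01.
  have := Jd _ Sv; have -> : J (fun x => t * f x + (1 - t) * f0 x) = J f0 - 2 * t * I + t ^+ 2 * Q.
    have i1 := sqwf.2; have i2 := sq_integM sqwf sqff; have i3 := sqff.2.
    have j2 := integZ (2 * t) mD i2; have j3 := integZ (t ^+ 2) mD i3.
    rewrite /J /I /Q -!RintZ// -RintB// -RintD//; last exact: integB.
    by apply: eq_Rintegral => x _; ring.
  by move: Jle; exact: variation_bound.
rewrite leNgt; apply/negP => I0.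
have Q1 : 0 < Q + 1 by rewrite ltr_wpDl.
(* A step small enough for the first order gain 2 t I to exceed the second order loss t^2 Q. *)
pose t := Num.min 1 (I / (Q + 1)).
have t0 : 0 < t by rewrite lt_min ltr01 divr_gt0.
have t1 : t <= 1 by rewrite ge_min lexx.
have := var t; rewrite (ltW t0) t1 => /(_ isT).
have tQ : t * Q < I.
  apply: (@le_lt_trans _ _ (I / (Q + 1) * Q)); first by rewrite ler_wpM2r// ge_min lexx orbT.
  by rewrite mulrAC ltr_pdivrMr// ltr_pM2l// ltrDl.
rewrite leNgt => /negP; apply.
rewrite expr2 -mulrA; apply: (@lt_trans _ _ (t * I)); first by rewrite ltr_pM2l.
by rewrite -mulrA ltr_pMl ?mulr_gt0// ltr1n.
Unshelve. all: by end_near. Qed.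

End hilbert_projection.

(** * Elementary properties of a ball Banach function norm *)

Section banach_function_norm.
Context {R : realType} {n : nat}.
Local Notation E := 'rV[R]_n.+1.
Local Notation mu := (@lebesgue_rV R n).
Variable N : (E -> R) -> \bar R.
Hypothesis bN : ball_banach N.
Implicit Types (f g w : E -> R).
Let qN := bb_quasi bN.

Lemma norm_ge0 f : measurable_fun setT f -> (0 <= N f)%E. Proof. exact: bqb_ge0. Qed.

Lemma norm_zero : N (fun=> 0) = 0%E.
Proof.
have H := bqb_ball qN 0 (ltr01 : 0 < (1 : R)).
have := bqb_homogeneous qN 0 H; rewrite normr0 mul0e => <-.
by congr N; apply/funext => x; rewrite mul0r.
Qed.

Lemma norm_mono f g : measurable_fun setT f -> measurable_fun setT g ->
  {ae mu, forall x, `|g x| <= `|f x|} -> (N g <= N f)%E.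
Proof. exact: bqb_mono. Qed.

Lemma norm_ae f g : measurable_fun setT f -> measurable_fun setT g ->
  {ae mu, forall x, f x = g x} -> N f = N g.
Proof.
move=> mf mg fg; apply/eqP; rewrite eq_le; apply/andP; split; apply: norm_mono => //;
  by apply: filterS fg => x ->.
Qed.

Lemma norm_add f g : measurable_fun setT f -> measurable_fun setT g ->
  (N (fun x => f x + g x)%R <= N f + N g)%E.
Proof.
move=> mf mg; have f0 := norm_ge0 mf; have g0 := norm_ge0 mg.
have [fo|] := ltP (N f) +oo%E; last first.
  by rewrite leye_eq => /eqP ->; rewrite addye ?leey// -ltNye (lt_le_trans _ g0).
have [go|] := ltP (N g) +oo%E; last first.
  by rewrite leye_eq => /eqP ->; rewrite addey ?leey// -ltNye (lt_le_trans _ f0).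
exact: (bb_triangle bN).
Qed.

Lemma norm_scale (a : R) f : measurable_fun setT f -> (N f < +oo)%E ->
  N (fun x => a * f x) = (`|a|%:E * N f)%E.
Proof. by move=> mf fo; apply: (bqb_homogeneous qN). Qed.

Lemma norm_sum (T : Type) (t : seq T) (F : T -> E -> R) :
  (forall q, measurable_fun setT (F q)) ->
  (N (fun x => \sum_(q <- t) F q x)%R <= \sum_(q <- t) N (F q))%E.
Proof.
move=> mF; elim: t => [|q t IH].
  by rewrite big_nil; under [X in N X]eq_fun do rewrite big_nil; rewrite norm_zero.
rewrite big_cons; under [X in N X]eq_fun do rewrite big_cons.
apply: (le_trans (norm_add (mF q) _)); last exact: leeD2l.
exact: measurable_sum.
Qed.

(** The monotone convergence axiom, applied to the infima of |u j| over j >= k: they increase to |f|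
    and lie below |u k|. *)
Lemma norm_fatou (u : nat -> E -> R) f (M : \bar R) : (forall k, measurable_fun setT (u k)) ->
  measurable_fun setT f -> {ae mu, forall x, u ^~ x @ \oo --> f x} ->
  (forall k, (N (u k) <= M)%E) -> (N f <= M)%E.
Proof.
move=> mu_u mf uf uM.
pose a x (j : nat) : \bar R := `|u j x|%:E.
have a0 x k : (0 <= einfs (a x) k)%E.
  by apply: le_ereal_inf_tmp => _ [j _ <-]; rewrite lee_fin.
have ale x k : (einfs (a x) k <= `|u k x|%:E)%E.
  by apply: ereal_inf_lbound; exists k => //=.
have afin x k : einfs (a x) k \is a fin_num.
  by rewrite ge0_fin_numE// (le_lt_trans (ale x k))// ltry.
pose v (k : nat) x : R := fine (einfs (a x) k).
have mv k : measurable_fun setT (v k).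
  apply: (@measurableT_comp _ _ _ _ _ _ fine); first exact: fine_measurable.
  apply: (@measurable_fun_einfs _ _ _ setT (fun j x => a x j)) => j.
  by apply/measurable_EFinP; exact: measurableT_comp.
have mnf : measurable_fun setT (fun x => `|f x|) by exact: measurableT_comp.
have [|_ cN] := bqb_fatou qN mv mnf.
  apply: filterS uf => x ux; split.
  - by move=> k; rewrite fine_ge0.
  - by move=> k l kl; apply: fine_le => //; exact: nondecreasing_einfs.
  - apply: fine_cvg => /=; apply: cvg_einfs; apply: cvg_EFin; first exact: nearW.
    exact: cvg_norm.
apply: le_trans (_ : (N (fun x => `|f x|%R) <= M)%E).
  by apply: norm_mono => //; apply: nearW => x; rewrite normr_id.
rewrite -(cvg_lim _ cN)//; apply: lime_le; first by apply/cvg_ex; eexists; exact: cN.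
apply: nearW => k; apply: le_trans (uM k); apply: norm_mono => //.
apply: nearW => x; rewrite ger0_norm ?fine_ge0//.
by rewrite -lee_fin fineK.
Qed.

End banach_function_norm.

(** Read off from the definition of the integral as a supremum over simple functions; it is applied
    to the maximal function, whose measurability is not established. *)
Lemma le_nnintegral (R : realType) (n : nat) (f g : 'rV[R]_n.+1 -> \bar R) :
  (forall x, (0 <= f x)%E) -> (forall x, (f x <= g x)%E) ->
  (\int[lebesgue_rV]_x f x <= \int[lebesgue_rV]_x g x)%E.
Proof.
move=> f0 fg; have g0 x : (0 <= g x)%E by exact: le_trans (fg x).
rewrite !ge0_integralTE//; apply: le_ereal_sup => _ [h hf <-]; exists h => //.
by move=> x; exact: le_trans (fg x).
Qed.

(** * Norming functions *)

Section norming.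
Context {R : realType} {n : nat}.
Local Notation E := 'rV[R]_n.+1.
Local Notation mu := (@lebesgue_rV R n).
Variable N : (E -> R) -> \bar R.
Hypothesis bN : ball_banach N.
Implicit Types (f g w h : E -> R).

(* h is the positive part of w - f0, where f0 is the projection of w on the
   unit ball of N in L^2(D), and c is the integral of (w - f0) f0. *)
Lemma norming_function (D : set E) w (A : R) : measurable D -> (mu D < +oo)%E ->
  measurable_fun setT w -> (forall x, ~ D x -> w x = 0) -> (forall x, 0 <= w x <= A) ->
  (1 < N w)%E ->
  exists h (c : R), [/\ measurable_fun setT h, (forall x, 0 <= h x), integ D h,
    (associate_norm N (EFin \o h) <= c%:E)%E & c < \int[mu]_(x in D) (w x * h x)].
Proof.
move=> mD fD mw w0 wA Nw.
have mS f : measurable_fun setT f -> measurable_fun D f by exact: measurable_funS.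
pose S : set (E -> R) := [set f | [/\ measurable_fun setT f, forall x, ~ D x -> f x = (0 : R),
  sq_integ D f & (N f <= 1)%E]].
have bounded_sq f (b : R) : measurable_fun setT f -> (forall x, `|f x| <= b) -> sq_integ D f.
  move=> mf fb; split; first exact: mS.
  apply: (@integ_bounded _ _ _ _ (b ^+ 2)); [exact: mD|exact: fD| |].
    by apply: measurable_funX; exact: mS.
  by move=> x _; rewrite normrX lerXn2r ?nnegrE// (le_trans _ (fb x)).
have sw : sq_integ D w.
  apply: (bounded_sq _ A) => // x; have /andP[x0 xA] := wA x; by rewrite ger0_norm.
have S0 : S (fun=> 0).
  split; [exact: measurable_cst|by []| |].
    by apply: (bounded_sq _ 0) => [|x]; [exact: measurable_cst|rewrite normr0].
  by rewrite (norm_zero bN).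
have conv f g (t : R) : S f -> S g -> 0 <= t <= 1 -> S (fun x => t * f x + (1 - t) * g x).
  move=> [mf f0 sf Nf] [mg g0 sg Ng] /andP[t0 t1].
  have t1' : 0 <= 1 - t by rewrite subr_ge0.
  have mtf : measurable_fun setT (fun x => t * f x) by apply: measurable_funM => //; exact: measurable_cst.
  have mtg : measurable_fun setT (fun x => (1 - t) * g x) by apply: measurable_funM => //; exact: measurable_cst.
  split; first exact: measurable_funD.
  - by move=> x Dx; rewrite f0// g0// !mulr0 addr0.
  - exact: sq_integ_lin.
  apply: (le_trans (norm_add bN mtf mtg)).
  rewrite !(norm_scale bN) ?(le_lt_trans Nf) ?(le_lt_trans Ng) ?ltry// !ger0_norm//.
  have -> : (1 = t%:E * 1 + (1 - t)%:E * 1 :> \bar R)%E.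
    by rewrite !mule1 -EFinD addrC subrK.
  by apply: leeD; apply: lee_wpmul2l.
have [f0 [mf0 f00 sf0 Nf0] Hf0] : exists2 f0, S f0 &
    forall f, S f -> \int[mu]_(x in D) ((w x - f0 x) * (f x - f0 x)) <= 0.
  apply: (hilbert_projection mD fD sw _ _ conv); first by exists (fun=> 0).
    by move=> f [].
  move=> u Su cu sl; have mu_u k : measurable_fun setT (u k) by case: (Su k).
  have l0 x : ~ D x -> llim u x = 0.
    move=> Dx; apply: llimE; rewrite (_ : u ^~ x = fun=> 0); first exact: cvg_cst.
    by apply/funext => k; case: (Su k) => _ ->.
  have ml : measurable_fun setT (llim u) by exact: measurable_llim.
  split=> //; apply: (norm_fatou bN mu_u ml); last by move=> k; case: (Su k).
  apply: filterS cu => x cx; have [Dx|Dx] := pselect (D x); first exact: cx.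
  rewrite l0// (_ : u ^~ x = fun=> 0); first exact: cvg_cst.
  by apply/funext => k; case: (Su k) => _ ->.
pose h0 x := w x - f0 x; pose h x := Num.max 0 (h0 x).
have mh0 : measurable_fun setT h0 by exact: measurable_funB.
have mh : measurable_fun setT h by apply: measurable_maxr => //; exact: measurable_cst.
have sh0 : sq_integ D h0 by exact: sq_integB.
have h_ge0 x : 0 <= h x by rewrite le_max lexx.
have hle x : `|h x| <= `|h0 x|.
  rewrite (ger0_norm (h_ge0 x)) /h; have [?|?] := leP 0 (h0 x); first by rewrite ler_norm.
  exact: normr_ge0.
have sh : sq_integ D h.
  split; first exact: mS.
  apply: (integ_le mD _ sh0.2); first by apply: measurable_funX; exact: mS.
  by move=> x _; rewrite !normrX lerXn2r ?nnegrE.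
pose c := \int[mu]_(x in D) (h0 x * f0 x).
have le_c f : S f -> \int[mu]_(x in D) (h0 x * f x) <= c.
  move=> Sf; have sf : sq_integ D f by case: Sf.
  have := Hf0 _ Sf; have -> : \int[mu]_(x in D) ((w x - f0 x) * (f x - f0 x)) =
     \int[mu]_(x in D) (h0 x * f x) - c.
    rewrite /c -RintB//; [|exact: sq_integM|exact: sq_integM].
    by apply: eq_Rintegral => x _; rewrite /h0 mulrBr.
  by rewrite subr_le0.
have c0 : 0 <= c.
  have := le_c _ S0; under eq_Rintegral do rewrite mulr0.
  by rewrite Rintegral_cst// mul0r.
have i1 : integ D h.
  have s1 : sq_integ D (fun=> 1).
    by apply: (bounded_sq _ 1) => [|x]; [exact: measurable_cst|rewrite normr1].
  by have := sq_integM mD sh s1; under eq_fun do rewrite mulr1.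
exists h, c; split=> //.
- apply: ge_ereal_sup => _ [g [mg Ng] <-].
  (* A function g of norm 1 need not be square integrable: |g| is truncated at k and cut to D and to
     Q, where h0 = h. The results belong to S, and Fatou's lemma recovers g. *)
  pose Q : set E := h0 @^-1` `[0, +oo[.
  have mQ : measurable Q by rewrite -[Q]setTI; exact: mh0.
  pose fk (k : nat) x : R := Num.min `|g x| k%:R * \1_(D `&` Q) x.
  have mng : measurable_fun setT (fun x => `|g x|) by exact: measurableT_comp.
  have mfk k : measurable_fun setT (fk k).
    apply: measurable_funM; last by apply: measurable_indic; exact: measurableI.
    by apply: measurable_minr => //; exact: measurable_cst.
  have fk0 k x : 0 <= fk k x by rewrite mulr_ge0// le_min normr_ge0 ler0n.
  have fkS k : S (fk k).
    split=> //.
    - by move=> x Dx; rewrite /fk indicE memNset ?mulr0// => -[].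
    - apply: (bounded_sq _ k%:R) => // x; rewrite ger0_norm// /fk indicE.
      by case: (_ \in _); rewrite ?mulr1 ?mulr0// ge_min lexx orbT.
    - rewrite -Ng; apply: norm_mono => //; apply: nearW => x; rewrite ger0_norm// /fk indicE.
      by case: (_ \in _); rewrite ?mulr1 ?mulr0// ge_min lexx.
  have hfk k x : h0 x * fk k x = h x * fk k x.
    rewrite /fk indicE; have [/set_mem[_ Qx]|_] := boolP (x \in D `&` Q); last by rewrite !mulr0.
    move: Qx; rewrite /Q /= in_itv /= andbT => Qx; by rewrite /h max_r.
  have hD x : ~ D x -> h x = 0 by move=> Dx; rewrite /h /h0 w0// f00// subrr maxxx.
  have lim x : (fun k => (h x * fk k x)%:E) @ \oo --> (h x * `|g x|)%:E.
    apply: cvg_EFin; first exact: nearW.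
    have : \forall k \near \oo, h x * `|g x| = h x * fk k x.
      near=> k; rewrite /fk indicE; have [_|/negP xDQ] := boolP (x \in D `&` Q).
        by rewrite mulr1 min_l//; near: k; exact: nat_large.
      suff -> : h x = 0 by rewrite !mul0r.
      have [Dx|] := pselect (D x); last exact: hD.
      rewrite /h max_l// leNgt; apply/negP => hx; apply: xDQ; apply/mem_set; split=> //.
      by rewrite /Q /= in_itv /= andbT ltW.
    by move=> /near_eq_cvg/cvg_trans; apply; exact: cvg_cst.
  have mhfk k : measurable_fun setT (fun x => (h x * fk k x)%:E).
    by apply/measurable_EFinP; exact: measurable_funM.
  have hfk0 k x : setT x -> (0 <= (h x * fk k x)%:E)%E by move=> _; rewrite lee_fin mulr_ge0.
  have := fatou mu measurableT mhfk hfk0.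
  have -> : (\int[mu]_x limn_einf (fun k => (h x * fk k x)%:E) = \int[mu]_x `|(EFin \o h) x * (g x)%:E|)%E.
    apply: eq_integral => x _; rewrite (cvg_limn_einf_sup (lim x)).1 /=.
    by rewrite normrM (ger0_norm (h_ge0 x)).
  move=> /le_trans; apply; rewrite limn_einf_lim; apply: lime_le; first exact: is_cvg_einfs.
  apply: nearW => k; apply: (@le_trans _ _ (\int[mu]_x (h x * fk k x)%:E)%E).
    by apply: ereal_inf_lbound; exists k => //=.
  have [_ _ sfk _] := fkS k; have [i2] := sq_integM mD sh0 sfk.
  apply: le_trans (_ : ((\int[mu]_(x in D) (h0 x * fk k x))%:E <= _)%E); last first.
    by rewrite lee_fin; exact: le_c.
  rewrite /Rintegral fineK; last exact: (integrable_fin_num mD i2).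
  rewrite [leRHS]integral_mkcond; rewrite le_eqVlt; apply/orP; left; apply/eqP.
  apply: eq_integral => x _; rewrite patchE -hfk; case: ifPn => // /negP xD.
  by rewrite hfk hD ?mul0r// => Dx; apply: xD; exact/mem_set.
(* The integral exceeds c by that of h0^2, which is not zero: otherwise w = f0 almost everywhere and
   N w <= 1. *)
have wpos : c < \int[mu]_(x in D) (w x * h0 x).
  have -> : \int[mu]_(x in D) (w x * h0 x) = c + \int[mu]_(x in D) (h0 x ^+ 2).
    rewrite /c -RintD//; [|exact: sq_integM|by case: sh0].
    by apply: eq_Rintegral => x _; rewrite /h0; ring.
  rewrite ltrDl lt_neqAle Rintegral_ge0 ?andbT//; last by move=> x _; exact: sqr_ge0.
  apply/eqP => h20; have /ae_zero_norm : integ D (fun x => h0 x ^+ 2) by case: sh0.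
  move=> /(_ mD) H; have {}H : {ae mu, forall x, D x -> h0 x ^+ 2 = 0}.
    by apply: H; rewrite h20; apply: eq_Rintegral => x _; rewrite ger0_norm// sqr_ge0.
  move: Nw; rewrite ltNge => /negP; apply; rewrite (_ : N w = N f0)//.
  apply: (norm_ae bN) => //; apply: filterS H => x Hx.
  have [Dx|Dx] := pselect (D x); last by rewrite w0// f00.
  have /eqP := Hx Dx; rewrite sqrf_eq0 subr_eq0 => /eqP//.
apply: (lt_le_trans wpos); apply: (le_Rint mD (sq_integM mD sw sh0) (sq_integM mD sw sh)).
move=> x _; have /andP[x0 _] := wA x; rewrite ler_wpM2l// /h le_max lexx orbT//.
Unshelve. all: by end_near. Qed.

End norming.

Lemma le_integral_subset (R : realType) (n : nat) (A B : set 'rV[R]_n.+1)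
    (f : 'rV[R]_n.+1 -> \bar R) : (forall x, (0 <= f x)%E) -> A `<=` B ->
  (\int[lebesgue_rV]_(x in A) f x <= \int[lebesgue_rV]_(x in B) f x)%E.
Proof.
move=> f0 AB; rewrite [leLHS]integral_mkcond [leRHS]integral_mkcond.
apply: le_nnintegral => x; rewrite !patchE; first by case: ifP.
case: ifPn => [/set_mem Ax|_]; last by case: ifP.
by rewrite mem_set//; exact: AB.
Qed.

(** * Boundedness of the averaging operators *)

Section averaging.
Context {R : realType} {n : nat}.
Local Notation E := 'rV[R]_n.+1.
Local Notation G := 'rV[int]_n.+1.
Local Notation I := (int * G)%type.
Local Notation mu := (@lebesgue_rV R n).
Local Notation sc := (@sc R).
Local Notation sc_gt0 := (@sc_gt0 R).
Local Notation d := (n.+1%:R : R).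
Variables (Omega : set E) (Ca ca : R).
Hypotheses (oO : open Omega) (O0 : Omega !=set0) (Ca0 : 0 < Ca) (ca0 : 0 < ca).
Implicit Types (K : int) (x y : E) (i : I).
Local Notation A := (Aset Omega Ca ca).
Local Notation B := (Bset Omega).
Local Notation Mi := (Mi Omega Ca ca).

(** TK restricted to a finite list of cells, with which it agrees on a given ball for a suitable
    list, see [TK_avg]. *)
Definition avg K (U : seq I) (v : E -> R) x : R := \sum_(i <- U) \1_(B K i) x * Mi i v.

Let mB K i : measurable (B K i). Proof. exact: measurable_Bset. Qed.
Let mA i : measurable (A i). Proof. exact: measurable_Aset. Qed.

Lemma ccube_sub_eball (c : E) (r rho : R) : d * r < rho -> ccube c r `<=` eball c rho.
Proof.
move=> rr x xr; rewrite /eball /=; apply: (le_lt_trans (enorm_le _)).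
by apply: le_lt_trans rr; rewrite ler_wpM2l.
Qed.

(** One Euclidean ball around the centre, of radius d * (Ca + 2) times the side, contains both
    [B K i] and [A i]. *)
Lemma le_maximal : exists2 C6 : R, 0 < C6 & forall (h : E -> R) K i y,
  (forall x, 0 <= h x) -> integ (B K i) h -> A i y ->
  ((\int[mu]_(x in B K i) h x / sc i.1 ^+ n.+1)%:E <= C6%:E * maximal h y)%E.
Proof.
pose k : R := 3 * (d * (Ca + 2)).
have k0 : 0 < k by rewrite mulr_gt0// mulr_gt0// addr_gt0.
exists (k ^+ n.+1) => [|h K i y h0 ih [Ay _]]; first exact: exprn_gt0.
have s0 := sc_gt0 i.1; pose rho := d * (Ca + 2) * sc i.1.
have rho0 : 0 < rho by rewrite mulr_gt0// mulr_gt0// addr_gt0.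
have ccB : ccube (ctr i.1 i.2) ((Ca + 1) * sc i.1) `<=` eball (ctr i.1 i.2) rho.
  by apply: ccube_sub_eball; rewrite /rho mulrA ltr_pM2r// ltr_pM2l// ltrD2l ltr1n.
have le1 : (((3 * rho) ^+ n.+1)^-1%:E * (\int[mu]_(x in B K i) h x)%:E <= maximal h y)%E.
  apply: le_trans (_ : ((mu (eball (ctr i.1 i.2) rho))^-1 *
      \int[mu]_(x in eball (ctr i.1 i.2) rho) `|h x|%:E <= _)%E); last first.
    apply: ereal_sup_ubound; exists (ctr i.1 i.2, rho) => //; split=> //=.
    by apply: ccB; apply: (le_trans Ay); rewrite ler_wpM2r ?(ltW s0)// lerDl.
  apply: lee_pmul.
  - by rewrite lee_fin invr_ge0 exprn_ge0// mulr_ge0// ltW.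
  - by rewrite lee_fin; exact: Rintegral_ge0.
  - have -> : (((3 * rho) ^+ n.+1)^-1%:E = (((3 * rho) ^+ n.+1)%:E)^-1)%E.
      by rewrite inver gt_eqF// exprn_gt0// mulr_gt0.
    rewrite lee_pV2 ?inE//=; last first.
      by rewrite lee_fin exprn_ge0// mulr_ge0// ltW.
    apply: (@le_trans _ _ (mu (ccube (ctr i.1 i.2) rho))); last exact: mu_ccube.
    apply: le_lebesgue_outer => x; rewrite /eball /ccube /= => /ltW; apply: le_trans.
    exact: le_enorm.
  - apply: (@le_trans _ _ (\int[mu]_(x in B K i) `|h x|%:E)%E).
      have [inf] := ih; rewrite -[leLHS](_ : (\int[mu]_(x in B K i) (h x)%:E = _)%E).
        by under [leRHS]eq_integral do rewrite ger0_norm//.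
      by rewrite /Rintegral fineK//; exact: (integrable_fin_num (mB K i) inf).
    apply: le_integral_subset => [x|x [xc _ _]]; first by rewrite lee_fin.
    by apply: ccB; apply: (le_trans xc); rewrite ler_peMl ?(ltW s0)// lerDr ltW.
have -> : (\int[mu]_(x in B K i) h x / sc i.1 ^+ n.+1)%:E =
    ((k ^+ n.+1)%:E * (((3 * rho) ^+ n.+1)^-1%:E * (\int[mu]_(x in B K i) h x)%:E))%E.
  have -> : 3 * rho = k * sc i.1 by rewrite /rho /k; ring.
  have sn : sc i.1 ^+ n.+1 != 0 by rewrite gt_eqF// exprn_gt0.
  have kn : k ^+ n.+1 != 0 by rewrite gt_eqF// exprn_gt0.
  rewrite -!EFinM [(k * sc i.1) ^+ n.+1]exprMn; congr EFin.
  by rewrite invfM !mulrA mulfV// mul1r mulrC.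
by apply: lee_wpmul2l => //; rewrite lee_fin exprn_ge0// ltW.
Qed.

Lemma ball_integ (N : (E -> R) -> \bar R) (v : E -> R) c (r : R) : ball_banach N ->
  measurable_fun setT v -> (N v < +oo)%E -> integ (ccube c r) v.
Proof.
move=> bN mv Nv; apply: integP; first exact: (@measurable_funS _ _ _ _ setT).
have rho0 : 0 < d * `|r| + 1 by rewrite ltr_wpDl// mulr_ge0.
have [C C0 HC] := bb_ball_integral bN c rho0.
apply: le_lt_trans (le_trans (le_integral_subset _ _) (HC v (conj mv Nv))) _.
- by move=> x; rewrite lee_fin.
- apply: ccube_sub_eball; rewrite (le_lt_trans (_ : _ <= d * `|r|)) ?ltrDl//.
  by rewrite ler_wpM2l// ler_norm.
have v0 := norm_ge0 bN mv; by rewrite lte_mul_pinfty// lee_fin ltW.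
Qed.

Lemma Bsets_bounded K (U : seq I) : exists2 r : R, 0 < r & forall i, i \in U -> B K i `<=` ccube 0 r.
Proof.
elim: U => [|i U [r r0 IH]]; first by exists 1.
have s0 := sc_gt0 i.1; have n0 := normr_ge0 (ctr i.1 i.2 : E).
exists (r + (`|ctr i.1 i.2| + sc i.1)) => [|i']; first by rewrite addr_gt0// ltr_wpDl.
rewrite inE => /predU1P[->|/IH H] x; last first.
  by move=> /H /le_trans; apply; rewrite lerDl addr_ge0// ltW.
move=> [xc _ _]; rewrite /ccube /= subr0 -[x](subrK (ctr i.1 i.2)).
rewrite (le_trans (ler_normD _ _))// addrC (le_trans (lerD (lexx _) xc))//.
by rewrite lerDr ltW.
Qed.

Lemma avg_integral K (U : seq I) (D : set E) (V h : E -> R) : measurable D ->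
  (forall i, i \in U -> B K i `<=` D) -> integ D h ->
  integ D (fun x => avg K U V x * h x) /\
  \int[mu]_(x in D) (avg K U V x * h x) = \sum_(i <- U) Mi i V * \int[mu]_(x in B K i) h x.
Proof.
move=> mD; rewrite /avg; elim: U => [|i U IH] UD ih.
  have -> : (fun x => (\sum_(j <- [::]) \1_(B K j) x * Mi j V) * h x) = fun=> 0.
    by apply/funext => x; rewrite big_nil mul0r.
  by split; [split; exact: integrable0|rewrite Rintegral_cst// mul0r big_nil].
have [|i1 e1] := IH _ ih; first by move=> j jU; apply: UD; rewrite inE jU orbT.
have BD : B K i `<=` D by apply: UD; rewrite mem_head.
have mi : measurable_fun D (\1_(B K i) : E -> R).
  by apply: (@measurable_funS _ _ _ _ setT) => //; exact: measurable_indic.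
have b1 x : `|(\1_(B K i) : E -> R) x| <= 1.
  by rewrite indicE; case: (_ \in _); rewrite ?normr1 ?normr0.
have [|i2 e2] := integ_supp mD (mB K i) BD (integ_sub (mB K i) mD BD ih) (integ_measurable ih) mi b1.
  by move=> x _ nx; rewrite indicE memNset.
have i3 := integZ (Mi i V) mD i2.
have -> : (fun x => (\sum_(j <- i :: U) \1_(B K j) x * Mi j V) * h x) =
   fun x => Mi i V * (h x * \1_(B K i) x) + (\sum_(j <- U) \1_(B K j) x * Mi j V) * h x.
  by apply/funext => x; rewrite big_cons mulrDl; congr (_ + _); ring.
split; first exact: integD.
rewrite RintD// RintZ// e2 e1 big_cons; congr (_ * _ + _).
by apply: eq_Rintegral => x xB; rewrite indicE xB mulr1.
Qed.

Lemma measurable_avg K U V : measurable_fun setT (avg K U V).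
Proof.
apply: measurable_sum => i; apply: measurable_funM; last exact: measurable_cst.
exact: measurable_indic.
Qed.

Lemma avg_ge0 K U V x : (forall y, 0 <= V y) -> 0 <= avg K U V x.
Proof.
move=> V0; apply: sumr_ge0 => i _; rewrite mulr_ge0// /Mi divr_ge0 ?exprn_ge0 ?(ltW (sc_gt0 _))//.
exact: Rintegral_ge0.
Qed.

(** By contradiction: otherwise the normalized average w has norm larger than 1 and a norming
    function h. The integral of w h is a sum over cells of [Mi i V] times the integral of h; by
    [le_maximal] and bounded overlap it is at most a constant times that of V against the maximal
    function of h, hence at most c. *)
Lemma avg_Y (Y : (E -> R) -> \bar R) : ball_banach Y -> maximal_bounded_on_associate Y ->
  exists2 C : R, 0 < C & forall K U (V : E -> R), uniq U -> (forall i, i \in U -> B K i !=set0) ->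
    measurable_fun setT V -> (forall x, 0 <= V x) -> (Y V < +oo)%E ->
    (Y (avg K U V) <= C%:E * Y V)%E.
Proof.
move=> bY [CM CM0 HCM]; have [C6 C60 H6] := le_maximal.
have [N2 HN2] := overlap_bound Omega Ca0 ca0.
pose kap := N2.+1%:R * C6; have kap0 : 0 < kap by rewrite mulr_gt0.
exists (kap * CM); first exact: mulr_gt0.
move=> K U V uU HU mV V0 YV; have YV0 := norm_ge0 bY mV.
have mavg := measurable_avg K U V.
have iV i : integ (A i) V.
  apply: (integ_sub (mA i) (measurable_ccube _ _) (@subIsetl _ _ _)).
  exact: (ball_integ _ _ bY mV YV).
(* When the norm is zero V cannot be normalized, but then it vanishes almost everywhere and so do
   its averages. *)
have [YVE|YVn] := eqVneq (Y V) 0%E.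
  have V0ae := bqb_eq0 (bb_quasi bY) mV YVE.
  have M0 i : Mi i V = 0.
    rewrite /Mi [X in X / _](_ : _ = 0) ?mul0r// /Rintegral.
    have -> : (\int[mu]_(x in A i) (V x)%:E = \int[mu]_(x in A i) 0)%E; last by rewrite integral0.
    apply: ae_eq_integral => //.
      by apply/measurable_EFinP; exact: integ_measurable.
    by apply: filterS V0ae => x -> _.
  rewrite (_ : avg K U V = fun=> 0) ?(norm_zero bY) ?YVE ?mule0//.
  by apply/funext => x; rewrite /avg big1// => i _; rewrite M0 mulr0.
pose yv := fine (Y V).
have yvE : Y V = yv%:E by rewrite fineK// ge0_fin_numE.
have yv0 : 0 < yv by rewrite fine_gt0// lt_def YVn YV0 YV.
pose l := kap * CM * yv; have l0 : 0 < l by rewrite !mulr_gt0.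
pose w x := l^-1 * avg K U V x.
have mw : measurable_fun setT w by apply: measurable_funM => //; exact: measurable_cst.
have Mi0 i : 0 <= Mi i V.
  by rewrite /Mi divr_ge0 ?exprn_ge0 ?(ltW (sc_gt0 _))//; exact: Rintegral_ge0.
suff Yw : (Y w <= 1)%E.
  have -> : avg K U V = fun x => l * w x by apply/funext => x; rewrite /w mulVKf ?gt_eqF.
  rewrite (norm_scale bY) ?(le_lt_trans Yw) ?ltry// gtr0_norm// yvE -EFinM -/l.
  by rewrite -[leRHS]mule1 lee_wpmul2l// lee_fin ltW.
have [r r0 UD] := Bsets_bounded K U; set D := ccube 0 r in UD.
have mD : measurable D by exact: measurable_ccube.
have fD : (mu D < +oo)%E by exact: mu_ccube_fin.
rewrite leNgt; apply/negP => Yw.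
have w_out x : ~ D x -> w x = 0.
  move=> Dx; rewrite /w /avg big_seq big1 ?mulr0// => i iU.
  by rewrite indicE memNset ?mul0r// => /(UD i iU).
have w_bd x : 0 <= w x <= l^-1 * \sum_(i <- U) Mi i V.
  rewrite mulr_ge0 ?invr_ge0 ?(ltW l0) ?avg_ge0//=; apply: ler_wpM2l; first by rewrite invr_ge0 ltW.
  by apply: ler_sum => i _; rewrite indicE; case: (_ \in _); rewrite ?mul1r ?mul0r.
have [h [c [mh h0 ih hc]]] := norming_function bY mD fD mw w_out w_bd Yw.
have [iavg eavg] := avg_integral V mD UD ih.
rewrite ltNge => /negP; apply.
have -> : \int[mu]_(x in D) (w x * h x) = l^-1 * \sum_(i <- U) Mi i V * \int[mu]_(x in B K i) h x.
  by rewrite -eavg -RintZ//; apply: eq_Rintegral => x _; rewrite /w mulrA.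
pose g1 x := yv^-1 * V x.
have mg1 : measurable_fun setT g1 by apply: measurable_funM => //; exact: measurable_cst.
have Yg1 : Y g1 = 1%E.
  rewrite (norm_scale bY _ mV YV) yvE gtr0_norm ?invr_gt0// -EFinM mulVf ?gt_eqF//.
have h_assoc : associate_space Y h by split=> //; rewrite (le_lt_trans hc) ?ltry.
have Mc : (\int[mu]_x `|maximal h x * (g1 x)%:E| <= (CM * c)%:E)%E.
  apply: (@le_trans _ _ (associate_norm Y (maximal h))).
    by apply: ereal_sup_ubound; exists g1.
  apply: le_trans (HCM h h_assoc) _; rewrite EFinM lee_wpmul2l// lee_fin ltW//.
pose b i := \int[mu]_(x in B K i) h x / sc i.1 ^+ n.+1.
have ihB i : i \in U -> integ (B K i) h by move=> iU; exact: integ_sub (mB K i) mD (UD i iU) ih.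
have b0 i : 0 <= b i by rewrite /b divr_ge0 ?exprn_ge0 ?(ltW (sc_gt0 _))//; exact: Rintegral_ge0.
have mi i : measurable_fun setT (\1_(A i) : E -> R) by exact: measurable_indic.
have b1 i x : `|(\1_(A i) : E -> R) x| <= 1.
  by rewrite indicE; case: (_ \in _); rewrite ?normr1 ?normr0.
have iVA i : integ setT (fun y => V y * \1_(A i) y) /\
    \int[mu]_y (V y * \1_(A i) y) = \int[mu]_(y in A i) V y.
  have [|j1 j2] := integ_supp measurableT (mA i) (@subsetT _ _) (iV i) mV (mi i) (b1 i).
    by move=> y _ ny; rewrite indicE memNset.
  split=> //; rewrite j2; apply: eq_Rintegral => y yA; rewrite indicE yA mulr1//.
pose q y := \sum_(i <- U) (kap^-1 * yv^-1 * b i) * (V y * \1_(A i) y).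
have iq : integ setT q by apply: integ_sum => // i; apply: integZ => //; case: (iVA i).
have eq : \int[mu]_y q y = kap^-1 * yv^-1 * \sum_(i <- U) Mi i V * \int[mu]_(x in B K i) h x.
  rewrite Rintegral_sum//; last by move=> i; apply: integZ => //; case: (iVA i).
  rewrite mulr_sumr; apply: eq_bigr => i _; rewrite RintZ//; last by case: (iVA i).
  rewrite (iVA i).2 /Mi /b; ring.
have q0 y : 0 <= q y.
  apply: sumr_ge0 => i _; apply: mulr_ge0; last by rewrite mulr_ge0.
  by apply: mulr_ge0; [rewrite mulr_ge0 ?invr_ge0 ?ltW|exact: b0].
have qle : (\int[mu]_y (q y)%:E <= \int[mu]_x `|maximal h x * (g1 x)%:E|)%E.
  apply: le_nnintegral => [y|y]; first by rewrite lee_fin.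
  have m0 : (0 <= maximal h y)%E.
    apply: le_trans (ereal_sup_ubound _); last first.
      exists (y, 1) => //; split=> //=; rewrite /eball /= subrr.
      apply: le_lt_trans (enorm_le _) _; by rewrite normr0 mulr0.
    by rewrite mule_ge0 ?inve_ge0// integral_ge0// => z _; rewrite lee_fin.
  (* The maximal function may be +oo; away from the zeros of V its product with g1 is then +oo as
     well. *)
  have [Vy|Vy] := eqVneq (V y) 0.
    by rewrite /q big1 ?abse_ge0// => i _; rewrite Vy mul0r mulr0.
  have Vy0 : 0 < V y by rewrite lt_def Vy V0.
  have g1y : 0 < g1 y by rewrite mulr_gt0// invr_gt0.
  rewrite gee0_abs; last by rewrite mule_ge0// lee_fin ltW.
  have key (z : R) : (forall i, i \in U -> A i y -> b i <= C6 * z) -> 0 <= z -> q y <= z * g1 y.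
    move=> Hz z0; rewrite /q.
    apply: (@le_trans _ _ (\sum_(i <- U) (y \in A i)%:R * (kap^-1 * (C6 * z) * g1 y))).
      rewrite big_seq [leRHS]big_seq; apply: ler_sum => i iU; rewrite indicE.
      have [yA|yA] := boolP (y \in A i); last by rewrite mulr0 mulr0 mul0r.
      rewrite mulr1 mul1r /g1 [leLHS](_ : _ = kap^-1 * b i * (yv^-1 * V y)); last by ring.
      apply: ler_wpM2r; first by rewrite mulr_ge0// invr_ge0 ltW.
      apply: ler_wpM2l; first by rewrite invr_ge0 ltW.
      by apply: Hz => //; exact: set_mem.
    rewrite -mulr_suml; apply: (@le_trans _ _ (N2.+1%:R * (kap^-1 * (C6 * z) * g1 y))).
      apply: ler_wpM2r.
        by rewrite !mulr_ge0// ?invr_ge0 ltW.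
      rewrite -natr_sum ler_nat; apply: leq_trans (leqnSn _).
      have := HN2 K y U uU HU; by rewrite size_filter -sum1_count big_mkcond.
    rewrite le_eqVlt; apply/orP; left; apply/eqP; rewrite /kap.
    by field; rewrite gt_eqF// nat1r pnatr_eq0.
  have := fun i => H6 h K i y h0; move: m0; case: (maximal h y) => [z|_ _|//].
    rewrite lee_fin => z0 Hz; rewrite -EFinM lee_fin; apply: key => // i iU Ay.
    by have := Hz i (ihB i iU) Ay; rewrite -EFinM lee_fin.
  by rewrite gt0_mulye ?lte_fin// leey.
have fq : (\int[mu]_y (q y)%:E = (\int[mu]_y q y)%:E)%E.
  by have [j] := iq; rewrite /Rintegral fineK//; exact: (integrable_fin_num measurableT j).
have := le_trans qle Mc; rewrite fq lee_fin eq => H.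
rewrite -(ler_pM2l CM0); apply: le_trans H; rewrite le_eqVlt; apply/orP; left; apply/eqP.
rewrite /l; field; rewrite !gt_eqF//.
Qed.

(** With t = a / l this is t <= 1 + t^p, clear for t <= 1 and for t >= 1. *)
Lemma young (a l p : R) : 0 <= a -> 0 < l -> 1 <= p -> a <= l + l * ((l^-1) `^ p * a `^ p).
Proof.
move=> a0 l0 p1; have li : 0 <= l^-1 by rewrite invr_ge0 ltW.
rewrite -powRM// -[X in X + _]mulr1 -mulrDr -ler_pdivrMl//.
have [t1|t1] := leP (l^-1 * a) 1; first by rewrite (le_trans t1)// lerDl powR_ge0.
apply: (@le_trans _ _ ((l^-1 * a) `^ p)); last by rewrite lerDr.
by rewrite -[leLHS]powRr1 ?mulr_ge0// ler_powR// ltW.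
Qed.

(* Instead of Hoelder's inequality, use [young] where l is the p-th root of the
   average of v^p. *)
Lemma Mi_pow (p : R) : 1 <= p -> exists2 CJ : R, 0 < CJ & forall i (v : E -> R),
  (forall x, 0 <= v x) -> integ (A i) v -> integ (A i) (fun x => v x `^ p) ->
  Mi i v <= CJ * (Mi i (fun x => v x `^ p)) `^ p^-1.
Proof.
move=> p1; have p0 : 0 < p by exact: lt_le_trans p1.
pose cA : R := (3 * Ca) ^+ n.+1; have cA0 : 0 < cA by rewrite exprn_gt0// mulr_gt0.
exists (cA + 1) => [|i v v0 iv ivp]; first by rewrite addr_gt0.
have s0 := sc_gt0 i.1; set X := Mi i (fun x => v x `^ p).
have X0 : 0 <= X.
  by rewrite /X /Mi divr_ge0 ?exprn_ge0 ?(ltW s0)//; apply: Rintegral_ge0 => x _; exact: powR_ge0.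
have fA : (mu (A i) <= ((3 * (Ca * sc i.1)) ^+ n.+1)%:E)%E.
  apply: le_trans (mu_ccube (ctr i.1 i.2) (mulr_gt0 Ca0 s0)).
  by apply: le_lebesgue_outer => y [].
have fin : mu (A i) \is a fin_num.
  by rewrite ge0_fin_numE//; apply: (le_lt_trans fA); rewrite ltry.
have H (l : R) : 0 < l -> Mi i v <= l * cA + l * ((l^-1) `^ p * X).
  move=> l0; rewrite /Mi ler_pdivrMr ?exprn_gt0//.
  have ic : integ (A i) (fun=> l).
    apply: (@integ_bounded _ _ _ _ l) => //; first by rewrite ltey_eq fin.
    by move=> y _; rewrite ger0_norm// ltW.
  have iz : integ (A i) (fun x => l * ((l^-1) `^ p * v x `^ p)) by apply: integZ => //; exact: integZ.
  apply: le_trans (le_Rint (mA i) iv (integD (mA i) ic iz) _) _.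
    by move=> x _; exact: young.
  rewrite RintD// Rintegral_cst// RintZ//; last exact: integZ.
  rewrite RintZ// mulrDl; apply: lerD; last first.
    by rewrite /X /Mi -!mulrA; rewrite mulVf ?mulr1// gt_eqF// exprn_gt0.
  rewrite -mulrA ler_wpM2l ?(ltW l0)// /cA -exprMn -mulrA -lee_fin fineK//.
(* The intended l is then 0; a small positive l shows instead that the average of v is at most half
   of itself. *)
have [XE|Xn] := eqVneq X 0.
  rewrite XE powR0 ?invr_eq0 ?gt_eqF// mulr0 leNgt; apply/negP => M0.
  have l0 : 0 < Mi i v / (2 * cA) by rewrite divr_gt0// mulr_gt0.
  have := H _ l0; rewrite XE !mulr0 addr0 leNgt => /negP; apply.
  rewrite [ltLHS](_ : _ = Mi i v / 2); last by field; rewrite gt_eqF.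
  by rewrite ltr_pdivrMr// ltr_pMr// ltr1n.
have Xp : 0 < X by rewrite lt_def Xn X0.
have l0 : 0 < X `^ p^-1 by exact: powR_gt0.
apply: le_trans (H _ l0) _.
have e : (X `^ p^-1)^-1 `^ p * X = 1.
  have e1 : (X `^ p^-1) `^ p = X by rewrite -powRrM mulVf ?gt_eqF// powRr1.
  by rewrite -{2}e1 -powRM ?invr_ge0 ?(ltW l0)// mulVf ?gt_eqF// powR1.
by rewrite e mulr1 -{2}[X `^ _]mulr1 -mulrDr mulrC.
Qed.

Lemma convexificationE (p : R) (N : (E -> R) -> \bar R) (v : E -> R) : 1 <= p ->
  (forall x, 0 <= v x) ->
  convexification p^-1 N (fun x => v x `^ p) = (N v `^ p)%E.
Proof.
move=> p1 v0; rewrite /convexification invrK; congr (N _ `^ p)%E; apply/funext => x.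
rewrite ger0_norm ?powR_ge0// -powRrM mulfV ?powRr1// gt_eqF//.
exact: lt_le_trans p1.
Qed.

(** Boundedly many cells are active at a point, so [Mi_pow] bounds the average of v pointwise by a
    constant times the p-th root of the average of v^p, whose norm [avg_Y] controls in X^(1/p). *)
Lemma avg_norm (N : (E -> R) -> \bar R) (p : R) : ball_banach N -> 1 <= p ->
  ball_banach (convexification p^-1 N) ->
  maximal_bounded_on_associate (convexification p^-1 N) ->
  exists2 C : R, 0 < C & forall K U (v : E -> R), uniq U ->
    (forall i, i \in U -> B K i !=set0) ->
    measurable_fun setT v -> (forall x, 0 <= v x) -> (N v < +oo)%E ->
    (N (avg K U v) <= C%:E * N v)%E.
Proof.
move=> bN p1 bY mY; have p0 : 0 < p by exact: lt_le_trans p1.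
have pi0 : 0 < p^-1 by rewrite invr_gt0.
have [C C0 HC] := avg_Y bY mY; have [CJ CJ0 HJ] := Mi_pow p1.
pose N1 : R := (5 * 6 ^ n.+1)%:R; have N10 : 0 < N1 by rewrite ltr0n muln_gt0 expn_gt0.
exists (N1 * CJ * C `^ p^-1) => [|K U v uU HU mv v0 Nv]; first by rewrite !mulr_gt0// powR_gt0.
have Nv0 := norm_ge0 bN mv.
pose V x := v x `^ p; have V0 x : 0 <= V x by exact: powR_ge0.
have mV : measurable_fun setT V by apply: (measurableT_comp (measurable_powR p)).
have YV : convexification p^-1 N V = (N v `^ p)%E by exact: convexificationE.
have YVo : (convexification p^-1 N V < +oo)%E by rewrite YV poweR_lty.
have iv i : integ (A i) v.
  apply: (integ_sub (mA i) (measurable_ccube _ _) (@subIsetl _ _ _)).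
  exact: (ball_integ _ _ bN mv Nv).
have iV i : integ (A i) V.
  apply: (integ_sub (mA i) (measurable_ccube _ _) (@subIsetl _ _ _)).
  exact: (ball_integ _ _ bY mV YVo).
pose z x := avg K U V x `^ p^-1.
have a0 x : 0 <= avg K U V x by exact: avg_ge0.
have z0 x : 0 <= z x by exact: powR_ge0.
have mz : measurable_fun setT z.
  by apply: (measurableT_comp (measurable_powR p^-1)); exact: measurable_avg.
have zp : (fun x => z x `^ p) = avg K U V.
  by apply/funext => x; rewrite /z -powRrM mulVf ?gt_eqF// powRr1.
have Nz : (N z <= (C `^ p^-1)%:E * N v)%E.
  have := HC K U V uU HU mV V0 YVo; rewrite YV -zp convexificationE// => H.
  have Nz0 := norm_ge0 bN mz.
  have pow (x : \bar R) : (0 <= x -> (x `^ p) `^ p^-1 = x)%E.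
    by move=> x0; rewrite -poweRrM mulfV ?gt_eqF// poweRe1.
  rewrite -(pow _ Nz0) -(pow _ Nv0) -poweR_EFin -poweRM ?lee_fin ?(ltW C0) ?poweR_ge0//.
  apply: gt0_ler_poweR => //; first exact: ltW.
  - by rewrite in_itv /= poweR_ge0 leey.
  - by rewrite in_itv /= leey andbT mule_ge0 ?lee_fin ?(ltW C0) ?poweR_ge0.
have Mi0 i (u : E -> R) : (forall x, 0 <= u x) -> 0 <= Mi i u.
  by move=> u0; rewrite /Mi divr_ge0 ?exprn_ge0 ?(ltW (sc_gt0 _))//; exact: Rintegral_ge0.
have pw x : avg K U v x <= N1 * CJ * z x.
  (* Taken with the zero family of polynomials, to obtain the list of the active cells. *)
  have [t [ut st tB _]] := FK_near (fun _ _ _ => 0) O0 K x.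
  pose W := [seq i <- U | x \in B K i].
  have WE u : avg K U u x = \sum_(i <- W) Mi i u.
    rewrite /avg big_filter [RHS]big_mkcond; apply: eq_bigr => i _.
    by rewrite indicE; case: ifP; rewrite ?mul1r ?mul0r.
  have sW : (size W <= 5 * 6 ^ n.+1)%N.
    apply: leq_trans st; apply: uniq_leq_size; first by rewrite filter_uniq.
    by move=> i; rewrite mem_filter => /andP[/set_mem Bi _]; apply/tB.
  rewrite WE; apply: (@le_trans _ _ (\sum_(i <- W) CJ * z x)).
    rewrite big_seq [leRHS]big_seq; apply: ler_sum => i iW.
    apply: le_trans (HJ i v v0 (iv i) (iV i)) _; apply: ler_wpM2l; first exact: ltW.
    apply: ge0_ler_powR; rewrite ?nnegrE ?Mi0 ?a0//; first exact: ltW.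
    rewrite WE (perm_big _ (perm_to_rem iW)) big_cons lerDl; apply: sumr_ge0 => j _; exact: Mi0.
  rewrite big_const_seq count_predT iter_addr_0 -[leLHS]mulr_natl -mulrA.
  by apply: ler_wpM2r; [rewrite mulr_ge0// ltW|rewrite ler_nat].
have NC0 : 0 <= N1 * CJ by rewrite mulr_ge0 ?ltW.
apply: (@le_trans _ _ (N (fun x => N1 * CJ * z x))).
  have mcz : measurable_fun setT (fun x => N1 * CJ * z x).
    by apply: measurable_funM => //; exact: measurable_cst.
  apply: (norm_mono bN mcz (measurable_avg K U v)).
  apply: nearW => x; rewrite !ger0_norm ?pw ?avg_ge0//.
  by rewrite mulr_ge0.
rewrite (norm_scale bN) ?(le_lt_trans Nz)//; last first.
  by rewrite lte_mul_pinfty ?lee_fin ?powR_ge0.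
by rewrite (ger0_norm NC0) [X in (_ <= X * _)%E]EFinM -muleA; apply: lee_wpmul2l; rewrite ?lee_fin.
Qed.

End averaging.

(** Segments join points and the boundary is empty. It makes the uniqueness of weak derivatives
    available on the whole space too. *)
Lemma eps_infty_domain_setT (R : realType) (n : nat) :
  eps_infty_domain 1 [set: 'rV[R]_n.+1].
Proof.
split=> [|x y _ _ xy]; first exact: openT.
pose gamma (t : R) : 'rV[R]_n.+1 := x + t *: (y - x).
have enormZ (c : R) (v : 'rV[R]_n.+1) : 0 <= c -> enorm (c *: v) = c * enorm v.
  move=> c0; rewrite /enorm; under eq_bigr do rewrite mxE exprMn.
  by rewrite -mulr_sumr sqrtrM ?sqr_ge0// sqrtr_sqr ger0_norm.
have enormN (v : 'rV[R]_n.+1) : enorm (- v) = enorm v.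
  by rewrite /enorm; congr Num.sqrt; apply: eq_bigr => i _; rewrite mxE sqrrN.
exists gamma; split=> //.
- apply: continuous_subspaceT => t; apply: cvgD; first exact: cvg_cst.
  by apply: cvgZr_tmp; exact: cvg_id.
- by rewrite /gamma scale0r addr0 scale1r addrC subrK.
- apply: ge_ereal_sup => _ [s [ps /eqP ls] <-]; rewrite lee_fin invr1 mul1r.
  rewrite /polygon_length big_nat; pose v := nth 1 (0 :: s).
  rewrite (eq_bigr (fun k => v k.+1 * enorm (y - x) - v k * enorm (y - x))); last first.
    move=> k /andP[_ ks] /=; rewrite /gamma opprD addrACA subrr add0r -scalerBl enormZ ?mulrBl//.
    by rewrite subr_ge0 ltW//; move/pathP : ps => /(_ 1 k ks).
  rewrite -big_nat telescope_sumr//.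
  have -> : v (size s) = 1 by rewrite /v -[size s]/((size (0 :: s)).-1) nth_last /= ls.
  by rewrite mul1r mul0r subr0 -opprB enormN.
- move=> t _; rewrite /dist_to_set (_ : boundary _ = set0) ?image_set0 ?ereal_inf0 ?leey//.
  by rewrite /boundary interiorT setDT.
Qed.

(** * Sobolev spaces *)

Section sobolev.
Context {R : realType} {n : nat}.
Local Notation E := 'rV[R]_n.+1.
Local Notation G := 'rV[int]_n.+1.
Local Notation I := (int * G)%type.
Local Notation mu := (@lebesgue_rV R n).
Local Notation sc := (@sc R).
Implicit Types (f g h : E -> R) (Omega : set E) (N : (E -> R) -> \bar R).

(** By [ae_zero_test] for g - g'; polynomials of degree 0 are enough for it, hence the order m' =
    0. *)
Lemma weak_deriv_unique (eps : R) Omega alpha f g g' : 0 < eps -> eps_infty_domain eps Omega ->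
  Omega !=set0 -> is_weak_deriv Omega alpha f g -> is_weak_deriv Omega alpha f g' ->
  {ae mu, forall x, Omega x -> g x = g' x}.
Proof.
move=> e0 domO O0 [lg Hg] [lg' Hg']; have oO := domO.1.
have mO : measurable Omega by exact: open_measurable_rV.
have [P [Ca [ca [C [k1 pdP]]]]] := poly_data_exists 0 e0 domO O0.
pose h y := -1 * g' y + g y.
have lh : loc_integrable Omega h by exact: loc_integrable_lin.
suff : {ae mu, forall x, Omega x -> h x = 0}.
  by apply: filterS => x Hx Ox; apply/eqP; rewrite -subr_eq0 addrC -mulN1r; exact/eqP/Hx.
apply: (ae_zero_test oO O0 pdP lh) => S u cS SO [su u0].
have tf : test_function Omega u by exact: test_functionP su cS SO u0.
have mS : measurable S by apply: closed_measurable_rV; exact: compact_closed.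
have [r r0 Sr] := compact_ccube cS.
have ur : supp_in r u.
  move=> x xr; apply: u0 => /Sr; rewrite /ccube /= subr0 leNgt xr//.
have [A A0 HA] := supp_bounded (smooth_continuous su) ur.
have mu_u : measurable_fun Omega u.
  by apply: (@measurable_funS _ _ _ _ setT) => //; exact/continuous_measurable_rV/smooth_continuous.
have prod v : loc_integrable Omega v -> integ Omega (fun y => v y * u y).
  move=> lv; have iv := loc_integ mS cS SO lv mO.
  exact: (integ_supp mO mS SO iv lv.1 mu_u HA (fun x _ nx => u0 x nx)).1.
have ig := prod g lg; have ig' := prod g' lg'.
have -> : \int[mu]_(y in Omega) (h y * u y) =
    \int[mu]_(y in Omega) (g y * u y) - \int[mu]_(y in Omega) (g' y * u y).
  by rewrite -RintB//; apply: eq_Rintegral => y _; rewrite /h; ring.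
apply/eqP; rewrite subr_eq0; apply/eqP; have := etrans (esym (Hg _ tf)) (Hg' _ tf).
by apply: mulfI; rewrite signr_eq0.
Qed.

Lemma weak_derivP Omega alpha f g : is_weak_deriv Omega alpha f g ->
  is_weak_deriv Omega alpha f (weak_deriv Omega alpha f).
Proof.
move=> H; rewrite /weak_deriv.
by have := @xgetPex _ (fun=> 0) [set g | is_weak_deriv Omega alpha f g] (ex_intro _ g H).
Qed.

Lemma norm_restrict_le N Omega h : ball_banach N -> measurable Omega ->
  measurable_fun Omega h -> (N (fun x => `|(h \_ Omega) x|%R) <= restr_norm N Omega h)%E.
Proof.
move=> bN mO mh; apply: le_ereal_inf_tmp => _ [g [[mg _] hg] <-].
have mr : measurable_fun setT (fun x => `|(h \_ Omega) x|).
  by apply: measurableT_comp => //; exact/(measurable_restrictT _ mO).1.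
apply: (norm_mono bN mg mr).
apply: filterS hg => x Hx; rewrite normr_id patchE; case: ifPn => [/set_mem Ox|_].
  by rewrite Hx.
by rewrite normr0.
Qed.

Lemma loc_integrable_ball Omega f : measurable_fun Omega f -> measurable Omega ->
  (forall r : R, 0 < r -> integ (ccube 0 r) f) -> loc_integrable Omega f.
Proof.
move=> mf mO fi; split=> // K cK KO; have [r r0 Kr] := compact_ccube cK.
apply: integ_fin; apply: (integ_sub _ (measurable_ccube _ _) Kr (fi r r0)).
by apply: closed_measurable_rV; exact: compact_closed.
Qed.

Lemma sobolev_weak_data (eps : R) N Omega (m' : nat) f : 0 < eps ->
  eps_infty_domain eps Omega -> Omega !=set0 -> ball_banach N -> sobolev N m'.+1 Omega f ->
  exists D g, [/\ weak_data Omega m'.+1 f D g, measurable_fun setT g, forall x, 0 <= g x,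
    (N g < +oo)%E & (N g <= sobolev_norm N m'.+1 Omega f)%E].
Proof.
move=> e0 domO O0 bN [lf Hf]; have oO := domO.1.
have mO : measurable Omega by exact: open_measurable_rV.
pose wd (alpha : {ffun 'I_n.+1 -> 'I_m'.+2}) := weak_deriv Omega (fun i => alpha i : nat) f.
pose ok (alpha : {ffun 'I_n.+1 -> 'I_m'.+2}) := (\sum_i alpha i)%N == m'.+1.
have Hwd alpha : ok alpha -> is_weak_deriv Omega (fun i => alpha i : nat) f (wd alpha).
  by move=> /eqP am; have [g Hg _] := Hf _ am; exact: weak_derivP Hg.
have fin alpha : ok alpha -> (restr_norm N Omega (wd alpha) < +oo)%E.
  move=> oa; have [g0 Hg0 [mg0 [g [mg Ng] g0g]]] := Hf _ (eqP oa).
  have u := weak_deriv_unique e0 domO O0 (Hwd _ oa) Hg0.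
  apply: (le_lt_trans _ Ng); apply: ereal_inf_lbound; exists g => //; split; first by split.
  by apply: filterS2 u g0g => x Hx Hx' Ox; rewrite Hx// Hx'.
(* Weak derivatives are only meaningful on Omega, so they are extended by 0 before entering the norm
   of the whole space. *)
pose wd' alpha : E -> R := if ok alpha then fun x => `|(wd alpha \_ Omega) x| else fun=> 0.
have mwd alpha : measurable_fun setT (wd' alpha).
  rewrite /wd'; case: ifPn => oa; last exact: measurable_cst.
  by apply: measurableT_comp => //; apply/(measurable_restrictT _ mO).1; case: (Hwd _ oa) => -[].
have wd0 alpha x : 0 <= wd' alpha x by rewrite /wd'; case: ifP.
pose g x := \sum_alpha wd' alpha x.
have mg : measurable_fun setT g by exact: measurable_sum.
have Ng : (N g <= sobolev_norm N m'.+1 Omega f)%E.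
  apply: (le_trans (norm_sum bN _ mwd)); rewrite /sobolev_norm [leRHS]big_mkcond.
  apply: lee_sum => alpha _; rewrite /wd' -/(ok alpha); case: ifPn => oa.
    by apply: norm_restrict_le => //; case: (Hwd _ oa) => -[].
  by rewrite (norm_zero bN).
have Nfin : (N g < +oo)%E.
  by apply: (le_lt_trans Ng); apply: lte_sum_pinfty => alpha oa; exact: fin.
have g0 x : 0 <= g x by exact: sumr_ge0.
have lg : loc_integrable Omega g.
  apply: loc_integrable_ball => //; first exact: (@measurable_funS _ _ _ _ setT).
  by move=> r r0; exact: (ball_integ _ _ bN mg Nfin).
(* [inord] is faithful here: for a list of length m each count is at most m. *)
pose al (s : seq 'I_n.+1) : {ffun 'I_n.+1 -> 'I_m'.+2} := [ffun i => inord (mcount s i)].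
have alE s : size s = m'.+1 -> (fun i => al s i : nat) = mcount s.
  move=> ss; apply/funext => i; rewrite ffunE inordK// ltnS -ss; exact: count_size.
have okal s : size s = m'.+1 -> ok (al s).
  move=> ss; apply/eqP; transitivity (\sum_i mcount s i)%N; last by rewrite sum_mcount.
  by apply: eq_bigr => i _; exact: (congr1 (fun F => F i) (alE s ss)).
exists (fun s => wd (al s)), g; split=> //; split.
- exact: loc_locint.
- exact: loc_locint.
- by move=> s ss; apply: loc_locint => //; case: (Hwd _ (okal s ss)).
- move=> s y ss Oy; rewrite /g (bigD1 (al s))//= {1}/wd' okal// patchE mem_set//.
  by rewrite lerDl sumr_ge0.
- move=> K s u cK KO [su u0] ss; have [_ H] := Hwd _ (okal s ss).
  have := H u (test_functionP su cK KO u0).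
  by rewrite (eqP (okal s ss)) (alE s ss) -DD_mderiv.
Qed.

Lemma TK_avg Omega (Ca ca : R) K (r : R) : Omega !=set0 -> 0 < Ca -> 0 < ca -> 0 < r ->
  exists U, [/\ uniq U, (forall i, i \in U -> Bset Omega K i !=set0) &
    forall v x, ccube 0 r x -> TK Omega Ca ca K v x = avg Omega Ca ca K U v x].
Proof.
move=> O0 Ca0 ca0 r0; have [U [uU HU UD]] := Bset_family O0 Ca0 ca0 K r0.
exists U; split=> // v x xr; rewrite /TK (lfsumE uU).
  by apply: eq_bigr => i _; rewrite indicE.
move=> i iU; rewrite memNset ?mul0r// => Bx; move: iU.
by rewrite (UD _ _ xr Bx).
Qed.

(** In Omega the derivative is at most g; outside, once stabilized at level p, at most C2 times the
    averages of that level. As a finite list of cells only describes TK on a ball, the bound is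
    proved on the sets Z p and passed to the limit by [norm_fatou]. *)
Lemma norm_ext_deriv Omega m' P (Ca ca C : R) k1 f D g s (C2 : R) N (CA : R) :
  open Omega -> Omega !=set0 -> poly_data Omega m' P Ca ca C k1 ->
  weak_data Omega m'.+1 f D g -> size s = m'.+1 -> 0 <= C2 ->
  (forall K x, `|DD s (FK Omega P K f) x| <= C2 * TK Omega Ca ca K g x) ->
  ball_banach N -> measurable_fun setT g -> (forall x, 0 <= g x) -> (N g < +oo)%E ->
  (forall K U, uniq U -> (forall i, i \in U -> Bset Omega K i !=set0) ->
    (N (avg Omega Ca ca K U g) <= CA%:E * N g)%E) -> 0 <= CA ->
  (N (ext_deriv Omega P f D s) <= (1 + C2 * CA)%:E * N g)%E.
Proof.
move=> oO O0 pdP wd ss C20 HC2 bN mg g0 Ng HA CA0.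
have mO : measurable Omega by exact: open_measurable_rV.
set Gs := ext_deriv _ _ _ _ _.
have mG : measurable_fun setT Gs by exact: (measurable_ext_deriv oO O0 pdP wd ss).
pose Z (p : nat) := (Omega `|` outer_set Omega p) `&` ccube (0 : E) p.+1%:R.
have mZ p : measurable (Z p).
  apply: measurableI; last exact: measurable_ccube.
  by apply: measurableU => //; exact: measurable_outer.
pose u (p : nat) x := Gs x * \1_(Z p) x.
have mu_u p : measurable_fun setT (u p) by apply: measurable_funM => //; exact: measurable_indic.
apply: (norm_fatou bN mu_u mG).
  apply: nearW => x.
  have ball_near : \forall p \near \oo, ccube (0 : E) p.+1%:R x.
    near=> p; rewrite /ccube /= subr0; apply: (@le_trans _ _ p%:R); last by rewrite ler_nat.
    by near: p; exact: nat_large.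
  have [[q Hq]|nZ] := pselect (exists q, (Omega `|` outer_set Omega q) x).
    have : \forall p \near \oo, Gs x = u p x.
      near=> p; rewrite /u indicE mem_set ?mulr1//; split; last by near: p.
      have qp : (q <= p)%N by near: p; exists q.
      by case: Hq => [Ox|Zx]; [left|right; exact: outer_le Zx].
    by move=> /near_eq_cvg/cvg_trans; apply; exact: cvg_cst.
  have G0 : Gs x = 0.
    apply: ext_deriv_boundary => [Ox|p Zx]; apply: nZ; first by exists 0%N; left.
    by exists p; right.
  rewrite G0 (_ : u ^~ x = fun=> 0); first exact: cvg_cst.
  by apply/funext => p; rewrite /u G0 mul0r.
move=> p; have [U [uU HU eU]] := @TK_avg Omega Ca ca p%:Z p.+1%:R O0 (pd_Ca pdP) (pd_ca pdP) (ltr0Sn R p).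
have mavg : measurable_fun setT (avg Omega Ca ca p%:Z U g) by exact: measurable_avg.
have mavg2 : measurable_fun setT (fun x => C2 * avg Omega Ca ca p%:Z U g x).
  by apply: measurable_funM; [exact: measurable_cst|exact: mavg].
have a0 x : 0 <= avg Omega Ca ca p%:Z U g x by exact: avg_ge0.
have NA := HA p%:Z U uU HU.
have N0 := norm_ge0 bN mg.
have NAo : (N (avg Omega Ca ca p%:Z U g) < +oo)%E.
  by apply: (le_lt_trans NA); rewrite lte_mul_pinfty// lee_fin.
apply: (@le_trans _ _ (N (fun x => g x + C2 * avg Omega Ca ca p%:Z U g x)%R)).
  apply: (norm_mono bN (measurable_funD mg mavg2) (mu_u p)).
  apply: nearW => x; rewrite [leRHS]ger0_norm ?addr_ge0 ?mulr_ge0//.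
  rewrite /u indicE; have [/set_mem[OZ xp]|_] := boolP (x \in Z p); last first.
    by rewrite mulr0 normr0 addr_ge0// mulr_ge0.
  rewrite mulr1; case: OZ => [Ox|Zx].
    by rewrite /Gs ext_deriv_in// (le_trans (weak_data_le wd ss Ox))// lerDl mulr_ge0.
  by rewrite /Gs (ext_deriv_out _ _ _ _ Zx) (le_trans (HC2 _ _))// eU// lerDr.
apply: (le_trans (norm_add bN mg mavg2)).
rewrite (norm_scale bN _ mavg NAo) ger0_norm// EFinD ge0_muleDl ?lee_fin ?mulr_ge0//.
rewrite mul1e leeD2l// EFinM -muleA lee_wpmul2l// lee_fin.
Unshelve. all: by end_near. Qed.

Lemma is_weak_deriv_zero alpha : is_weak_deriv [set: E] alpha (fun=> 0) (fun=> 0).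
Proof.
split=> [|phi _]; first exact: (@loc_integrable_cst R n setT 0).
have z v : \int[mu]_x (0 * v x) = 0.
  by under eq_Rintegral do rewrite mul0r; rewrite Rintegral_cst// mul0r.
by rewrite !z mulr0.
Qed.

Lemma sobolev_zero N (m : nat) : ball_banach N -> sobolev N m [set: E] (fun=> 0).
Proof.
move=> bN; split=> [|alpha _]; first exact: (@loc_integrable_cst R n setT 0).
exists (fun=> 0); first exact: is_weak_deriv_zero.
split; first exact: measurable_cst.
exists (fun=> 0); last exact: aeW.
by split; [exact: measurable_cst|rewrite (norm_zero bN) ltry].
Qed.

Lemma sobolev_norm_zero N (m' : nat) : ball_banach N ->
  sobolev_norm N m'.+1 [set: E] (fun=> 0) = 0%E.
Proof.
move=> bN; apply: big1 => alpha _.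
have w0 := weak_derivP (is_weak_deriv_zero (fun i => alpha i : nat)).
set w := weak_deriv _ _ _ in w0 *; have mw : measurable_fun setT w by case: w0 => -[].
have setT0 : [set: E] !=set0 by exists 0.
rewrite (restr_norm_setT bN mw) -(norm_zero bN).
have mz : measurable_fun setT (fun _ : E => 0 : R) by exact: measurable_cst.
apply: (norm_ae bN mw mz).
apply: filterS (weak_deriv_unique ltr01 (@eps_infty_domain_setT R n) setT0 w0
  (is_weak_deriv_zero (fun i => alpha i : nat))) => x; exact.
Qed.

(** * The extension operator and its properties *)

Section extension.
Variables (eps p : R) (Omega : set E) (N : (E -> R) -> \bar R) (m' : nat).
Hypotheses (eps_gt0 : 0 < eps) (domO : eps_infty_domain eps Omega) (O0 : Omega !=set0)
  (bN : ball_banach N) (p1 : 1 <= p) (bY : ball_banach (convexification p^-1 N))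
  (mY : maximal_bounded_on_associate (convexification p^-1 N)).
Variables (P : (E -> R) -> I -> E -> R) (Ca ca C : R) (k1 : int).
Hypothesis pdP : poly_data Omega m' P Ca ca C k1.

Let oO : open Omega. Proof. exact: domO.1. Qed.
Let mO : measurable Omega. Proof. exact: open_measurable_rV. Qed.

Definition extend f : E -> R := llim (fun k : nat => FK Omega P k%:Z f).

Lemma extend_data f : sobolev N m'.+1 Omega f -> exists D g,
  [/\ weak_data Omega m'.+1 f D g, loc_integrable Omega g,
    (forall r, integ (Omega `&` ccube 0 r) g), measurable_fun setT g &
    [/\ forall x, 0 <= g x, (N g < +oo)%E & (N g <= sobolev_norm N m'.+1 Omega f)%E]].
Proof.
move=> sf; have [D [g [wd mg g0 Ng Ngs]]] := sobolev_weak_data eps_gt0 domO O0 bN sf.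
have gb c r := ball_integ c r bN mg Ng.
exists D, g; split=> //.
  apply: loc_integrable_ball => //; first exact: (@measurable_funS _ _ _ _ setT).
move=> r; apply: (integ_sub _ (measurable_ccube _ _) (@subIsetr _ _ _) (gb 0 r)).
by apply: measurableI => //; exact: measurable_ccube.
Qed.

Lemma extend_cvg f : sobolev N m'.+1 Omega f ->
  {ae mu, forall x, (fun k : nat => FK Omega P k%:Z f x) @ \oo --> extend f x}.
Proof.
move=> /extend_data[D [g [wd lg gb _ _]]].
have H (k : nat) := let: And3 a _ _ := FK_limit oO O0 pdP wd lg gb (ltr0Sn R k) in a.
apply: filterS (ae_foralln H) => x Hx; apply: (Hx (Num.truncn `|x|)).
by rewrite /ccube /= subr0 ltW// truncnS_gt.
Qed.

Lemma extend_weak_deriv : exists2 C0 : R, 0 <= C0 & forall f alpha, sobolev N m'.+1 Omega f ->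
  (\sum_i alpha i)%N = m'.+1 -> exists g, [/\ is_weak_deriv setT alpha (extend f) g,
    measurable_fun setT g, (N g < +oo)%E &
    (N g <= C0%:E * sobolev_norm N m'.+1 Omega f)%E].
Proof.
have [C2 C20 HC2] := FK_DD_le O0 pdP.
have [CA CA0 HCA] := avg_norm O0 (pd_Ca pdP) (pd_ca pdP) bN p1 bY mY.
have c0 : 0 <= 1 + C2 * CA by rewrite addr_ge0// mulr_ge0// ltW.
exists (1 + C2 * CA) => // f alpha sf am.
have [D [g [wd lg gb mg [g0 Ng Ngs]]]] := extend_data sf.
pose s := mlist alpha; have ss : size s = m'.+1 by rewrite size_mlist.
have HC2' K x : `|DD s (FK Omega P K f) x| <= C2 * TK Omega Ca ca K g x by exact: HC2 wd lg K s x ss.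
have mG := measurable_ext_deriv oO O0 pdP wd ss.
have NG : (N (ext_deriv Omega P f D s) <= (1 + C2 * CA)%:E * N g)%E.
  apply: (norm_ext_deriv oO O0 pdP wd ss C20 HC2' bN mg g0 Ng) => [K U uU HU|]; last exact: ltW.
  exact: HCA.
exists (ext_deriv Omega P f D s); split=> //.
- split.
    apply: loc_integrable_ball => // r r0.
    exact: (integ_ext_deriv oO O0 pdP wd gb ss C20 HC2').
  move=> phi /test_function_supp[sphi [K [r [_ _ _ _ phir]]]].
  rewrite mderivE am; have r1 : 0 < Num.max r 1 by rewrite lt_max ltr01 orbT.
  apply: (ext_weak_deriv oO O0 pdP wd lg gb ss C20 HC2' sf.1 r1 sphi).
  by apply: supp_in_le phir; rewrite le_max lexx.
- by apply: (le_lt_trans NG); rewrite lte_mul_pinfty ?lee_fin// norm_ge0.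
- by apply: (le_trans NG); rewrite lee_wpmul2l// lee_fin.
Qed.

Lemma extend_loc_integrable f : sobolev N m'.+1 Omega f -> loc_integrable setT (extend f).
Proof.
move=> /extend_data[D [g [wd lg gb _ _]]]; apply: loc_integrable_ball => //.
  apply: measurable_llim => k; apply: continuous_measurable_rV.
  by apply: smooth_continuous; exact: (smooth_FK O0 pdP _ (weak_data_f wd)).
by move=> r r0; have [] := FK_limit oO O0 pdP wd lg gb r0.
Qed.

Lemma extend_operator : sobolev_linear_operator N m'.+1 Omega setT extend.
Proof.
have [C0 C00 HC0] := extend_weak_deriv; split.
- move=> f sf; split; first exact: extend_loc_integrable.
  move=> alpha am; have [g [wg mg Ng _]] := HC0 f alpha sf am.
  by exists g => //; split=> //; exists g => //; exact: aeW.
(* The polynomials only involve integrals of f over Omega, so equivalent functions have the same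
   extension at every point. *)
- move=> f g [lf _] [lg _] fg; apply: aeW => x _; rewrite /extend.
  by under [in LHS]eq_fun do rewrite (FK_ae pdP _ lf.1 lg.1 fg).
- move=> a f g sf sg; have [lf _] := sf; have [lg _] := sg.
  have lfO := loc_locint mO lf; have lgO := loc_locint mO lg.
  apply: filterS2 (extend_cvg sf) (extend_cvg sg) => x cf cg _.
  apply: llimE; under eq_fun do rewrite (FK_lin O0 pdP _ _ lfO lgO).
  by apply: cvgD => //; apply: cvgMr.
Qed.

(** The norm refers to the representative chosen by [weak_deriv]; by uniqueness on the whole space
    it agrees almost everywhere with the derivative that was constructed. *)
Lemma extend_bound : exists2 C1 : R, 0 < C1 & forall f, sobolev N m'.+1 Omega f ->
  (sobolev_norm N m'.+1 setT (extend f) <= C1%:E * sobolev_norm N m'.+1 Omega f)%E.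
Proof.
have [C0 C00 HC0] := extend_weak_deriv.
pose S : R := \sum_(alpha : {ffun 'I_n.+1 -> 'I_m'.+2} | (\sum_i alpha i)%N == m'.+1) C0.
have S0 : 0 <= S by exact: sumr_ge0.
exists (S + 1) => [|f sf]; first by rewrite ltr_wpDl.
have [D [g [wd lg gb mg [g0 Ng Ngs]]]] := extend_data sf.
have n0 : (0 <= sobolev_norm N m'.+1 Omega f)%E by apply: le_trans Ngs; exact: norm_ge0.
apply: (@le_trans _ _ (S%:E * sobolev_norm N m'.+1 Omega f)%E); last first.
  by rewrite lee_wpmul2r// lee_fin lerDl.
rewrite /S -sumEFin ge0_sume_distrl; last by move=> alpha _; rewrite lee_fin.
rewrite {1}/sobolev_norm; apply: lee_sum => alpha /eqP am.
have [G [wG mG _ NG]] := HC0 f _ sf am.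
have wG' := weak_derivP wG; set w := weak_deriv _ _ _ in wG' *.
have mw : measurable_fun setT w by case: wG' => -[].
have setT0 : [set: E] !=set0 by exists 0.
rewrite (restr_norm_setT bN mw) (norm_ae bN mw mG)//.
apply: filterS (weak_deriv_unique ltr01 (@eps_infty_domain_setT R n) setT0 wG' wG) => x; exact.
Qed.

Lemma extend_ae f : sobolev N m'.+1 Omega f -> {ae mu, forall x, Omega x -> extend f x = f x}.
Proof.
move=> sf; have [lf _] := sf; have [D [g [wd lg gb _ _]]] := extend_data sf.
exact: (ae_llim oO O0 pdP wd lf lg gb).
Qed.

End extension.

End sobolev.

Theorem theorem3p15 (R : realType) (n m : nat) (eps : R)
    (Omega : set 'rV[R]_n.+1) (N : ('rV[R]_n.+1 -> R) -> \bar R)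
    (eps_gt0 : 0 < eps) (eps_le1 : eps <= 1)
    (domOmega : eps_infty_domain eps Omega)
    (m_gt0 : (0 < m)%N)
    (bbN : ball_banach N)
    (acN : abs_continuous_norm N)
    (maxN : exists p : R, [/\ 1 <= p,
      ball_banach (convexification p^-1 N) &
      maximal_bounded_on_associate (convexification p^-1 N)]) :
  exists Lambda : ('rV[R]_n.+1 -> R) -> 'rV[R]_n.+1 -> R,
    [/\ sobolev_linear_operator N m Omega setT Lambda,
        forall f, sobolev N m Omega f ->
          {ae lebesgue_rV, forall x, Omega x -> Lambda f x = f x} &
        exists2 C : R, 0 < C & forall f, sobolev N m Omega f ->
          (sobolev_norm N m setT (Lambda f)
             <= C%:E * sobolev_norm N m Omega f)%E].
Proof.
case: m m_gt0 => // m' _; have [p [p1 bY mY]] := maxN.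
have [nO|nO] := pselect (Omega !=set0).
  have [P [Ca [ca [C [k1 pdP]]]]] := poly_data_exists m' eps_gt0 domOmega nO.
  exists (extend Omega P); split.
  - exact: (extend_operator eps_gt0 domOmega nO bbN p1 bY mY pdP).
  - by move=> f; exact: (extend_ae eps_gt0 domOmega nO bbN pdP).
  - exact: (extend_bound eps_gt0 domOmega nO bbN p1 bY mY pdP).
(* An empty Omega offers no cube to reflect to; the zero operator does the job. *)
have s0 := sobolev_zero m'.+1 bbN; have norm0 := sobolev_norm_zero m' bbN.
exists (fun _ _ => 0); split.
- split=> // [f g _ _ _|a f g _ _]; apply: aeW => x _ //.
  by rewrite mulr0 addr0.
- by move=> f _; apply: aeW => x Ox; case: nO; exists x.
- exists 1 => // f _; rewrite norm0 mul1e; apply: sume_ge0 => alpha _.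
  by apply: le_ereal_inf_tmp => _ [g [[mg _] _] <-]; exact: norm_ge0.
Qed.
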